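(* For any natural integer $m$, the following range decompositions hold, the sums being direct and orthogonal in $L^2(\partial_+ SM)$: \begin{align*} I(S^{2m}) &= I_0(L^2(M)) \stackrel{\perp}{\oplus} \bigoplus_{k=1}^m I(\ker^{2k} \eta_-) \stackrel{\perp}{\oplus} \bigoplus_{k=1}^{m} I(\ker^{-2k} \eta_+), \\ I(S^{2m+1}) &= I_\perp( \dot{H}^1(M) ) \stackrel{\perp}{\oplus} \bigoplus_{k=1}^m I(\ker^{2k+1} \eta_-) \stackrel{\perp}{\oplus} \bigoplus_{k=1}^{m} I(\ker^{-(2k+1)} \eta_+). \end{align*}
   Context: $M=\{(x,y)\in\mathbb{R}^2: x^2+y^2<1\}$ is the Euclidean unit disk (points also written $z=x+iy$), $\mathbb{S}^1=\mathbb{R}/2\pi\mathbb{Z}$, and $SM = M\times \mathbb{S}^1\ni(\mathrm{x},\theta)$ is its unit circle bundle, with measure $d\mathrm{x}\,d\theta$. All functions are complex-valued. Any $u\in L^2(SM)$ is uniquely written $u=\sum_{k\in\mathbb{Z}}u_k(\mathrm{x})e^{ik\theta}$ with $u_k(\mathrm{x})=\frac{1}{2\pi}\int_{\mathbb{S}^1}u(\mathrm{x},\theta)e^{-ik\theta}d\theta$. $S^m$ denotes the subspace of $m$-tensors in $L^2(SM)$, i.e. of functions whose only (possibly) nonzero harmonics $u_k$ have $k\in\{-m,-m+2,\dots,m-2,m\}$. $\partial_+SM$ (influx boundary) is parameterized by fan-beam coordinates $(\beta,\alpha)\in\mathbb{S}^1\times(-\frac{\pi}{2},\frac{\pi}{2})$,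 representing the boundary point $e^{i\beta}$ and the direction of angle $\beta+\pi+\alpha$; $L^2(\partial_+SM)$ is taken with respect to $d\beta\,d\alpha$. The X-ray transform $I:L^2(SM)\to L^2(\partial_+SM)$ is the continuous extension of $$If(\beta,\alpha)=\int_0^{2\cos\alpha}f(e^{i\beta}+te^{i(\beta+\pi+\alpha)},\,\beta+\pi+\alpha)\,dt.$$ With $\partial=\frac12(\partial_x-i\partial_y)$, $\overline{\partial}=\frac12(\partial_x+i\partial_y)$: $\eta_+=e^{i\theta}\partial$, $\eta_-=e^{-i\theta}\overline\partial$, $X_\perp=\frac{1}{i}(\eta_+-\eta_-)=\sin\theta\,\partial_x-\cos\theta\,\partial_y$. For $k\in\mathbb{Z}$, $\ker^k\eta_+=\{f(\mathrm{x})e^{ik\theta}: f\in L^2(M),\ \partial f=0\}$ and $\ker^k\eta_-=\{f(\mathrm{x})e^{ik\theta}: f\in L^2(M),\ \overline\partial f=0\}$. $\dot H^1(M)=\{f\in H^1(M):\int_{\mathbb{S}^1}f(e^{i\beta})\,d\beta=0\}$ (boundary values in the trace sense). For $f\in L^2(M)$, $I_0f:=I[f]$, where $f$ is regarded as a function on $SM$ constant in $\theta$; for $h\in\dot H^1(M)$, $I_\perp h:=I[X_\perp h]$. *)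

(* Defs.v *)
From HB Require Import structures.
From mathcomp Require Import all_boot all_order all_algebra.
From mathcomp Require Import complex.
From mathcomp Require Import all_classical all_reals all_analysis.

Set Implicit Arguments.
Unset Strict Implicit.
Unset Printing Implicit Defensive.
Import Order.TTheory GRing.Theory Num.Theory.
Import numFieldNormedType.Exports.

Local Open Scope classical_set_scope.
Local Open Scope ring_scope.
Local Open Scope complex_scope.

(** Elements of an L^2 space are represented by functions, not by classes modulo
    null sets; a.e. identification is explicit where it matters.  A function on
    the circle R/2piZ is a 2pi-periodic function on R, and it is integrated
    over [0, 2pi[. *)

Section complex_L2.
Context d (T : measurableType d) (R : realType).
Implicit Types (mu : {measure set T -> \bar R}) (D : set T) (f g : T -> R[i]).

Definition cintegral mu D f : R[i] :=
  (\int[mu]_(x in D) complex.Re (f x)) +i* (\int[mu]_(x in D) complex.Im (f x)).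

Definition sqnorm2 mu D f : \bar R :=
  (\int[mu]_(x in D) (complex.Re (f x) ^+ 2 + complex.Im (f x) ^+ 2)%:E)%E.

Definition L2 mu D : set (T -> R[i]) :=
  [set f | [/\ measurable_fun D (fun x => complex.Re (f x)),
               measurable_fun D (fun x => complex.Im (f x)) &
               (sqnorm2 mu D f < +oo)%E]].

Definition cvgL2 mu D (fn : nat -> T -> R[i]) f : Prop :=
  sqnorm2 mu D (fun x => fn n x - f x) @[n --> \oo] --> (0 : \bar R).

Definition inner mu D f g : R[i] := cintegral mu D (fun x => f x * conjc (g x)).

End complex_L2.

Section xray_transform.
Variable R : realType.
Implicit Types (f g h : R * R -> R[i]) (u : R * R * R -> R[i]) (m : nat).

Local Notation leb1 := (@lebesgue_measure R).
Local Notation leb2 := (leb1 \x leb1)%E.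
Local Notation leb3 := (leb2 \x leb1)%E.

Definition circle : set R := `[0, 2 * pi[.

Definition disk : set (R * R) := [set x | x.1 ^+ 2 + x.2 ^+ 2 < 1].

Definition closed_disk : set (R * R) := [set x | x.1 ^+ 2 + x.2 ^+ 2 <= 1].

(** Points of SM are triples ((x, y), theta), those of the influx boundary are
    pairs (beta, alpha). *)
Definition SM : set (R * R * R) := disk `*` circle.

Definition influx : set (R * R) := circle `*` `]- (pi / 2), pi / 2[.

Definition expi (k : int) (t : R) : R[i] :=
  cos (k%:~R * t) +i* sin (k%:~R * t).

Definition L2M : set (R * R -> R[i]) := L2 leb2 disk.

Definition periodicSM : set (R * R * R -> R[i]) :=
  [set u | forall x t, u (x, t + 2 * pi) = u (x, t)].

Definition L2SM : set (R * R * R -> R[i]) := periodicSM `&` L2 leb3 SM.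

Definition L2influx : set (R * R -> R[i]) :=
  [set g | forall b a, g (b + 2 * pi, a) = g (b, a)] `&` L2 leb2 influx.

Definition fourier u (k : int) : R * R -> R[i] := fun x =>
  ((2 * pi)^-1)%:C * cintegral leb1 circle (fun t => u (x, t) * expi (- k) t).

Definition tensors m : set (R * R * R -> R[i]) :=
  [set u | L2SM u /\
    forall k : int,
      ~ (exists2 j : nat, (j <= m)%N & k = - m%:Z + j.*2%:Z) ->
      {ae leb2, forall x, disk x -> fourier u k x = 0}].

Definition continuousSM : set (R * R * R -> R[i]) :=
  [set u | [/\ periodicSM u,
    {within closed_disk `*` setT, continuous (fun p => complex.Re (u p))} &
    {within closed_disk `*` setT, continuous (fun p => complex.Im (u p))}]].

Definition xray_integral u : R * R -> R[i] := fun ba =>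
  let th := ba.1 + pi + ba.2 in
  cintegral leb1 `[0, 2 * cos ba.2]
    (fun t => u ((cos ba.1 + t * cos th, sin ba.1 + t * sin th), th)).

(** [xray u g] means I u = g in L^2: it is the graph of the continuous extension
    to L^2(SM) of the line integral, which makes pointwise sense on functions
    continuous up to the boundary of the disk. *)
Definition xray u g : Prop :=
  [/\ L2SM u, L2influx g &
      exists un : nat -> R * R * R -> R[i],
        [/\ forall n, continuousSM (un n),
            cvgL2 leb3 SM un u &
            cvgL2 leb2 influx (fun n => xray_integral (un n)) g]].

Definition xray_image (A : set (R * R * R -> R[i])) : set (R * R -> R[i]) :=
  [set g | exists2 u, A u & xray u g].

(** C^oo on the whole plane: every iterated directional derivative is (Frechet)
    differentiable. *)
Definition smooth (phi : R * R -> R) : Prop :=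
  forall (s : seq (R * R)) x,
    differentiable (foldr (fun v psi => 'D_v psi) phi s) x.

Definition csmooth : set (R * R -> R[i]) :=
  [set f | smooth (fun x => complex.Re (f x)) /\
           smooth (fun x => complex.Im (f x))].

Definition partial (v : R * R) f : R * R -> R[i] := fun x =>
  'D_v (fun y => complex.Re (f y)) x +i* 'D_v (fun y => complex.Im (f y)) x.

Definition partialx := partial (1, 0).
Definition partialy := partial (0, 1).

Definition del f : R * R -> R[i] := fun x =>
  2^-1 * (partialx f x - (0 +i* 1) * partialy f x).

Definition delbar f : R * R -> R[i] := fun x =>
  2^-1 * (partialx f x + (0 +i* 1) * partialy f x).

Definition test_function : set (R * R -> R[i]) :=
  [set phi | csmooth phi /\
    exists K : set (R * R),
      [/\ compact K, K `<=` disk & forall x, ~ K x -> phi x = 0]].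

(** [weakly P f g] means P f = g as distributions on the disk, where P is one of
    the four first-order operators above (whose formal transpose is -P). *)
Definition weakly (P : (R * R -> R[i]) -> R * R -> R[i]) f g : Prop :=
  forall phi, test_function phi ->
    cintegral leb2 disk (fun x => f x * P phi x)
    = - cintegral leb2 disk (fun x => g x * phi x).

Definition ker_eta_plus (k : int) : set (R * R * R -> R[i]) :=
  [set u | exists f, [/\ L2M f, weakly del f (fun=> 0) &
                         u = fun p => f p.1 * expi k p.2]].

Definition ker_eta_minus (k : int) : set (R * R * R -> R[i]) :=
  [set u | exists f, [/\ L2M f, weakly delbar f (fun=> 0) &
                         u = fun p => f p.1 * expi k p.2]].

(** [H1 h hx hy]: h is in H^1(M), with weak gradient (hx, hy). *)
Definition H1 h hx hy : Prop :=
  [/\ L2M h, L2M hx, L2M hy, weakly partialx h hx & weakly partialy h hy].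

(** [trace h hx hy tau]: tau is the boundary trace, as a function of beta, of
    the H^1 function h with weak gradient (hx, hy); the trace operator is the
    continuous extension to H^1(M) of the restriction to the boundary of
    functions smooth on the closed disk. *)
Definition trace h hx hy (tau : R -> R[i]) : Prop :=
  [/\ H1 h hx hy,
      (forall b, tau (b + 2 * pi) = tau b) /\ L2 leb1 circle tau &
      exists hn : nat -> R * R -> R[i],
        [/\ forall n, csmooth (hn n),
            [/\ cvgL2 leb2 disk hn h,
                cvgL2 leb2 disk (fun n => partialx (hn n)) hx &
                cvgL2 leb2 disk (fun n => partialy (hn n)) hy] &
            cvgL2 leb1 circle (fun n b => hn n (cos b, sin b)) tau]].

Definition H1dot h hx hy : Prop :=
  exists2 tau, trace h hx hy tau & cintegral leb1 circle tau = 0.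

Definition X_perp hx hy : R * R * R -> R[i] := fun p =>
  (sin p.2)%:C * hx p.1 - (cos p.2)%:C * hy p.1.

Definition range_I0 : set (R * R -> R[i]) :=
  xray_image [set u | exists2 f, L2M f & u = fun p => f p.1].

Definition range_Iperp : set (R * R -> R[i]) :=
  xray_image [set u | exists h hx hy, H1dot h hx hy /\ u = X_perp hx hy].

(** V is the direct sum of the W j, which are pairwise orthogonal, in L^2 of the
    influx boundary. *)
Definition orthogonal_direct_sum (J : finType) (V : set (R * R -> R[i]))
    (W : J -> set (R * R -> R[i])) : Prop :=
  [/\ forall j, W j `<=` L2influx,
      forall g, V g <->
        L2influx g /\
        exists2 w : J -> R * R -> R[i], (forall j, W j (w j)) &
          {ae leb2, forall p, influx p -> g p = \sum_j w j p},
      forall w w' : J -> R * R -> R[i],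
        (forall j, W j (w j)) -> (forall j, W j (w' j)) ->
        {ae leb2, forall p, influx p -> \sum_j w j p = \sum_j w' j p} ->
        forall j, {ae leb2, forall p, influx p -> w j p = w' j p} &
      forall i j, i != j -> forall g h, W i g -> W j h ->
        inner leb2 influx g h = 0].

(** The 2m + 1 summands: W0 and, for 1 <= k <= m, Wminus k and Wplus k. *)
Definition summands m (W0 : set (R * R -> R[i]))
    (Wminus Wplus : nat -> set (R * R -> R[i])) :
    option ('I_m + 'I_m) -> set (R * R -> R[i]) :=
  fun j => match j with
           | None => W0
           | Some (inl k) => Wminus k.+1
           | Some (inr k) => Wplus k.+1
           end.

End xray_transform.

Arguments range_I0 : clear implicits.
Arguments range_Iperp : clear implicits.
Arguments tensors : clear implicits.
Arguments ker_eta_plus : clear implicits.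
Arguments ker_eta_minus : clear implicits.

(* Main.v *)
(** The geodesic vector field is X = e^(i theta) del + e^(-i theta) delbar, and I(X u) = 0
    when u vanishes on the boundary circle.  If f is in L^2(M), then f = g + del v, where g is
    the Bergman projection of f and v vanishes on the boundary; hence
    I(f e^(i k theta)) = I(g e^(i k theta)) - I(delbar v e^(i (k - 2) theta)), which lowers a
    positive frequency by 2 at the price of an element of I(ker^k eta_-).  Complex conjugation
    treats negative frequencies, and the descent stops at the frequency 0, or at the frequencies
    1 and -1, where f1 e^(i theta) + f2 e^(-i theta) is X_perp h plus X of a function vanishing
    on the boundary.

    All of this is done on the monomials z^a conj(z)^b, where v, g and a primitive of g are
    explicit, and extended to L^2 by density: the norm bounds only involve Gram matrices of
    monomials on the disk, for instance <del v, del v'> = <delbar v, delbar v'>.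

    For the orthogonality, the fan-beam transform of z^a conj(z)^b e^(i k theta) is
    e^(i (a - b + k) beta) times a trigonometric polynomial in alpha.  If a >= b, its frequencies
    have the parity of k - 1 and lie outside ]k - 1, 2 (a - b) + k + 1[, and only the two
    endpoints occur when b = 0. *)

From HB Require Import structures.
From mathcomp Require Import all_boot all_order all_algebra.
From mathcomp Require Import complex.
From mathcomp Require Import all_classical all_reals all_analysis.
From mathcomp Require Import measurable_realfun.
From mathcomp Require Import ring lra zify.
Require Import Defs.

Set Implicit Arguments.
Unset Strict Implicit.
Unset Printing Implicit Defensive.
Import Order.TTheory GRing.Theory Num.Theory.
Import numFieldNormedType.Exports HBNNSimple.

Local Open Scope classical_set_scope.
Local Open Scope ring_scope.
Local Open Scope complex_scope.

(** * Complex-valued square-integrable functions *)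

(** [xray] is a graph, so linearity, conjugation and limits are proved for pairs [(u, g)], the
    existence of an image is a theorem ([xray_total]), and two images of one [u] agree almost
    everywhere only. Boundedness is Santalo's formula, whose change of variables is broken into
    translations, shears and y = sin alpha. The weak kernel of [delbar] meets the monomials at one
    place: the equation is tested against (1 - |z|^2) z^a conj(z)^b, reached through compactly
    supported cutoffs. The resulting recursion says that f has the same product with a monomial and
    with its Bergman projection. Applied to f = 1, it yields every integral of a monomial over the
    disk, up to the area. The most delicate estimate bounds v by f in L^2. It serves at the
    frequencies 1 and -1, where h contains v itself, and comes from integrating del(z |v|^2). A
    finite combination is a list of coefficients and indices, evaluated in several families
    (monomials, primitives, traces, transforms). All limits follow one sequence of lists, so
    identities between families survive. *)

Section complex_numbers.
Variable R : realType.
Implicit Types z w : R[i].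

Lemma ReD z w : complex.Re (z + w) = complex.Re z + complex.Re w.
Proof. by case: z w => [a b] [c d]. Qed.

Lemma ImD z w : complex.Im (z + w) = complex.Im z + complex.Im w.
Proof. by case: z w => [a b] [c d]. Qed.

Lemma ReN z : complex.Re (- z) = - complex.Re z.
Proof. by case: z. Qed.

Lemma ImN z : complex.Im (- z) = - complex.Im z.
Proof. by case: z. Qed.

Lemma ReM z w :
  complex.Re (z * w) = complex.Re z * complex.Re w - complex.Im z * complex.Im w.
Proof. by case: z w => [a b] [c d]. Qed.

Lemma ImM z w :
  complex.Im (z * w) = complex.Re z * complex.Im w + complex.Im z * complex.Re w.
Proof. by case: z w => [a b] [c d]. Qed.

Lemma Re_conjc z : complex.Re (conjc z) = complex.Re z.
Proof. by case: z. Qed.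

Lemma Im_conjc z : complex.Im (conjc z) = - complex.Im z.
Proof. by case: z. Qed.

Definition ReImE := (ReD, ImD, ReN, ImN, ReM, ImM, Re_conjc, Im_conjc).

Lemma complex_eq z w :
  complex.Re z = complex.Re w -> complex.Im z = complex.Im w -> z = w.
Proof. by case: z w => [a b] [c d] /= -> ->. Qed.

(** The squared modulus, with values in [R]. All norms of the development are squared norms. *)
Definition nsq z : R := complex.Re z ^+ 2 + complex.Im z ^+ 2.

Lemma nsq_ge0 z : 0 <= nsq z.
Proof. by rewrite /nsq addr_ge0// sqr_ge0. Qed.

Lemma nsqM z w : nsq (z * w) = nsq z * nsq w.
Proof. rewrite /nsq !ReImE; ring. Qed.

Lemma nsqN z : nsq (- z) = nsq z.
Proof. rewrite /nsq !ReImE; ring. Qed.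

Lemma nsqC z w : nsq (z - w) = nsq (w - z).
Proof. by rewrite -opprB nsqN. Qed.

Lemma nsq_conj z : nsq (conjc z) = nsq z.
Proof. rewrite /nsq !ReImE; ring. Qed.

Lemma nsq0 : nsq 0 = 0.
Proof. by rewrite /nsq /= expr0n /= addr0. Qed.

Lemma nsq_eq0 z : nsq z = 0 -> z = 0.
Proof.
move=> /eqP; rewrite paddr_eq0 ?sqr_ge0// !sqrf_eq0 => /andP[/eqP a /eqP b].
exact: complex_eq.
Qed.

(** Substitute for the triangle inequality at the level of squares. The factor 2 explains the
    tolerances [e / 4] of the later limit arguments. *)
Lemma nsqD_le z w : nsq (z + w) <= 2 * nsq z + 2 * nsq w.
Proof.
rewrite /nsq !ReImE.
have := sqr_ge0 (complex.Re z - complex.Re w).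
have := sqr_ge0 (complex.Im z - complex.Im w).
lra.
Qed.

Lemma nsq_real (a : R) : nsq a%:C = a ^+ 2.
Proof. by rewrite /nsq /= expr0n /= addr0. Qed.

Lemma Re_sqr_le z : complex.Re z ^+ 2 <= nsq z.
Proof. by rewrite /nsq lerDl sqr_ge0. Qed.

Lemma Im_sqr_le z : complex.Im z ^+ 2 <= nsq z.
Proof. by rewrite /nsq lerDr sqr_ge0. Qed.

End complex_numbers.

Section complex_integral.
Context d (T : measurableType d) (R : realType).
Variables (mu : {measure set T -> \bar R}) (D : set T).
Hypothesis mD : measurable D.
Implicit Types f g : T -> R[i].

Definition cmeas f := measurable_fun D (fun x => complex.Re (f x)) /\
  measurable_fun D (fun x => complex.Im (f x)).

Lemma cmeasD f g : cmeas f -> cmeas g -> cmeas (fun x => f x + g x).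
Proof.
move=> [a b] [c e]; split.
- under eq_fun do rewrite ReD; exact: measurable_funD.
- under eq_fun do rewrite ImD; exact: measurable_funD.
Qed.

Lemma cmeasN f : cmeas f -> cmeas (fun x => - f x).
Proof.
move=> [a b]; split.
- under eq_fun do rewrite ReN; exact: measurableT_comp.
- under eq_fun do rewrite ImN; exact: measurableT_comp.
Qed.

Lemma cmeasB f g : cmeas f -> cmeas g -> cmeas (fun x => f x - g x).
Proof. by move=> mf mg; apply: cmeasD => //; exact: cmeasN. Qed.

Lemma cmeasM f g : cmeas f -> cmeas g -> cmeas (fun x => f x * g x).
Proof.
move=> [a b] [c e]; split.
- under eq_fun do rewrite ReM; apply: measurable_funB; exact: measurable_funM.
- under eq_fun do rewrite ImM; apply: measurable_funD; exact: measurable_funM.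
Qed.

Lemma cmeas_cst (c : R[i]) : cmeas (fun=> c).
Proof. by split; exact: measurable_cst. Qed.

Lemma cmeas_conj f : cmeas f -> cmeas (fun x => conjc (f x)).
Proof.
move=> [a b]; split.
- by under eq_fun do rewrite Re_conjc.
- under eq_fun do rewrite Im_conjc; exact: measurableT_comp.
Qed.

Lemma cmeas_real (h : T -> R) : measurable_fun D h -> cmeas (fun x => (h x)%:C).
Proof. by move=> mh; split => //=; exact: measurable_cst. Qed.

Lemma measurable_nsq f : cmeas f -> measurable_fun D (fun x => nsq (f x)).
Proof.
by move=> [a b]; apply: measurable_funD; exact: measurable_funX.
Qed.

Definition cintegrable f := mu.-integrable D (fun x => (complex.Re (f x))%:E) /\
  mu.-integrable D (fun x => (complex.Im (f x))%:E).

Lemma cintegrableD f g :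
  cintegrable f -> cintegrable g -> cintegrable (fun x => f x + g x).
Proof.
move=> [a b] [c e]; split.
- by under eq_fun do rewrite ReD EFinD; exact: integrableD.
- by under eq_fun do rewrite ImD EFinD; exact: integrableD.
Qed.

Lemma cintegrableZ (c : R[i]) f : cintegrable f -> cintegrable (fun x => c * f x).
Proof.
move=> [a b]; split.
- under eq_fun do rewrite ReM EFinB 2!EFinM.
  by apply: integrableB => //; exact: integrableZl.
- under eq_fun do rewrite ImM EFinD 2!EFinM.
  by apply: integrableD => //; exact: integrableZl.
Qed.

Lemma cintegrable0 : cintegrable (fun=> 0).
Proof. by split; exact: integrable0. Qed.

Lemma cintegrable_sum I (s : seq I) (F : I -> T -> R[i]) :
  (forall i, cintegrable (F i)) -> cintegrable (fun x => \sum_(i <- s) F i x).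
Proof.
move=> mF; elim: s => [|i s ih].
  by under eq_fun do rewrite big_nil; exact: cintegrable0.
by under eq_fun do rewrite big_cons; exact: cintegrableD.
Qed.

Lemma eq_cintegral f g : (forall x, D x -> f x = g x) ->
  cintegral mu D f = cintegral mu D g.
Proof.
move=> fg; congr (_ +i* _); apply: eq_Rintegral => x; rewrite inE => Dx;
by rewrite fg.
Qed.

Lemma cintegralD f g : cintegrable f -> cintegrable g ->
  cintegral mu D (fun x => f x + g x) = cintegral mu D f + cintegral mu D g.
Proof.
move=> [a b] [c e]; apply: complex_eq => /=.
- under eq_Rintegral do rewrite ReD.
  by rewrite RintegralD.
- under eq_Rintegral do rewrite ImD.
  by rewrite RintegralD.
Qed.

Lemma cintegralZ (c : R[i]) f : cintegrable f ->
  cintegral mu D (fun x => c * f x) = c * cintegral mu D f.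
Proof.
move=> [a b]; apply: complex_eq; rewrite !ReImE /=.
- under eq_Rintegral do rewrite ReM.
  rewrite RintegralB ?RintegralZl//.
    by apply: (integrableZl mD _ a).
  by apply: (integrableZl mD _ b).
- under eq_Rintegral do rewrite ImM.
  rewrite RintegralD ?RintegralZl//.
    by apply: (integrableZl mD _ b).
  by apply: (integrableZl mD _ a).
Qed.

Lemma cintegralN f : cintegrable f ->
  cintegral mu D (fun x => - f x) = - cintegral mu D f.
Proof.
move=> fi; rewrite -mulN1r -cintegralZ//.
by apply: eq_cintegral => x _; rewrite mulN1r.
Qed.

Lemma cintegrableN f : cintegrable f -> cintegrable (fun x => - f x).
Proof.
by move=> /(cintegrableZ (-1)); under eq_fun do rewrite mulN1r.
Qed.

Lemma cintegrableB f g :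
  cintegrable f -> cintegrable g -> cintegrable (fun x => f x - g x).
Proof. by move=> a b; apply: cintegrableD => //; exact: cintegrableN. Qed.

Lemma cintegralB f g : cintegrable f -> cintegrable g ->
  cintegral mu D (fun x => f x - g x) = cintegral mu D f - cintegral mu D g.
Proof.
by move=> fi gi; rewrite cintegralD ?cintegralN//; exact: cintegrableN.
Qed.

Lemma cintegral0 : cintegral mu D (fun=> 0) = 0.
Proof.
by apply: complex_eq; rewrite /= Rintegral_cst// mul0r.
Qed.

Lemma cintegral_sum I (s : seq I) (F : I -> T -> R[i]) :
  (forall i, cintegrable (F i)) ->
  cintegral mu D (fun x => \sum_(i <- s) F i x) = \sum_(i <- s) cintegral mu D (F i).
Proof.
move=> mF; elim: s => [|i s ih].
  rewrite big_nil -[RHS]cintegral0; apply: eq_cintegral => x _.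
  by rewrite big_nil.
rewrite big_cons -ih -cintegralD//; last exact: cintegrable_sum.
by apply: eq_cintegral => x _; rewrite big_cons.
Qed.

Lemma cintegral_conj f : cintegrable f ->
  cintegral mu D (fun x => conjc (f x)) = conjc (cintegral mu D f).
Proof.
move=> [a b]; apply: complex_eq; rewrite !ReImE /=.
- by apply: eq_Rintegral => x _; rewrite Re_conjc.
- rewrite -mulN1r -RintegralZl//.
  by apply: eq_Rintegral => x _; rewrite Im_conjc mulN1r.
Qed.

End complex_integral.

(** * Square-integrable functions: norms, inner products, Cauchy-Schwarz *)

Section L2_theory.
Context d (T : measurableType d) (R : realType).
Variables (mu : {measure set T -> \bar R}) (D : set T).
Hypothesis mD : measurable D.
Implicit Types f g : T -> R[i].
Local Notation L2 := (L2 mu D).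
Local Notation cmeas := (cmeas D).

Lemma L2_meas f : L2 f -> cmeas f.
Proof. by case. Qed.

Lemma sqnorm2E f : sqnorm2 mu D f = (\int[mu]_(x in D) (nsq (f x))%:E)%E.
Proof. by []. Qed.

Lemma sqnorm2_ge0 f : (0 <= sqnorm2 mu D f)%E.
Proof. by apply: integral_ge0 => x _; rewrite lee_fin nsq_ge0. Qed.

Lemma sqnorm2_le_lin f g h (a b : R) : 0 <= a -> 0 <= b ->
  cmeas f -> cmeas g -> cmeas h ->
  (forall x, D x -> nsq (f x) <= a * nsq (g x) + b * nsq (h x)) ->
  (sqnorm2 mu D f <= a%:E * sqnorm2 mu D g + b%:E * sqnorm2 mu D h)%E.
Proof.
move=> a0 b0 mf mg mh fgh; rewrite !sqnorm2E.
have mE (u : T -> R[i]) : cmeas u -> measurable_fun D (fun x => (nsq (u x))%:E).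
  by move=> mu'; apply/measurable_EFinP; exact: measurable_nsq.
rewrite -!ge0_integralZl_EFin//; try exact: mE; try by move=> x _; rewrite lee_fin nsq_ge0.
rewrite -ge0_integralD//; first last.
- by apply: measurable_funeM; exact: mE.
- by move=> x _; rewrite -EFinM lee_fin mulr_ge0// nsq_ge0.
- by apply: measurable_funeM; exact: mE.
- by move=> x _; rewrite -EFinM lee_fin mulr_ge0// nsq_ge0.
apply: ge0_le_integral => //.
- by move=> x _; rewrite lee_fin nsq_ge0.
- exact: mE.
- by apply: emeasurable_funD; apply: measurable_funeM; exact: mE.
Qed.

Lemma sqnorm2_0 : sqnorm2 mu D (fun=> 0) = 0%E.
Proof. by rewrite sqnorm2E nsq0 integral0. Qed.

Lemma sqnorm2_le f g (a : R) : 0 <= a -> cmeas f -> cmeas g ->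
  (forall x, D x -> nsq (f x) <= a * nsq (g x)) ->
  (sqnorm2 mu D f <= a%:E * sqnorm2 mu D g)%E.
Proof.
move=> a0 mf mg fg.
have := @sqnorm2_le_lin f g (fun=> 0) a 0 a0 (lexx _) mf mg (cmeas_cst _ _).
rewrite sqnorm2_0 mule0 adde0; apply => x Dx.
by rewrite mul0r addr0 fg.
Qed.

Lemma eq_sqnorm2 f g : (forall x, D x -> nsq (f x) = nsq (g x)) ->
  sqnorm2 mu D f = sqnorm2 mu D g.
Proof.
by move=> fg; rewrite !sqnorm2E; apply: eq_integral => x; rewrite inE => Dx; rewrite fg.
Qed.

(** [fine] turns +oo into 0, so this squared norm is informative only on [L2]; membership in [L2] is
    therefore carried along with every estimate. *)
Definition sqnorm f : R := fine (sqnorm2 mu D f).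

Lemma sqnorm_ge0 f : 0 <= sqnorm f.
Proof. exact/fine_ge0/sqnorm2_ge0. Qed.

Lemma sqnormE f : L2 f -> sqnorm2 mu D f = (sqnorm f)%:E.
Proof.
move=> [_ _ fi]; rewrite /sqnorm fineK// ge0_fin_numE//; exact: sqnorm2_ge0.
Qed.

Lemma L2_le_lin f g h (a b : R) : 0 <= a -> 0 <= b ->
  cmeas f -> L2 g -> L2 h ->
  (forall x, D x -> nsq (f x) <= a * nsq (g x) + b * nsq (h x)) ->
  L2 f /\ sqnorm f <= a * sqnorm g + b * sqnorm h.
Proof.
move=> a0 b0 mf Lg Lh fgh.
have := sqnorm2_le_lin a0 b0 mf (L2_meas Lg) (L2_meas Lh) fgh.
rewrite (sqnormE Lg) (sqnormE Lh) => le.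
have Lf : L2 f.
  case: mf => ? ?; split => //; apply: (le_lt_trans le).
  by rewrite -!EFinM -EFinD ltry.
by split => //; move: le; rewrite (sqnormE Lf) -!EFinM -EFinD lee_fin.
Qed.

Lemma L2_0 : L2 (fun=> 0).
Proof. by split; [exact: measurable_cst..|rewrite sqnorm2_0 ltry]. Qed.

Lemma sqnorm0 : sqnorm (fun=> 0) = 0.
Proof. by rewrite /sqnorm sqnorm2_0. Qed.

Lemma L2_le f g (a : R) : 0 <= a -> cmeas f -> L2 g ->
  (forall x, D x -> nsq (f x) <= a * nsq (g x)) -> L2 f /\ sqnorm f <= a * sqnorm g.
Proof.
move=> a0 mf Lg fg.
have := @L2_le_lin f g (fun=> 0) a 0 a0 (lexx _) mf Lg L2_0.
rewrite !mul0r !addr0; apply => x Dx.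
by rewrite addr0 fg.
Qed.

Lemma L2D f g : L2 f -> L2 g -> L2 (fun x => f x + g x).
Proof.
move=> Lf Lg.
have [] // := @L2_le_lin (fun x => f x + g x) f g 2 2 _ _ _ Lf Lg.
- by apply: cmeasD; exact: L2_meas.
- by move=> x _; exact: nsqD_le.
Qed.

Lemma sqnormD_le f g : L2 f -> L2 g -> sqnorm (fun x => f x + g x) <= 2 * sqnorm f + 2 * sqnorm g.
Proof.
move=> Lf Lg.
have [] // := @L2_le_lin (fun x => f x + g x) f g 2 2 _ _ _ Lf Lg.
- by apply: cmeasD; exact: L2_meas.
- by move=> x _; exact: nsqD_le.
Qed.

Lemma eq_sqnorm f g : (forall x, D x -> nsq (f x) = nsq (g x)) -> sqnorm f = sqnorm g.
Proof. by move=> fg; rewrite /sqnorm (eq_sqnorm2 fg). Qed.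

Lemma L2_bdM f g (C : R) : cmeas f -> (forall x, D x -> nsq (f x) <= C) ->
  L2 g -> L2 (fun x => f x * g x) /\ sqnorm (fun x => f x * g x) <= `|C| * sqnorm g.
Proof.
move=> mf fC Lg; apply: L2_le => //.
- by apply: cmeasM => //; exact: L2_meas.
- move=> x Dx; rewrite nsqM ler_wpM2r ?nsq_ge0//.
  by rewrite (le_trans (fC _ Dx))// ler_norm.
Qed.

Lemma L2Z (c : R[i]) f : L2 f -> L2 (fun x => c * f x).
Proof.
move=> Lf; have [] // := @L2_bdM (fun=> c) f (nsq c) _ _ Lf.
Qed.

Lemma sqnormZ (c : R[i]) f : L2 f -> sqnorm (fun x => c * f x) = nsq c * sqnorm f.
Proof.
move=> Lf; rewrite /sqnorm !sqnorm2E.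
under eq_integral do rewrite nsqM EFinM.
rewrite ge0_integralZl_EFin ?nsq_ge0//.
- by rewrite -sqnorm2E sqnormE// -EFinM.
- by move=> x _; rewrite lee_fin nsq_ge0.
- by apply/measurable_EFinP/measurable_nsq; exact: L2_meas.
Qed.

Lemma L2N f : L2 f -> L2 (fun x => - f x).
Proof. by move/(L2Z (-1)); under eq_fun do rewrite mulN1r. Qed.

Lemma L2B f g : L2 f -> L2 g -> L2 (fun x => f x - g x).
Proof. by move=> a b; apply: L2D => //; exact: L2N. Qed.

Lemma sqnormBC f g : sqnorm (fun x => f x - g x) = sqnorm (fun x => g x - f x).
Proof. by apply: eq_sqnorm => x _; rewrite nsqC. Qed.

Lemma L2conj f : L2 f -> L2 (fun x => conjc (f x)).
Proof.
move=> Lf; have [] // := @L2_le (fun x => conjc (f x)) f 1 _ _ Lf.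
- by apply: cmeas_conj; exact: L2_meas.
- by move=> x _; rewrite nsq_conj mul1r.
Qed.

Lemma L2_sum I (s : seq I) (F : I -> T -> R[i]) :
  (forall i, L2 (F i)) -> L2 (fun x => \sum_(i <- s) F i x).
Proof.
move=> mF; elim: s => [|i s ih].
  by under eq_fun do rewrite big_nil; exact: L2_0.
by under eq_fun do rewrite big_cons; exact: L2D.
Qed.

Lemma sqnorm_tri f g h : L2 f -> L2 g -> L2 h ->
  sqnorm (fun x => f x - h x) <= 2 * sqnorm (fun x => f x - g x) + 2 * sqnorm (fun x => g x - h x).
Proof.
move=> Lf Lg Lh; rewrite (@eq_sqnorm _ (fun x => (f x - g x) + (g x - h x))).
  by apply: sqnormD_le; exact: L2B.
by move=> x _; rewrite addrA subrK.
Qed.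

(** Each coordinate of a product has the form ab + ce, which is dominated by the sum of the two
    squared moduli, an integrable function. *)
Lemma L2M_integrable f g : L2 f -> L2 g -> cintegrable mu D (fun x => f x * g x).
Proof.
move=> Lf Lg.
have mfg : cmeas (fun x => f x * g x) by apply: cmeasM; exact: L2_meas.
have bd : mu.-integrable D (fun x => (nsq (f x) + nsq (g x))%:E).
  have h u : L2 u -> mu.-integrable D (fun x => (nsq (u x))%:E).
    move=> Lu; apply/integrableP; split.
      by apply/measurable_EFinP/measurable_nsq; exact: L2_meas.
    rewrite (eq_integral (fun x => (nsq (u x))%:E)); first by case: Lu.
    by move=> x _; rewrite /= ger0_norm// nsq_ge0.
  by under eq_fun do rewrite EFinD; apply: integrableD => //; exact: h.
have key (a b c e : R) : `|a * b + c * e| <= a ^+ 2 + c ^+ 2 + (b ^+ 2 + e ^+ 2).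
  have := sqr_ge0 (a + b); have := sqr_ge0 (c + e).
  have := sqr_ge0 (a - b); have := sqr_ge0 (c - e).
  have := sqr_ge0 a; have := sqr_ge0 b; have := sqr_ge0 c; have := sqr_ge0 e.
  by rewrite ler_norml => *; apply/andP; split; lra.
case: mfg => m1 m2; split; apply: (le_integrable mD _ _ bd).
- exact/measurable_EFinP.
- move=> x Dx /=; rewrite lee_fin (@ger0_norm _ (_ + _)); last by apply: addr_ge0; exact: nsq_ge0.
  rewrite ReM -mulrN; apply: (le_trans (key _ _ _ _)).
  by rewrite sqrrN.
- exact/measurable_EFinP.
- move=> x Dx /=; rewrite lee_fin (@ger0_norm _ (_ + _)); last by apply: addr_ge0; exact: nsq_ge0.
  rewrite ImM; apply: (le_trans (key _ _ _ _)).
  by rewrite lerD2l addrC.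
Qed.

Lemma inner_integrable f g : L2 f -> L2 g ->
  cintegrable mu D (fun x => f x * conjc (g x)).
Proof. by move=> Lf Lg; apply: L2M_integrable => //; exact: L2conj. Qed.

Local Notation inner := (inner mu D).

Lemma innerDl f g h : L2 f -> L2 g -> L2 h ->
  inner (fun x => f x + g x) h = inner f h + inner g h.
Proof.
move=> Lf Lg Lh; rewrite /inner -cintegralD//; try exact: inner_integrable.
by apply: eq_cintegral => x _; rewrite mulrDl.
Qed.

Lemma innerZl (c : R[i]) f h : L2 f -> L2 h ->
  inner (fun x => c * f x) h = c * inner f h.
Proof.
move=> Lf Lh; rewrite /inner -cintegralZ//; try exact: inner_integrable.
by apply: eq_cintegral => x _; rewrite mulrA.
Qed.

Lemma innerC f g : L2 f -> L2 g -> inner g f = conjc (inner f g).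
Proof.
move=> Lf Lg; rewrite /inner -cintegral_conj//; try exact: inner_integrable.
apply: eq_cintegral => x _; rewrite rmorphM mulrC /=; congr (_ * _).
by apply: complex_eq; rewrite !ReImE ?opprK.
Qed.

Lemma innerBl f g h : L2 f -> L2 g -> L2 h ->
  inner (fun x => f x - g x) h = inner f h - inner g h.
Proof.
move=> Lf Lg Lh; rewrite /inner -cintegralB//; try exact: inner_integrable.
by apply: eq_cintegral => x _; rewrite mulrBl.
Qed.

Lemma innerDr f g h : L2 f -> L2 g -> L2 h ->
  inner h (fun x => f x + g x) = inner h f + inner h g.
Proof.
move=> Lf Lg Lh; rewrite (innerC (L2D Lf Lg) Lh) innerDl// rmorphD.
by rewrite (innerC Lf Lh) (innerC Lg Lh).
Qed.

Lemma innerBr f g h : L2 f -> L2 g -> L2 h ->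
  inner h (fun x => f x - g x) = inner h f - inner h g.
Proof.
move=> Lf Lg Lh; rewrite (innerC (L2B Lf Lg) Lh) innerBl// rmorphB.
by rewrite (innerC Lf Lh) (innerC Lg Lh).
Qed.

Lemma innerZr (c : R[i]) f h : L2 f -> L2 h ->
  inner h (fun x => c * f x) = conjc c * inner h f.
Proof.
move=> Lf Lh; rewrite (innerC (L2Z c Lf) Lh) innerZl// rmorphM.
by rewrite (innerC Lf Lh).
Qed.

Lemma inner_self f : L2 f -> inner f f = (sqnorm f)%:C.
Proof.
move=> Lf; apply: complex_eq => /=.
- rewrite /sqnorm sqnorm2E; congr fine; apply: eq_integral => x _.
  by rewrite ReM !ReImE /nsq; congr (_%:E); ring.
- transitivity (\int[mu]_(x in D) (0 : R)); last by rewrite Rintegral_cst ?mul0r.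
  by apply: eq_Rintegral => x _; rewrite ImM !ReImE; ring.
Qed.

Lemma inner_suml I (s : seq I) (F : I -> T -> R[i]) h :
  (forall i, L2 (F i)) -> L2 h ->
  inner (fun x => \sum_(i <- s) F i x) h = \sum_(i <- s) inner (F i) h.
Proof.
move=> LF Lh; rewrite -cintegral_sum => [|//|i]; last exact: inner_integrable.
by apply: eq_cintegral => x _; rewrite mulr_suml.
Qed.

Lemma sqnormD f g : L2 f -> L2 g ->
  sqnorm (fun x => f x + g x) = sqnorm f + 2 * complex.Re (inner f g) + sqnorm g.
Proof.
move=> Lf Lg; have LD := L2D Lf Lg.
have := inner_self LD; rewrite innerDl// !innerDr// (innerC Lf Lg) !inner_self//.
move: (inner f g) (sqnorm _) (sqnorm _) (sqnorm _) => z a b c.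
by move=> /(congr1 (fun z => complex.Re z)); rewrite !ReImE /= => <-; ring.
Qed.

Lemma cauchy_schwarz f g : L2 f -> L2 g -> nsq (inner f g) <= sqnorm f * sqnorm g.
Proof.
move=> Lf Lg.
set z := inner f g.
(* The coefficient [t * z] of [g] makes the cross term real, so the norm of [f + t z g] is a real
   quadratic polynomial in [t]. *)
have key (t : R) : 0 <= sqnorm f + 2 * (t * nsq z) + t ^+ 2 * (nsq z * sqnorm g).
  have := sqnorm_ge0 (fun x => f x + (t%:C * z) * g x).
  rewrite sqnormD//; last exact: L2Z.
  rewrite sqnormZ// innerZr// -/z nsqM nsq_real.
  move: (z) (sqnorm f) (sqnorm g) => {}z a b.
  rewrite /nsq !ReImE /= => h.
  apply: (le_trans h); rewrite le_eqVlt; apply/orP; left; apply/eqP; ring.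
have := sqnorm_ge0 f; have := sqnorm_ge0 g; have := nsq_ge0 z.
move: key; move: (nsq z) (sqnorm f) (sqnorm g) => a b c key a0 c0 b0.
have [c00|c00] := eqVneq c 0.
  (* For a null [g] the polynomial is affine, and this [t] would give it the value -1 unless [a] is
     0. *)
  move: (key (- (b + 1) / (2 * a))); rewrite c00 !mulr0 addr0.
  have [->//|an0] := eqVneq a 0.
  rewrite (_ : 2 * _ = - (b + 1)); last by field; rewrite an0.
  by move=> ?; lra.
have cp : 0 < c by rewrite lt_neqAle eq_sym c00.
(* The point where the quadratic polynomial is minimal. *)
have := key (- c^-1).
rewrite sqrrN exprVn (_ : _ + _ = b - a / c); last by field.
by rewrite subr_ge0 ler_pdivrMr.
Qed.

End L2_theory.

(** * Pointwise limits and completeness of L^2 *)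

Section limits.
Variable R : realType.

(** The limit superior exists for every sequence and depends measurably on parameters, so it serves
    as a total limit operator; [fine] gives 0 where it is infinite. *)
Definition elimit (g : nat -> R) : R := fine (limn_esup (fun j => (g j)%:E)).

Definition climit (g : nat -> R[i]) : R[i] :=
  elimit (fun j => complex.Re (g j)) +i* elimit (fun j => complex.Im (g j)).

Lemma elimit_cvg (g : nat -> R) l : g j @[j --> \oo] --> l -> elimit g = l.
Proof.
move=> gl; rewrite /elimit.
have h : (g j)%:E @[j --> \oo] --> l%:E by apply: cvg_EFin => //; exact: nearW.
by rewrite (cvg_limn_einf_sup h).2.
Qed.

Lemma limn_einf_le (u : nat -> \bar R) (l : \bar R) : (forall n, u n <= l)%E -> (limn_einf u <= l)%E.
Proof.
move=> ul; apply: (le_trans (limn_einf_sup _)).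
rewrite limn_esup_lim; apply: lime_le; first exact: is_cvg_esups.
by apply: nearW => n; apply: ge_ereal_sup => _ [m _ <-].
Qed.

(** As C <= (C + 1)^2, the increments are at most (C + 1) 2^-j and the telescoping series converges
    absolutely. *)
Lemma geometric_step_cvg (g : nat -> R) (C : R) : 0 <= C ->
  (forall j, 4 ^+ j * (g j.+1 - g j) ^+ 2 <= C) -> cvgn g.
Proof.
move=> C0 gC.
have C1 : 0 < C + 1 by lra.
have step j : `|g j.+1 - g j| <= geometric (C + 1) 2^-1 j.
  rewrite -(@ler_pXn2r _ 2) ?nnegrE//; last first.
    by rewrite /geometric /= mulr_ge0 ?exprn_ge0 ?ltW.
  rewrite real_normK ?num_real// /geometric /= exprMn -exprM mulnC exprM exprVn.
  rewrite -[X in X^-1]/((2:R) ^+ 2) (_ : (2 : R) ^+ 2 = 4); last by rewrite -natrX.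
  rewrite exprVn ler_pdivlMr ?exprn_gt0// mulrC (le_trans (gC j))// expr2.
  nra.
have : cvgn (series (telescope g)).
  apply: normed_cvg; apply: (@series_le_cvg _ _ (geometric (C + 1) 2^-1)) => //.
  - by move=> n /=.
  - by move=> n; rewrite /geometric /= mulr_ge0 ?exprn_ge0 ?ltW.
  - by apply: is_cvg_geometric_series; rewrite ger0_norm// invf_lt1// ltr1n.
rewrite telescopeK => h.
have -> : g = (fun n => (g n - g 0%N) + g 0%N) by apply/funext => n; rewrite subrK.
by apply: is_cvgD => //; exact: is_cvg_cst.
Qed.

End limits.

Section riesz_fischer.
Context d (T : measurableType d) (R : realType).
Variables (mu : {measure set T -> \bar R}) (D : set T).
Hypothesis mD : measurable D.
Implicit Types f g : T -> R[i].
Local Notation L2 := (L2 mu D).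
Local Notation N := (sqnorm mu D).

Definition cauchyL2 (fn : nat -> T -> R[i]) := forall e : R, 0 < e ->
  exists n0, forall n m, (n0 <= n)%N -> (n0 <= m)%N ->
    N (fun x => fn n x - fn m x) <= e.

Definition limL2 (fn : nat -> T -> R[i]) f := forall e : R, 0 < e ->
  exists n0, forall n, (n0 <= n)%N -> N (fun x => fn n x - f x) <= e.

Lemma cmeas_climit (g : nat -> T -> R[i]) : (forall j, cmeas D (g j)) ->
  cmeas D (fun x => climit (fun j => g j x)).
Proof.
move=> mg; split => /=.
- apply: measurableT_comp => //; apply: measurable_fun_limn_esup => j.
  by apply/measurable_EFinP; exact: (mg j).1.
- apply: measurableT_comp => //; apply: measurable_fun_limn_esup => j.
  by apply/measurable_EFinP; exact: (mg j).2.
Qed.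

(** Weighted by 4^j, the squared increments have integrals at most 4^j 8^-j = 2^-j. Their sum is
    integrable, hence finite almost everywhere, and at such a point [geometric_step_cvg] applies to
    both coordinates. *)
Lemma fast_cauchy_ae (g : nat -> T -> R[i]) : (forall j, L2 (g j)) ->
  (forall j, N (fun x => g j.+1 x - g j x) <= 8 ^- j) ->
  {ae mu, forall x, D x ->
    (fun j => complex.Re (g j x)) @ \oo --> complex.Re (climit (fun j => g j x)) /\
    (fun j => complex.Im (g j x)) @ \oo --> complex.Im (climit (fun j => g j x))}.
Proof.
move=> Lg g8.
pose w j x : R := 4 ^+ j * nsq (g j.+1 x - g j x).
have w0 j x : 0 <= w j x by rewrite mulr_ge0 ?exprn_ge0 ?nsq_ge0.
have Ld j : L2 (fun x => g j.+1 x - g j x) by exact: L2B.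
have mw j : measurable_fun D (fun x => (w j x)%:E).
  apply/measurable_EFinP; apply: measurable_funM => //.
  by apply: measurable_nsq => //; exact/L2_meas/Ld.
have iw j : (\int[mu]_(x in D) (w j x)%:E <= (geometric 1 2^-1 j)%:E)%E.
  rewrite /w; under eq_integral do rewrite EFinM.
  rewrite ge0_integralZl_EFin ?exprn_ge0//.
  - rewrite -sqnorm2E (sqnormE (Ld j)) -EFinM lee_fin /geometric /= mul1r.
    apply: (le_trans (ler_wpM2l _ (g8 j))); first by rewrite exprn_ge0.
    by rewrite -exprVn -exprMn (_ : 4 / 8 = 2^-1)//; field.
  - by move=> x _; rewrite lee_fin nsq_ge0.
  - by apply/measurable_EFinP/measurable_nsq => //; exact/L2_meas/Ld.
have Sint : mu.-integrable D (fun x => \sum_(0 <= j <oo) (w j x)%:E)%E.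
  apply/integrableP; split.
    by apply: ge0_emeasurable_sum => // j x _ _; rewrite lee_fin.
  rewrite (eq_integral (fun x => \sum_(0 <= j <oo) (w j x)%:E)%E); last first.
    by move=> x _; rewrite gee0_abs// nneseries_ge0// => j _ _; rewrite lee_fin.
  rewrite integral_nneseries//; last by move=> j x _; rewrite lee_fin.
  apply: (@le_lt_trans _ _ (\sum_(0 <= j <oo) (geometric 1 2^-1 j)%:E)%E).
    apply: lee_nneseries => *; last exact: iw.
    by apply: integral_ge0 => *; rewrite lee_fin.
  rewrite (_ : (\sum_(0 <= j <oo) _)%E = (limn (series (geometric (1:R) 2^-1)))%:E) ?ltry//.
  apply/cvg_lim => //.
  rewrite (_ : (fun n => _) = EFin \o series (geometric (1:R) 2^-1)); last first.
    by apply/funext => n; rewrite /= /series /= sumEFin.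
  apply: cvg_EFin; first exact: nearW.
  by apply: is_cvg_geometric_series; rewrite ger0_norm// invf_lt1// ltr1n.
have := integrable_ae mD Sint; apply: filterS => x Sx Dx.
have {}Sx := Sx Dx.
pose S := (\sum_(0 <= j <oo) (w j x)%:E)%E.
have wS j : w j x <= fine S.
  rewrite -lee_fin fineK// (le_trans _ (nneseries_lim_ge j.+1 _))//; last first.
    by move=> i _ _; rewrite lee_fin.
  rewrite big_nat_recr//= leeDr// sume_ge0// => i _; rewrite lee_fin//.
have S0 : 0 <= fine S by exact: le_trans (w0 0%N x) (wS 0%N).
have cR : cvgn (fun j => complex.Re (g j x)).
  apply: (geometric_step_cvg S0) => j; apply: le_trans (wS j).
  by rewrite /w ler_wpM2l ?exprn_ge0// -ReN -ReD Re_sqr_le.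
have cI : cvgn (fun j => complex.Im (g j x)).
  apply: (geometric_step_cvg S0) => j; apply: le_trans (wS j).
  by rewrite /w ler_wpM2l ?exprn_ge0// -ImN -ImD Im_sqr_le.
by split => /=; [rewrite (elimit_cvg cR)|rewrite (elimit_cvg cI)].
Qed.

(** The limit is an explicit [climit] along a subsequence, so that pointwise identities shared by
    all [fn n], such as periodicity, hold for it at every point and not just almost everywhere. *)
Theorem riesz_fischer (fn : nat -> T -> R[i]) : (forall n, L2 (fn n)) ->
  cauchyL2 fn ->
  exists k : nat -> nat, let f x := climit (fun j => fn (k j) x) in
    L2 f /\ limL2 fn f.
Proof.
move=> Lf cf.
have e8 j : 0 < (8 ^- j : R) by rewrite invr_gt0 exprn_gt0.
have [n0 n0P] := choice (fun j => cf _ (e8 j)).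
(* A partial sum of the [(n0 i).+1] exceeds [n0 j], increases with [j] and exceeds [j], whatever the
   order of the values of [n0]. *)
pose k j := (\sum_(i < j.+1) (n0 i).+1)%N.
have n0k j : (n0 j < k j)%N by rewrite /k big_ord_recr/= leq_addl.
have kS j : (k j <= k j.+1)%N by rewrite [k j.+1]/k big_ord_recr/= leq_addr.
have kj j : (j < k j)%N.
  elim: j => [|j ih]; first by rewrite /k big_ord1.
  by rewrite /k big_ord_recr/= -/(k j) (leq_ltn_trans ih)// -addn1 leq_add2l.
exists k => f.
pose g j := fn (k j).
have ae := @fast_cauchy_ae g (fun j => Lf (k j)) (fun j => n0P j _ _
  (ltnW (leq_trans (n0k j) (kS j))) (ltnW (n0k j))).
have mf : cmeas D f by apply: cmeas_climit => j; exact/L2_meas/Lf.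
(* Fatou's lemma along the subsequence: almost everywhere, the integrand for [f] is the limit of the
   integrands [h j]. The shift by [n1] keeps all indices where the Cauchy bound holds. *)
have key (e : R) n1 : 0 < e -> (forall n m, (n1 <= n)%N -> (n1 <= m)%N ->
    N (fun x => fn n x - fn m x) <= e) ->
    forall n, (n1 <= n)%N -> (sqnorm2 mu D (fun x => fn n x - f x)%R <= e%:E)%E.
  move=> e0 n1P n n1n.
  pose h j x := (nsq (fn n x - fn (k (j + n1)%N) x))%:E.
  have mh j : measurable_fun D (h j).
    apply/measurable_EFinP; apply: measurable_nsq => //.
    by apply: L2_meas; exact: L2B.
  have -> : sqnorm2 mu D (fun x => fn n x - f x) =
      (\int[mu]_(x in D) limn_einf (h^~ x))%E.
    rewrite sqnorm2E; apply: ae_eq_integral => //.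
    - apply/measurable_EFinP/measurable_nsq => //.
      by apply: cmeasB => //; exact/L2_meas/Lf.
    - rewrite (_ : (fun x => _) = (fun x => - limn_esup (fun j => - h j x))%E); last first.
        apply/funext => x; rewrite -[RHS]limn_einfN; congr limn_einf.
        by apply/funext => j; exact: (esym (oppeK _)).
      apply: measurableT_comp => //.
      apply: measurable_fun_limn_esup => j; exact: measurableT_comp.
    - move: ae; apply: filterS => x + Dx => /(_ Dx) [cR cI].
      apply/esym; apply: (cvg_limn_einf_sup _).1.
      apply: cvg_EFin; first exact: nearW.
      have sh (u : nat -> R) (l : R) : u @ \oo --> l -> (fun j => u (j + n1)%N) @ \oo --> l.
        by move=> ul; rewrite (cvg_shiftn n1).
      have sq (u : nat -> R) (l c : R) : u @ \oo --> l ->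
          (fun j => (c - u (j + n1)%N) ^+ 2) @ \oo --> (c - l) ^+ 2.
        move=> /sh ul.
        have h1 : (fun j => c - u (j + n1)%N) @ \oo --> c - l.
          by apply: cvgB => //; exact: cvg_cst.
        exact: (cvgM h1 h1).
      rewrite (_ : fine \o h^~ x = (fun j =>
          (complex.Re (fn n x) - complex.Re (g (j + n1)%N x)) ^+ 2 +
          (complex.Im (fn n x) - complex.Im (g (j + n1)%N x)) ^+ 2)); last first.
        by apply/funext => j; rewrite /= /nsq !ReImE.
      rewrite /nsq !ReImE; apply: cvgD.
      + exact: (sq (fun j => complex.Re (g j x))).
      + exact: (sq (fun j => complex.Im (g j x))).
  apply: (@le_trans _ _ (limn_einf (fun j => \int[mu]_(x in D) h j x)))%E.
    by apply: fatou => // j x _; rewrite lee_fin nsq_ge0.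
  apply: limn_einf_le => j; rewrite -[leLHS]/(sqnorm2 mu D _) (sqnormE (L2B mD (Lf _) (Lf _))) lee_fin.
  apply: n1P => //.
  by apply: ltnW; apply: leq_ltn_trans (kj _); rewrite leq_addl.
have Lff : L2 f.
  have [n1 n1P] := cf 1 ltr01.
  have h := key 1 n1 ltr01 n1P n1 (leqnn _).
  have Ld : L2 (fun x => fn n1 x - f x).
    have [a b] : cmeas D (fun x => fn n1 x - f x).
      by apply: cmeasB => //; exact/L2_meas/Lf.
    by split => //; apply: (le_lt_trans h); rewrite ltry.
  have := L2B mD (Lf n1) Ld.
  by under eq_fun do rewrite opprB addrC subrK.
split => // e e0; have [n1 n1P] := cf _ e0; exists n1 => n n1n.
by have := key _ _ e0 n1P _ n1n; rewrite (sqnormE (L2B mD (Lf _) Lff)) lee_fin.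
Qed.

End riesz_fischer.

(** * Density of algebras of bounded functions *)

Section step_polynomials.
Variable R : realType.

Lemma bernoulli_ge (x : R) n : 0 <= x -> 1 + x *+ n <= (1 + x) ^+ n.
Proof.
move=> x0; elim: n => [|n ih]; first by rewrite mulr0n addr0 expr0.
rewrite exprS mulrSr; apply: (@le_trans _ _ ((1 + x) * (1 + x *+ n))).
  have : 0 <= x *+ n by rewrite mulrn_wge0.
  by move: (x *+ n) => a a0; nra.
by rewrite ler_wpM2l// addr_ge0.
Qed.

Lemma bernoulli_le (x : R) n : 0 <= x <= 1 -> 1 - x *+ n <= (1 - x) ^+ n.
Proof.
move=> /andP[x0 x1]; elim: n => [|n ih]; first by rewrite mulr0n subr0 expr0.
rewrite exprS mulrSr; apply: (@le_trans _ _ ((1 - x) * (1 - x *+ n))).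
  have : 0 <= x *+ n by rewrite mulrn_wge0.
  by move: (x *+ n) => a a0; nra.
by rewrite ler_wpM2l// subr_ge0.
Qed.

(* The Brosowski--Deutsch polynomials (1 - x^M)^(2^M), whose argument is shifted
   by 1/m so that they also converge at the jump 1/2. *)
Definition step_poly (n : nat) (x : R) : R :=
  let m := n.+4 in (1 - (x + m%:R^-1) ^+ (m * m)) ^+ (2 ^ (m * m)).

Let minv n : 0 < (n.+4%:R^-1 : R) <= 4^-1.
Proof. by rewrite invr_gt0 ltr0n /= lef_pV2 ?posrE ?ltr0n// ler_nat. Qed.

Lemma step_poly_itv n x : 4^-1 <= x <= 3 / 4 -> 0 <= step_poly n x <= 1.
Proof.
move=> x34; have := minv n; rewrite /step_poly; move: (n.+4%:R^-1) => a a4.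
have h : 0 <= (x + a) ^+ (n.+4 * n.+4) <= 1.
  have : 0 <= x + a <= 1 by lra.
  by move=> /andP[? ?]; rewrite exprn_ge0//= exprn_ile1.
by rewrite exprn_ge0/= ?exprn_ile1//; lra.
Qed.

(** Put y = (x + 1/m)^M with M = m^2 and N = 2^M, so that N y = (2x + 2/m)^M. Below 1/2 this tends
    to 0, and (1 - y)^N >= 1 - N y. From 1/2 on it is at least (1 + 2/m)^M >= 2m, and (1 - y)^N <=
    (1 + y)^-N <= 1/(N y). *)
Lemma step_poly_cvg x : 4^-1 <= x <= 3 / 4 ->
  (fun n => step_poly n x) @ \oo --> ((x < 2^-1)%R%:R : R).
Proof.
move=> x34; have [xlt|xge] := ltP x 2^-1 => /=.
(* Midway between 2x and 1: 2x + 2/m stays below [rho] as soon as 1/m <= (1 - 2x)/4. *)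
- pose rho : R := (1 + 2 * x) / 2.
  have rho01 : 0 <= rho < 1 by rewrite /rho; lra.
  apply: (@squeeze_cvgr _ _ _ _ (fun n => 1 - rho ^+ n) (fun=> 1)); last 2 first.
  + rewrite -[X in _ --> X]subr0; apply: cvgB; first exact: cvg_cst.
    by apply: cvg_expr; rewrite ger0_norm//; lra.
  + exact: cvg_cst.
  have : \forall n \near \oo, (n.+4%:R^-1 : R) <= (1 - 2 * x) / 4.
    have p : 0 < (1 - 2 * x) / 4 by lra.
    near=> n; rewrite -[leRHS]invrK lef_pV2 ?posrE ?invr_gt0 ?ltr0n//.
    apply: (@le_trans _ _ n%:R); last by rewrite ler_nat -addn4 leq_addr.
    by near: n; exact: nbhs_infty_ger.
  apply: filterS => n hn; rewrite (andP (step_poly_itv n x34)).2 andbT.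
  move: hn (minv n); rewrite /step_poly; move: (n.+4%:R^-1) => a ha a4.
  set M := (n.+4 * n.+4)%N.
  have y01 : 0 <= (x + a) ^+ M <= 1.
    by rewrite exprn_ge0 ?exprn_ile1//; lra.
  apply: le_trans (bernoulli_le _ y01).
  rewrite lerD2l lerN2 -(mulr_natl ((x + a) ^+ M)) natrX -exprMn.
  apply: (@le_trans _ _ (rho ^+ M)).
    by apply: lerXn2r; rewrite ?nnegrE /rho; lra.
  apply: ler_wiXn2l; [lra|lra|].
  by rewrite /M mulnS (leq_trans _ (leq_addr _ _))// -addn4 leq_addr.
- apply: (@squeeze_cvgr _ _ _ _ (fun=> 0) (fun n => n.+1%:R^-1)); last 2 first.
  + exact: cvg_cst.
  + exact: cvg_harmonic.
  apply: nearW => n; rewrite (andP (step_poly_itv n x34)).1 /=.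
  rewrite /step_poly; set M := (n.+4 * n.+4)%N.
  have := minv n; set a := n.+4%:R^-1 => a4.
  have y01 : 0 <= (x + a) ^+ M <= 1.
    by rewrite exprn_ge0 ?exprn_ile1//; lra.
  set y := (x + a) ^+ M in y01 *.
  have big : n.+1%:R <= y *+ (2 ^ M).
    rewrite -(mulr_natl y) natrX -exprMn.
    apply: (@le_trans _ _ ((1 + 2 * a) ^+ M)); last first.
      by apply: lerXn2r; rewrite ?nnegrE; lra.
    apply: le_trans (bernoulli_ge _ _); last lra.
    have an : n.+4%:R * a = 1 by rewrite /a divff// pnatr_eq0.
    rewrite -(mulr_natl (2 * a)) natrM.
    rewrite (_ : _ * (2 * a) = 2 * n.+4%:R * (n.+4%:R * a)); last by ring.
    have e1 : n.+1%:R = n%:R + 1 :> R by rewrite -natr1.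
    have e4 : n.+4%:R = n%:R + 4 :> R by rewrite -addn4 natrD.
    rewrite an mulr1 e1 e4; have := ler0n R n; move: (n%:R : R) => z; lra.
  have yp : 0 < y *+ (2 ^ M) by apply: lt_le_trans big; rewrite ltr0n.
  apply: (@le_trans _ _ ((y *+ (2 ^ M))^-1)); last by rewrite lef_pV2 ?posrE ?ltr0n.
  rewrite -[leRHS]mul1r ler_pdivlMr//.
  apply: (@le_trans _ _ ((1 - y) ^+ (2 ^ M) * (1 + y) ^+ (2 ^ M))).
    apply: ler_wpM2l; first by rewrite exprn_ge0//; lra.
    by apply: le_trans (bernoulli_ge _ _); [rewrite lerDr|lra].
  rewrite -exprMn exprn_ile1//; nra.
Unshelve. all: by end_near.
Qed.

End step_polynomials.

(** * L^2 density of an algebra of bounded functions on a domain of finite measure *)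

Section density.
Context d (T : measurableType d) (R : realType).
Variables (mu : {measure set T -> \bar R}) (D : set T).
Hypothesis mD : measurable D.
Hypothesis muD : (mu D < +oo)%E.
Local Notation L2 := (L2 mu D).
Local Notation N := (sqnorm mu D).
Local Notation cmeas := (cmeas D).
Implicit Types f g : T -> R[i].

Lemma bounded_L2 f (C : R) : cmeas f -> (forall x, D x -> nsq (f x) <= C) ->
  L2 f /\ N f <= `|C| * fine (mu D).
Proof.
move=> mf fC.
have E : sqnorm2 mu D (fun=> (1 : R[i])) = mu D.
  rewrite sqnorm2E /nsq /= expr1n expr0n/= addr0 integral_cst//= mul1e//.
have L1 : L2 (fun=> 1) by split; rewrite ?E//; exact: measurable_cst.
have [] := @L2_bdM _ _ _ mu D mD f (fun=> 1) C mf fC L1.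
by under eq_fun do rewrite mulr1; rewrite {2}/sqnorm E.
Qed.

Variable A : set (T -> R[i]).

Definition Cl f := L2 f /\ forall e : R, 0 < e ->
  exists2 p, A p & N (fun x => f x - p x) <= e.

Hypothesis A1 : forall c : R[i], A (fun=> c).
Hypothesis AD : forall f g, A f -> A g -> A (fun x => f x + g x).
Hypothesis AM : forall f g, A f -> A g -> A (fun x => f x * g x).
Hypothesis Ameas : forall f, A f -> cmeas f.
Hypothesis Abd : forall f, A f -> exists C, forall x, D x -> nsq (f x) <= C.

Lemma A_L2 f : A f -> L2 f.
Proof.
by move=> Af; have [C fC] := Abd Af; have [] := bounded_L2 (Ameas Af) fC.
Qed.

Lemma Cl_A f : A f -> Cl f.
Proof.
move=> Af; split; first exact: A_L2.
move=> e e0; exists f => //.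
by under eq_fun do rewrite subrr; rewrite sqnorm0 ltW.
Qed.

Lemma ClD f g : Cl f -> Cl g -> Cl (fun x => f x + g x).
Proof.
move=> [Lf cf] [Lg cg]; split; first exact: L2D.
move=> e e0; have e4 : 0 < e / 4 by lra.
have [p Ap fp] := cf _ e4; have [q Aq gq] := cg _ e4.
exists (fun x => p x + q x); first exact: AD.
have := sqnormD_le mD (L2B mD Lf (A_L2 Ap)) (L2B mD Lg (A_L2 Aq)).
under eq_fun do rewrite addrACA -opprD.
move: fp gq; lra.
Qed.

Lemma ClZ (c : R[i]) f : Cl f -> Cl (fun x => c * f x).
Proof.
move=> [Lf cf]; split; first exact: L2Z.
move=> e e0; have e4 : 0 < e / (nsq c + 1).
  by rewrite divr_gt0// ltr_wpDl// nsq_ge0.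
have [p Ap fp] := cf _ e4.
exists (fun x => c * p x); first exact: AM.
have := sqnormZ mD c (L2B mD Lf (A_L2 Ap)).
under eq_fun do rewrite mulrBr.
move=> ->; apply: (le_trans (ler_wpM2l (nsq_ge0 _) fp)).
have c0 := nsq_ge0 c.
rewrite mulrA ler_pdivrMr; last lra.
nra.
Qed.

Lemma Cl_sum I (s : seq I) (F : I -> T -> R[i]) :
  (forall i, Cl (F i)) -> Cl (fun x => \sum_(i <- s) F i x).
Proof.
move=> mF; elim: s => [|i s ih].
  by under eq_fun do rewrite big_nil; exact/Cl_A/A1.
by under eq_fun do rewrite big_cons; exact: ClD.
Qed.

Lemma Cl_closed f : L2 f -> (forall e : R, 0 < e ->
  exists2 g, Cl g & N (fun x => f x - g x) <= e) -> Cl f.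
Proof.
move=> Lf cf; split => // e e0; have e4 : 0 < e / 4 by lra.
have [g [Lg cg] fg] := cf _ e4; have [p Ap gp] := cg _ e4.
exists p => //; have := sqnorm_tri mD Lf Lg (A_L2 Ap); move: fg gp; lra.
Qed.

(** Dominated convergence for squared norms. Each stage of the monotone class argument (boxes,
    generated sigma-algebra, nonnegative functions) is one application of it. *)
Lemma Cl_dominated (h : nat -> T -> R) (f g : T -> R) :
  (forall n, Cl (fun x => (h n x)%:C)) -> measurable_fun D f ->
  L2 (fun x => (g x)%:C) ->
  (forall n x, D x -> `|h n x - f x| <= g x) ->
  (forall x, D x -> h n x @[n --> \oo] --> f x) ->
  Cl (fun x => (f x)%:C).
Proof.
move=> Clh mf Lg hg hf.
have mh n : measurable_fun D (h n) by have [[+ _ _] _] := Clh n.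
have Lhf n : L2 (fun x => (h n x - f x)%:C).
  have [] // := @L2_le _ _ _ mu D mD (fun x => (h n x - f x)%:C) _ 1 ler01 _ Lg.
    by apply: cmeas_real; exact: measurable_funB.
  move=> x Dx; rewrite !nsq_real mul1r -[leLHS]real_normK ?num_real//.
  by apply: lerXn2r; rewrite ?nnegrE// ?hg// (le_trans _ (hg n x Dx)).
have Lf : L2 (fun x => (f x)%:C).
  have [Lh _] := Clh 0%N.
  have := L2B mD Lh (Lhf 0%N).
  by under eq_fun do rewrite -rmorphB opprB addrC subrK.
apply: Cl_closed => // e e0.
pose k n x := ((h n x - f x) ^+ 2)%:E.
have mk n : measurable_fun D (k n).
  apply/measurable_EFinP; apply: measurable_funX.
  exact: measurable_funB.
have k0 x : D x -> (k n x @[n --> \oo] --> 0%E).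
  move=> Dx; apply: cvg_EFin; first exact: nearW.
  have h0 : (fun n => h n x - f x) @ \oo --> (0 : R).
    by rewrite -(subrr (f x)); apply: cvgB; [exact: hf|exact: cvg_cst].
  by rewrite /comp /= -(mul0r 0); exact: (cvgM h0 h0).
have gi : mu.-integrable D (fun x => (g x ^+ 2)%:E).
  apply/integrableP; split.
    by apply/measurable_EFinP; apply: measurable_funX; case: Lg.
  case: Lg => _ _; rewrite sqnorm2E; congr (_ < _)%E.
  by apply: eq_integral => x _; rewrite nsq_real /= ger0_norm// sqr_ge0.
have kg x n : D x -> (`|k n x| <= (g x ^+ 2)%:E)%E.
  move=> Dx; rewrite lee_fin ger0_norm ?sqr_ge0//.
  rewrite -[leLHS]real_normK ?num_real//.
  by apply: lerXn2r; rewrite ?nnegrE// ?hg// (le_trans _ (hg n x Dx)).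
have [_ _] := dominated_convergence mD mk (measurable_cst _) (aeW _ k0) gi
  (aeW _ (fun x n => kg x n)).
rewrite integral0.
move=> /fine_cvgP[_] /cvgrPdist_le /(_ e e0) [n _ /(_ n (leqnn _))] /=.
rewrite sub0r normrN => hn; exists (fun x => (h n x)%:C) => //.
apply: le_trans hn; apply: le_trans (ler_norm _); rewrite le_eqVlt.
apply/orP; left; apply/eqP; congr fine; apply: eq_integral => x _.
by rewrite -rmorphB -/(nsq _) nsq_real -sqrrN opprB.
Qed.

Lemma A_prod n (F : nat -> T -> R[i]) :
  (forall i, A (F i)) -> A (fun x => \prod_(i < n) F i x).
Proof.
move=> mF; elim: n => [|n ih].
  by under eq_fun do rewrite big_ord0; exact: A1.
by under eq_fun do rewrite big_ord_recr /=; exact: AM.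
Qed.

Lemma A_exp n f : A f -> A (fun x => f x ^+ n).
Proof.
move=> Af; elim: n => [|n ih]; first exact: A1.
by under eq_fun do rewrite exprS; exact: AM.
Qed.

Definition realA (X : T -> R) := A (fun x => (X x)%:C).

Lemma realA_step_poly n X : realA X -> realA (fun x => step_poly n (X x)).
Proof.
rewrite /realA /step_poly => AX.
under eq_fun do rewrite rmorphXn rmorphB rmorph1 /= rmorphXn rmorphD /=.
apply: A_exp; rewrite -/(GRing.opp _).
have := AD (A1 1) (AM (A1 (-1)) (A_exp (n.+4 * n.+4) (AD AX (A1 (n.+4%:R^-1)%:C)))).
by under eq_fun do rewrite mulN1r.
Qed.

(** Finite intersections are built in to obtain a pi-system, and the inequalities are strict because
    the step polynomials converge to the indicator of a strict inequality. *)
Definition boxes : set (set T) := [set E | exists (n : nat) (X : nat -> T -> R),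
  (forall i, realA (X i)) /\ E = [set x | forall i, (i < n)%N -> X i x < 0]].

Lemma boxesI : setI_closed boxes.
Proof.
move=> _ _ [n [X [AX ->]]] [m [Y [AY ->]]].
exists (n + m)%N, (fun i => if (i < n)%N then X i else Y (i - n)%N); split.
  by move=> i; case: ifP.
apply/seteqP; split => x /=.
- move=> [hX hY] i inm; case: ifPn => [/hX//|]; rewrite -leqNgt => ni.
  by apply: hY; rewrite ltn_subLR.
- move=> h; split => i ilt.
    by have := h i (ltn_addr _ ilt); rewrite ilt.
  have := h (n + i)%N; rewrite ltn_add2l => /(_ ilt).
    by rewrite (_ : (n + i < n)%N = false) ?addKn// ltnNge leq_addr.
Qed.

Lemma realA_bounded X : realA X -> exists2 B : R, 0 < B & forall x, D x -> `|X x| <= B.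
Proof.
move=> /Abd[C hC]; exists (1 + `|C|); first by rewrite ltr_pwDl.
move=> x Dx; have := hC x Dx; rewrite nsq_real => XC.
have : `|X x| ^+ 2 <= `|C|.
  by rewrite real_normK ?num_real// (le_trans XC)// ler_norm.
have := normr_ge0 (X x); have := normr_ge0 C; nra.
Qed.

Lemma realA_step X : realA X -> exists2 Y : nat -> T -> R,
  (forall n, realA (Y n)) & forall x, D x ->
    (forall n, 0 <= Y n x <= 1) /\ Y n x @[n --> \oo] --> ((X x < 0)%R%:R : R).
Proof.
move=> AX; have [B B0 XB] := realA_bounded AX.
(* The affine map that sends [-B, B] into [1/4, 3/4] and 0 to the jump 1/2 of the step
   polynomials. *)
pose Z x : R := X x / (4 * B) + 2^-1.
have AZ : realA Z.
  rewrite /realA /Z; under eq_fun do rewrite rmorphD rmorphM /=.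
  by apply: AD => //; apply: AM => //; exact: A1.
exists (fun n x => step_poly n (Z x)); first by move=> n; exact: realA_step_poly.
move=> x Dx.
have Zx : 4^-1 <= Z x <= 3 / 4.
  have : `|X x / (4 * B)| <= 4^-1.
    rewrite normrM (@ger0_norm _ (_^-1)) ?invr_ge0; last lra.
    rewrite ler_pdivrMr; last lra.
    by rewrite mulrA mulVf ?mul1r ?XB.
  by rewrite ler_norml /Z; lra.
split => [n|]; first exact: step_poly_itv.
have -> : (X x < 0)%R = (Z x < 2^-1)%R.
  by rewrite /Z gtrDr pmulr_llt0// invr_gt0; lra.
exact: step_poly_cvg.
Qed.

Definition indC (E : set T) : T -> R[i] := fun x => (\1_E x)%:C.

Lemma Cl_boxes E : boxes E -> Cl (indC E).
Proof.
move=> [n [X [AX ->]]].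
have [Y YP] := choice (fun i => let: ex_intro2 Y h1 h2 := realA_step (AX i) in
  ex_intro (fun Y => (forall n, realA (Y n)) /\ forall x, D x ->
    (forall n, 0 <= Y n x <= 1) /\ Y n x @[n --> \oo] --> ((X i x < 0)%R%:R : R))
   Y (conj h1 h2)).
pose h k x := \prod_(i < n) Y i k x.
have Ah k : realA (h k).
  rewrite /realA; under eq_fun do rewrite rmorph_prod /=.
  by apply: (@A_prod n (fun i x => (Y i k x)%:C)) => i; exact: (YP i).1.
have h01 k x : D x -> 0 <= h k x <= 1.
  move=> Dx; rewrite prodr_ge0 ?prodr_ile1// => i _.
    by rewrite ((YP i).2 x Dx).1.
  by have /andP[] := ((YP i).2 x Dx).1 k.
have indE x : \1_[set x | forall i, (i < n)%N -> X i x < 0] x =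
    \prod_(i < n) ((X i x < 0)%R%:R : R).
  rewrite indicE; case: (boolP (x \in _)) => [|].
    rewrite inE /= => h1; rewrite big1// => i _; by rewrite h1.
  rewrite notin_setE /= => /existsNP[i /not_implyP[iln /negP Xi]].
  by rewrite (bigD1 (Ordinal iln)) //= (negbTE Xi) mul0r.
have hcv x : D x -> h k x @[k --> \oo] --> (\1_[set x | forall i, (i < n)%N -> X i x < 0] x : R).
  move=> Dx; rewrite indE.
  rewrite /h; elim: n {AX h Ah h01 indE} => [|m ih].
    by under eq_fun do rewrite big_ord0; rewrite big_ord0; exact: cvg_cst.
  under eq_fun do rewrite big_ord_recr; rewrite big_ord_recr /=.
  by apply: cvgM => //; exact: ((YP m).2 x Dx).2.
have [L1 _] := @bounded_L2 (fun=> (1 : R)%:C) 1 (cmeas_cst _ _)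
   (fun x _ => ltac:(by rewrite nsq_real expr1n)).
apply: (@Cl_dominated h _ (fun=> 1)) => //.
- by move=> k; exact/Cl_A/Ah.
- apply: (@measurable_fun_cvg _ _ _ _ h) => // k.
  by have [] := Ameas (Ah k).
- move=> k x Dx; have := h01 k x Dx; rewrite indicE; case: (_ \in _) => /=;
    by rewrite ler_norml; lra.
Qed.

Lemma Cl_setT : Cl (indC setT).
Proof.
have := Cl_A (A1 1); congr Cl; apply/funext => x.
by rewrite /indC indicE in_setT.
Qed.

(** Dynkin's pi-lambda theorem. For a disjoint union, the partial sums of the indicators stay
    between 0 and 1, so dominated convergence applies with the bound 1. *)
Lemma Cl_sigma E : <<s boxes >> E -> Cl (indC E).
Proof.
rewrite -setI_closed_g_dynkin_g_sigma_algebra; last exact: boxesI.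
have := @smallest_sub _ dynkin boxes [set E | Cl (indC E)].
move=> h; apply: h E; last exact: Cl_boxes.
split; first exact: Cl_setT.
- move=> F ClF; have := ClD Cl_setT (ClZ (-1) ClF); congr Cl.
  apply/funext => x; rewrite /indC !indicE in_setC in_setT mulN1r -rmorphN -rmorphD /=.
  by case: (x \in F); rewrite /= ?subrr ?subr0.
- move=> F tF ClF.
pose h n x := \sum_(i < n) (\1_(F i) x : R).
have hE x : (exists2 k, F k x & forall n, h n x = (k < n)%N%:R) \/
    (~ (\bigcup_k F k) x /\ forall n, h n x = 0).
  have [[k _ Fk]|nF] := pselect ((\bigcup_k F k) x).
    left; exists k => // n; elim: n => [|n ih]; first by rewrite /h big_ord0.
    rewrite /h big_ord_recr /= -/(h n x) ih indicE.
    have [<-|nk] := eqVneq k n; first by rewrite mem_set// ltnn ltnSn add0r.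
    rewrite memNset; first by rewrite addr0 [in RHS]ltnS [in RHS]leq_eqVlt (negbTE nk).
    by move=> Fn; move: nk; rewrite (@tF k n)// ?eqxx//; exists x.
  right; split => // n; rewrite /h big1// => i _; rewrite indicE memNset// => Fi.
  by apply: nF; exists i.
have h01 n x : 0 <= h n x <= 1.
  by have [[k _ ->]|[_ ->]] := hE x; [case: (k < n)%N|]; rewrite ?ler01 ?lexx.
have hcv x : h k x @[k --> \oo] --> (\1_(\bigcup_k F k) x : R).
  have [[k Fk hk]|[nF hk]] := hE x; rewrite indicE.
    rewrite mem_set; last by exists k.
    apply: (@cvg_near_cst _ _ _ _ _ _) => //; near=> n; rewrite hk.
    suff -> : (k < n)%N by [].
    by near: n; exact: nbhs_infty_gt.
  rewrite memNset//; under eq_fun do rewrite hk; exact: cvg_cst.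
have [L1 _] := @bounded_L2 (fun=> (1 : R)%:C) 1 (cmeas_cst _ _)
   (fun x _ => ltac:(by rewrite nsq_real expr1n)).
have Clh n : Cl (fun x => (h n x)%:C).
  rewrite /h; under eq_fun do rewrite rmorph_sum /=.
  have := @Cl_sum nat (iota 0 n) (fun i => indC (F i)) ClF; congr Cl.
  by apply/funext => x; rewrite -{1}(subn0 n) big_mkord.
apply: (@Cl_dominated h _ (fun=> 1)) => //.
- apply: (@measurable_fun_cvg _ _ _ _ h) => // k.
  by have [[]] := Clh k.
- move=> k x Dx; have := h01 k x; rewrite indicE; case: (_ \in _) => /=;
    by rewrite ler_norml; lra.
Unshelve. all: by end_near.
Qed.

(** Only traces on [D] are compared, because functions are compared on [D]. This allows an angle to
    be described by its cosine and sine within one period. *)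
Hypothesis gen : forall E, measurable E ->
  exists2 E', <<s boxes >> E' & E `&` D = E' `&` D.

Lemma eq_Cl f g : L2 g -> (forall x, D x -> f x = g x) -> Cl f -> Cl g.
Proof.
move=> Lg fg [Lf cf]; split => // e e0; have [p Ap fp] := cf _ e0.
exists p => //; apply: le_trans fp; rewrite le_eqVlt; apply/orP; left.
by apply/eqP; apply: eq_sqnorm => x Dx; rewrite fg.
Qed.

Lemma Cl_measurable E : measurable E -> Cl (indC E).
Proof.
move=> mE; have [E' sE' EE'] := gen mE.
apply: (@eq_Cl (indC E')); last exact: Cl_sigma.
- have [] // := @bounded_L2 (indC E) 1.
    by apply: cmeas_real; exact: measurable_indic.
  by move=> x _; rewrite nsq_real indicE; case: (_ \in _); rewrite ?expr1n ?expr0n.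
- move=> x Dx; rewrite /indC !indicE; rewrite (_ : (x \in E') = (x \in E))//.
  apply/idP/idP; rewrite !inE => Ex.
    by have : (E' `&` D) x by []; rewrite -EE' => -[].
  by have : (E `&` D) x by []; rewrite EE' => -[].
Qed.

Lemma Cl_nonneg (h : T -> R) : (forall x, D x -> 0 <= h x) ->
  L2 (fun x => (h x)%:C) -> Cl (fun x => (h x)%:C).
Proof.
move=> h0 Lh; have [mh _ _] := Lh.
have mh' : measurable_fun D (EFin \o h) by exact/measurable_EFinP.
pose g n x : R := nnsfun_approx mD mh' n x.
have gcv x : D x -> g n x @[n --> \oo] --> h x.
  move=> Dx; have := cvg_nnsfun_approx mD mh' (fun x Dx => h0 x Dx) Dx.
  by move=> /fine_cvgP[_].
have gh n x : D x -> 0 <= g n x <= h x.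
  move=> Dx; rewrite /g fun_ge0 /=; rewrite -(cvg_lim _ (gcv x Dx))//.
  apply: (nondecreasing_cvgn_le _ (cvgP _ (gcv x Dx))) => i j ij.
  by have := nd_nnsfun_approx mD mh' ij => /lefP; apply.
apply: (@Cl_dominated g h h) => //.
- move=> n; pose s := fset_set (range (g n)).
  have := @Cl_sum _ (index_enum 'I_(size (finmap.enum_fset s)))
    (fun i x => ((finmap.enum_fset s)`_i)%:C * indC (g n @^-1` [set (finmap.enum_fset s)`_i]) x).
  under eq_fun do under eq_bigr do rewrite -rmorphM.
  under eq_fun do rewrite -rmorph_sum.
  rewrite (_ : (fun x => _) = (fun x => (g n x)%:C)); last first.
    by apply/funext => x; rewrite /g [in RHS]fimfunEord.
  by apply => i; apply: ClZ; exact: Cl_measurable.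
- by move=> n x Dx; have := gh n x Dx; rewrite ler_norml; lra.
Qed.

Theorem L2_density f : L2 f -> forall e : R, 0 < e ->
  exists2 p, A p & N (fun x => f x - p x) <= e.
Proof.
suff rC (h : T -> R) : L2 (fun x => (h x)%:C) -> Cl (fun x => (h x)%:C).
  move=> Lf; have mf := L2_meas Lf.
  have h (u : T -> R) : measurable_fun D u -> (forall x, u x ^+ 2 <= nsq (f x)) ->
      Cl (fun x => (u x)%:C).
    move=> mu' uf; apply: rC; have [] // := @L2_le _ _ _ mu D mD (fun x => (u x)%:C) f 1 ler01 _ Lf.
    by move=> x Dx; rewrite nsq_real mul1r.
  have := ClD (h _ mf.1 (fun x => Re_sqr_le _)) (ClZ 'i (h _ mf.2 (fun x => Im_sqr_le _))).
  rewrite (_ : (fun x => _) = f); first by case.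
  by apply/funext => x; rewrite -complexE.
move=> Lh; have [mh _ _] := Lh.
have L (u : T -> R) : measurable_fun D u -> (forall x, u x ^+ 2 <= h x ^+ 2) ->
    L2 (fun x => (u x)%:C).
  move=> mu' uh; have [] // := @L2_le _ _ _ mu D mD (fun x => (u x)%:C) _ 1 ler01 _ Lh.
  by move=> x Dx; rewrite !nsq_real mul1r.
have hp : Cl (fun x => (Num.max (h x) 0)%:C).
  apply: Cl_nonneg; first by move=> x _; rewrite le_max lexx orbT.
  apply: L => [|x]; first by apply: measurable_maxr => //; exact: measurable_cst.
  by case: (leP (h x) 0) => // _; rewrite expr0n sqr_ge0.
have hn : Cl (fun x => (Num.max (- h x) 0)%:C).
  apply: Cl_nonneg; first by move=> x _; rewrite le_max lexx orbT.
  apply: L => [|x].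
    by apply: measurable_maxr; [exact: measurableT_comp|exact: measurable_cst].
  by case: (leP (- h x) 0) => // _; rewrite ?expr0n ?sqr_ge0// sqrrN.
have := ClD hp (ClZ (-1) hn); congr Cl; apply/funext => x.
rewrite mulN1r -rmorphN -rmorphD /=; congr (_%:C).
by case: (leP (h x) 0); case: (leP (- h x) 0) => *; lra.
Qed.

End density.

Notation plane R := (measurableTypeR R * measurableTypeR R)%type.

Notation bundle R := (plane R * measurableTypeR R)%type.

Notation diskP := (@disk _ : set (plane _)).

Notation closed_diskP := (@closed_disk _ : set (plane _)).

Notation circleP := (@circle _ : set (measurableTypeR _)).

Notation SMP := (@SM _ : set (bundle _)).

Notation influxP := (@influx _ : set (plane _)).

(** * Trigonometric polynomials on the circle bundle *)

Section exponentials.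
Variable R : realType.
Implicit Types (k l : int) (s t : R).

Lemma expi0 t : expi 0 t = 1.
Proof. by rewrite /expi mul0r cos0 sin0. Qed.

Lemma expiD k l t : expi (k + l) t = expi k t * expi l t.
Proof.
apply: complex_eq; rewrite !ReImE /= intrD mulrDl ?cosD ?sinD; ring.
Qed.

Lemma expi_add k s t : expi k (s + t) = expi k s * expi k t.
Proof.
apply: complex_eq; rewrite !ReImE /= mulrDr ?cosD ?sinD; ring.
Qed.

Lemma expi_conj k t : conjc (expi k t) = expi (- k) t.
Proof. by apply: complex_eq; rewrite !ReImE /= mulrNz mulNr ?cosN ?sinN. Qed.

Lemma nsq_expi k t : nsq (expi k t) = 1.
Proof. by rewrite /nsq /= cos2Dsin2. Qed.

Lemma expi_mulV k t : expi k t * expi (- k) t = 1.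
Proof. by rewrite -expiD subrr expi0. Qed.

Lemma expi_nat (n : nat) t : expi n t = expi 1 t ^+ n.
Proof.
elim: n => [|n ih]; first by rewrite expr0 expi0.
by rewrite intS expiD ih exprS.
Qed.

Lemma expi_natN (n : nat) t : expi (- n%:Z) t = conjc (expi 1 t) ^+ n.
Proof. by rewrite -expi_conj expi_nat rmorphXn. Qed.

Lemma expi_pi1 : expi 1 (pi : R) = - 1.
Proof. by rewrite /expi mul1r cospi sinpi; apply: complex_eq; rewrite /= ?oppr0. Qed.

Lemma expi_2pi k : expi k (2 * pi : R) = 1.
Proof.
have h n : expi (Posz n) (2 * pi : R) = 1.
  by rewrite expi_nat mulr_natl mulr2n expi_add expi_pi1 mulrNN mulr1 expr1n.
case: k => n //; rewrite NegzE -expi_conj h.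
by apply: complex_eq; rewrite /= ?oppr0.
Qed.

Lemma expi_periodic k t : expi k (t + 2 * pi) = expi k t.
Proof. by rewrite expi_add expi_2pi mulr1. Qed.

Lemma continuous_cos_mul k : continuous (fun t : R => cos (k%:~R * t)).
Proof.
move=> t; apply: (@continuous_comp _ _ _ (fun t : R => k%:~R * t) cos).
  by apply: continuousM; [exact: cst_continuous|exact: cvg_id].
exact: continuous_cos.
Qed.

Lemma continuous_sin_mul k : continuous (fun t : R => sin (k%:~R * t)).
Proof.
move=> t; apply: (@continuous_comp _ _ _ (fun t : R => k%:~R * t) sin).
  by apply: continuousM; [exact: cst_continuous|exact: cvg_id].
exact: continuous_sin.
Qed.

Lemma cmeas_expi k (D : set (measurableTypeR R)) : cmeas D (expi k).
Proof.
by split; apply: measurable_funTS; apply: continuous_measurable_fun;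
  [exact: continuous_cos_mul|exact: continuous_sin_mul].
Qed.

End exponentials.

Lemma cmeas_comp d1 d2 (T1 : measurableType d1) (T2 : measurableType d2)
    (R : realType) (D : set T1) (f : T2 -> R[i]) (g : T1 -> T2) :
  cmeas setT f -> measurable_fun D g -> cmeas D (fun x => f (g x)).
Proof.
move=> [a b] mg; split.
- exact: (measurableT_comp a mg).
- exact: (measurableT_comp b mg).
Qed.

Section linear_extension.
Context (R : realType) (T I : Type).
Implicit Types (F : I -> T -> R[i]) (s : seq (R[i] * I)).

(** A formal combination is a list, not a function: the same list evaluated in several families [F]
    carries a polynomial to its derivatives, its primitive, its boundary values and its X-ray
    transform. *)
Definition lext F s : T -> R[i] := fun x => \sum_(t <- s) t.1 * F t.2 x.

Definition negl s := [seq (- t.1, t.2) | t <- s].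

Lemma lext_cat F s1 s2 x : lext F (s1 ++ s2) x = lext F s1 x + lext F s2 x.
Proof. by rewrite /lext big_cat. Qed.

Lemma lext_neg F s x : lext F (negl s) x = - lext F s x.
Proof.
by rewrite /lext big_map -sumrN; apply: eq_bigr => t _; rewrite mulNr.
Qed.

Lemma lext_sub F s1 s2 : lext F (s1 ++ negl s2) = fun x => lext F s1 x - lext F s2 x.
Proof. by apply/funext => x; rewrite lext_cat lext_neg. Qed.

Lemma lext_nil F x : lext F [::] x = 0.
Proof. by rewrite /lext big_nil. Qed.

Lemma lext_cons F t s x : lext F (t :: s) x = t.1 * F t.2 x + lext F s x.
Proof. by rewrite /lext big_cons. Qed.

End linear_extension.

Section domains.
Variable R : realType.
Local Notation leb1 := (@lebesgue_measure R).
Local Notation leb2 := (leb1 \x leb1)%E.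
Local Notation leb3 := (leb2 \x leb1)%E.

Lemma measurable_sqnorm2d :
  measurable_fun setT (fun x : plane R => x.1 ^+ 2 + x.2 ^+ 2 : R).
Proof.
by apply: measurable_funD; apply: measurable_funX;
  [exact: measurable_fst|exact: measurable_snd].
Qed.

Lemma measurable_disk : measurable (@disk R : set (plane R)).
Proof.
have := measurable_sqnorm2d measurableT (measurable_itv `]-oo, (1 : R)[).
rewrite setTI; congr measurable.
Qed.

Lemma measurable_circle : measurable (@circle R : set (measurableTypeR R)).
Proof. exact: measurable_itv. Qed.

Lemma measurable_SM : measurable (@SM R : set (bundle R)).
Proof. by apply: measurableX; [exact: measurable_disk|exact: measurable_circle]. Qed.

Lemma measurable_influx : measurable (@influx R : set (plane R)).
Proof. by apply: measurableX; [exact: measurable_circle|exact: measurable_itv]. Qed.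

Lemma pi2_gt0 : 0 < 2 * pi :> R.
Proof. by rewrite mulr_gt0// pi_gt0. Qed.

Lemma leb_circle : leb1 circleP = (2 * pi)%:E.
Proof.
by rewrite /circle lebesgue_measure_itv /= lte_fin pi2_gt0 sube0.
Qed.

Lemma leb2_setX (A B : set (measurableTypeR R)) : measurable A -> measurable B ->
  leb2 (A `*` B) = (leb1 A * leb1 B)%E.
Proof. exact: product_measure1E. Qed.

Lemma leb3_setX (A : set (plane R)) (B : set (measurableTypeR R)) : measurable A -> measurable B ->
  leb3 (A `*` B) = (leb2 A * leb1 B)%E.
Proof. exact: product_measure1E. Qed.

Lemma leb_disk_fin : (leb2 diskP < +oo)%E.
Proof.
apply: (@le_lt_trans _ _ (leb2 (`[-1, 1]%classic `*` `[-1, 1]%classic))).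
  apply: le_measure; rewrite ?inE.
  - exact: measurable_disk.
  - by apply: measurableX; exact: measurable_itv.
  - move=> x; rewrite /disk /= !in_itv /= => h.
    have := sqr_ge0 x.1; have := sqr_ge0 x.2 => h2 h1.
    by split; nra.
rewrite leb2_setX; [|exact: measurable_itv..].
rewrite lebesgue_measure_itv /= lte_fin; case: ifP => _; last by rewrite mul0e.
by rewrite -EFinB -EFinM ltry.
Qed.

Lemma leb_SM_fin : (leb3 SMP < +oo)%E.
Proof.
rewrite leb3_setX; [|exact: measurable_disk|exact: measurable_circle].
rewrite leb_circle; apply: lte_mul_pinfty; [exact: measure_ge0| |exact: ltry].
by rewrite ge0_fin_numE; [exact: leb_disk_fin|exact: measure_ge0].
Qed.

Lemma leb_influx_fin : (leb2 influxP < +oo)%E.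
Proof.
rewrite leb2_setX; [|exact: measurable_circle|exact: measurable_itv].
rewrite leb_circle lebesgue_measure_itv /=; case: ifP => _; last by rewrite mule0.
by rewrite -EFinB -EFinM ltry.
Qed.

Definition zc (x : R * R) : R[i] := x.1 +i* x.2.

Definition zmon (ab : nat * nat) (x : R * R) : R[i] :=
  zc x ^+ ab.1 * conjc (zc x) ^+ ab.2.

Definition emon (i : nat * nat * int) (p : R * R * R) : R[i] :=
  zmon i.1 p.1 * expi i.2 p.2.

Lemma cmeas_zc (D : set (plane R)) : cmeas D zc.
Proof.
by split; apply: measurable_funTS; [exact: measurable_fst|exact: measurable_snd].
Qed.

Lemma cmeas_exp d (T : measurableType d) (D : set T) (f : T -> R[i]) n :
  cmeas D f -> cmeas D (fun x => f x ^+ n).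
Proof.
move=> mf; elim: n => [|n ih]; first exact: cmeas_cst.
by under eq_fun do rewrite exprS; exact: cmeasM.
Qed.

Lemma cmeas_zmon ab (D : set (plane R)) : cmeas D (zmon ab).
Proof.
by apply: cmeasM; apply: cmeas_exp; [|apply: cmeas_conj]; exact: cmeas_zc.
Qed.

Lemma cmeas_emon i (D : set (bundle R)) : cmeas D (emon i).
Proof.
apply: cmeasM.
- apply: (cmeas_comp (g := fst)); first exact: cmeas_zmon.
  by apply: measurable_funTS; exact: measurable_fst.
- apply: (cmeas_comp (g := snd)); first exact: cmeas_expi.
  by apply: measurable_funTS; exact: measurable_snd.
Qed.

Lemma nsqX (z : R[i]) n : nsq (z ^+ n) = nsq z ^+ n.
Proof.
elim: n => [|n ih]; first by rewrite !expr0 /nsq /= expr1n expr0n addr0.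
by rewrite !exprS nsqM ih.
Qed.

Lemma nsq_zmon ab x : @closed_disk R x -> nsq (zmon ab x) <= 1.
Proof.
rewrite /closed_disk /= => x1.
have x0 : 0 <= x.1 ^+ 2 + x.2 ^+ 2 by rewrite addr_ge0// sqr_ge0.
rewrite nsqM !nsqX nsq_conj mulr_ile1 ?exprn_ge0 ?exprn_ile1//.
Qed.

Lemma disk_closed x : @disk R x -> @closed_disk R x.
Proof. by rewrite /disk /closed_disk /= => /ltW. Qed.

Lemma nsq_emon i p : @closed_disk R p.1 -> nsq (emon i p) <= 1.
Proof. by move=> h; rewrite nsqM nsq_expi mulr1 nsq_zmon. Qed.

Lemma emonM i j p : emon i p * emon j p =
  emon ((i.1.1 + j.1.1)%N, (i.1.2 + j.1.2)%N, i.2 + j.2) p.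
Proof.
rewrite /emon /zmon /= expiD !exprD; ring.
Qed.

Definition trigpoly : set (R * R * R -> R[i]) :=
  [set u | exists s, u = lext emon s].

Lemma trigpoly_cst (c : R[i]) : trigpoly (fun=> c).
Proof.
exists [:: (c, (0%N, 0%N, 0))]; apply/funext => p.
by rewrite lext_cons lext_nil /emon /zmon /= !expr0 expi0 !mulr1 addr0.
Qed.

Lemma trigpolyD u v : trigpoly u -> trigpoly v -> trigpoly (fun p => u p + v p).
Proof.
by move=> [s ->] [t ->]; exists (s ++ t); apply/funext => p; rewrite lext_cat.
Qed.

Lemma trigpolyM u v : trigpoly u -> trigpoly v -> trigpoly (fun p => u p * v p).
Proof.
move=> [s ->] [t ->].
exists [seq (x.1 * y.1,
  ((x.2.1.1 + y.2.1.1)%N, (x.2.1.2 + y.2.1.2)%N, x.2.2 + y.2.2)) | x <- s, y <- t].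
apply/funext => p; rewrite /lext big_allpairs_dep /= mulr_suml.
apply: eq_bigr => x _; rewrite mulr_sumr; apply: eq_bigr => y _.
rewrite /= -emonM; ring.
Qed.

Lemma cmeas_lext d (T : measurableType d) (D : set T) (mD : measurable D) I
    (F : I -> T -> R[i]) s : (forall i, cmeas D (F i)) -> cmeas D (lext F s).
Proof.
move=> mF; elim: s => [|t s ih].
  rewrite (_ : lext F [::] = fun=> 0); first exact: cmeas_cst.
  by apply/funext => x; rewrite lext_nil.
rewrite (_ : lext F _ = fun x => t.1 * F t.2 x + lext F s x); last first.
  by apply/funext => x; rewrite lext_cons.
apply: cmeasD => //.
by apply: cmeasM => //; exact: cmeas_cst.
Qed.

Lemma nsq_lext T I (F : I -> T -> R[i]) s : exists C, forall x,
  (forall i, nsq (F i x) <= 1) -> nsq (lext F s x) <= C.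
Proof.
elim: s => [|t s [C hC]].
  by exists 0 => x _; rewrite lext_nil nsq0.
exists (2 * nsq t.1 + 2 * C) => x hx; rewrite lext_cons.
apply: (le_trans (nsqD_le _ _)); have := hC x hx; rewrite nsqM.
have := hx t.2; have := nsq_ge0 t.1; nra.
Qed.

Lemma trigpoly_meas u : trigpoly u -> cmeas SMP u.
Proof.
move=> [s ->]; apply: cmeas_lext; first exact: measurable_SM.
move=> i; exact: cmeas_emon.
Qed.

Lemma trigpoly_bd u : trigpoly u -> exists C, forall x, @SM R x -> nsq (u x) <= C.
Proof.
move=> [s ->]; have [C hC] := nsq_lext emon s; exists C => x [/disk_closed dx _].
by apply: hC => i; exact: nsq_emon.
Qed.

Lemma trigpoly_x : trigpoly (fun p => p.1.1%:C).
Proof.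
exists [:: (2^-1, (1%N, 0%N, 0)); (2^-1, (0%N, 1%N, 0))]; apply/funext => p.
rewrite !lext_cons lext_nil /emon /zmon /= !expr0 !expr1 expi0 !mulr1 mul1r addr0.
apply: complex_eq; by rewrite !ReImE /=; field.
Qed.

Lemma trigpoly_y : trigpoly (fun p => p.1.2%:C).
Proof.
exists [:: (0 +i* (- 2^-1), (1%N, 0%N, 0)); (0 +i* 2^-1, (0%N, 1%N, 0))]; apply/funext => p.
rewrite !lext_cons lext_nil /emon /zmon /= !expr0 !expr1 expi0 !mulr1 mul1r addr0.
apply: complex_eq; by rewrite !ReImE /=; field.
Qed.

Lemma trigpoly_cos : trigpoly (fun p => (cos p.2)%:C).
Proof.
exists [:: (2^-1, (0%N, 0%N, 1)); (2^-1, (0%N, 0%N, - 1))]; apply/funext => p.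
rewrite !lext_cons lext_nil /emon /zmon /= !expr0 !mul1r -expi_conj addr0 /expi mul1r.
apply: complex_eq; by rewrite !ReImE /=; field.
Qed.

Lemma trigpoly_sin : trigpoly (fun p => (sin p.2)%:C).
Proof.
exists [:: (0 +i* (- 2^-1), (0%N, 0%N, 1)); (0 +i* 2^-1, (0%N, 0%N, - 1))]; apply/funext => p.
rewrite !lext_cons lext_nil /emon /zmon /= !expr0 !mul1r -expi_conj addr0 /expi mul1r.
apply: complex_eq; by rewrite !ReImE /=; field.
Qed.

End domains.

(** * Sigma-algebras up to their trace on a domain *)

Section sigma_trace.
Context (T : Type) (D : set T) (G : set (set T)).

Definition traced : set (set T) :=
  [set E | exists2 E', <<s G>> E' & E `&` D = E' `&` D].

Lemma traced_sigma_algebra : sigma_algebra setT traced.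
Proof.
split.
- by exists set0 => //; exact: sigma_algebra0.
- move=> E [E' sE' EE']; exists (~` E').
    by rewrite -setTD; exact: sigma_algebraCD.
  rewrite setTD; apply/seteqP; split => x [nE Dx]; split => // h; apply: nE.
    have : (E' `&` D) x by []. by rewrite -EE' => -[].
  have : (E `&` D) x by []. by rewrite EE' => -[].
- move=> F tF.
  have [E' E'P] := choice (fun n => let: ex_intro2 E' a b := tF n in
    ex_intro (fun E' => <<s G>> E' /\ F n `&` D = E' `&` D) E' (conj a b)).
  exists (\bigcup_n E' n); first by apply: sigma_algebra_bigcup => n; exact: (E'P n).1.
  rewrite !setI_bigcupl; apply: eq_bigcupr => n _; exact: (E'P n).2.
Qed.

Lemma traced_base E : G E -> traced E.
Proof. by move=> GE; exists E => //; exact: sub_sigma_algebra. Qed.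

Lemma tracedC E : traced E -> traced (~` E).
Proof. by case: traced_sigma_algebra => _ + _ => /(_ E) + tE => /(_ tE); rewrite setTD. Qed.

Lemma tracedU E F : traced E -> traced F -> traced (E `|` F).
Proof.
move=> tE tF; rewrite -bigcup2E; case: traced_sigma_algebra => t0 _; apply.
by move=> [|[|n]].
Qed.

Lemma tracedI E F : traced E -> traced F -> traced (E `&` F).
Proof.
by move=> /tracedC tE /tracedC tF; rewrite -[E `&` F]setCK setCI; exact/tracedC/tracedU.
Qed.

Lemma eq_traced E F : E `&` D = F `&` D -> traced E -> traced F.
Proof. by move=> EF [E' sE' EE']; exists E' => //; rewrite -EF. Qed.

Lemma traced_preimage S (phi : T -> S) (H : set (set S)) :
  (forall B, H B -> traced (phi @^-1` B)) ->
  forall B, <<s H>> B -> traced (phi @^-1` B).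
Proof.
move=> tH B sB.
apply: (@smallest_sub _ (sigma_algebra setT) H [set B | traced (phi @^-1` B)] _ tH B sB).
case: traced_sigma_algebra => t0 tC tU; split => //=.
- by move=> C tC'; rewrite setTD preimage_setC; exact: tracedC.
- by move=> F tF; rewrite preimage_bigcup; exact: tU.
Qed.

End sigma_trace.

Section density_SM.
Variable R : realType.
Local Notation leb1 := (@lebesgue_measure R).
Local Notation leb2 := (leb1 \x leb1)%E.
Local Notation leb3 := (leb2 \x leb1)%E.
Let G : set (set (bundle R)) := boxes (@trigpoly R).
Let traced := traced (@SM R : set (bundle R)) G.

Lemma boxlt X : realA (@trigpoly R) X -> traced [set p | X p < 0].
Proof.
move=> AX; apply: traced_base; exists 1%N, (fun=> X); split => //.
by apply/seteqP; split => p /= h => [i _ //|]; exact: (h 0%N).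
Qed.

Lemma realA_affine X (a b : R) : realA (@trigpoly R) X -> realA (@trigpoly R) (fun p => a * X p + b).
Proof.
move=> AX; rewrite /realA; under eq_fun do rewrite rmorphD rmorphM /=.
apply: trigpolyD; last exact: trigpoly_cst.
by apply: trigpolyM => //; exact: trigpoly_cst.
Qed.

Lemma lt_cst X c : realA (@trigpoly R) X -> traced [set p | X p < c].
Proof.
move=> AX; rewrite (_ : [set p | _] = [set p | 1 * X p + - c < 0]).
  exact/boxlt/realA_affine.
by apply/seteqP; split => p /=; rewrite mul1r subr_lt0.
Qed.

Lemma gt_cst X c : realA (@trigpoly R) X -> traced [set p | c < X p].
Proof.
move=> AX; rewrite (_ : [set p | _] = [set p | -1 * X p + c < 0]).
  exact/boxlt/realA_affine.
by apply/seteqP; split => p /=; rewrite mulN1r addrC subr_lt0.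
Qed.

Lemma cos_mono_pi2pi (s t : R) : pi <= s <= 2 * pi -> pi <= t <= 2 * pi ->
  (cos s < cos t) = (s < t).
Proof.
move=> hs ht.
have e (u : R) : cos u = cos (2 * pi - u).
  by rewrite addrC mulr_natl cosD2pi cosN.
rewrite (e s) (e t) ltr_cos ?in_itv /=; [|lra|lra].
by rewrite ltrD2l ltrN2.
Qed.

(** The angle itself is no trigonometric polynomial. On [0, 2pi[ the sign of sin separates the two
    half-periods, and cos is strictly monotone on each, so the half-line is a combination of sets
    defined by sin and cos. *)
Lemma lt_angle b : traced [set p | p.2 < b].
Proof.
have p0 := @pi_gt0 R.
have sin0 : traced [set p | 0 <= sin p.2].
  rewrite (_ : [set p | _] = ~` [set p | sin p.2 < 0]); first exact/tracedC/lt_cst/trigpoly_sin.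
  by apply/seteqP; split => p /=; rewrite leNgt => /negP.
have sinpos (t : R) : 0 <= t < 2 * pi -> (0 <= sin t) = (t <= pi).
  move=> ht; case: (leP t pi) => tp; first by rewrite sin_ge0_pi//; lra.
  apply/negbTE; rewrite -ltNge; have : 0 < sin (t - pi) by apply: sin_gt0_pi; lra.
  by rewrite -[t in X in _ -> X](subrK pi) sinDpi; lra.
have [b0|b0] := leP b 0.
  apply: (@eq_traced _ _ _ set0); last by apply: traced_base; exists 1%N, (fun _ _ => 1);
    split; [move=> _; exact: trigpoly_cst|apply/seteqP; split => p //= /(_ 0%N isT); lra].
  rewrite set0I; apply/seteqP; split => // p [/= pb [_]]; rewrite /circle /= in_itv /=; lra.
have [b2|b2] := leP (2 * pi) b.
  apply: (@eq_traced _ _ _ setT); last first.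
    by rewrite -setC0; apply: tracedC; have [] := traced_sigma_algebra SMP G.
  rewrite setTI; apply/seteqP; split => p; last by case.
  move=> Sp; split => //; case: Sp => _; rewrite /circle /= in_itv /=; lra.
have [bpi|bpi] := leP b pi.
- apply: (@eq_traced _ _ _ ([set p | 0 <= sin p.2] `&` [set p | cos b < cos p.2])); last first.
    by apply: tracedI => //; exact/gt_cst/trigpoly_cos.
  apply/seteqP; split => p [h Sp]; split => //; case: (Sp) => _;
    rewrite /circle /= in_itv /= => c02; move: h => /=; rewrite sinpos//.
  + move=> [hp]; rewrite ltr_cos ?in_itv//=; lra.
  + by move=> hb; rewrite ltr_cos ?in_itv//=; lra.
- apply: (@eq_traced _ _ _ ([set p | 0 <= sin p.2] `|` [set p | cos p.2 < cos b])); last first.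
    by apply: tracedU => //; exact/lt_cst/trigpoly_cos.
  apply/seteqP; split => p [h Sp]; split => //; case: (Sp) => _;
    rewrite /circle /= in_itv /= => c02; move: h => /=; rewrite sinpos//.
  + case; first lra.
    by have [|ppi] := leP p.2 pi; [lra|rewrite cos_mono_pi2pi//; lra].
  + move=> hb; have [|ppi] := leP p.2 pi; [by left|right].
    by rewrite cos_mono_pi2pi//; lra.
Qed.

Lemma traced_real (phi : R * R * R -> R) : (forall b, traced [set p | phi p < b]) ->
  forall B : set (measurableTypeR R), measurable B -> traced (phi @^-1` B).
Proof.
move=> h B mB; apply: (@traced_preimage _ _ _ _ _ (@RGenInftyO.G R)).
  by move=> _ [b ->]; have := h b.
have e := RGenInftyO.measurableE R.
have : (@ocitv R).-sigma.-measurable B by [].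
by rewrite e.
Qed.

Lemma traced_measurable E : measurable E -> traced E.
Proof.
have t1 : forall B : set (measurableTypeR R), measurable B -> traced ((fun p => p.1.1) @^-1` B).
  by apply: traced_real => b; exact/lt_cst/trigpoly_x.
have t2 : forall B : set (measurableTypeR R), measurable B -> traced ((fun p => p.1.2) @^-1` B).
  by apply: traced_real => b; exact/lt_cst/trigpoly_y.
have t3 : forall B : set (measurableTypeR R), measurable B -> traced ((fun p => p.2) @^-1` B).
  by apply: traced_real; exact: lt_angle.
have t12 : forall B : set (plane R), measurable B -> traced (fst @^-1` B).
  move=> B; rewrite measurable_prod_measurableType => sB.
  apply: traced_preimage sB => _ [A1 mA1 [A2 mA2 <-]].
  by have := tracedI (t1 _ mA1) (t2 _ mA2); congr traced.
rewrite measurable_prod_measurableType => sE.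
apply: (@traced_preimage _ _ _ _ id) sE => _ [A1 mA1 [A2 mA2 <-]].
by have := tracedI (t12 _ mA1) (t3 _ mA2); congr traced.
Qed.

Theorem density_SM (f : R * R * R -> R[i]) : L2 leb3 SMP f ->
  forall e : R, 0 < e ->
  exists s, sqnorm leb3 SMP (fun x => f x - lext (@emon R) s x) <= e.
Proof.
move=> Lf e e0.
have [_ [s ->] h] := L2_density (@measurable_SM R) (@leb_SM_fin R)
  (@trigpoly_cst R) (@trigpolyD R) (@trigpolyM R) (@trigpoly_meas R)
  (@trigpoly_bd R) traced_measurable Lf e0.
by exists s.
Qed.

End density_SM.

(** Turns a proof of sigma-finiteness into the bundled structure that the Fubini lemmas expect; it
    is applied to [leb2] as the first factor of [leb3]. *)
Lemma sigma_finite_measureP d (T : measurableType d) (R : realType)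
    (m : {measure set T -> \bar R}) : sigma_finite setT m ->
  exists m' : {sigma_finite_measure set T -> \bar R},
    m = m' :> {measure set T -> \bar R}.
Proof.
case: m => m c h.
pose H := Measure_isSigmaFinite.Build _ _ _ (Measure.Pack c) h.
pose m' : {sigma_finite_measure set T -> \bar R} := HB.pack m c H.
by exists m'.
Qed.

(** * Fubini and Tonelli on products of domains *)

Section fubini_domains.
Context d1 d2 (T1 : measurableType d1) (T2 : measurableType d2) (R : realType).
Variables (m1 : {sigma_finite_measure set T1 -> \bar R})
  (m2 : {sigma_finite_measure set T2 -> \bar R}) (D1 : set T1) (D2 : set T2).
Hypotheses (mD1 : measurable D1) (mD2 : measurable D2).

Lemma slice_restrict (f : T1 * T2 -> \bar R) x y :
  (f \_ (D1 `*` D2)) (x, y) =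
  ((fun x => ((fun y => f (x, y)) \_ D2) y) \_ D1) x.
Proof.
rewrite /patch in_setX /=; case: (x \in D1) => //=.
Qed.

Lemma tonelli_domains (f : T1 * T2 -> \bar R) :
  measurable_fun (D1 `*` D2) f -> (forall p, (D1 `*` D2) p -> 0 <= f p)%E ->
  (\int[m1 \x m2]_(p in D1 `*` D2) f p =
   \int[m1]_(x in D1) \int[m2]_(y in D2) f (x, y))%E.
Proof.
move=> mf f0; have mDD : measurable (D1 `*` D2) by exact: measurableX.
rewrite integral_mkcond fubini_tonelli1; first last.
- by apply: erestrict_ge0.
- by apply/(measurable_restrict _ mDD measurableT); rewrite setTI.
rewrite [RHS]integral_mkcond; apply: eq_integral => x _; rewrite /fubini_F.
rewrite [in RHS]/patch; case: ifPn => xD1.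
- rewrite [RHS]integral_mkcond; apply: eq_integral => y _.
  by rewrite slice_restrict /patch xD1.
- by rewrite integral0_eq// => y _; rewrite slice_restrict /patch (negbTE xD1).
Qed.

Lemma Rfubini_domains (f : T1 * T2 -> R) :
  (m1 \x m2)%E.-integrable (D1 `*` D2) (EFin \o f) ->
  \int[(m1 \x m2)%E]_(p in D1 `*` D2) f p =
  \int[m1]_(x in D1) \int[m2]_(y in D2) f (x, y).
Proof.
move=> fi; have mDD : measurable (D1 `*` D2) by exact: measurableX.
have fi' := (integrable_mkcond _ mDD).1 fi.
have E x : x \in D1 -> fubini_F m2 ((EFin \o f) \_ (D1 `*` D2)) x =
    (\int[m2]_(y in D2) (f (x, y))%:E)%E.
  move=> xD1; rewrite /fubini_F [RHS]integral_mkcond; apply: eq_integral => y _.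
  by rewrite slice_restrict /patch xD1.
rewrite /Rintegral integral_mkcond -integral12_prod_meas1//; congr fine.
transitivity (\int[m1]_(x in D1) fubini_F m2 ((EFin \o f) \_ (D1 `*` D2)) x)%E.
  rewrite [RHS]integral_mkcond; apply: eq_integral => x _.
  rewrite [in RHS]/patch; case: ifPn => // xD1.
  by rewrite /fubini_F integral0_eq// => y _; rewrite slice_restrict /patch (negbTE xD1).
have Fi := integrable_fubini_F fi'.
have FiD : m1.-integrable D1 (fubini_F m2 ((EFin \o f) \_ (D1 `*` D2))).
  by apply: integrableS Fi.
apply: ae_eq_integral => //.
- exact: measurable_int FiD.
- apply/measurable_EFinP; apply: measurableT_comp => //.
  apply: (eq_measurable_fun (fubini_F m2 ((EFin \o f) \_ (D1 `*` D2)))).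
    by move=> x xD1; rewrite E.
  exact: measurable_int FiD.
- have := integrable_ae mD1 FiD; apply: filterS => x + Dx => /(_ Dx).
  by rewrite E ?mem_set// => h; rewrite fineK.
Qed.

Lemma Rfubini_zero (f : T1 * T2 -> R) :
  (m1 \x m2)%E.-integrable (D1 `*` D2) (EFin \o f) ->
  {ae m1, forall x, D1 x -> \int[m2]_(y in D2) f (x, y) = 0} ->
  \int[(m1 \x m2)%E]_(p in D1 `*` D2) f p = 0.
Proof.
move=> fi f0; have mDD : measurable (D1 `*` D2) by exact: measurableX.
have fi' := (integrable_mkcond _ mDD).1 fi.
have E x : x \in D1 -> fubini_F m2 ((EFin \o f) \_ (D1 `*` D2)) x =
    (\int[m2]_(y in D2) (f (x, y))%:E)%E.
  move=> xD1; rewrite /fubini_F [RHS]integral_mkcond; apply: eq_integral => y _.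
  by rewrite slice_restrict /patch xD1.
rewrite /Rintegral integral_mkcond -integral12_prod_meas1//.
have Fi := integrable_fubini_F fi'.
rewrite (_ : (\int[m1]_x _)%E = 0%E)//.
rewrite -(integral0 m1 setT); apply: ae_eq_integral => //.
- exact: measurable_int Fi.
- have := integrable_ae measurableT Fi; move: f0; apply: filterS2 => x f0 h _.
  have [xD1|xD1] := boolP (x \in D1).
    have := f0 (set_mem xD1); have := h I; rewrite E// /Rintegral => hf e0.
    by rewrite -(fineK hf) e0.
  by rewrite /fubini_F integral0_eq// => y _; rewrite slice_restrict /patch (negbTE xD1).
Qed.

Lemma ae_integrable_slice (f : T1 * T2 -> R) :
  (m1 \x m2)%E.-integrable (D1 `*` D2) (EFin \o f) ->
  {ae m1, forall x, D1 x -> m2.-integrable D2 (fun y => (f (x, y))%:E)}.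
Proof.
move=> fi; have mDD : measurable (D1 `*` D2) by exact: measurableX.
have fi' := (integrable_mkcond _ mDD).1 fi.
have := ae_integrable1 fi'; apply: filterS => x h Dx.
apply/(integrable_mkcond _ mD2); move: h; congr (_.-integrable _ _).
by apply/funext => y; rewrite slice_restrict /patch mem_set.
Qed.

Lemma cfubini_zero (f : T1 * T2 -> R[i]) :
  cintegrable (m1 \x m2)%E (D1 `*` D2) f ->
  {ae m1, forall x, D1 x -> cintegral m2 D2 (fun y => f (x, y)) = 0} ->
  cintegral (m1 \x m2)%E (D1 `*` D2) f = 0.
Proof.
move=> [fR fI] f0; rewrite /cintegral !Rfubini_zero//; move: f0; apply: filterS => x h Dx;
  by have := h Dx; rewrite /cintegral => -[].
Qed.

Lemma ae_cintegrable_slice (f : T1 * T2 -> R[i]) :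
  cintegrable (m1 \x m2)%E (D1 `*` D2) f ->
  {ae m1, forall x, D1 x -> cintegrable m2 D2 (fun y => f (x, y))}.
Proof.
move=> [fR fI]; have := ae_integrable_slice fI; have := ae_integrable_slice fR.
by apply: filterS2 => x h1 h2 Dx; split; [exact: h1|exact: h2].
Qed.

(** [f] supplies integrable slices: where its slice fails to be integrable, slice integrals may be
    default values, and the hypothesis asks nothing there. This happens on a null set. *)
Lemma cfubini_zero_slice (f g : T1 * T2 -> R[i]) :
  cintegrable (m1 \x m2)%E (D1 `*` D2) f ->
  cintegrable (m1 \x m2)%E (D1 `*` D2) g ->
  {ae m1, forall x, D1 x -> cintegrable m2 D2 (fun y => f (x, y)) ->
    cintegral m2 D2 (fun y => g (x, y)) = 0} ->
  cintegral (m1 \x m2)%E (D1 `*` D2) g = 0.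
Proof.
move=> fi gi h; apply: cfubini_zero => //.
have := ae_cintegrable_slice fi.
by move: h; apply: filterS2 => x h1 h2 Dx; exact: h1 (h2 Dx).
Qed.

Lemma cfubini_domains (f : T1 * T2 -> R[i]) :
  cintegrable (m1 \x m2)%E (D1 `*` D2) f ->
  cintegral (m1 \x m2)%E (D1 `*` D2) f =
  cintegral m1 D1 (fun x => cintegral m2 D2 (fun y => f (x, y))).
Proof.
by move=> [fR fI]; rewrite /cintegral /=; congr (_ +i* _); rewrite Rfubini_domains.
Qed.

End fubini_domains.

Lemma product_sigma_finite d1 d2 (T1 : measurableType d1)
    (T2 : measurableType d2) (R : realType)
    (m1 : {sigma_finite_measure set T1 -> \bar R})
    (m2 : {sigma_finite_measure set T2 -> \bar R}) :
  sigma_finite setT (m1 \x m2)%E.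
Proof.
have /sigma_finiteP[F [FT ndF Foo]] := sigma_finiteT m1.
have /sigma_finiteP[G [GT ndG Goo]] := sigma_finiteT m2.
exists (fun n => F n `*` G n).
  apply/seteqP; split => [[x y] _|//].
  have [n _ Fx] : (\bigcup_n F n) x by rewrite -FT.
  have [k _ Gy] : (\bigcup_n G n) y by rewrite -GT.
  exists (maxn n k) => //; split => /=.
  - by move/subsetPset: (ndF _ _ (leq_maxl n k)); apply.
  - by move/subsetPset: (ndG _ _ (leq_maxr n k)); apply.
move=> n; have [mF Fn] := Foo n; have [mG Gn] := Goo n; split.
  exact: measurableX.
rewrite /= product_measure1E//; apply: lte_mul_pinfty => //.
by rewrite ge0_fin_numE.
Qed.

Section SM_fubini.
Variable R : realType.
Local Notation leb1 := (@lebesgue_measure R).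
Local Notation leb2 := (leb1 \x leb1)%E.
Local Notation leb3 := (leb2 \x leb1)%E.

Let fubini_gen (m1 : {measure set (plane R) -> \bar R}) (f : R * R * R -> R[i]) :
  sigma_finite setT m1 -> cintegrable (m1 \x leb1)%E (@SM R) f ->
  cintegral (m1 \x leb1)%E (@SM R) f =
  cintegral m1 (@disk R) (fun x => cintegral leb1 (@circle R) (fun t => f (x, t))).
Proof.
move=> /sigma_finite_measureP[m' ->] fi.
by apply: cfubini_domains fi; [exact: measurable_disk|exact: measurable_circle].
Qed.

Let tonelli_gen (m1 : {measure set (plane R) -> \bar R}) (f : R * R * R -> \bar R) :
  sigma_finite setT m1 ->
  measurable_fun (@SM R : set (bundle R)) f -> (forall p, 0 <= f p)%E ->
  (\int[m1 \x leb1]_(p in @SM R) f p =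
   \int[m1]_(x in @disk R) \int[leb1]_(t in @circle R) f (x, t))%E.
Proof.
move=> /sigma_finite_measureP[m' ->] mf f0.
by apply: tonelli_domains => //; [exact: measurable_disk|exact: measurable_circle].
Qed.

Lemma sigma_finite_leb2 : sigma_finite setT leb2.
Proof. exact: product_sigma_finite. Qed.

Lemma cintegral_SM (f : R * R * R -> R[i]) : cintegrable leb3 (@SM R) f ->
  cintegral leb3 (@SM R) f =
  cintegral leb2 (@disk R) (fun x => cintegral leb1 (@circle R) (fun t => f (x, t))).
Proof. exact/fubini_gen/sigma_finite_leb2. Qed.

Let zero_gen (m1 : {measure set (plane R) -> \bar R}) (f g : R * R * R -> R[i]) :
  sigma_finite setT m1 -> cintegrable (m1 \x leb1)%E (@SM R) f ->
  cintegrable (m1 \x leb1)%E (@SM R) g ->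
  {ae m1, forall x, @disk R x -> cintegrable leb1 (@circle R) (fun t => f (x, t)) ->
    cintegral leb1 (@circle R) (fun t => g (x, t)) = 0} ->
  cintegral (m1 \x leb1)%E (@SM R) g = 0.
Proof.
move=> /sigma_finite_measureP[m' ->] fi gi f0.
exact: (cfubini_zero_slice (@measurable_disk R) (@measurable_circle R) fi gi f0).
Qed.

Lemma cintegral_SM_zero (f g : R * R * R -> R[i]) :
  cintegrable leb3 (@SM R) f -> cintegrable leb3 (@SM R) g ->
  {ae leb2, forall x, @disk R x -> cintegrable leb1 (@circle R) (fun t => f (x, t)) ->
    cintegral leb1 (@circle R) (fun t => g (x, t)) = 0} ->
  cintegral leb3 (@SM R) g = 0.
Proof. exact/zero_gen/sigma_finite_leb2. Qed.

Lemma tonelli_SM (f : R * R * R -> \bar R) :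
  measurable_fun (@SM R : set (bundle R)) f -> (forall p, 0 <= f p)%E ->
  (\int[leb3]_(p in @SM R) f p =
   \int[leb2]_(x in @disk R) \int[leb1]_(t in @circle R) f (x, t))%E.
Proof. exact/tonelli_gen/sigma_finite_leb2. Qed.

End SM_fubini.

Section complex_ftc.
Variable R : realType.
Local Notation leb1 := (@lebesgue_measure R).

Lemma continuous_integrable_itv (f : R -> R) (a b : R) : continuous f ->
  leb1.-integrable `[a, b] (EFin \o f).
Proof.
move=> cf; apply: continuous_compact_integrable; first exact: segment_compact.
exact: continuous_subspaceT.
Qed.

Lemma Rintegral_ftc (F f : R -> R) (a b : R) : a <= b ->
  (forall t : R, is_derive t 1 F (f t)) -> continuous f ->
  \int[leb1]_(t in `[a, b]) f t = F b - F a.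
Proof.
move=> ab dF cf; have [->|ab'] := eqVneq a b.
  by rewrite set_itv1 Rintegral_set1 subrr.
have cF t : {for t, continuous F}.
  by apply: differentiable_continuous; apply/derivable1_diffP; case: (dF t).
rewrite /Rintegral (@continuous_FTC2 _ f F)//.
- by rewrite lt_neqAle ab' ab.
- exact: continuous_subspaceT.
- split => [t _||].
  + by case: (dF t).
  + exact/cvg_at_right_filter/cF.
  + exact/cvg_at_left_filter/cF.
- by move=> t _; rewrite derive1E; case: (dF t).
Qed.

Lemma cintegral_ftc (F f : R -> R[i]) (a b : R) : a <= b ->
  (forall t : R, is_derive t 1 (fun t => complex.Re (F t)) (complex.Re (f t))) ->
  (forall t : R, is_derive t 1 (fun t => complex.Im (F t)) (complex.Im (f t))) ->
  continuous (fun t => complex.Re (f t)) -> continuous (fun t => complex.Im (f t)) ->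
  cintegral leb1 `[a, b] f = F b - F a.
Proof.
move=> ab dR dI cR cI; apply: complex_eq; rewrite !ReImE /=.
- by rewrite (Rintegral_ftc ab dR).
- by rewrite (Rintegral_ftc ab dI).
Qed.

Lemma is_derive_cstM (f : R -> R) (c df t : R) :
  is_derive t 1 f df -> is_derive t 1 (fun t => c * f t) (c * df).
Proof. exact: is_deriveZ. Qed.

Lemma is_derive_sin_mul (k t : R) :
  is_derive t 1 (fun t => sin (k * t)) (k * cos (k * t)).
Proof.
have dk : is_derive t 1 (fun t : R => k * t) (k * 1).
  by apply: is_derive_cstM; exact: is_derive_id.
have := is_derive1_comp (is_derive_sin _) dk.
by rewrite mulr1 mulrC.
Qed.

Lemma is_derive_cos_mul (k t : R) :
  is_derive t 1 (fun t => cos (k * t)) (- (k * sin (k * t))).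
Proof.
have dk : is_derive t 1 (fun t : R => k * t) (k * 1).
  by apply: is_derive_cstM; exact: is_derive_id.
have := is_derive1_comp (is_derive_cos _) dk.
by rewrite mulr1 mulNr mulrC.
Qed.

(** The factor [0 -i* k%:~R^-1] is 1/(ik). *)
Lemma cintegral_expi (k : int) (a b : R) : a <= b -> k != 0 ->
  cintegral leb1 `[a, b] (expi k) = (expi k b - expi k a) * (0 -i* k%:~R^-1).
Proof.
move=> ab k0; have k0' : (k%:~R : R) != 0 by rewrite intr_eq0.
pose F (t : R) := (k%:~R^-1 * sin (k%:~R * t)) +i* (- k%:~R^-1 * cos (k%:~R * t)).
have dR (t : R) : is_derive t 1 (fun t => complex.Re (F t)) (complex.Re (expi k t)).
  have := is_derive_cstM (k%:~R^-1) (is_derive_sin_mul k%:~R t).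
  by rewrite mulrA mulVf// mul1r.
have dI (t : R) : is_derive t 1 (fun t => complex.Im (F t)) (complex.Im (expi k t)).
  have := is_derive_cstM (- k%:~R^-1) (is_derive_cos_mul k%:~R t).
  by rewrite mulrNN mulrA mulVf// mul1r.
rewrite (cintegral_ftc ab dR dI).
- by rewrite /F; apply: complex_eq; rewrite !ReImE /=; ring.
- exact: continuous_cos_mul.
- exact: continuous_sin_mul.
Qed.

Lemma cintegral_bndbnd (f : R -> R[i]) (a b : R) (x y : bool) :
  cintegrable leb1 `[a, b] f ->
  cintegral leb1 [set` Interval (BSide x a) (BSide y b)] f =
  cintegral leb1 `[a, b] f.
Proof.
move=> [fR fI].
have h (g : R -> R) : leb1.-integrable `[a, b] (EFin \o g) ->
  \int[leb1]_(t in [set` Interval (BSide x a) (BSide y b)]) g t = \int[leb1]_(t in `[a, b]) g t.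
  move=> gi.
  have s (i : interval R) : [set` i] `<=` `[a, b]%classic -> leb1.-integrable [set` i] (EFin \o g).
    by move=> ia; apply: integrableS gi => //; exact: measurable_itv.
  case: x; case: y => //.
  - apply: Rintegral_itv_bndo_bndc; apply: s => t /=; rewrite !in_itv /= => /andP[? ?].
    by apply/andP; split; rewrite // ltW.
  - rewrite Rintegral_itv_bndo_bndc ?Rintegral_itv_obnd_cbnd//; apply: s => t /=;
      rewrite !in_itv /= => /andP[? ?]; by apply/andP; split; rewrite // ltW.
  - apply: Rintegral_itv_obnd_cbnd; apply: s => t /=; rewrite !in_itv /= => /andP[? ?].
    by apply/andP; split; rewrite // ltW.
by rewrite /cintegral !h.
Qed.

Lemma cintegrable_expi (k : int) (a b : R) : cintegrable leb1 `[a, b] (expi k).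
Proof.
by split; apply: continuous_integrable_itv; [exact: continuous_cos_mul|exact: continuous_sin_mul].
Qed.

Lemma cintegral_circle_expi (k : int) :
  cintegral leb1 (@circle R) (expi k) = if k == 0 then (2 * pi)%:C else 0.
Proof.
case: eqP => [->|/eqP k0].
  rewrite (@eq_cintegral _ _ _ _ _ _ (fun=> 1)); last by move=> t _; rewrite expi0.
  rewrite /cintegral Rintegral_cst ?Rintegral_cst; [|exact: measurable_itv..].
  rewrite (_ : fine _ = 2 * pi); last by rewrite -[RHS]/(fine (2 * pi)%:E) -leb_circle.
  by rewrite mul1r mul0r.
rewrite /circle cintegral_bndbnd; last exact: cintegrable_expi.
rewrite cintegral_expi ?pi_ge0 ?mulr_ge0 ?pi_ge0//.
have -> : expi k (0 : R) = 1 by rewrite /expi mulr0 cos0 sin0.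
by rewrite expi_2pi subrr mul0r.
Qed.

End complex_ftc.

Section limit_lemmas.
Context d (T : measurableType d) (R : realType).
Variables (mu : {measure set T -> \bar R}) (D : set T).
Hypothesis mD : measurable D.
Local Notation L2 := (L2 mu D).
Local Notation N := (sqnorm mu D).
Local Notation limL2 := (limL2 mu D).
Local Notation cauchyL2 := (cauchyL2 mu D).

Lemma limL2_cauchy (fn : nat -> T -> R[i]) f : (forall n, L2 (fn n)) -> L2 f ->
  limL2 fn f -> cauchyL2 fn.
Proof.
move=> Ln Lf cf e e0; have e4 : 0 < e / 4 by lra.
have [n0 h] := cf _ e4; exists n0 => n m nn nm.
have := sqnorm_tri mD (Ln n) Lf (Ln m); rewrite (sqnormBC mu D f).
have := h n nn; have := h m nm; lra.
Qed.

Lemma limL2_of_approx (I : Type) (Q : I -> Prop) (F : I -> T -> R[i]) f :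
  (forall e : R, 0 < e -> exists2 s, Q s & N (fun x => f x - F s x) <= e) ->
  exists2 sn : nat -> I, forall n, Q (sn n) & limL2 (fun n => F (sn n)) f.
Proof.
move=> h.
have n0 (n : nat) : 0 < (n.+1%:R^-1 : R) by rewrite invr_gt0.
have [sn hn] := choice (fun n => let: ex_intro2 s a b := h _ (n0 n) in
  ex_intro (fun s => Q s /\ N (fun x => f x - F s x) <= n.+1%:R^-1) s (conj a b)).
exists sn => [n|e e0]; first by have [] := hn n.
have [k ke] : exists k : nat, e^-1 < k%:R.
  by exists (Num.truncn e^-1).+1; rewrite truncnS_gt.
exists k => n kn; rewrite sqnormBC; apply: (le_trans (hn n).2).
rewrite -(invrK e) lef_pV2 ?posrE ?invr_gt0// (le_trans (ltW ke))//.
by rewrite ler_nat (leq_trans kn).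
Qed.

Lemma limL2_D (fn gn : nat -> T -> R[i]) f g :
  (forall n, L2 (fn n)) -> (forall n, L2 (gn n)) -> L2 f -> L2 g ->
  limL2 fn f -> limL2 gn g ->
  limL2 (fun n x => fn n x + gn n x) (fun x => f x + g x).
Proof.
move=> Lfn Lgn Lf Lg cf cg e e0; have e4 : 0 < e / 4 by lra.
have [n1 h1] := cf _ e4; have [n2 h2] := cg _ e4; exists (maxn n1 n2) => n.
rewrite geq_max => /andP[/h1 {}h1 /h2 {}h2].
rewrite (@eq_sqnorm _ _ _ mu D _ (fun x => (fn n x - f x) + (gn n x - g x))); last first.
  by move=> x _; rewrite opprD addrACA.
have := sqnormD_le mD (L2B mD (Lfn n) Lf) (L2B mD (Lgn n) Lg); move: h1 h2; lra.
Qed.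

Lemma limL2_Z (c : R[i]) (fn : nat -> T -> R[i]) f :
  (forall n, L2 (fn n)) -> L2 f -> limL2 fn f ->
  limL2 (fun n x => c * fn n x) (fun x => c * f x).
Proof.
move=> Lfn Lf cf e e0; have e4 : 0 < e / (nsq c + 1).
  by rewrite divr_gt0// ltr_wpDl// nsq_ge0.
have [n1 h1] := cf _ e4; exists n1 => n /h1 {}h1.
rewrite (@eq_sqnorm _ _ _ mu D _ (fun x => c * (fn n x - f x))); last first.
  by move=> x _; rewrite mulrBr.
rewrite sqnormZ//; last exact: L2B.
apply: (le_trans (ler_wpM2l (nsq_ge0 _) h1)).
have c0 := nsq_ge0 c.
rewrite mulrA ler_pdivrMr; last lra.
nra.
Qed.

Lemma limL2_N (fn : nat -> T -> R[i]) f :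
  (forall n, L2 (fn n)) -> L2 f -> limL2 fn f ->
  limL2 (fun n x => - fn n x) (fun x => - f x).
Proof.
move=> Lfn Lf /(limL2_Z (-1) Lfn Lf) h e /h[n0 hn]; exists n0 => n /hn.
by congr (_ <= _); apply: eq_sqnorm => x _; rewrite !mulN1r.
Qed.

Lemma limL2_conj (fn : nat -> T -> R[i]) f : limL2 fn f ->
  limL2 (fun n x => conjc (fn n x)) (fun x => conjc (f x)).
Proof.
move=> h e /h[n0 hn]; exists n0 => n /hn; congr (_ <= _).
by apply: eq_sqnorm => x _; rewrite -rmorphB nsq_conj.
Qed.

Lemma limL2_inner (fn : nat -> T -> R[i]) f g (c : R[i]) :
  (forall n, L2 (fn n)) -> L2 f -> L2 g -> limL2 fn f ->
  (forall n, inner mu D (fn n) g = c) -> inner mu D f g = c.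
Proof.
move=> Ln Lf Lg cf hc.
apply/eqP; rewrite -subr_eq0; apply/eqP/nsq_eq0/eqP.
rewrite eq_le nsq_ge0 andbT; apply/ler_addgt0Pl => e e0; rewrite addr0.
have Ng := sqnorm_ge0 mu D g.
have e1 : 0 < e / (N g + 1) by rewrite divr_gt0//; lra.
have [n h] := cf _ e1; have := h n (leqnn _).
have := cauchy_schwarz mD (L2B mD (Ln n) Lf) Lg.
rewrite innerBl// hc nsqC => cs hN; apply: (le_trans cs).
apply: (@le_trans _ _ (e / (N g + 1) * N g)); first by rewrite ler_wpM2r.
rewrite mulrAC ler_pdivrMr; last lra.
nra.
Qed.

Lemma limL2_unique (fn : nat -> T -> R[i]) f g :
  (forall n, L2 (fn n)) -> L2 f -> L2 g -> limL2 fn f -> limL2 fn g ->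
  N (fun x => f x - g x) = 0.
Proof.
move=> Ln Lf Lg cf cg; apply/eqP; rewrite eq_le sqnorm_ge0 andbT.
apply/ler_addgt0Pl => e e0; rewrite addr0; have e4 : 0 < e / 4 by lra.
have [n1 h1] := cf _ e4; have [n2 h2] := cg _ e4.
have := h1 _ (leq_maxl n1 n2); have := h2 _ (leq_maxr n1 n2).
have := sqnorm_tri mD Lf (Ln (maxn n1 n2)) Lg; rewrite (sqnormBC mu D f (fn _)); lra.
Qed.

Lemma sqnorm0_ae f : L2 f -> N f = 0 -> {ae mu, forall x, D x -> f x = 0}.
Proof.
move=> Lf Nf.
have mf : measurable_fun D (fun x => (nsq (f x))%:E).
  by apply/measurable_EFinP/measurable_nsq => //; exact: L2_meas Lf.
have : (\int[mu]_(x in D) `|(nsq (f x))%:E| = 0)%E.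
  rewrite -[RHS]/(0%:E) -Nf -(sqnormE Lf) sqnorm2E; apply: eq_integral => x _.
  by rewrite gee0_abs// lee_fin nsq_ge0.
move=> /(ae_eq_integral_abs mu mD mf).
by apply: filterS => x h /h [/nsq_eq0].
Qed.

Lemma ae_sqnorm0 f : cmeas D f -> {ae mu, forall x, D x -> f x = 0} -> L2 f /\ N f = 0.
Proof.
move=> mf f0; have E : sqnorm2 mu D f = 0%E.
  rewrite sqnorm2E -(integral0 mu D); apply: ae_eq_integral => //.
    by apply/measurable_EFinP/measurable_nsq.
  by move: f0; apply: filterS => x h Dx; rewrite h ?nsq0.
by case: (mf) => ? ?; split; [split; rewrite ?E|rewrite /sqnorm E].
Qed.

End limit_lemmas.

Section lext_limit.
Context d (T : measurableType d) d' (T' : measurableType d') (R : realType) (I : Type).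
Variables (mu : {measure set T -> \bar R}) (D : set T).
Variables (mu' : {measure set T' -> \bar R}) (D' : set T').
Hypotheses (mD : measurable D) (mD' : measurable D').
Variables (B : I -> T -> R[i]) (F : I -> T' -> R[i]).

Lemma L2_lext (B' : I -> T -> R[i]) s : (forall i, L2 mu D (B' i)) -> L2 mu D (lext B' s).
Proof.
by move=> LB; apply: L2_sum => // t; apply: L2Z.
Qed.

Lemma inner_lext (I' : Type) (B1 : I -> T -> R[i]) (B2 : I' -> T -> R[i]) s t :
  (forall i, L2 mu D (B1 i)) -> (forall i, L2 mu D (B2 i)) ->
  inner mu D (lext B1 s) (lext B2 t) =
  \sum_(x <- s) \sum_(y <- t) x.1 * conjc y.1 * inner mu D (B1 x.2) (B2 y.2).
Proof.
move=> L1 L2'; rewrite inner_suml//; last 2 first.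
- by move=> x; exact: L2Z.
- by apply: L2_sum => // y; exact: L2Z.
apply: eq_bigr => x _; rewrite innerZl//; last by apply: L2_sum => // y; exact: L2Z.
rewrite innerC//; last by apply: L2_sum => // y; exact: L2Z.
rewrite inner_suml//; last by move=> y; exact: L2Z.
rewrite rmorph_sum mulr_sumr; apply: eq_bigr => y _.
by rewrite innerZl// rmorphM (innerC mD (L2' y.2) (L1 x.2)) mulrA.
Qed.

(** Extension of a bounded operator by density, with no operator in sight: if [B i -> F i] is
    bounded on combinations, then along lists whose [B]-sums converge the [F]-sums are Cauchy, hence
    converge. *)
Lemma lext_limit (C : R) (sn : nat -> seq (R[i] * I)) f :
  (forall i, L2 mu D (B i)) -> (forall i, L2 mu' D' (F i)) -> 0 <= C ->
  (forall s, sqnorm mu' D' (lext F s) <= C * sqnorm mu D (lext B s)) ->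
  L2 mu D f -> limL2 mu D (fun n => lext B (sn n)) f ->
  exists k : nat -> nat, let g x := climit (fun j => lext F (sn (k j)) x) in
    L2 mu' D' g /\ limL2 mu' D' (fun n => lext F (sn n)) g.
Proof.
move=> LB LF C0 FB Lf cf; apply: riesz_fischer => //.
  by move=> n; apply: L2_sum => // t; exact: L2Z.
have LBs s : L2 mu D (lext B s) by exact: L2_lext.
have cB := limL2_cauchy mD (fun n => LBs (sn n)) Lf cf.
move=> e e0; have e1 : 0 < e / (C + 1) by rewrite divr_gt0//; lra.
have [n0 h] := cB _ e1; exists n0 => n m nn nm.
rewrite -lext_sub; apply: (le_trans (FB _)); rewrite lext_sub.
apply: (le_trans (ler_wpM2l C0 (h n m nn nm))).
rewrite mulrA ler_pdivrMr; last lra.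
nra.
Qed.

End lext_limit.

Section ae_lemmas.
Context d (T : measurableType d) (R : realType) (mu : {measure set T -> \bar R}).

Lemma ae_imp (P Q : T -> Prop) : {ae mu, forall x, P x} ->
  (forall x, P x -> Q x) -> {ae mu, forall x, Q x}.
Proof. by move=> aP PQ; apply: filterS aP. Qed.

End ae_lemmas.

(** * Fourier components on the circle bundle *)

Section SM_fourier.
Variable R : realType.
Local Notation leb1 := (@lebesgue_measure R).
Local Notation leb2 := (leb1 \x leb1)%E.
Local Notation leb3 := (leb2 \x leb1)%E.
Local Notation L2d := (L2 leb2 (@disk R)).
Local Notation L2s := (L2 leb3 (@SM R)).
Local Notation Nd := (sqnorm leb2 (@disk R)).
Local Notation Ns := (sqnorm leb3 (@SM R)).
Local Notation innd := (inner leb2 (@disk R)).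
Local Notation inns := (inner leb3 (@SM R)).
Implicit Types (f g : R * R -> R[i]) (u : R * R * R -> R[i]) (k l : int).

Definition freq f k : R * R * R -> R[i] := fun p => f p.1 * expi k p.2.

Lemma L2d_zmon ab : L2d (@zmon R ab).
Proof.
have [] // := @bounded_L2 _ _ _ leb2 (@disk R) (@measurable_disk R) (@leb_disk_fin R) (zmon ab) 1.
- exact: cmeas_zmon.
- by move=> x /disk_closed; exact: nsq_zmon.
Qed.

Lemma L2s_emon i : L2s (@emon R i).
Proof.
have [] // := @bounded_L2 _ _ _ leb3 (@SM R) (@measurable_SM R) (@leb_SM_fin R) (emon i) 1.
- exact: cmeas_emon.
- by move=> p [/disk_closed h _]; exact: nsq_emon.
Qed.

Lemma cmeas_fst f : cmeas (@disk R : set (plane R)) f ->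
  cmeas (@SM R : set (bundle R)) (fun p => f p.1).
Proof.
have sub : (fst @` (@SM R)) `<=` @disk R by move=> _ [p [Dp _] <-].
have m1 : measurable_fun (@SM R : set (bundle R)) (fst : bundle R -> plane R).
  by apply: measurable_funTS; exact: measurable_fst.
move=> [a b]; split.
- exact: (measurable_comp (@measurable_disk R) sub a m1).
- exact: (measurable_comp (@measurable_disk R) sub b m1).
Qed.

Lemma cmeas_snd_expi k : cmeas (@SM R : set (bundle R)) (fun p => expi k p.2).
Proof.
apply: (cmeas_comp (g := snd)); first exact: cmeas_expi.
by apply: measurable_funTS; exact: measurable_snd.
Qed.

Lemma cmeas_freq f k : cmeas (@disk R : set (plane R)) f ->
  cmeas (@SM R : set (bundle R)) (freq f k).
Proof. by move=> mf; apply: cmeasM; [exact: cmeas_fst|exact: cmeas_snd_expi]. Qed.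

Lemma sqnorm2_freq f k : cmeas (@disk R : set (plane R)) f ->
  sqnorm2 leb3 (@SM R) (freq f k) = ((2 * pi)%:E * sqnorm2 leb2 (@disk R) f)%E.
Proof.
move=> mf; rewrite sqnorm2E tonelli_SM; first last.
- by move=> p; rewrite lee_fin nsq_ge0.
- by apply/measurable_EFinP; apply: measurable_nsq; exact: cmeas_freq.
rewrite sqnorm2E -ge0_integralZl_EFin//; first last.
- by rewrite ltW// pi2_gt0.
- by apply/measurable_EFinP; apply: measurable_nsq.
- by move=> x _; rewrite lee_fin nsq_ge0.
- exact: measurable_disk.
apply: eq_integral => x _; rewrite /freq /=.
under eq_integral do rewrite nsqM nsq_expi mulr1.
rewrite integral_cst; last exact: measurable_circle.
by rewrite muleC; congr (_ * _)%E; exact: leb_circle.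
Qed.

Lemma L2s_freq f k : L2d f -> L2s (freq f k).
Proof.
move=> Lf; have mf := L2_meas Lf; have [a b] := cmeas_freq k mf; split => //.
by rewrite sqnorm2_freq// (sqnormE Lf) -EFinM ltry.
Qed.

Lemma sqnorm_freq f k : L2d f -> Ns (freq f k) = 2 * pi * Nd f.
Proof.
move=> Lf; rewrite /sqnorm sqnorm2_freq; last exact: L2_meas Lf.
by rewrite (sqnormE Lf) -EFinM.
Qed.

Lemma cintegrable_circle_expi k : cintegrable leb1 (@circle R) (expi k).
Proof.
have [a b] := @cintegrable_expi R k 0 (2 * pi).
have h : @circle R `<=` `[0, 2 * pi]%classic.
  by move=> t; rewrite /circle /= !in_itv /= => /andP[-> /ltW ->].
by split; [apply: integrableS a|apply: integrableS b] => //; exact: measurable_circle.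
Qed.

Lemma inns_freq f g k l : L2d f -> L2d g ->
  inns (freq f k) (freq g l) = if k == l then (2 * pi)%:C * innd f g else 0.
Proof.
move=> Lf Lg; rewrite /inner cintegral_SM; last first.
  by apply: inner_integrable; [exact: measurable_SM|exact: L2s_freq..].
have E (x : R * R) : cintegral leb1 (@circle R)
    (fun t => freq f k (x, t) * conjc (freq g l (x, t))) =
    (if k == l then (2 * pi)%:C else 0) * (f x * conjc (g x)).
  transitivity (cintegral leb1 (@circle R)
      (fun t => (f x * conjc (g x)) * expi (k - l) t)).
    apply: eq_cintegral => t _; rewrite /freq /= rmorphM expiD -expi_conj /=; ring.
  rewrite cintegralZ; first by rewrite cintegral_circle_expi subr_eq0 mulrC.
  - exact: measurable_circle.
  - exact: cintegrable_circle_expi.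
transitivity (cintegral leb2 (@disk R)
  (fun x => (if k == l then (2 * pi)%:C else 0) * (f x * conjc (g x)))).
  by apply: eq_cintegral => x _; exact: E.
rewrite cintegralZ//; [|exact: measurable_disk|]; last first.
  by apply: inner_integrable => //; exact: measurable_disk.
by case: eqP; rewrite ?mul0r.
Qed.

Lemma emon_freq i : @emon R i = freq (zmon i.1) i.2.
Proof. by []. Qed.

(** Fubini over the circle. The pairing of [u] with e^(ik theta) alone provides integrable slices,
    so that [conjc (f x)] can be taken out of the inner integral. *)
Lemma inns_fourier0 u k f : L2s u -> L2d f ->
  {ae leb2, forall x, @disk R x -> fourier u k x = 0} ->
  inns u (freq f k) = 0.
Proof.
move=> Lu Lf u0; have mS := @measurable_SM R.
have L1 : L2d (fun=> 1).
  have := L2d_zmon (0, 0)%N; congr L2; apply/funext => x.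
  by rewrite /zmon /= !expr0 mulr1.
have := @cintegral_SM_zero R (fun p => u p * conjc (freq (fun=> 1) k p)).
move=> /(_ (fun p => u p * conjc (freq f k p))); apply.
- by apply: inner_integrable => //; exact: L2s_freq.
- by apply: inner_integrable => //; exact: L2s_freq.
apply: (ae_imp u0) => x ux Dx xi; have {ux} := ux Dx.
have xi' : cintegrable leb1 (@circle R) (fun t => u (x, t) * expi (- k) t).
  move: xi; congr cintegrable; apply/funext => t.
  by rewrite /freq mul1r -expi_conj.
rewrite /fourier => /eqP; rewrite mulf_eq0 => /orP[/eqP|/eqP h].
  move=> /(congr1 (fun z => complex.Re z)) /= /eqP.
  by rewrite invr_eq0 gt_eqF// pi2_gt0.
transitivity (cintegral leb1 (@circle R)
    (fun t => conjc (f x) * (u (x, t) * expi (- k) t))).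
  apply: eq_cintegral => t _; rewrite /freq -expi_conj rmorphM /=; ring.
by rewrite cintegralZ ?h ?mulr0//; exact: measurable_circle.
Qed.

Lemma L2s_lext (s : seq (R[i] * (nat * nat * int))) : L2s (lext (@emon R) s).
Proof. by apply: L2_lext; [exact: measurable_SM|exact: L2s_emon]. Qed.

Lemma L2d_lext (s : seq (R[i] * (nat * nat))) : L2d (lext (@zmon R) s).
Proof. by apply: L2_lext; [exact: measurable_disk|exact: L2d_zmon]. Qed.

Lemma lext_filter (T I : Type) (F : I -> T -> R[i]) (P : pred (R[i] * I)) s x :
  lext F s x = lext F (seq.filter P s) x + lext F (seq.filter (predC P) s) x.
Proof.
elim: s => [|t s ih]; first by rewrite /= !lext_nil addr0.
rewrite lext_cons ih /=; case: (P t); rewrite /= lext_cons; ring.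
Qed.

(** Take any approximating trigonometric polynomial and drop the frequencies outside [P]: the
    dropped part is orthogonal to [u] and to the part that is kept, so the error can only
    decrease. *)
Lemma approx_freq (P : pred int) u : L2s u ->
  (forall i, ~~ P i.2 -> inns u (emon i) = 0) ->
  forall e : R, 0 < e -> exists2 s, all (fun t => P t.2.2) s &
    Ns (fun p => u p - lext (@emon R) s p) <= e.
Proof.
move=> Lu uP e e0; have mS := @measurable_SM R.
have [s0 h] := density_SM Lu e0.
set Q := fun t : R[i] * (nat * nat * int) => P t.2.2.
exists (seq.filter Q s0); first exact: filter_all.
apply: le_trans h; set s := seq.filter Q s0; set r := seq.filter (predC Q) s0.
rewrite (@eq_sqnorm _ _ _ leb3 (@SM R) (fun p => u p - lext _ s0 p)
  (fun p => (u p - lext (@emon R) s p) + - 1 * lext (@emon R) r p)); last first.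
  by move=> p _; rewrite (lext_filter (@emon R) Q s0) opprD addrA mulN1r.
have Lus : L2s (fun p => u p - lext (@emon R) s p) by apply: L2B => //; exact: L2s_lext.
have Lr := L2s_lext r; have Ls := L2s_lext s.
rewrite [leRHS](sqnormD mS Lus (L2Z mS (-1) Lr)) (innerZr mS _ Lr Lus).
suff -> : inns (fun p => u p - lext (@emon R) s p) (lext (@emon R) r) = 0.
  by rewrite mulr0 /= mulr0 addr0 lerDl sqnorm_ge0.
rewrite (innerBl mS Lu Ls Lr).
have -> : inns u (lext (@emon R) r) = 0.
  have LZ (t : R[i] * (nat * nat * int)) : L2s (fun p => t.1 * emon t.2 p).
    by apply: (L2Z mS); exact: L2s_emon.
  rewrite (innerC mS Lr Lu) (inner_suml mS _ LZ Lu).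
  rewrite big_filter big1 ?rmorph0// => t Qt.
  by rewrite (innerZl mS _ (L2s_emon _) Lu) (innerC mS Lu (L2s_emon _)) (uP _ Qt) rmorph0 mulr0.
rewrite (inner_lext mS _ _ L2s_emon L2s_emon).
rewrite big_filter big1 ?subrr// => t Qt; rewrite big_filter big1// => t' Qt'.
rewrite !emon_freq inns_freq; try exact: L2d_zmon.
case: eqP => [E|_]; last by rewrite mulr0.
by move: Qt'; rewrite /= /Q -E; move: Qt; rewrite /Q => ->.
Qed.

Definition freq_part (s : seq (R[i] * (nat * nat * int))) k : seq (R[i] * (nat * nat)) :=
  [seq (t.1, t.2.1) | t <- s & t.2.2 == k].

(** The frequencies of an m-tensor in increasing order, from -m at [j = 0] to m at [j = m]. *)
Definition tfreq (m j : nat) : int := - m%:Z + j.*2%:Z.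

Lemma tfreq_inj m : injective (tfreq m).
Proof. by move=> i j /addrI [] /double_inj. Qed.

Lemma lext_comp m s p : all (fun t => [exists j : 'I_m.+1, t.2.2 == tfreq m j]) s ->
  lext (@emon R) s p =
  \sum_(j < m.+1) freq (lext (@zmon R) (freq_part s (tfreq m j))) (tfreq m j) p.
Proof.
elim: s => [_|t s ih /= /andP[/existsP[i /eqP ti] hs]].
  by rewrite lext_nil big1// => j _; rewrite /freq /freq_part /= lext_nil mul0r.
rewrite lext_cons ih// (bigD1 i)//= [RHS](bigD1 i)//= addrA; congr (_ + _).
  by rewrite /freq /freq_part /= ti eqxx /= lext_cons /emon ti; ring.
apply: eq_bigr => j ji; rewrite /freq_part /= ti.
by rewrite (inj_eq (@tfreq_inj m)) (inj_eq val_inj) eq_sym (negbTE ji).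
Qed.

Lemma sqnorm_freq_sum m (f : nat -> R * R -> R[i]) : (forall j, L2d (f j)) ->
  Ns (fun p => \sum_(j < m.+1) freq (f j) (tfreq m j) p) =
  \sum_(j < m.+1) 2 * pi * Nd (f j).
Proof.
move=> Lf; have mS := @measurable_SM R.
suff H n : Ns (fun p => \sum_(j < n) freq (f j) (tfreq m j) p) =
    \sum_(j < n) 2 * pi * Nd (f j) by [].
have LS n' : L2s (fun p => \sum_(j < n') freq (f j) (tfreq m j) p).
  by apply: L2_sum => // j; exact: L2s_freq.
elim: n => [|n ih].
  rewrite big_ord0 -[RHS](@sqnorm0 _ _ _ leb3 (@SM R)); apply: eq_sqnorm => p _.
  by rewrite big_ord0.
rewrite big_ord_recr /= -ih -(sqnorm_freq (tfreq m n))//.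
rewrite (@eq_sqnorm _ _ _ leb3 (@SM R) (fun p => \sum_(j < n.+1) freq (f j) (tfreq m j) p)
    (fun p => \sum_(j < n) freq (f j) (tfreq m j) p + freq (f n) (tfreq m n) p));
      last by move=> p _; rewrite big_ord_recr.
rewrite sqnormD//; last exact: L2s_freq.
rewrite inner_suml//; [|by move=> j; exact: L2s_freq|exact: L2s_freq].
rewrite big1 ?mulr0 ?addr0// => j _; rewrite inns_freq//.
by rewrite (inj_eq (@tfreq_inj m)) ltn_eqF.
Qed.

Lemma tensors_inner0 m u i : tensors R m u ->
  ~~ [exists j : 'I_m.+1, i.2 == tfreq m j] -> inns u (emon i) = 0.
Proof.
move=> [[_ Lu] ut] /existsPn hi; apply: inns_fourier0 => //; first exact: L2d_zmon.
apply: ut => -[j jm ij]; move: (hi (Ordinal (jm : (j < m.+1)%N))).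
by rewrite /= ij eqxx.
Qed.

(** The components are not the integrals [fourier u k]: they are obtained as L^2 limits of the
    components of approximating polynomials, which makes them measurable and square-integrable by
    construction. *)
Theorem tensor_decomposition m u : tensors R m u ->
  exists2 f : nat -> R * R -> R[i], forall j, L2d (f j) &
    Ns (fun p => u p - \sum_(j < m.+1) freq (f j) (tfreq m j) p) = 0.
Proof.
move=> tu; have [[_ Lu] _] := tu; have mS := @measurable_SM R.
have mD := @measurable_disk R.
have [sn hsn cs] := limL2_of_approx (@approx_freq
  (fun k => [exists j : 'I_m.+1, k == tfreq m j]) u Lu (fun i => tensors_inner0 tu)).
pose fn j n := lext (@zmon R) (freq_part (sn n) (tfreq m j)).
have Lfn j n : L2d (fn j n) by exact: L2d_lext.
have p0 := @pi_gt0 R.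
have cf j : exists2 f, L2d f & (j < m.+1)%N -> limL2 leb2 (@disk R) (fn j) f.
  have [jm|jm] := boolP (j < m.+1)%N; last by exists (fun=> 0) => //; exact: L2_0.
  (* By Pythagoras over the frequencies, each component of a difference of approximants is bounded
     by the whole difference, as 2 pi >= 1. *)
  suff /(riesz_fischer mD (Lfn j)) [k [Lf cf]] : cauchyL2 leb2 (@disk R) (fn j).
    by exists (fun x => climit (fun i => fn j (k i) x)).
  have := limL2_cauchy mS (fun n => L2s_lext (sn n)) Lu cs.
  move=> c e e0; have [n0 h] := c _ e0; exists n0 => n n' nn nn'.
  apply: le_trans (h n n' nn nn').
  rewrite (@eq_sqnorm _ _ _ leb3 (@SM R) _ (fun p => \sum_(j < m.+1)
      freq (fun x => fn j n x - fn j n' x) (tfreq m j) p)); last first.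
    move=> p _; rewrite !(@lext_comp m); [|exact: hsn..].
    by rewrite -sumrB; congr nsq; apply: eq_bigr => i _; rewrite /freq mulrBl.
  rewrite (@sqnorm_freq_sum m (fun j x => fn j n x - fn j n' x)); last first.
    by move=> i; exact: L2B.
  rewrite (bigD1 (Ordinal jm))//= -[leLHS]addr0; apply: lerD; last first.
    by apply: sumr_ge0 => i _; rewrite mulr_ge0 ?sqnorm_ge0// ltW// pi2_gt0.
  have := sqnorm_ge0 leb2 (@disk R) (fun x => fn j n x - fn j n' x).
  have := @pi_ge2 R; nra.
have [f hf] := choice (fun j => let: ex_intro2 f a b := cf j in
  ex_intro (fun f => L2d f /\ ((j < m.+1)%N -> limL2 leb2 (@disk R) (fn j) f)) f (conj a b)).
exists f => [j|]; first by have [] := hf j.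
have LS : L2s (fun p => \sum_(j < m.+1) freq (f j) (tfreq m j) p).
  by apply: L2_sum => // j; apply: L2s_freq; exact: (hf j).1.
apply: (limL2_unique mS (fun n => L2s_lext (sn n)) Lu LS cs).
move=> e e0; pose C : R := 2 * pi * m.+1%:R.
have C0 : 0 < C by rewrite mulr_gt0 ?ltr0n// pi2_gt0.
have e1 : 0 < e / C by rewrite divr_gt0.
have hn j : exists n0, forall n, (n0 <= n)%N -> (j < m.+1)%N ->
    Nd (fun x => fn j n x - f j x) <= e / C.
  have [jm|jm] := boolP (j < m.+1)%N; last by exists 0%N.
  by have [n0 h] := (hf j).2 jm _ e1; exists n0 => n /h.
have [n0 hn0] := choice hn.
exists (\max_(j < m.+1) n0 j)%N => n nn.
rewrite (@eq_sqnorm _ _ _ leb3 (@SM R) _ (fun p => \sum_(j < m.+1)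
    freq (fun x => fn j n x - f j x) (tfreq m j) p)); last first.
  move=> p _; rewrite (@lext_comp m); last exact: hsn.
  by rewrite -sumrB; congr nsq; apply: eq_bigr => i _; rewrite /freq mulrBl.
rewrite (@sqnorm_freq_sum m (fun j x => fn j n x - f j x)); last first.
  by move=> i; apply: L2B => //; exact: (hf i).1.
apply: (@le_trans _ _ (\sum_(j < m.+1) 2 * pi * (e / C))).
  apply: ler_sum => j _; apply: ler_wpM2l; first by rewrite ltW// pi2_gt0.
  by apply: hn0 => //; apply: leq_trans nn; exact: (leq_bigmax j).
rewrite sumr_const card_ord -[leLHS]mulr_natr mulrAC -/C.
by rewrite mulrCA divff ?mulr1// gt_eqF.
Qed.

Lemma tensors_freq_sum m (f : nat -> R * R -> R[i]) : (forall j, L2d (f j)) ->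
  tensors R m (fun p => \sum_(j < m.+1) freq (f j) (tfreq m j) p).
Proof.
move=> Lf; have mS := @measurable_SM R; split.
  split; last by apply: L2_sum => // j; exact: L2s_freq.
  move=> x t; apply: eq_bigr => j _.
  by rewrite /freq /= expi_periodic.
move=> k hk; apply: aeW => x Dx; rewrite /fourier.
have ci (c : R[i]) l : cintegrable leb1 (@circle R) (fun t => c * expi l t).
  apply: cintegrableZ; first exact: measurable_circle.
  exact: cintegrable_circle_expi.
transitivity (((2 * pi)^-1)%:C * cintegral leb1 (@circle R)
    (fun t => \sum_(j < m.+1) f j x * expi (tfreq m j - k) t)).
  congr (_ * _); apply: eq_cintegral => t _; rewrite mulr_suml.
  by apply: eq_bigr => j _; rewrite /freq /= expiD mulrA.
rewrite cintegral_sum; [|exact: measurable_circle|by move=> j; exact: ci].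
rewrite big1 ?mulr0// => j _; rewrite cintegralZ; [|exact: measurable_circle|].
  rewrite cintegral_circle_expi subr_eq0; case: eqP => [E|_]; last by rewrite mulr0.
  by exfalso; apply: hk; exists j; rewrite ?E// -ltnS ltn_ord.
by have := ci 1 (tfreq m j - k); congr cintegrable; apply/funext => t; rewrite mul1r.
Qed.

(** Density on the bundle, applied to [f] as a function constant in theta, with only the frequency 0
    retained. The conjunct [True] gives the shape expected by [limL2_of_approx]. *)
Theorem density_disk f : L2d f -> forall e : R, 0 < e ->
  exists2 s, True & Nd (fun x => f x - lext (@zmon R) s x) <= e.
Proof.
move=> Lf e e0; have mS := @measurable_SM R.
have h (i : nat * nat * int) : ~~ pred1 0 i.2 -> inns (freq f 0) (emon i) = 0.
  rewrite emon_freq inns_freq//; last exact: L2d_zmon.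
  by rewrite /= eq_sym => /negbTE ->.
have [s hs Hs] := approx_freq (L2s_freq 0 Lf) h e0.
exists (freq_part s 0) => //; apply: le_trans Hs.
rewrite (@eq_sqnorm _ _ _ leb3 (@SM R) _ (freq (fun x => f x - lext (@zmon R) (freq_part s 0) x) 0)).
  rewrite sqnorm_freq; last by apply: L2B; [exact: measurable_disk|exact: Lf|exact: L2d_lext].
  have := sqnorm_ge0 leb2 (@disk R) (fun x => f x - lext (@zmon R) (freq_part s 0) x).
  have := @pi_ge2 R; nra.
move=> p _; congr nsq; rewrite {2}/freq mulrBl; congr (_ - _).
elim: s hs => [|t s ih /= /andP[/eqP t0 /ih e1]].
  by rewrite /freq_part /= !lext_nil mul0r.
by rewrite /freq_part /= t0 eqxx /= !lext_cons e1 /emon t0; ring.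
Qed.

End SM_fourier.

(** * Santalo's formula *)

Section measurability_of_open_sets.
Variable R : realType.

Lemma measurable_box3 (r : R) (q : R * R * R) :
  measurable (@ball R (R * R * R)%type q r : set (bundle R)).
Proof.
have -> : (ball q r : set (bundle R)) = (ball q.1.1 r `*` ball q.1.2 r) `*` ball q.2 r.
  apply/seteqP; split => [p /= [[? ?] ?]|p [[? ?] ?]] //; by split.
by apply: measurableX; [apply: measurableX|]; exact: measurable_ball.
Qed.

Lemma open_measurable3 (U : set (R * R * R)) : open U -> measurable (U : set (bundle R)).
Proof.
move=> oU.
pose c (x : rat * rat * rat) : R * R * R := ((ratr x.1.1, ratr x.1.2), ratr x.2).
pose B n : set (bundle R) := if @unpickle (rat * rat * rat * nat)%type n is Some x then
  (if `[< ball (c x.1) (x.2.+1%:R^-1) `<=` U >] then ball (c x.1) (x.2.+1%:R^-1) else set0)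
  else set0.
have -> : (U : set (bundle R)) = \bigcup_n B n.
  apply/seteqP; split => [p Up|p [n _]]; last first.
    rewrite /B; case: unpickle => // x; case: asboolP => // h; exact: h.
  have := oU p Up; rewrite -nbhs_ballE => -[e /= e0 he].
  have [k hk] : exists k : nat, k.+1%:R^-1 < e / 2.
    have e20 : 0 < e / 2 by rewrite divr_gt0.
    by have [k _ hk] := near_infty_natSinv_lt (PosNum e20); exists k; exact: (hk k (leqnn _)).
  have k0 : 0 < (k.+1%:R^-1 : R) by rewrite invr_gt0.
  have [d [k0' hk' de]] : exists d : R, [/\ 0 < d, d < e / 2 & d = k.+1%:R^-1] by exists k.+1%:R^-1.
  have rt (x : R) : exists q : rat, `|ratr q - x| < d.
    have /rat_in_itvoo [q] : x < x + d by rewrite ltrDl.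
    rewrite in_itv /= => /andP[h1 h2]; exists q; rewrite ltr_norml; apply/andP; split; lra.
  have [q1 h1] := rt p.1.1; have [q2 h2] := rt p.1.2; have [q3 h3] := rt p.2.
  have tr (u v w : R) : `|u - v| < d -> `|u - w| < d -> `|v - w| < e.
    move=> a b; rewrite (_ : v - w = (u - w) - (u - v)); last by ring.
    by apply: (le_lt_trans (ler_normB _ _)); move: a b hk'; clear; lra.
  have sub : ball (c ((q1, q2), q3)) d `<=` U.
    apply: subset_trans he => y [[y1 y2] y3]; split; first split.
    - exact: tr h1 y1.
    - exact: tr h2 y2.
    - exact: tr h3 y3.
  have pin : ball (c ((q1, q2), q3)) d p by split; first split.
  have [n hn] : exists n, unpickle n = Some (((q1, q2), q3), k).
    by exists (pickle (((q1, q2), q3), k)); exact: pickleK.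
  have En : B n = ball (c ((q1, q2), q3)) d.
    rewrite /B hn; cbn beta iota delta [fst snd]; rewrite -de; by case: asboolP.
  exists n; [exact: I|by rewrite En].
apply: bigcupT_measurable => n; rewrite /B; case: unpickle => [x|]; last exact: measurable0.
by case: asboolP => _; [exact: measurable_box3|exact: measurable0].
Qed.

End measurability_of_open_sets.

(** * Invariance of integrals under translations and rotations *)

Section translation.
Variable R : realType.
Local Notation leb1 := (@lebesgue_measure R).

(** The push-forward of Lebesgue measure by a translation agrees with it on intervals, hence
    everywhere by uniqueness. *)
Lemma ge0_integral_shift (f : R -> \bar R) (c : R) :
  measurable_fun setT (f : measurableTypeR R -> _) -> (forall x, 0 <= f x)%E ->
  (\int[leb1]_x f (x + c)%R = \int[leb1]_x f x)%E.
Proof.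
move=> mf f0; pose phi : measurableTypeR R -> measurableTypeR R := fun x => x + c.
have mphi : measurable_fun setT phi by apply: measurable_funD.
have := @ge0_integral_pushforward _ _ _ _ R phi mphi leb1 setT f measurableT mf (fun x _ => f0 x).
rewrite preimage_setT => <-; apply: eq_measure_integral => A mA _.
apply/esym.
pose mphi_mixin := isMeasurableFun.Build _ _ _ _ _ mphi.
pose phi' : {mfun _ >-> _} := HB.pack phi mphi_mixin.
apply: (@lebesgue_measure_unique R (pushforward leb1 phi')) => //= _ [[a b]] _ <-.
rewrite /pushforward (_ : _ @^-1` _ = `]a - c, b - c]%classic); last first.
  apply/seteqP; split => x; rewrite /phi /= !in_itv /= => /andP[h1 h2]; apply/andP; split; lra.
rewrite !lebesgue_measure_itv/= !lte_fin ltrD2r; case: ifP => // _.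
by rewrite -!EFinB; congr EFin; ring.
Qed.

End translation.
Section translation_periodic.
Variable R : realType.
Local Notation leb1 := (@lebesgue_measure R).

Lemma ge0_integral_circle_shift (f : R -> \bar R) (c : R) :
  measurable_fun setT (f : measurableTypeR R -> _) -> (forall x, 0 <= f x)%E ->
  (forall x, f (x + 2 * pi) = f x) ->
  (\int[leb1]_(x in @circle R) f (x + c)%R = \int[leb1]_(x in @circle R) f x)%E.
Proof.
move=> mf f0 pf; have p0 : 0 < 2 * pi :> R by rewrite mulr_gt0// pi_gt0.
have pfn (n : nat) x : f (x + 2 * pi * n%:R) = f x.
  elim: n x => [|n ih] x; first by rewrite mulr0 addr0.
  by rewrite (_ : _ + _ = x + 2 * pi * n%:R + 2 * pi) ?pf ?ih// -natr1; ring.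
have pfz (z : int) x : f (x + 2 * pi * z%:~R) = f x.
  case: z => n; first exact: pfn.
  by rewrite NegzE mulrNz mulrN -(pfn n.+1 (x - _)) subrK.
(* Periodicity allows [c] to be reduced modulo 2 pi. The part of the shifted interval beyond 2 pi is
   then brought back by one period. *)
wlog c0p : c / 0 <= c < 2 * pi => [H|].
  pose z := Num.floor (c / (2 * pi)).
  have E : c = (c - 2 * pi * z%:~R) + 2 * pi * z%:~R by rewrite subrK.
  rewrite -(H (c - 2 * pi * z%:~R)).
    by apply: eq_integral => x _; rewrite {1}E addrA pfz.
  have := floor_le (c / (2 * pi)); have := floorD1_gt (c / (2 * pi)).
  rewrite -/z intrD ltr_pdivrMr// ler_pdivlMr// => h1 h2.
  by apply/andP; split; move: h1 h2; rewrite ?mulrDl; lra.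
case/andP: c0p => c0 cp.
have shift (d a b : R) : (\int[leb1]_(x in `[a, b[) f (x + d)%R =
    \int[leb1]_(x in `[(a + d)%R, (b + d)%R[) f x)%E.
  rewrite integral_mkcond [RHS]integral_mkcond -(@ge0_integral_shift _ (f \_ `[(a + d)%R, (b +
    d)%R[) d).
  - apply: eq_integral => x _; rewrite /patch !mem_setE !in_itv /= lerD2r ltrD2r//.
  - by apply/(measurable_restrict _ _ _).1 => //; rewrite setTI; exact: measurable_funTS.
  - by move=> x; apply: erestrict_ge0 => y _; exact: f0.
have split (a b e : R) : a <= b -> b <= e -> (\int[leb1]_(x in `[a, e[) f x =
   \int[leb1]_(x in `[a, b[) f x + \int[leb1]_(x in `[b, e[) f x)%E.
  move=> ab be; rewrite -ge0_integral_setU//.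
  - congr integral; apply/seteqP; split => x /=; rewrite !in_itv /=.
      move=> /andP[h1 h2]; case: (ltP x b) => h; [left|right]; apply/andP; split => //.
    by case=> /andP[h1 h2]; apply/andP; split; lra.
  - exact: measurable_funTS.
  - rewrite disj_set2E; apply/eqP/seteqP; split => x //=; rewrite !in_itv /=.
    by move=> [/andP[h1 h2] /andP[h3 h4]]; lra.
have h1 : 2 * pi <= 2 * pi + c by rewrite lerDl.
rewrite /circle shift add0r (split _ _ _ (ltW cp) h1) (split _ _ _ c0 (ltW cp)).
rewrite addeC; congr (_ + _)%E.
have := shift (2 * pi) 0 c; rewrite add0r (addrC c) => <-.
by apply: eq_integral => x _.
Qed.

End translation_periodic.

Lemma measurable_pint d (T : measurableType d) (R : realType) (D : set (measurableTypeR R))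
    (f : T -> R -> \bar R) : measurable D ->
  measurable_fun setT (fun p : T * measurableTypeR R => f p.1 p.2) ->
  (forall x y, 0 <= f x y)%E ->
  measurable_fun setT (fun x => \int[@lebesgue_measure R]_(y in D) f x y)%E.
Proof.
move=> mD mf f0.
rewrite (_ : (fun x => _) = fubini_F (@lebesgue_measure R)
  ((fun p : T * measurableTypeR R => f p.1 p.2) \_ (setT `*` D))).
  apply: measurable_fun_fubini_tonelli_F.
  - apply/(measurable_restrict _ _ _).1 => //; first exact: measurableX.
    by rewrite setTI; exact: measurable_funTS.
  - by move=> x; apply: erestrict_ge0 => y _; exact: f0.
apply/funext => x; rewrite /fubini_F [LHS]integral_mkcond; apply: eq_integral => y _.
by rewrite /patch in_setX in_setT.
Qed.

Section rotation.
Variable R : realType.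
Local Notation leb1 := (@lebesgue_measure R).
Implicit Types f : R -> R -> \bar R.

Definition iint2 f : \bar R := (\int[leb1]_x \int[leb1]_y f x y)%E.

Definition nnmeas2 f := measurable_fun setT (fun p : plane R => f p.1 p.2) /\
  (forall x y, 0 <= f x y)%E.

Lemma iint2_swap f : nnmeas2 f -> (iint2 f = \int[leb1]_y \int[leb1]_x f x y)%E.
Proof.
by move=> [mf f0]; apply: (@fubini_tonelli _ _ _ _ _ leb1 leb1 (fun p => f p.1 p.2)).
Qed.

Lemma nnmeas2_comp f (g h : R -> R -> R) : nnmeas2 f ->
  measurable_fun setT (fun p : plane R => g p.1 p.2 : measurableTypeR R) ->
  measurable_fun setT (fun p : plane R => h p.1 p.2 : measurableTypeR R) ->
  nnmeas2 (fun x y => f (g x y) (h x y)).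
Proof.
move=> [mf f0] mg mh; split => // .
exact: (measurableT_comp mf (measurable_fun_pair mg mh)).
Qed.

Lemma measurable_lin2 (D : set (plane R)) (a b : R) :
  measurable_fun D (fun p : plane R => a * p.1 + b * p.2 : measurableTypeR R).
Proof.
apply: measurable_funTS; apply: measurable_funD; exact: measurable_funM.
Qed.

Lemma nnmeas2_lin f a b c d : nnmeas2 f ->
  nnmeas2 (fun x y => f (a * x + b * y) (c * x + d * y)).
Proof. by move=> h; apply: nnmeas2_comp => //; exact: measurable_lin2. Qed.

Lemma nnmeas2_slice2 f x : nnmeas2 f -> measurable_fun setT (f x : measurableTypeR R -> _).
Proof.
move=> [mf _].
have := measurableT_comp mf (measurable_fun_pair (@measurable_cst _ _ (measurableTypeR R)
  (measurableTypeR R) setT x) (@measurable_id _ (measurableTypeR R) setT)).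
exact.
Qed.

Lemma nnmeas2_slice1 f y : nnmeas2 f ->
  measurable_fun setT ((fun x => f x y) : measurableTypeR R -> _).
Proof.
move=> [mf _].
have := measurableT_comp mf (measurable_fun_pair (@measurable_id _ (measurableTypeR R) setT)
  (@measurable_cst _ _ (measurableTypeR R) (measurableTypeR R) setT y)).
exact.
Qed.

Lemma iint2_shear_y f a : nnmeas2 f -> iint2 (fun x y => f x (a * x + y)) = iint2 f.
Proof.
move=> h; apply: eq_integral => x _.
rewrite -(@ge0_integral_shift _ (f x) (a * x)); last exact: (h.2 x).
  by apply: eq_integral => y _; rewrite addrC.
exact: nnmeas2_slice2.
Qed.

Lemma iint2_shear_x f a : nnmeas2 f -> iint2 (fun x y => f (x + a * y) y) = iint2 f.
Proof.
move=> h; have h' : nnmeas2 (fun x y => f (x + a * y) y).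
  by have := nnmeas2_lin 1 a 0 1 h; congr nnmeas2; apply/funext => x; apply/funext => y;
     rewrite !mul1r mul0r add0r.
rewrite (iint2_swap h') (iint2_swap h); apply: eq_integral => y _.
rewrite -(@ge0_integral_shift _ (fun x => f x y) (a * y))//; last exact: (h.2 ^~ y).
exact: nnmeas2_slice1.
Qed.

(** A rotation is a product of three shears, and a shear preserves iterated integrals by
    one-dimensional translation invariance and Tonelli; no change of variables in the plane is
    involved. *)
Lemma iint2_rot f c s : nnmeas2 f -> c ^+ 2 + s ^+ 2 = 1 ->
  iint2 (fun x y => f (c * x - s * y) (s * x + c * y)) = iint2 f.
Proof.
move=> h; have key c' s' g : nnmeas2 g -> c' ^+ 2 + s' ^+ 2 = 1 -> s' != 0 ->
    iint2 (fun x y => g (c' * x - s' * y) (s' * x + c' * y)) = iint2 g.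
  move=> mg cs s0.
  (* [t] is the tangent of half the angle, the parameter of the two outer shears; it requires a
     nonzero sine. *)
  have [t [ts tc]] : exists t, t * s' = 1 - c' /\ t * (1 + c') = s'.
    exists ((1 - c') / s'); rewrite divfK//; split=> //.
    apply: (mulIf s0); rewrite mulrAC divfK//.
    rewrite (_ : (1 - c') * (1 + c') = 1 - c' ^+ 2); last by ring.
    by rewrite -cs; ring.
  pose g1 x y := g (x + - t * y) y; pose g2 x y := g1 x (s' * x + y).
  have mg1 : nnmeas2 g1.
    by have := nnmeas2_lin 1 (- t) 0 1 mg; congr nnmeas2; apply/funext => x; apply/funext => y;
      rewrite /g1 !mul1r mul0r add0r.
  have mg2 : nnmeas2 g2.
    by have := nnmeas2_lin 1 0 s' 1 mg1; congr nnmeas2; apply/funext => x; apply/funext => y;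
      rewrite /g2 !mul1r mul0r addr0.
  rewrite -[RHS](iint2_shear_x (- t) mg) -[RHS](iint2_shear_y s' mg1) -[RHS](iint2_shear_x (- t) mg2).
  congr iint2; apply/funext => x; apply/funext => y; rewrite /g2 /g1.
  have -> : s' * (x + - t * y) + y = s' * x + c' * y.
    rewrite (_ : _ + y = s' * x + (1 - t * s') * y); last by ring.
    by rewrite ts; ring.
  congr (g _ _).
  rewrite (_ : x + - t * y + _ = (1 - t * s') * x - (t * (1 + c')) * y); last by ring.
  by rewrite ts tc; ring.
move=> cs; have [s0|s0] := eqVneq s 0; last exact: key.
move: cs; rewrite s0 expr0n addr0 => /eqP; rewrite sqrf_eq1 => /orP[/eqP ->|/eqP ->].
  by congr iint2; apply/funext => x; apply/funext => y; rewrite mul0r subr0 mul0r add0r !mul1r.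
(* The half-turn, which has sine 0, is a quarter-turn applied twice. *)
have e1 : 0 ^+ 2 + 1 ^+ 2 = 1 :> R by rewrite expr0n expr1n add0r.
have h2 : nnmeas2 (fun x y => f (0 * x - 1 * y) (1 * x + 0 * y)).
  have := nnmeas2_lin 0 (- 1) 1 0 h; congr nnmeas2; apply/funext => x; apply/funext => y.
  by congr (f _ _); ring.
have E1 := key 0 1 _ h e1 (oner_neq0 R); have E2 := key 0 1 _ h2 e1 (oner_neq0 R).
rewrite -E1 -E2; congr iint2; apply/funext => x; apply/funext => y.
by congr (f _ _); ring.
Qed.

End rotation.
Section sine_substitution.
Variable R : realType.
Local Notation leb1 := (@lebesgue_measure R).

Lemma integral_sin_subst (G : R -> R) (r : R) : 0 <= r <= 1 ->
  {within `[- r, r], continuous G} ->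
  (\int[leb1]_(x in `[(- r)%R, r]) (G x)%:E =
   \int[leb1]_(x in `[(- asin r)%R, asin r]) (G (sin x) * cos x)%:E)%E.
Proof.
move=> /andP[r0 r1] cG; have rI : -1 <= r <= 1 by rewrite r1 andbT; lra.
have sa : sin (asin r) = r by apply: asinK; rewrite in_itv.
have sNa : sin (- asin r) = - r by rewrite sinN sa.
have a0 : 0 <= asin r.
  rewrite leNgt; apply/negP => h; have : sin (asin r) < sin 0; last by rewrite sa sin0; lra.
  rewrite ltr_sin// in_itv /= ?asin_geNpi2//=; last by have := @pi_gt0 R; lra.
  by have := @pi_gt0 R; lra.
have ds : derive1 (@sin R) = @cos R.
  by apply/funext => x; rewrite derive1E; apply: derive_val.
have := @integration_by_substitution_increasing R sin G (- asin r) (asin r).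
rewrite sa sNa ds => -> //.
- lra.
- move=> x y; rewrite !in_itv /= => /andP[x1 x2] /andP[y1 y2]; rewrite ltr_sin// in_itv /=.
    by have := asin_lepi2 rI; lra.
  by have := asin_lepi2 rI; lra.
- by move=> x _; exact: continuous_cos.
- by apply/cvg_ex; exists (cos (- asin r)); apply: cvg_at_right_filter; exact: continuous_cos.
- by apply/cvg_ex; exists (cos (asin r)); apply: cvg_at_left_filter; exact: continuous_cos.
- split => //.
  + by apply: cvg_at_right_filter; exact: continuous_sin.
  + by apply: cvg_at_left_filter; exact: continuous_sin.
Qed.

Lemma sin_lt_asin (r x : R) : 0 <= r <= 1 -> - (pi / 2) < x < pi / 2 ->
  (- r < sin x < r) = (- asin r < x < asin r).
Proof.
move=> /andP[r0 r1] /andP[x1 x2]; have rI : -1 <= r <= 1 by rewrite r1 andbT; lra.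
have sa : sin (asin r) = r by apply: asinK; rewrite in_itv.
have h1 := asin_lepi2 rI; have h2 := asin_geNpi2 rI.
rewrite -{2}sa -{1}sa -sinN !ltr_sin// in_itv /=; lra.
Qed.

Lemma integral_sin_subst_oo (G : R -> R) (r : R) : 0 <= r <= 1 ->
  {within `[- r, r], continuous G} ->
  (\int[leb1]_(x in `](- (pi / 2))%R, (pi / 2)%R[)
     ((cos x)%:E * ((EFin \o G) \_ `](- r)%R, r[) (sin x)) =
   \int[leb1]_x ((EFin \o G) \_ `](- r)%R, r[) x)%E.
Proof.
move=> r01 cG; rewrite -[RHS]integral_mkcond.
have mG : measurable_fun (`]- r, r[ : set (measurableTypeR R)) (EFin \o G).
  apply/measurable_EFinP; apply: (@measurable_funS _ _ _ _ `[- r, r]) => //.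
    exact: subset_itv_oo_cc.
  exact: subspace_continuous_measurable_fun.
have sub x : `]- asin r, asin r[%classic x -> - (pi / 2) < x < pi / 2.
  move=> /=; rewrite in_itv /=; case/andP: r01 => r0 r1.
  have rI : -1 <= r <= 1 by rewrite r1 andbT; lra.
  have h1 := asin_lepi2 rI; have h2 := asin_geNpi2 rI.
  by move=> /andP[x1 x2]; apply/andP; split; lra.
have mGs : measurable_fun (`]- asin r, asin r[ : set (measurableTypeR R))
    (fun x => (G (sin x) * cos x)%:E).
  apply/measurable_EFinP; apply: measurable_funM; last first.
    by apply: measurable_funTS; apply: continuous_measurable_fun; exact: continuous_cos.
  apply: (@measurable_comp _ _ _ _ _ _ (`]- r, r[ : set (measurableTypeR R)) G) => //.
  - by move=> _ [x xa <-] /=; rewrite in_itv /= sin_lt_asin// sub.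
  - exact/measurable_EFinP.
  - by apply: measurable_funTS; apply: continuous_measurable_fun; exact: continuous_sin.
rewrite [LHS]integral_mkcond.
transitivity (\int[leb1]_(x in `](- asin r)%R, asin r[) (G (sin x) * cos x)%:E)%E.
  rewrite [RHS]integral_mkcond; apply: eq_integral => x _; rewrite /patch !mem_setE.
  case: ifPn => xp.
    rewrite (_ : (sin x \in `]- r, r[) = (x \in `]- asin r, asin r[)).
      by case: ifP => _; rewrite ?mule0// -EFinM mulrC.
    by rewrite !in_itv /= sin_lt_asin//; move: xp; rewrite in_itv.
  case: ifPn => // xa; exfalso; move: xp xa; rewrite !in_itv /= => /negP xp /andP[x1 x2].
  by apply: xp; apply: sub; rewrite /= in_itv /= x1.
rewrite -(@integral_itv_bndoo _ (- asin r) (asin r) _ true false mGs) -integral_sin_subst//.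
by rewrite (@integral_itv_bndoo _ (- r) r _ true false mG).
Qed.

End sine_substitution.
Section tonelli_swap.
Variable R : realType.
Local Notation leb1 := (@lebesgue_measure R).

Lemma tonelli_swap (D1 D2 : set (measurableTypeR R)) (f : R -> R -> \bar R) :
  measurable D1 -> measurable D2 ->
  measurable_fun (D1 `*` D2 : set (plane R)) (fun p => f p.1 p.2) ->
  (forall x y, D1 x -> D2 y -> 0 <= f x y)%E ->
  (\int[leb1]_(x in D1) \int[leb1]_(y in D2) f x y =
   \int[leb1]_(y in D2) \int[leb1]_(x in D1) f x y)%E.
Proof.
move=> mD1 mD2 mf f0; have mDD : measurable (D1 `*` D2 : set (plane R)) by exact: measurableX.
pose g : plane R -> \bar R := (fun p => f p.1 p.2) \_ (D1 `*` D2).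
have gE x y : g (x, y) = if (x \in D1) && (y \in D2) then f x y else 0%E.
  by rewrite /g /patch in_setX.
transitivity (\int[leb1]_x \int[leb1]_y g (x, y))%E.
  rewrite integral_mkcond; apply: eq_integral => x _; rewrite {1}/patch.
  case: ifPn => xD1; last by rewrite integral0_eq// => y _; rewrite gE (negbTE xD1).
  by rewrite integral_mkcond; apply: eq_integral => y _; rewrite gE xD1.
rewrite fubini_tonelli; last 2 first.
- by apply/(measurable_restrict _ _ _).1 => //; rewrite setTI.
- by move=> p; apply: erestrict_ge0 => -[x y] [/= x1 y1]; exact: f0.
rewrite [RHS]integral_mkcond; apply: eq_integral => y _; rewrite [RHS]/patch.
case: ifPn => yD2; last by rewrite integral0_eq// => x _; rewrite gE (negbTE yD2) andbF.
by rewrite [RHS]integral_mkcond; apply: eq_integral => x _; rewrite gE yD2 andbT.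
Qed.

End tonelli_swap.

Lemma within_continuous_comp (T U V : topologicalType) (A : set T) (B : set U)
    (f : U -> V) (L : T -> U) :
  continuous L -> (forall x, A x -> B (L x)) -> {within B, continuous f} ->
  {within A, continuous (fun x => f (L x))}.
Proof.
move=> cL AB /subspace_continuousP cf; apply/subspace_continuousP => x Ax.
apply: (cvg_comp L f); last exact: cf (AB _ Ax).
move=> S; rewrite /within /= => nS; have := cL x _ nS.
move=> H; change (nbhs x (fun y => A y -> S (L y))); move: H.
by apply: (@filterS _ (nbhs x)) => y h /AB; exact: h.
Qed.

Lemma measurable_fun_within3 (R : realType) (D : set (R * R * R)) (f : R * R * R -> R) :
  open D -> {within D, continuous f} -> measurable_fun (D : set (bundle R)) f.
Proof.
move=> oD cf; apply: (measurability _ (RGenOpens.measurableE R)) => _ [_ [a [b ->] <-]].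
have /open_subspaceP [V oV VE] : open (f @^-1` `]a, b[ : set (subspace D)).
  by move/continuousP : cf; apply; exact: interval_open.
rewrite (_ : _ `&` _ = V `&` D) ?[D `&` _]setIC//.
by apply: open_measurable3; exact: openI.
Qed.

Lemma open_disk (R : realType) : open (@disk R).
Proof.
have c : continuous (fun x : R * R => x.1 * x.1 + x.2 * x.2).
  by move=> x; apply: cvgD; apply: cvgM; first [exact: cvg_fst|exact: cvg_snd].
have := (continuousP _).1 c `]-oo, 1[%classic (@interval_open _ -oo%O (BLeft 1) isT isT).
by congr open; apply/seteqP; split => x /=; rewrite in_itv /= /disk /= !expr2.
Qed.

Lemma open_diskT (R : realType) : open (@disk R `*` [set: R]).
Proof.
have c : continuous (@fst (R * R) R) by move=> x; exact: cvg_fst.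
have := (continuousP _).1 c _ (@open_disk R).
by congr open; apply/seteqP; split => [x|x []].
 Qed.
Lemma continuous_pair (T U V : topologicalType) (f : T -> U) (g : T -> V) :
  continuous f -> continuous g -> continuous (fun x => (f x, g x)).
Proof. by move=> cf cg x;
  exact: (@cvg_pair _ _ _ (nbhs x) (nbhs (f x)) (nbhs (g x)) _ _ _ f g (cf x) (cg x)). Qed.

(** * Fan-beam and parallel-beam coordinates, Santalo's formula *)

Section santalo.
Variable R : realType.
Local Notation leb1 := (@lebesgue_measure R).
Local Notation leb2 := (leb1 \x leb1)%E.
Local Notation leb3 := (leb2 \x leb1)%E.

Definition chord (b a t : R) : R * R * R :=
  ((cos b + t * cos (b + pi + a), sin b + t * sin (b + pi + a)), b + pi + a).

Definition turn (th x y : R) : R * R * R :=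
  ((cos th * x - sin th * y, sin th * x + cos th * y), th).

(** Passage from fan-beam to parallel-beam coordinates: measured from its midpoint, reached at time
    cos a, the chord is the line of direction b + pi + a at signed distance sin a from the
    centre. *)
Lemma chordE b a t : chord b a (t + cos a) = turn (b + pi + a) t (sin a).
Proof.
have e : b + pi = (b + pi + a) - a by ring.
have hc : cos b = - (cos (b + pi + a) * cos a + sin (b + pi + a) * sin a).
  by rewrite -cosB -e cosDpi opprK.
have hs : sin b = - (sin (b + pi + a) * cos a - cos (b + pi + a) * sin a).
  by rewrite -sinB -e sinDpi opprK.
by rewrite /chord /turn; congr ((_, _), _); [rewrite hc|rewrite hs]; ring.
Qed.

Lemma measurable_cos : measurable_fun setT (@cos R : measurableTypeR R -> measurableTypeR R).
Proof. by apply: continuous_measurable_fun; exact: continuous_cos. Qed.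

Lemma measurable_sin : measurable_fun setT (@sin R : measurableTypeR R -> measurableTypeR R).
Proof. by apply: continuous_measurable_fun; exact: continuous_sin. Qed.

Lemma measurable_chord :
  measurable_fun setT (fun p : bundle R => chord p.1.1 p.1.2 p.2 : bundle R).
Proof.
have m11 : measurable_fun setT (fun p : bundle R => p.1.1).
  exact: (measurableT_comp (@measurable_fst _ _ (measurableTypeR R) (measurableTypeR R))
    (@measurable_fst _ _ (plane R) (measurableTypeR R))).
have m12 : measurable_fun setT (fun p : bundle R => p.1.2).
  exact: (measurableT_comp (@measurable_snd _ _ (measurableTypeR R) (measurableTypeR R))
    (@measurable_fst _ _ (plane R) (measurableTypeR R))).
have mth : measurable_fun setT (fun p : bundle R => p.1.1 + pi + p.1.2 : measurableTypeR R).
  by apply: measurable_funD => //; apply: measurable_funD.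
have m2 := @measurable_snd _ _ (plane R) (measurableTypeR R).
apply: measurable_fun_pair => //; apply: measurable_fun_pair.
- apply: measurable_funD; first exact: (measurableT_comp measurable_cos m11).
  by apply: measurable_funM => //; exact: (measurableT_comp measurable_cos mth).
- apply: measurable_funD; first exact: (measurableT_comp measurable_sin m11).
  by apply: measurable_funM => //; exact: (measurableT_comp measurable_sin mth).
Qed.

Lemma measurable_turn d (T : measurableType d) (f g h : T -> measurableTypeR R) :
  measurable_fun setT f -> measurable_fun setT g -> measurable_fun setT h ->
  measurable_fun setT (fun p => turn (f p) (g p) (h p) : bundle R).
Proof.
move=> mf mg mh; apply: measurable_fun_pair => //.
have mc := measurableT_comp measurable_cos mf; have ms := measurableT_comp measurable_sin mf.
apply: measurable_fun_pair.
- by apply: measurable_funB; apply: measurable_funM.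
- by apply: measurable_funD; apply: measurable_funM.
Qed.

Lemma continuous_chord b a : continuous (chord b a).
Proof.
have c (x y : R) : continuous (fun t : R => x + t * y).
  by move=> t; apply: cvgD; [exact: cvg_cst|apply: cvgM; [exact: cvg_id|exact: cvg_cst]].
apply: continuous_pair; last by move=> t; exact: cvg_cst.
by apply: continuous_pair; exact: c.
Qed.

Lemma continuous_turn th x : continuous (turn th x).
Proof.
have c (u v : R) : continuous (fun t : R => u + v * t).
  by move=> t; apply: cvgD; [exact: cvg_cst|apply: cvgM; [exact: cvg_cst|exact: cvg_id]].
apply: continuous_pair; last by move=> t; exact: cvg_cst.
apply: continuous_pair; last exact: c.
by under eq_fun do rewrite -mulNr; exact: c.
Qed.

Lemma turn_norm th x y : (turn th x y).1.1 ^+ 2 + (turn th x y).1.2 ^+ 2 = x ^+ 2 + y ^+ 2.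
Proof.
have cs := cos2Dsin2 th; rewrite /turn /=.
transitivity ((cos th ^+ 2 + sin th ^+ 2) * (x ^+ 2 + y ^+ 2)); first by ring.
by rewrite cs mul1r.
Qed.

Lemma chord_norm b a t : (chord b a t).1.1 ^+ 2 + (chord b a t).1.2 ^+ 2 =
  1 - t * (2 * cos a - t).
Proof.
rewrite -(subrK (cos a) t) chordE turn_norm; have := cos2Dsin2 a; move: (t - cos a) => s h.
have -> : sin a ^+ 2 = 1 - cos a ^+ 2 by rewrite -h; ring.
ring.
Qed.

Lemma chord_closed_disk b a t : 0 <= t <= 2 * cos a -> closed_disk (chord b a t).1.
Proof.
by move=> /andP[t0 t1]; rewrite /closed_disk /= chord_norm lerBlDr lerDl mulr_ge0 ?subr_ge0.
Qed.

Lemma chord_disk b a t : 0 < cos a -> disk (chord b a t).1 <-> 0 < t < 2 * cos a.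
Proof.
move=> c0; rewrite /disk /= chord_norm; split => [h|/andP[t0 t1]]; last first.
  by rewrite ltrBlDr ltrDl mulr_gt0// subr_gt0.
have {h} h : 0 < t * (2 * cos a - t) by lra.
have [t0|t0] := ltP 0 t; first by move: h; rewrite pmulr_rgt0// subr_gt0.
by move: h; rewrite ltNge => /negP[]; rewrite mulr_le0_ge0//; lra.
Qed.

End santalo.
Section santalo_formula.
Variable R : realType.
Local Notation leb1 := (@lebesgue_measure R).
Local Notation leb2 := (leb1 \x leb1)%E.
Local Notation leb3 := (leb2 \x leb1)%E.
Variable v : R * R * R -> R[i].
Hypothesis cv : continuousSM v.

(** Extension by zero outside the disk turns integrals over chords into integrals over whole lines,
    to which translations and rotations apply. *)
Definition densq : R * R * R -> \bar R := (fun p => (nsq (v p))%:E) \_ (@disk R `*` setT).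

Lemma densq_ge0 p : (0 <= densq p)%E.
Proof. by apply: erestrict_ge0 => q _; rewrite lee_fin nsq_ge0. Qed.

Lemma within_nsq : {within @closed_disk R `*` setT, continuous (fun p => nsq (v p))}.
Proof.
case: cv => _ cR cI; rewrite /nsq.
rewrite (_ : (fun p => _) = fun p => complex.Re (v p) * complex.Re (v p) + complex.Im (v p) *
  complex.Im (v p)).
  by move=> p; apply: cvgD; apply: cvgM; first [exact: cR|exact: cI].
by apply/funext => p; rewrite !expr2.
Qed.

Lemma disk_sub : @disk R `*` [set: R] `<=` @closed_disk R `*` setT.
Proof. by move=> p [/= /ltW h _]; split. Qed.

Lemma measurable_diskT : measurable (@disk R `*` [set: R] : set (bundle R)).
Proof. by apply: measurableX => //; exact: measurable_disk. Qed.

Lemma measurable_within_disk (f : R * R * R -> R) :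
  {within @closed_disk R `*` setT, continuous f} ->
  measurable_fun setT ((EFin \o f) \_ (@disk R `*` setT) : bundle R -> \bar R).
Proof.
move=> cf; apply/(measurable_restrict _ measurable_diskT measurableT); rewrite setTI;
  apply/measurable_EFinP; apply: measurable_fun_within3; first exact: open_diskT.
exact: (continuous_subspaceW disk_sub).
Qed.

Lemma measurable_densq : measurable_fun setT (densq : bundle R -> \bar R).
Proof. exact: measurable_within_disk within_nsq. Qed.

Lemma densq_periodic x t : densq (x, t + 2 * pi) = densq (x, t).
Proof. by rewrite /densq /patch !in_setX /= !in_setT; case: cv => ->. Qed.

(** For fixed x, the disk cuts out |y| < r with r^2 = 1 - x^2, and the substitution y = sin a
    produces the weight cos a. If x^2 > 1, both sides vanish. *)
Lemma densq_turn_sin th x :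
  (\int[leb1]_(a in `](- (pi / 2))%R, (pi / 2)%R[) ((cos a)%:E * densq (turn th x (sin a))) =
   \int[leb1]_y densq (turn th x y))%E.
Proof.
have dE y : (turn th x y \in @disk R `*` setT) = (x ^+ 2 + y ^+ 2 < 1).
  by rewrite in_setX in_setT andbT; apply/idP/idP; rewrite inE /disk /= turn_norm.
have [x1|x1] := ltP 1 (x ^+ 2).
  have z y : densq (turn th x y) = 0%E.
    rewrite /densq /patch dE; case: ifP => // h; exfalso; have := sqr_ge0 y; lra.
  by rewrite !integral0_eq// => y _; rewrite z ?mule0.
pose r := Num.sqrt (1 - x ^+ 2); pose G y := nsq (v (turn th x y)).
have r2 : r ^+ 2 = 1 - x ^+ 2 by rewrite sqr_sqrtr// subr_ge0.
have r0 : 0 <= r by exact: sqrtr_ge0.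
have r1 : r <= 1.
  by rewrite -(@ler_pXn2r _ 2%N)// ?nnegrE// r2 expr1n lerBlDr lerDl sqr_ge0.
have dG y : densq (turn th x y) = ((EFin \o G) \_ `](- r)%R, r[) y.
  rewrite /densq /patch dE mem_setE in_itv /= -ltr_norml.
  rewrite (_ : (x ^+ 2 + y ^+ 2 < 1) = (`|y| < r))//.
  by rewrite -[RHS](@ltr_pXn2r _ 2%N)// ?nnegrE// r2 ltrBrDl real_normK// num_real.
transitivity (\int[leb1]_y ((EFin \o G) \_ `](- r)%R, r[) y)%E; last by apply: eq_integral.
rewrite -integral_sin_subst_oo ?r0//; first by apply: eq_integral => a _; rewrite dG.
apply: (within_continuous_comp (@continuous_turn _ th x) _ within_nsq) => y.
rewrite /= in_itv /= -ler_norml => yr; split => //; rewrite /closed_disk /= turn_norm.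
rewrite -lerBrDl -r2 -(real_normK (num_real y)) ler_pXn2r// nnegrE//.
Qed.

Let mcirc : measurable (@circle R : set (measurableTypeR R)) := @measurable_circle R.

Let Ioo : set (measurableTypeR R) := `](- (pi / 2))%R, (pi / 2)%R[.

Lemma measurable_densq_turn d (T : measurableType d) (f g h : T -> measurableTypeR R) :
  measurable_fun setT f -> measurable_fun setT g -> measurable_fun setT h ->
  measurable_fun setT (fun p => densq (turn (f p) (g p) (h p))).
Proof.
by move=> mf mg mh; exact: (measurableT_comp measurable_densq (measurable_turn mf mg mh)).
Qed.

Lemma integral_chord b a :
  (\int[leb1]_t densq (chord b a t) = \int[leb1]_x densq (turn (b + pi + a) x (sin a)))%E.
Proof.
rewrite -(@ge0_integral_shift _ (fun t => densq (chord b a t)) (cos a)).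
- by apply: eq_integral => t _; rewrite chordE.
- have m : measurable_fun setT (fun t : measurableTypeR R => ((b, a), t) : bundle R).
    exact: measurable_fun_pair.
  exact: (measurableT_comp measurable_densq (measurableT_comp (@measurable_chord R) m)).
- by move=> t; exact: densq_ge0.
Qed.

Definition chordsq b a : \bar R := (\int[leb1]_t densq (chord b a t))%E.

Lemma measurable_chordsq : measurable_fun setT (fun p : plane R => chordsq p.1 p.2).
Proof.
apply: (@measurable_pint _ (plane R) R setT (fun p t => densq (chord p.1 p.2 t))) => //.
- exact: (measurableT_comp measurable_densq (@measurable_chord R)).
- by move=> *; exact: densq_ge0.
Qed.

Let mI : measurable Ioo. Proof. exact: measurable_itv. Qed.

Let cos0 a : Ioo a -> 0 <= cos a.
Proof. by rewrite /Ioo /= in_itv /= => /cos_gt0_pihalf /ltW. Qed.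

Let K th a := (\int[leb1]_x densq (turn th x (sin a)))%E.

Let K0 th a : (0 <= K th a)%E.
Proof. by apply: integral_ge0 => x _; exact: densq_ge0. Qed.

Let m11 : measurable_fun setT (fun p : bundle R => p.1.1).
Proof. exact: (measurableT_comp (@measurable_fst _ _ (measurableTypeR R) (measurableTypeR R))
  (@measurable_fst _ _ (plane R) (measurableTypeR R))). Qed.

Let m12 : measurable_fun setT (fun p : bundle R => p.1.2).
Proof. exact: (measurableT_comp (@measurable_snd _ _ (measurableTypeR R) (measurableTypeR R))
  (@measurable_fst _ _ (plane R) (measurableTypeR R))). Qed.

Let mK : measurable_fun setT (fun p : plane R => K p.1 p.2).
Proof.
apply: (@measurable_pint _ (plane R) R setT (fun p x => densq (turn p.1 x (sin p.2)))) => //.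
  apply: measurable_densq_turn => //.
  exact: (measurableT_comp (@measurable_sin R) m12).
by move=> *; exact: densq_ge0.
Qed.

Let mcos (D : set (plane R)) : measurable_fun D (fun p : plane R => (cos p.2)%:E).
Proof.
apply: measurable_funTS; apply/measurable_EFinP.
exact: (measurableT_comp (@measurable_cos R)).
Qed.

Let mcos1 (D : set (plane R)) : measurable_fun D (fun p : plane R => (cos p.1)%:E).
Proof.
apply: measurable_funTS; apply/measurable_EFinP.
exact: (measurableT_comp (@measurable_cos R)).
Qed.

Let mcs (f : R -> R -> \bar R) : measurable_fun setT (fun p : plane R => f p.1 p.2) ->
  measurable_fun (@circle R `*` Ioo : set (plane R)) (fun p => (cos p.2)%:E * f p.1 p.2)%E.
Proof. by move=> mf; apply: emeasurable_funM; [exact: mcos|exact: measurable_funTS]. Qed.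

Let slice1 (f : R -> R -> \bar R) a : measurable_fun setT (fun p : plane R => f p.1 p.2) ->
  measurable_fun setT (fun x : measurableTypeR R => f x a).
Proof.
move=> mf; exact: (measurableT_comp mf (measurable_fun_pair (@measurable_id _ (measurableTypeR R)
  setT) (@measurable_cst _ _ (measurableTypeR R) (measurableTypeR R) setT a))).
Qed.

Let cswap (f : R -> R -> \bar R) : measurable_fun setT (fun p : plane R => f p.1 p.2) ->
  (forall x y, 0 <= f x y)%E ->
  (\int[leb1]_(b in @circle R) \int[leb1]_(a in Ioo) ((cos a)%:E * f b a) =
   \int[leb1]_(a in Ioo) ((cos a)%:E * \int[leb1]_(b in @circle R) f b a))%E.
Proof.
move=> mf f0; rewrite (@tonelli_swap R (@circle R) Ioo (fun b a => (cos a)%:E * f b a)%E mcirc mI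
  (mcs mf)).
  apply: eq_integral => a; rewrite inE => /cos0 a0.
  rewrite ge0_integralZl//; apply: measurable_funTS; exact: (@slice1 f a mf).
by move=> x a _ /cos0 a0; apply: mule_ge0; rewrite ?lee_fin.
Qed.

(** At fixed [a], the direction b + pi + a is a translate of [b] on the circle, and the integral
    along the chord depends on this direction and on sin a alone. *)
Lemma santalo_polar :
  (\int[leb1]_(b in @circle R) \int[leb1]_(a in Ioo) ((cos a)%:E * chordsq b a) =
   \int[leb1]_(th in @circle R) \int[leb1]_(a in Ioo) ((cos a)%:E * K th a))%E.
Proof.
have c0 b a : (0 <= chordsq b a)%E by apply: integral_ge0 => t _; exact: densq_ge0.
rewrite (cswap measurable_chordsq c0) (cswap mK K0).
apply: eq_integral => a _; congr (_ * _)%E.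
rewrite -(@ge0_integral_circle_shift _ (fun th => K th a) (pi + a)).
- by apply: eq_integral => b _; rewrite (addrA b pi a); exact: integral_chord.
- exact: (@slice1 K a mK).
- by move=> th; exact: K0.
- move=> th; apply: eq_integral => x _; rewrite /turn densq_periodic.
  by rewrite (_ : th + 2 * pi = th + pi *+ 2) ?cosD2pi ?sinD2pi// mulr_natl.
Qed.

(** At fixed direction, first substitute y = sin a, which absorbs cos a, then rotate the plane by
    [th]. *)
Lemma integral_turn th :
  (\int[leb1]_(a in Ioo) ((cos a)%:E * K th a) = iint2 (fun x y => densq ((x, y), th)))%E.
Proof.
have mH (f : measurableTypeR R -> measurableTypeR R) : measurable_fun setT f ->
    measurable_fun setT (fun p : plane R => densq (turn th p.2 (f p.1))).
  by move=> mf; apply: measurable_densq_turn => //; apply: (measurableT_comp mf).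
transitivity (\int[leb1]_(a in Ioo) \int[leb1]_x ((cos a)%:E * densq (turn th x (sin a))))%E.
  apply: eq_integral => a; rewrite inE => /cos0 a0; rewrite ge0_integralZl//.
  - by apply: measurable_densq_turn.
  - by move=> *; exact: densq_ge0.
rewrite (@tonelli_swap R Ioo setT (fun a x => (cos a)%:E * densq (turn th x (sin a)))%E mI
  measurableT); first last.
- by move=> a x /cos0 a0 _; rewrite mule_ge0 ?lee_fin ?densq_ge0.
- by apply: emeasurable_funM; [exact: mcos1|apply: measurable_funTS; exact: (mH _ (@measurable_sin R))].
transitivity (iint2 (fun x y => densq (turn th x y))).
  by apply: eq_integral => x _; exact: densq_turn_sin.
apply: (@iint2_rot _ (fun x y => densq ((x, y), th))); last exact: cos2Dsin2.
split; last by move=> *; exact: densq_ge0.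
have m : measurable_fun setT (fun p : plane R => (p, th) : bundle R) by exact: measurable_fun_pair.
by have := measurableT_comp measurable_densq m; congr measurable_fun; apply/funext => -[].
Qed.

Lemma santalo_iint :
  (\int[leb1]_(b in @circle R) \int[leb1]_(a in Ioo) ((cos a)%:E * chordsq b a) =
   \int[leb1]_(th in @circle R) iint2 (fun x y => densq ((x, y), th)))%E.
Proof. by rewrite santalo_polar; apply: eq_integral => th _; exact: integral_turn. Qed.

End santalo_formula.

(** * Boundedness of the X-ray transform on continuous functions *)

Section xray_bound.
Variable R : realType.
Local Notation leb1 := (@lebesgue_measure R).
Local Notation leb2 := (leb1 \x leb1)%E.
Local Notation leb3 := (leb2 \x leb1)%E.
Variable v : R * R * R -> R[i].
Hypothesis cv : continuousSM v.

Lemma cmeas_disk : cmeas (@disk R `*` setT : set (bundle R)) v.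
Proof.
by case: cv => _ cR cI; split; apply: measurable_fun_within3; try exact: open_diskT;
  exact: (continuous_subspaceW (@disk_sub R)).
Qed.

Lemma cmeas_SM_cont : cmeas (@SM R : set (bundle R)) v.
Proof.
have sub : @SM R `<=` @disk R `*` setT by move=> p [].
by case: cmeas_disk => mR mI; split; [apply: measurable_funS mR|apply: measurable_funS mI];
  try exact: measurable_diskT.
Qed.

Lemma santalo :
  (\int[leb1]_(th in @circle R) iint2 (fun x y => densq v ((x, y), th)) =
   sqnorm2 leb3 (@SM R) v)%E.
Proof.
have m0 := measurable_densq cv; have d0 := @densq_ge0 R v.
have mc := @measurable_circle R.
have mp d (T : measurableType d) (f g h : T -> measurableTypeR R) :
  measurable_fun setT f -> measurable_fun setT g -> measurable_fun setT h ->
  measurable_fun setT (fun p => densq v ((f p, g p), h p)).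
  move=> mf mg mh; apply: (measurableT_comp m0).
  by apply: measurable_fun_pair => //; exact: measurable_fun_pair.
have m11 := measurableT_comp (@measurable_fst _ _ (measurableTypeR R) (measurableTypeR R))
  (@measurable_fst _ _ (plane R) (measurableTypeR R)).
have m12 := measurableT_comp (@measurable_snd _ _ (measurableTypeR R) (measurableTypeR R))
  (@measurable_fst _ _ (plane R) (measurableTypeR R)).
have m1 := @measurable_fst _ _ (measurableTypeR R) (measurableTypeR R).
have m2 := @measurable_snd _ _ (measurableTypeR R) (measurableTypeR R).
have m3 := @measurable_snd _ _ (plane R) (measurableTypeR R).
rewrite /iint2 (@tonelli_swap R (@circle R) setT (fun th x => \int[leb1]_y densq v ((x, y), th))%E
  mc measurableT); first last.
- by move=> th x _ _; apply: integral_ge0 => y _; exact: d0.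
- apply: measurable_funTS.
  apply: (@measurable_pint _ (plane R) R setT (fun p y => densq v ((p.2, y), p.1))) => //.
  exact: (mp _ _ _ _ _ m12 m3 m11).
transitivity (\int[leb1]_x \int[leb1]_y \int[leb1]_(th in @circle R) densq v ((x, y), th))%E.
  apply: eq_integral => x _.
  rewrite (@tonelli_swap R (@circle R) setT (fun th y => densq v ((x, y), th))%E mc measurableT) => //.
  apply: measurable_funTS; exact: (mp _ _ _ _ _ (@measurable_cst _ _ _ _ _ x) m2 m1).
have md := @measurable_disk R.
transitivity (\int[leb2]_p \int[leb1]_(th in @circle R) densq v (p, th))%E.
  symmetry; apply: (@fubini_tonelli1 _ _ _ _ R leb1 leb1 (fun p => \int[leb1]_(th in @circle R)
    densq v (p, th))%E).
    apply: (@measurable_pint _ (plane R) R (@circle R) (fun p th => densq v (p, th))) => //.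
    by have := m0; congr measurable_fun; apply/funext => -[].
  by move=> p; apply: integral_ge0 => th _; exact: d0.
rewrite /sqnorm2 tonelli_SM; last 2 first.
- apply/measurable_EFinP.
  exact: (measurable_nsq cmeas_SM_cont).
- by move=> p; rewrite lee_fin addr_ge0// sqr_ge0.
rewrite [RHS]integral_mkcond; apply: eq_integral => p _; rewrite /patch.
case: ifPn => pd.
  by apply: eq_integral => th _; rewrite /densq /patch in_setX in_setT andbT /= pd.
by rewrite integral0_eq// => th _; rewrite /densq /patch in_setX in_setT andbT /= (negbTE pd).
Qed.

Lemma compact_closed_disk : compact (@closed_disk R).
Proof.
have c : continuous (fun x : R * R => x.1 * x.1 + x.2 * x.2).
  by move=> x; apply: cvgD; apply: cvgM; first [exact: cvg_fst|exact: cvg_snd].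
have cl : closed (@closed_disk R).
  have := (continuous_closedP _).1 c `]-oo, 1]%classic (@interval_closed _ -oo%O (BRight 1) isT isT).
  by congr closed; apply/seteqP; split => x /=; rewrite in_itv /= /closed_disk /= !expr2.
apply: (@subclosed_compact _ _ (`[(-1 : R), 1] `*` `[(-1 : R), 1])) => //.
  by apply: compact_setX; exact: segment_compact.
move=> x; rewrite /closed_disk /= => h; split; rewrite /= in_itv /=;
  have := sqr_ge0 x.1; have := sqr_ge0 x.2 => h1 h2; rewrite -ler_norml -(@ler_pXn2r _ 2%N)// ?nnegrE//
    expr1n real_normK ?num_real//; lra.
Qed.

Lemma continuousSM_bounded : exists M, forall p, (@SM R) p -> nsq (v p) <= M.
Proof.
pose K := @closed_disk R `*` `[(0 : R), 2 * pi]%classic.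
have cK : compact K by apply: compact_setX; [exact: compact_closed_disk|exact: segment_compact].
have sub : K `<=` @closed_disk R `*` setT by move=> p [].
have cf : {within K, continuous (fun p => nsq (v p))} := continuous_subspaceW sub (within_nsq cv).
have [M [_ hM]] := compact_bounded (continuous_compact cf cK).
exists (`|M| + 1) => p [pd pc]; apply: le_trans (ler_norm _) _.
apply: (hM (`|M| + 1)); first by rewrite (le_lt_trans (ler_norm _))// ltrDl.
exists p => //; split; first exact: ltW.
by move: pc; rewrite /circle /= !in_itv /= => /andP[-> /ltW].
Qed.

Lemma L2_continuousSM : L2SM v.
Proof.
have [M hM] := continuousSM_bounded.
split; first by case: cv.
have mS : measurable (@SM R : set (bundle R)) := @measurable_SM R.
have one : L2 leb3 (@SM R) (fun=> 1).
  split; [exact: measurable_cst|exact: measurable_cst|].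
  rewrite /sqnorm2 /= expr1n expr0n addr0 integral_cst// mul1e.
  exact: leb_SM_fin.
apply: (@L2_le _ _ _ leb3 (@SM R) mS v (fun=> 1) `|M| _ cmeas_SM_cont one _).1 => // p Sp.
by rewrite /nsq /= expr1n expr0n addr0 mulr1 (le_trans (hM _ Sp))// ler_norm.
Qed.

End xray_bound.
Section xray_of_continuous.
Variable R : realType.
Local Notation leb1 := (@lebesgue_measure R).
Local Notation leb2 := (leb1 \x leb1)%E.
Local Notation leb3 := (leb2 \x leb1)%E.

Section chord_integrals.
Variable f : R * R * R -> R.
Hypothesis cf : {within @closed_disk R `*` setT, continuous f}.

Lemma within_chord b a : {within `[0, 2 * cos a], continuous (fun t => f (chord b a t))}.
Proof.
apply: (within_continuous_comp (@continuous_chord _ b a) _ cf) => t.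
by rewrite /= in_itv /= => h; split => //; exact: chord_closed_disk.
Qed.

Lemma integral_chord_disk b a : 0 < cos a ->
  (\int[leb1]_(t in `[0%R, (2 * cos a)%R]) (f (chord b a t))%:E =
   \int[leb1]_t ((EFin \o f) \_ (@disk R `*` setT)) (chord b a t))%E.
Proof.
move=> c0.
have mf : measurable_fun (`]0, 2 * cos a[ : set (measurableTypeR R))
    (fun t => (f (chord b a t))%:E).
  apply/measurable_EFinP; apply: (@measurable_funS _ _ _ _ `[0, 2 * cos a]) => //.
    exact: subset_itv_oo_cc.
  exact: (subspace_continuous_measurable_fun _ (@within_chord b a)).
rewrite (@integral_itv_bndoo _ _ _ _ true false mf) integral_mkcond.
apply: eq_integral => t _; rewrite /patch mem_setE in_itv /= in_setX in_setT andbT.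
by rewrite (_ : (_ \in _) = (0 < t < 2 * cos a))//; apply/idP/idP; rewrite inE => /(chord_disk _ _ c0).
Qed.

(** Extended by zero, the integrand lives on a fixed line, so measurability of parameter integrals
    applies. That result is for nonnegative functions, hence the positive and negative parts. *)
Lemma measurable_chord_integral :
  measurable_fun (@influx R : set (plane R))
    (fun p => \int[leb1]_(t in `[0, 2 * cos p.2]) f (chord p.1 p.2 t)).
Proof.
pose W : R * R * R -> \bar R := (EFin \o f) \_ (@disk R `*` setT).
have mW : measurable_fun setT (W : bundle R -> _) := measurable_within_disk cf.
have mI : measurable_fun setT (fun p : plane R => \int[leb1]_t W (chord p.1 p.2 t))%E.
  have h g : measurable_fun setT (g : bundle R -> \bar R) -> (forall p, 0 <= g p)%E ->
      measurable_fun setT (fun p : plane R => \int[leb1]_t g (chord p.1 p.2 t))%E.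
    move=> mg g0.
    apply: (@measurable_pint _ (plane R) R setT (fun p t => g (chord p.1 p.2 t))) => //.
    exact: (measurableT_comp mg (@measurable_chord R)).
  rewrite (_ : (fun p : plane R => _) = (fun p => (\int[leb1]_t (W^\+ (chord p.1 p.2 t))) -
       (\int[leb1]_t (W^\- (chord p.1 p.2 t))))%E); last first.
    apply/funext => p; rewrite [LHS]integralE; congr (_ - _)%E; apply: eq_integral => t _.
    - by rewrite !funeposE.
    - by rewrite !funenegE.
  apply: emeasurable_funB; apply: h; try exact: funepos_ge0; try exact: funeneg_ge0.
  - exact: measurable_funepos.
  - exact: measurable_funeneg.
apply: (@eq_measurable_fun _ _ _ _ _ (fun p => fine (\int[leb1]_t W (chord p.1 p.2 t))%E)).
  move=> p; rewrite inE => -[_]; rewrite /= in_itv /= => /cos_gt0_pihalf c0.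
  by rewrite /Rintegral integral_chord_disk.
by apply: measurable_funTS; exact: (measurableT_comp (fine_measurable measurableT) mI).
Qed.

End chord_integrals.

Variable v : R * R * R -> R[i].
Hypothesis cv : continuousSM v.

Lemma xray_integralE b a : xray_integral v (b, a) =
  cintegral leb1 `[0, 2 * cos a] (fun t => v (chord b a t)).
Proof. by []. Qed.

Lemma cmeas_xray_integral : cmeas (@influx R : set (plane R)) (xray_integral v).
Proof. by case: cv => _ cR cI; split;
  [exact: (measurable_chord_integral cR)|exact: (measurable_chord_integral cI)]. Qed.

Lemma xray_integral_periodic b a : xray_integral v (b + 2 * pi, a) = xray_integral v (b, a).
Proof.
rewrite !xray_integralE; congr cintegral; apply/funext => t.
have e : b + 2 * pi + pi + a = (b + pi + a) + 2 * pi by ring.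
rewrite /chord e; case: cv => -> _ _.
have e2 x : x + 2 * pi = x + pi *+ 2 :> R by rewrite mulr_natl.
by rewrite !e2 !cosD2pi !sinD2pi.
Qed.

(** Cauchy-Schwarz against the constant 1 on a chord of length 2 cos a: the length is exactly the
    weight that occurs in Santalo's formula. *)
Lemma nsq_xray_integral b a : 0 < cos a ->
  ((nsq (xray_integral v (b, a)))%:E <= 2%:E * ((cos a)%:E * chordsq v b a))%E.
Proof.
move=> c0; set L := 2 * cos a; have L0 : 0 <= L by rewrite mulr_ge0// ltW.
have mL : measurable (`[0, L]%classic : set (measurableTypeR R)) by exact: measurable_itv.
have cn := @within_chord _ (within_nsq cv) b a.
have Lv : L2 leb1 `[0, L] (fun t => v (chord b a t)).
  case: cv => _ cR cI; split.
  - exact: (subspace_continuous_measurable_fun _ (@within_chord _ cR b a)).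
  - exact: (subspace_continuous_measurable_fun _ (@within_chord _ cI b a)).
  - have := continuous_compact_integrable (@segment_compact _ 0 L) cn.
    move=> /integrableP[_]; apply: le_lt_trans; rewrite le_eqVlt; apply/orP; left; apply/eqP.
    by apply: eq_integral => t _; rewrite /= ger0_norm// nsq_ge0.
have N1 : sqnorm2 leb1 `[0, L] (fun=> 1) = L%:E.
  rewrite /sqnorm2 /= expr1n expr0n addr0 integral_cst// mul1e.
  have := @lebesgue_measure_itv R `[0, L]; rewrite /= lte_fin sube0 => ->.
  by case: ltP => // L0'; congr EFin; apply/eqP; rewrite eq_le L0 L0'.
have L1 : L2 leb1 `[0, L] (fun=> 1).
  by split; [exact: measurable_cst|exact: measurable_cst|rewrite N1 ltry].
have := cauchy_schwarz mL Lv L1; rewrite {2}/sqnorm N1 /= => cs.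
rewrite /chordsq -(integral_chord_disk (within_nsq cv) b c0) muleA -EFinM.
rewrite -[X in (_ <= _ * X)%E]/(sqnorm2 leb1 `[0, L] (fun t => v (chord b a t))) (sqnormE Lv);
  rewrite -EFinM lee_fin mulrC; move: cs; congr (nsq _ <= _).
by rewrite /inner xray_integralE; congr cintegral; apply/funext => t; rewrite conjc1 mulr1.
Qed.

Lemma xray_integral_bound : L2influx (xray_integral v) /\
  sqnorm leb2 (@influx R) (xray_integral v) <= 2 * sqnorm leb3 (@SM R) v.
Proof.
have mI := @measurable_influx R.
have [_ Lv] := L2_continuousSM cv.
have key : (sqnorm2 leb2 (@influx R) (xray_integral v) <= 2%:E * sqnorm2 leb3 (@SM R) v)%E.
  pose Ioo : set (measurableTypeR R) := `](- (pi / 2))%R, (pi / 2)%R[%classic.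
  have mI1 : measurable Ioo by exact: measurable_itv.
  have mc : measurable (@circle R : set (measurableTypeR R)) := @measurable_circle R.
  have mS := measurable_chordsq cv.
  have cs0 x y : (0 <= chordsq v x y)%E by apply: integral_ge0 => t _; exact: densq_ge0.
  have mcs : measurable_fun (@influx R : set (plane R))
      (fun p => 2%:E * ((cos p.2)%:E * chordsq v p.1 p.2))%E.
    apply: measurable_funeM; apply: emeasurable_funM; last exact: measurable_funTS.
    apply: measurable_funTS; apply/measurable_EFinP.
    exact: (measurableT_comp (@measurable_cos R)).
  have cpos p : influx p -> 0 < cos p.2.
    by move=> [_]; rewrite /= in_itv /= => /cos_gt0_pihalf.
  have ge0 (p : plane R) : influx p -> (0 <= 2%:E * ((cos p.2)%:E * chordsq v p.1 p.2))%E.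
    by move=> /cpos /ltW h; rewrite !mule_ge0.
  apply: (@le_trans _ _ (\int[leb2]_(p in @influx R) (2%:E * ((cos p.2)%:E * chordsq v p.1 p.2)))%E).
    apply: ge0_le_integral => //.
    - by move=> p _; rewrite lee_fin nsq_ge0.
    - by apply/measurable_EFinP; exact: (measurable_nsq cmeas_xray_integral).
    - by move=> -[b a] /cpos h; exact: nsq_xray_integral.
  rewrite -(santalo cv) -(santalo_iint cv).
  have h b a : Ioo a -> (0 <= (cos a)%:E * chordsq v b a)%E.
    by rewrite /Ioo /= in_itv /= => /cos_gt0_pihalf /ltW c0; rewrite mule_ge0.
  have mh : measurable_fun (@circle R `*` Ioo : set (plane R)) (fun p => (cos p.2)%:E * chordsq v
    p.1 p.2)%E.
    apply: emeasurable_funM; last exact: measurable_funTS.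
    by apply: measurable_funTS; apply/measurable_EFinP; exact: (measurableT_comp (@measurable_cos R)).
  rewrite -(@tonelli_domains _ _ _ _ _ leb1 leb1 _ _ mc mI1 (fun p => (cos p.2)%:E * chordsq v p.1
    p.2)%E mh); last first.
    by move=> p [_ /(h p.1)].
  rewrite -ge0_integralZl//; first by move=> p [_ /(h p.1)].
have fin : (sqnorm2 leb2 (@influx R) (xray_integral v) < +oo)%E.
  by apply: (le_lt_trans key); rewrite (sqnormE Lv) -EFinM ltry.
have [m1 m2] := cmeas_xray_integral.
have L : L2 leb2 (@influx R) (xray_integral v) by split.
split; first by split => // b a; exact: xray_integral_periodic.
by move: key; rewrite (sqnormE Lv) (sqnormE L) -EFinM lee_fin.
Qed.

End xray_of_continuous.

(** * The X-ray transform on L^2 *)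

Section continuous_functions.
Variable R : realType.
Local Notation leb1 := (@lebesgue_measure R).
Implicit Types v w : R * R * R -> R[i].

Lemma continuousSM_D v w : continuousSM v -> continuousSM w ->
  continuousSM (fun p => v p + w p).
Proof.
move=> [pv vR vI] [pw wR wI]; split.
- by move=> x t; rewrite pv pw.
- rewrite (_ : (fun p => _) = fun p => complex.Re (v p) + complex.Re (w p)).
    by move=> p; apply: cvgD; [exact: vR|exact: wR].
  by apply/funext => p; rewrite ReD.
- rewrite (_ : (fun p => _) = fun p => complex.Im (v p) + complex.Im (w p)).
    by move=> p; apply: cvgD; [exact: vI|exact: wI].
  by apply/funext => p; rewrite ImD.
Qed.

Lemma continuousSM_M v w : continuousSM v -> continuousSM w ->
  continuousSM (fun p => v p * w p).
Proof.
move=> [pv vR vI] [pw wR wI]; split.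
- by move=> x t; rewrite pv pw.
- rewrite (_ : (fun p => _) = fun p => complex.Re (v p) * complex.Re (w p) -
     complex.Im (v p) * complex.Im (w p)).
    by move=> p; apply: cvgB; apply: cvgM; first [exact: vR|exact: wR|exact: vI|exact: wI].
  by apply/funext => p; rewrite ReM.
- rewrite (_ : (fun p => _) = fun p => complex.Re (v p) * complex.Im (w p) +
     complex.Im (v p) * complex.Re (w p)).
    by move=> p; apply: cvgD; apply: cvgM; first [exact: vR|exact: wR|exact: vI|exact: wI].
  by apply/funext => p; rewrite ImM.
Qed.

Lemma continuousSM_conj v : continuousSM v -> continuousSM (fun p => conjc (v p)).
Proof.
move=> [pv vR vI]; split.
- by move=> x t; rewrite pv.
- rewrite (_ : (fun p => _) = fun p => complex.Re (v p))//.
  by apply/funext => p; rewrite Re_conjc.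
- rewrite (_ : (fun p => _) = fun p => - complex.Im (v p)).
    by move=> p; apply: cvgN; exact: vI.
  by apply/funext => p; rewrite Im_conjc.
Qed.

Lemma continuousSM_cst c : continuousSM (fun=> c : R[i]).
Proof. by split => // p; exact: cvg_cst. Qed.

Lemma continuousSM_X v n : continuousSM v -> continuousSM (fun p => v p ^+ n).
Proof.
move=> cv; elim: n => [|n ih]; first exact: continuousSM_cst.
have := continuousSM_M cv ih; congr continuousSM; apply/funext => p.
by rewrite exprS.
Qed.

Lemma continuousSM_emon i : continuousSM (@emon R i).
Proof.
have cz : continuousSM (fun p : R * R * R => zc p.1).
  split => //=; apply: continuous_subspaceT => p.
  - apply: (cvg_comp (fun p : R * R * R => p.1) fst); [exact: cvg_fst|exact: cvg_fst].
  - apply: (cvg_comp (fun p : R * R * R => p.1) snd); [exact: cvg_fst|exact: cvg_snd].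
apply: continuousSM_M.
  by apply: continuousSM_M; apply: continuousSM_X => //; exact: continuousSM_conj.
split => [x t||]; first by rewrite /= expi_periodic.
- apply: continuous_subspaceT => p /=.
  apply: (@continuous_comp _ _ _ (fun p : R * R * R => p.2) (fun t => cos (i.2%:~R * t))).
    exact: cvg_snd.
  exact: continuous_cos_mul.
- apply: continuous_subspaceT => p /=.
  apply: (@continuous_comp _ _ _ (fun p : R * R * R => p.2) (fun t => sin (i.2%:~R * t))).
    exact: cvg_snd.
  exact: continuous_sin_mul.
Qed.

Lemma continuousSM_lext s : continuousSM (lext (@emon R) s).
Proof.
elim: s => [|t s ih].
  by have := continuousSM_cst 0; congr continuousSM; apply/funext => p; rewrite lext_nil.
have := continuousSM_D (continuousSM_M (continuousSM_cst t.1) (continuousSM_emon t.2)) ih.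
by congr continuousSM; apply/funext => p; rewrite lext_cons.
Qed.

Lemma cintegrable_chord v b a : continuousSM v ->
  cintegrable leb1 `[0, 2 * cos a] (fun t => v (chord b a t)).
Proof.
move=> [_ vR vI]; split; apply: continuous_compact_integrable; try exact: segment_compact.
- exact: (@within_chord _ _ vR b a).
- exact: (@within_chord _ _ vI b a).
Qed.

Lemma xray_integralD v w p : continuousSM v -> continuousSM w ->
  xray_integral (fun p => v p + w p) p = xray_integral v p + xray_integral w p.
Proof.
case: p => b a cv cw; rewrite !xray_integralE cintegralD//; exact: cintegrable_chord.
Qed.

Lemma xray_integralZ c v p : continuousSM v ->
  xray_integral (fun p => c * v p) p = c * xray_integral v p.
Proof.
case: p => b a cv; rewrite !xray_integralE cintegralZ//; exact: cintegrable_chord.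
Qed.

Lemma xray_integral_conj v p : continuousSM v ->
  xray_integral (fun p => conjc (v p)) p = conjc (xray_integral v p).
Proof.
case: p => b a cv; rewrite !xray_integralE cintegral_conj//; exact: cintegrable_chord.
Qed.

Lemma xray_integral_lext s :
  xray_integral (lext (@emon R) s) = lext (fun i => xray_integral (emon i)) s.
Proof.
elim: s => [|t s ih].
  apply/funext => -[b a]; rewrite lext_nil xray_integralE.
  rewrite (_ : (fun t => _) = fun=> 0) ?cintegral0//.
  by apply/funext => t; rewrite lext_nil.
apply/funext => p; rewrite lext_cons -ih -xray_integralZ; last exact: continuousSM_emon.
rewrite -xray_integralD; last exact: continuousSM_lext; last first.
  by apply: continuousSM_M; [exact: continuousSM_cst|exact: continuousSM_emon].
by congr xray_integral; apply/funext => q; rewrite lext_cons.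
Qed.

End continuous_functions.

Lemma cvgL2_limL2 d (T : measurableType d) (R : realType) (mu : {measure set T -> \bar R}) (D : set T)
    (mD : measurable D) (fn : nat -> T -> R[i]) f :
  (forall n, L2 mu D (fn n)) -> L2 mu D f -> cvgL2 mu D fn f <-> limL2 mu D fn f.
Proof.
move=> Ln Lf; have E n := sqnormE (L2B mD (Ln n) Lf).
split => [c e e0|c].
  have /cvgrPdist_lt/(_ _ e0) [n0 _ h] : fine (sqnorm2 mu D (fun x => fn n x - f x)) @[n --> \oo]
    --> (0 : R).
    exact: (fine_cvg c).
  exists n0 => n /h /=; rewrite sub0r normrN => /ltW; apply: le_trans; exact: ler_norm.
rewrite /cvgL2; under eq_fun do rewrite E.
apply: cvg_EFin; first exact: nearW.
apply/cvgrPdist_le => e e0; have [n0 h] := c _ e0.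
by exists n0 => // n /= nn; rewrite sub0r normrN /= ger0_norm ?sqnorm_ge0//; exact: h.
Qed.

Lemma limL2_const d (T : measurableType d) (R : realType) (mu : {measure set T -> \bar R}) (D : set T)
    (f g : T -> R[i]) : sqnorm mu D (fun x => f x - g x) = 0 -> limL2 mu D (fun=> f) g.
Proof. by move=> h e e0; exists 0%N => n _; rewrite h ltW. Qed.

(** * Closure of a bounded linear operator, as a relation *)

Section closure_of_operator.
Context d (T : measurableType d) d' (T' : measurableType d') (R : realType).
Variables (mu : {measure set T -> \bar R}) (D : set T).
Variables (mu' : {measure set T' -> \bar R}) (D' : set T').
Hypotheses (mD : measurable D) (mD' : measurable D').
Variables (Q P : set (T -> R[i])) (P' : set (T' -> R[i])).
Variable Op : (T -> R[i]) -> T' -> R[i].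
Local Notation N1 := (sqnorm mu D).
Local Notation N2 := (sqnorm mu' D').
Local Notation LP := (P `&` L2 mu D).
Local Notation LP' := (P' `&` L2 mu' D').
Implicit Types (u v : T -> R[i]) (g h : T' -> R[i]).

Hypotheses (QD : forall v w, Q v -> Q w -> Q (fun p => v p + w p))
  (QZ : forall c v, Q v -> Q (fun p => c * v p))
  (Qconj : forall v, Q v -> Q (fun p => conjc (v p)))
  (PD : forall v w, P v -> P w -> P (fun p => v p + w p))
  (PZ : forall c v, P v -> P (fun p => c * v p))
  (Pconj : forall v, P v -> P (fun p => conjc (v p)))
  (PD' : forall g h, P' g -> P' h -> P' (fun p => g p + h p))
  (PZ' : forall c g, P' g -> P' (fun p => c * g p))
  (Pconj' : forall g, P' g -> P' (fun p => conjc (g p)))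
  (QL : forall v, Q v -> LP v) (OpL : forall v, Q v -> LP' (Op v))
  (Opbd : forall v, Q v -> N2 (Op v) <= 2 * N1 v)
  (OpD : forall v w p, Q v -> Q w -> Op (fun p => v p + w p) p = Op v p + Op w p)
  (OpZ : forall c v p, Q v -> Op (fun p => c * v p) p = c * Op v p)
  (Opconj : forall v p, Q v -> Op (fun p => conjc (v p)) p = conjc (Op v p)).

(** [Q] is a core on which [Op] is known. [P] and [P'] are pointwise side conditions, here
    periodicity; they are kept apart from [L2] because they are not almost-everywhere notions. *)
Definition op_closure u g := [/\ LP u, LP' g & exists un : nat -> T -> R[i],
  [/\ forall n, Q (un n), cvgL2 mu D un u & cvgL2 mu' D' (fun n => Op (un n)) g]].

Let Lc v : Q v -> L2 mu D v. Proof. by move/QL => []. Qed.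

Let LI v : Q v -> L2 mu' D' (Op v). Proof. by move/OpL => []. Qed.

(** Replaces sequences by a single element of the core, close to [u] and with image close to [g] at
    once. For the converse, the tolerances 1/(n + 1) give a sequence. *)
Lemma op_closureP u g : op_closure u g <->
  [/\ LP u, LP' g & forall e : R, 0 < e -> exists v,
     [/\ Q v, N1 (fun p => v p - u p) <= e &
         N2 (fun p => Op v p - g p) <= e]].
Proof.
split=> [[Lu Lg [un [cu cuu cg]]]|[Lu Lg h]].
  split=> // e e0; have [_ Lu'] := Lu; have [_ Lg'] := Lg.
  have /(_ _ e0)[n1 h1] := (cvgL2_limL2 mD (fun n => Lc (cu n)) Lu').1 cuu.
  have /(_ _ e0)[n2 h2] := (cvgL2_limL2 mD' (fun n => LI (cu n)) Lg').1 cg.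
  exists (un (maxn n1 n2)); split => //; [apply: h1|apply: h2]; exact: leq_maxl || exact: leq_maxr.
have n0 (n : nat) : 0 < (n.+1%:R^-1 : R) by rewrite invr_gt0.
have [un hn] := choice (fun n => h _ (n0 n)).
have cu n : Q (un n) by case: (hn n).
have lim (e : R) : 0 < e -> exists n0, forall n, (n0 <= n)%N -> n.+1%:R^-1 <= e.
  move=> e0; have [k _ hk] := near_infty_natSinv_lt (PosNum e0).
  by exists k => n /hk /ltW.
have [_ Lu'] := Lu; have [_ Lg'] := Lg.
split=> //; exists un; split => //.
- apply/(cvgL2_limL2 mD (fun n => Lc (cu n)) Lu') => e /lim[k hk]; exists k => n /hk.
  by apply: le_trans; case: (hn n).
- apply/(cvgL2_limL2 mD' (fun n => LI (cu n)) Lg') => e /lim[k hk]; exists k => n /hk.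
  by apply: le_trans; case: (hn n).
Qed.

(** The constant 8 is the factor 2 of [Opbd] times the factor 2 lost in each of two inequalities for
    squared norms of sums; the errors add up to 10 times the tolerance. *)
Lemma op_closure_bound u g : op_closure u g -> N2 g <= 8 * N1 u.
Proof.
move=> /op_closureP[[_ Lu] [_ Lg] h]; apply/ler_addgt0Pl => e e0.
have e1 : 0 < e / 10 by lra.
have [v [cv h1 h2]] := h _ e1.
have := sqnormD_le mD' (LI cv) (L2B mD' Lg (LI cv)); have := Opbd cv; rewrite (sqnormBC mu').
have := sqnormD_le mD Lu (L2B mD (Lc cv) Lu).
rewrite (eq_sqnorm _ (g := v)) => [|p _]; last by congr nsq; ring.
rewrite [X in _ -> _ -> X <= _ -> _](eq_sqnorm _ (g := g)) => [|p _]; last by congr nsq; ring.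
by move: h1 h2; lra.
Qed.

Lemma op_closure_core v : Q v -> op_closure v (Op v).
Proof.
move=> cv; apply/op_closureP; split; [exact: QL|exact: OpL|].
move=> e e0; exists v; split => //; rewrite (eq_sqnorm _ (g := fun=> 0)) ?sqnorm0 ?ltW// => p _;
  by rewrite subrr.
Qed.

Lemma LP_D u v : LP u -> LP v -> LP (fun p => u p + v p).
Proof.
move=> [pu Lu] [pv Lv]; split; last exact: L2D.
by auto.
Qed.

Lemma LP_Z c u : LP u -> LP (fun p => c * u p).
Proof. by move=> [pu Lu]; split; [auto|exact: L2Z]. Qed.

Lemma LP'_D g h : LP' g -> LP' h -> LP' (fun p => g p + h p).
Proof.
move=> [pu Lu] [pv Lv]; split; last exact: L2D.
by auto.
Qed.

Lemma LP'_Z c g : LP' g -> LP' (fun p => c * g p).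
Proof. by move=> [pu Lu]; split; [auto|exact: L2Z]. Qed.

Lemma op_closureD u v g h : op_closure u g -> op_closure v h ->
  op_closure (fun p => u p + v p) (fun p => g p + h p).
Proof.
move=> /op_closureP[Lu Lg a] /op_closureP[Lv Lh b]; apply/op_closureP; split;
  [exact: LP_D|exact: LP'_D|].
move=> e e0; have e4 : 0 < e / 4 by lra.
have [v1 [c1 h1 k1]] := a _ e4; have [v2 [c2 h2 k2]] := b _ e4.
have [_ Lu'] := Lu; have [_ Lg'] := Lg; have [_ Lv'] := Lv; have [_ Lh'] := Lh.
exists (fun p => v1 p + v2 p); split; first exact: QD.
- have := sqnormD_le mD (L2B mD (Lc c1) Lu') (L2B mD (Lc c2) Lv').
  rewrite (eq_sqnorm _ (g := fun p => v1 p + v2 p - (u p + v p))) => [|p _]; last by congr nsq; ring.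
  by move: h1 h2; lra.
- have := sqnormD_le mD' (L2B mD' (LI c1) Lg') (L2B mD' (LI c2) Lh').
  rewrite (eq_sqnorm _ (g := fun p => Op (fun p => v1 p + v2 p) p - (g p + h p))) => [|p _]; last first.
    by rewrite OpD//; congr nsq; ring.
  by move: k1 k2; lra.
Qed.

Lemma op_closureZ c u g : op_closure u g -> op_closure (fun p => c * u p) (fun p => c * g p).
Proof.
move=> /op_closureP[Lu Lg a]; apply/op_closureP; split; [exact: LP_Z|exact: LP'_Z|].
move=> e e0; have e4 : 0 < e / (nsq c + 1) by rewrite divr_gt0// ltr_wpDl// nsq_ge0.
have [v [cv h k]] := a _ e4; have [_ Lu'] := Lu; have [_ Lg'] := Lg.
have le : nsq c * (e / (nsq c + 1)) <= e.
  by rewrite mulrCA ger_pMr// ler_pdivrMr ?mul1r ?lerDl// ltr_wpDl// nsq_ge0.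
exists (fun p => c * v p); split.
- exact: QZ.
- rewrite (eq_sqnorm _ (g := fun p => c * (v p - u p))) => [|p _]; last by rewrite mulrBr.
  by rewrite sqnormZ; [apply: le_trans le;
    rewrite ler_wpM2l// nsq_ge0|exact: mD|exact: L2B (Lc cv) Lu'].
- rewrite (eq_sqnorm _ (g := fun p => c * (Op v p - g p))) => [|p _]; last first.
    by rewrite OpZ// mulrBr.
  by rewrite sqnormZ; [apply: le_trans le;
    rewrite ler_wpM2l// nsq_ge0|exact: mD'|exact: L2B (LI cv) Lg'].
Qed.

Lemma op_closure_conj u g : op_closure u g -> op_closure (fun p => conjc (u p)) (fun p => conjc (g p)).
Proof.
move=> /op_closureP[[pu Lu] [pg Lg] a]; apply/op_closureP; split.
- by split; [auto|exact: L2conj].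
- by split; [auto|exact: L2conj].
move=> e /a[v [cv h1 h2]]; exists (fun p => conjc (v p)); split; first exact: Qconj.
- by rewrite (eq_sqnorm _ (g := fun p => v p - u p)) => // p _; rewrite -rmorphB nsq_conj.
- rewrite (eq_sqnorm _ (g := fun p => Op v p - g p)) => // p _.
  by rewrite Opconj// -rmorphB nsq_conj.
Qed.

Lemma op_closure_closed (un : nat -> T -> R[i]) (gn : nat -> T' -> R[i]) u g :
  LP u -> LP' g -> (forall n, op_closure (un n) (gn n)) ->
  limL2 mu D un u -> limL2 mu' D' gn g -> op_closure u g.
Proof.
move=> Lu Lg xn cu cg; apply/op_closureP; split => // e e0; have e4 : 0 < e / 4 by lra.
have [_ Lu'] := Lu; have [_ Lg'] := Lg.
have [n1 h1] := cu _ e4; have [n2 h2] := cg _ e4; pose n := maxn n1 n2.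
have {}h1 := h1 n (leq_maxl _ _); have {}h2 := h2 n (leq_maxr _ _).
have /op_closureP[[_ Ln] [_ Lgn] /(_ _ e4)[v [cv k1 k2]]] := xn n.
exists v; split => //.
- by have := sqnorm_tri mD (Lc cv) Ln Lu'; move: h1 k1; lra.
- by have := sqnorm_tri mD' (LI cv) Lgn Lg'; move: h2 k2; lra.
Qed.

Lemma op_closure_ext u u' g g' : op_closure u g -> LP u' -> LP' g' ->
  N1 (fun p => u p - u' p) = 0 -> N2 (fun p => g p - g' p) = 0 -> op_closure u' g'.
Proof.
move=> x Lu Lg h1 h2; apply: (@op_closure_closed (fun=> u) (fun=> g)) => //; exact: limL2_const.
Qed.

(** The image is the explicit [climit] of [lext_limit]. The hypothesis on [P'] and [climit] is where
    this explicit form matters: the side condition holds at every point of the limit. *)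
Lemma op_closure_total (J : Type) (B : J -> T -> R[i]) u :
  (forall s, Q (lext B s)) -> (forall i, Q (B i)) ->
  (forall s, Op (lext B s) = lext (fun i => Op (B i)) s) ->
  (forall G : nat -> T' -> R[i], (forall j, P' (G j)) -> P' (fun x => climit (fun j => G j x))) ->
  LP u -> (forall e : R, 0 < e -> exists s, N1 (fun x => u x - lext B s x) <= e) ->
  exists g, op_closure u g.
Proof.
move=> QB Qi OpB Plim Lu den; have [pu Lu'] := Lu.
have [sn _ hs] := @limL2_of_approx _ _ _ mu D _ (fun=> True) (lext B) u
  (fun e e0 => let: ex_intro s h := den e e0 in ex_intro2 _ _ s I h).
have [k [Lg lg]] := @lext_limit _ _ _ _ R _ mu D mu' D' mD mD' B
  (fun i => Op (B i)) 2 sn u (fun i => Lc (Qi i)) (fun i => LI (Qi i)) (ler0n _ _)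
  (fun s => eq_ind _ (fun F => N2 F <= _) (Opbd (QB s)) _ (OpB s)) Lu' hs.
exists (fun x => climit (fun j => lext (fun i => Op (B i)) (sn (k j)) x)).
apply: (op_closure_closed (un := fun n => lext B (sn n))
  (gn := fun n => lext (fun i => Op (B i)) (sn n))) => //.
- split => //; apply: (Plim (fun j => lext (fun i => Op (B i)) (sn (k j)))) => j.
  by rewrite -OpB; case: (OpL (QB (sn (k j)))).
- by move=> n; rewrite -OpB; exact: op_closure_core.
Qed.

End closure_of_operator.

Section xray_relation.
Variable R : realType.
Local Notation leb1 := (@lebesgue_measure R).
Local Notation leb2 := (leb1 \x leb1)%E.
Local Notation leb3 := (leb2 \x leb1)%E.
Local Notation NS := (sqnorm leb3 (@SM R)).
Local Notation NI := (sqnorm leb2 (@influx R)).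
Implicit Types (u v w : R * R * R -> R[i]) (g h : R * R -> R[i]).

Definition influx_periodic : set (R * R -> R[i]) :=
  [set g | forall b a, g (b + 2 * pi, a) = g (b, a)].

Let mS := @measurable_SM R.

Let mI := @measurable_influx R.

Let QZ c v : continuousSM v -> continuousSM (fun p => c * v p).
Proof. by move=> cv; apply: continuousSM_M => //; exact: continuousSM_cst. Qed.

Let PD v w : periodicSM v -> periodicSM w -> periodicSM (fun p => v p + w p).
Proof. by move=> pv pw x t; rewrite pv pw. Qed.

Let PZ c v : periodicSM v -> periodicSM (fun p => c * v p).
Proof. by move=> pv x t; rewrite pv. Qed.

Let Pconj v : periodicSM v -> periodicSM (fun p => conjc (v p)).
Proof. by move=> pv x t; rewrite pv. Qed.

Let PD' g h : influx_periodic g -> influx_periodic h -> influx_periodic (fun p => g p + h p).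
Proof. by move=> pv pw x t; rewrite pv pw. Qed.

Let PZ' c g : influx_periodic g -> influx_periodic (fun p => c * g p).
Proof. by move=> pv x t; rewrite pv. Qed.

Let Pconj' g : influx_periodic g -> influx_periodic (fun p => conjc (g p)).
Proof. by move=> pv x t; rewrite pv. Qed.

Let OpL v : continuousSM v -> L2influx (xray_integral v).
Proof. by case/xray_integral_bound. Qed.

Let Opbd v : continuousSM v -> NI (xray_integral v) <= 2 * NS v.
Proof. by case/xray_integral_bound. Qed.

Local Notation closure := (op_closure leb3 (@SM R) leb2 (@influx R) (@continuousSM R)
  (@periodicSM R) influx_periodic (@xray_integral R)).

(** [L2SM] and [L2influx] are intersections of a periodicity condition with an [L2] space, so both
    sides unfold to the same term. *)
Let xrayE u g : xray u g = closure u g. Proof. by []. Qed.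

Lemma L2SM_D u v : L2SM u -> L2SM v -> L2SM (fun p => u p + v p).
Proof. exact: (LP_D mS PD). Qed.

Lemma xray_bound u g : xray u g -> NI g <= 8 * NS u.
Proof. rewrite xrayE; exact: (op_closure_bound mS mI (@L2_continuousSM R) OpL Opbd). Qed.

Lemma xray_continuous v : continuousSM v -> xray v (xray_integral v).
Proof. rewrite xrayE; exact: (op_closure_core mS mI (@L2_continuousSM R) OpL). Qed.

Lemma xrayD u v g h : xray u g -> xray v h ->
  xray (fun p => u p + v p) (fun p => g p + h p).
Proof.
rewrite !xrayE; exact: (op_closureD mS mI (@continuousSM_D R) PD PD' (@L2_continuousSM R) OpL
  (@xray_integralD R)).
Qed.

Lemma xrayZ c u g : xray u g -> xray (fun p => c * u p) (fun p => c * g p).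
Proof.
rewrite !xrayE; exact: (op_closureZ mS mI QZ PZ PZ' (@L2_continuousSM R) OpL (@xray_integralZ R)).
Qed.

Lemma xrayB u v g h : xray u g -> xray v h ->
  xray (fun p => u p - v p) (fun p => g p - h p).
Proof.
move=> a /(xrayZ (-1)) b; have := xrayD a b.
by congr xray; apply/funext => p; rewrite mulN1r.
Qed.

Lemma xray_conj u g : xray u g -> xray (fun p => conjc (u p)) (fun p => conjc (g p)).
Proof.
rewrite !xrayE; exact: (op_closure_conj mS mI (@continuousSM_conj R) Pconj Pconj' (@L2_continuousSM
  R) OpL (@xray_integral_conj R)).
Qed.

Lemma xray_closed (un : nat -> R * R * R -> R[i]) (gn : nat -> R * R -> R[i]) u g :
  L2SM u -> L2influx g -> (forall n, xray (un n) (gn n)) ->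
  limL2 leb3 (@SM R) un u -> limL2 leb2 (@influx R) gn g -> xray u g.
Proof. exact: (op_closure_closed mS mI (@L2_continuousSM R) OpL). Qed.

Lemma xray_ext u u' g g' : xray u g -> L2SM u' -> L2influx g' ->
  NS (fun p => u p - u' p) = 0 -> NI (fun p => g p - g' p) = 0 -> xray u' g'.
Proof. exact: (op_closure_ext mS mI (@L2_continuousSM R) OpL). Qed.

Lemma xray_total u : L2SM u -> exists g, xray u g.
Proof.
move=> Lu; apply: (@op_closure_total _ _ _ _ _ _ _ _ _ mS mI _ _ _ _ (@L2_continuousSM R) OpL Opbd
  _ (@emon R)) => //.
- exact: continuousSM_lext.
- exact: continuousSM_emon.
- exact: xray_integral_lext.
- by move=> G hG b a; congr climit; apply/funext => j; exact: hG.
- by case: Lu => _ Lu' e e0; exact: density_SM.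
Qed.

End xray_relation.

(** * X-ray transforms of monomials *)

Section complex_derivative.
Variable R : realType.
Implicit Types (f g : R -> R[i]) (t : R).

Definition cder f g := forall t,
  is_derive t 1 (fun t => complex.Re (f t)) (complex.Re (g t)) /\
  is_derive t 1 (fun t => complex.Im (f t)) (complex.Im (g t)).

Lemma eq_cder f f' g g' : cder f g -> (forall t, f t = f' t) -> (forall t, g t = g' t) ->
  cder f' g'.
Proof. by move=> h /funext <- /funext <-. Qed.

Lemma cderD f g f' g' : cder f f' -> cder g g' ->
  cder (fun t => f t + g t) (fun t => f' t + g' t).
Proof.
move=> hf hg t; have [a b] := hf t; have [c e] := hg t; split.
- under eq_fun do rewrite ReD; rewrite ReD; exact: is_deriveD.
- under eq_fun do rewrite ImD; rewrite ImD; exact: is_deriveD.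
Qed.

Lemma cderM f g f' g' : cder f f' -> cder g g' ->
  cder (fun t => f t * g t) (fun t => f' t * g t + f t * g' t).
Proof.
move=> hf hg t; have [a b] := hf t; have [c e] := hg t; split.
- under eq_fun do rewrite ReM.
  apply: (is_derive_eq (is_deriveB (is_deriveM a c) (is_deriveM b e))).
  rewrite ReD !ReM /GRing.scale /=; ring.
- under eq_fun do rewrite ImM.
  apply: (is_derive_eq (is_deriveD (is_deriveM a e) (is_deriveM b c))).
  rewrite ImD !ImM /GRing.scale /=; ring.
Qed.

Lemma cder_cst c : cder (fun=> c) (fun=> 0).
Proof. by move=> t; split; exact: is_derive_cst. Qed.

Lemma cderZ c f f' : cder f f' -> cder (fun t => c * f t) (fun t => c * f' t).
Proof.
by move=> h; apply: eq_cder (cderM (cder_cst c) h) _ _ => // t; rewrite mul0r add0r.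
Qed.

Lemma cder_conj f f' : cder f f' -> cder (fun t => conjc (f t)) (fun t => conjc (f' t)).
Proof.
move=> h t; have [a b] := h t; split.
- by under eq_fun do rewrite Re_conjc; rewrite Re_conjc.
- by under eq_fun do rewrite Im_conjc; rewrite Im_conjc; exact: is_deriveN.
Qed.

Lemma cderX f f' n : cder f f' -> cder (fun t => f t ^+ n) (fun t => n%:R * f t ^+ n.-1 * f' t).
Proof.
move=> h; elim: n => [|n ih].
  by apply: eq_cder (cder_cst 1) _ _ => t; rewrite ?expr0 ?mul0r.
apply: eq_cder (cderM h ih) _ _ => t; first by rewrite exprS.
case: n {ih} => [|n]; first by rewrite expr0; ring.
by rewrite /= exprS -[n.+2%:R]natr1; ring.
Qed.

Lemma cder_affine (z w : R[i]) : cder (fun t => z + t%:C * w) (fun=> w).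
Proof.
have h : cder (fun t => t%:C) (fun=> 1) by move=> t; split; [exact: is_derive_id|exact: is_derive_cst].
apply: eq_cder (cderD (cder_cst z) (cderM h (cder_cst w))) _ _ => // t; ring.
Qed.

Lemma cder_continuous f g : cder f g ->
  continuous (fun t => complex.Re (f t)) /\ continuous (fun t => complex.Im (f t)).
Proof.
move=> h; split => t; apply: differentiable_continuous; apply/derivable1_diffP;
  by case: (h t) => -[? ?] [? ?].
Qed.

Lemma cder_ftc f g h (a b : R) : a <= b -> cder f g -> cder g h ->
  cintegral (@lebesgue_measure R) `[a, b] g = f b - f a.
Proof.
move=> ab fg gh; have [cR cI] := cder_continuous gh.
by apply: cintegral_ftc => // t; case: (fg t).
Qed.

End complex_derivative.

Section chord_monomials.
Variable R : realType.
Local Notation leb1 := (@lebesgue_measure R).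
Local Notation leb2 := (leb1 \x leb1)%E.
Implicit Types (a b p q : nat) (k : int) (be al t : R).

Lemma zc_chord be al t :
  zc (chord be al t).1 = expi 1 be + t%:C * expi 1 (be + pi + al).
Proof. by apply: complex_eq; rewrite !ReImE /= !mul1r mul0r ?subr0 ?addr0. Qed.

Lemma chord_start be al : zc (chord be al 0).1 = expi 1 be.
Proof. by rewrite zc_chord mul0r addr0. Qed.

Lemma chord_end be al : zc (chord be al (2 * cos al)).1 = expi 1 (be + pi + 2 * al).
Proof.
rewrite zc_chord (expi_add 1 (be + pi) al) (expi_add 1 (be + pi) (2 * al)) (expi_add 1 be pi) expi_pi1.
have -> : expi 1 (2 * al) = expi 1 al * expi 1 al by rewrite mulr_natl mulr2n expi_add.
have -> : (2 * cos al)%:C = expi 1 al + expi (-1) al :> R[i].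
  rewrite -expi_conj; apply: complex_eq; rewrite !ReImE /= !mul1r; ring.
have e1 := expi_mulV 1 al.
transitivity (expi 1 be * (1 - expi 1 al * expi 1 al - expi 1 al * expi (-1) al)); first by ring.
by rewrite e1; ring.
Qed.

Lemma expi_pow (p q : nat) t : expi 1 t ^+ p * conjc (expi 1 t) ^+ q = expi (p%:Z - q%:Z) t.
Proof. by rewrite expiD -expi_nat -expi_natN. Qed.

(** The left side integrates X(z^p conj(z)^q e^(i (k - 1) theta)) along the chord, so it is a
    difference of boundary values at the entry point e^(i be) and the exit point e^(i (be + pi + 2
    al)). It depends on p - q only. Truncated predecessors occur with coefficient 0. *)
Lemma chord_zmon_ftc p q k be al : 0 <= cos al ->
  p%:R * xray_integral (emon (p.-1, q, k)) (be, al) +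
  q%:R * xray_integral (emon (p, q.-1, k - 2)) (be, al) =
  expi (k - 1) (be + pi + al) *
    (expi (p%:Z - q%:Z) (be + pi + 2 * al) - expi (p%:Z - q%:Z) be) :> R[i].
Proof.
move=> c0; set th := be + pi + al; pose w := expi 1 th.
have L0 : 0 <= 2 * cos al by rewrite mulr_ge0.
pose z t := zc (chord be al t).1.
have zE t : z t = expi 1 be + t%:C * w by exact: zc_chord.
have dz : cder z (fun=> w) by apply: eq_cder (cder_affine _ w) _ _ => // t; rewrite zE.
have dzc : cder (fun t => conjc (z t)) (fun=> conjc w) by exact: cder_conj.
have dm m n : cder (fun t => z t ^+ m * conjc (z t) ^+ n)
    (fun t => m%:R * z t ^+ m.-1 * w * conjc (z t) ^+ n +
              z t ^+ m * (n%:R * conjc (z t) ^+ n.-1 * conjc w)).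
  by apply: cderM; exact: cderX.
have ww : w * expi (k - 1) th = expi k th by rewrite -expiD addrC subrK.
have ww' : conjc w * expi (k - 1) th = expi (k - 2) th.
  by rewrite expi_conj -expiD; congr expi; ring.
pose F t := expi (k - 1) th * (z t ^+ p * conjc (z t) ^+ q).
pose G t := p%:R * emon (p.-1, q, k) (chord be al t) + q%:R * emon (p, q.-1, k - 2) (chord be al t).
have GE t : G t = p%:R * expi k th * (z t ^+ p.-1 * conjc (z t) ^+ q) +
    q%:R * expi (k - 2) th * (z t ^+ p * conjc (z t) ^+ q.-1).
  by rewrite /G /emon /zmon /= -/th -/(z t); ring.
have FG : cder F G.
  apply: eq_cder (cderZ (expi (k - 1) th) (dm p q)) _ _ => // t.
  by rewrite GE -ww -ww'; ring.
(* A derivative of the integrand is exhibited for its continuity, which the fundamental theorem of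
   calculus demands. *)
have dG : exists H, cder G H.
  eexists; apply: eq_cder (cderD (cderZ (p%:R * expi k th) (dm p.-1 q)) (cderZ (q%:R * expi (k - 2)
    th) (dm p q.-1))) _ _ => t.
    by rewrite GE.
  by [].
have [H GH] := dG; have := cder_ftc L0 FG GH.
rewrite /F -mulrBr {1 2 3 4}/z chord_start chord_end !expi_pow => <-.
rewrite /G cintegralD ?cintegralZ//; try exact: measurable_itv.
- by apply: cintegrable_chord; exact: continuousSM_emon.
- by apply: cintegrable_chord; exact: continuousSM_emon.
- apply: (@cintegrable_chord R (fun x => p%:R * emon (p.-1, q, k) x)).
  by apply: continuousSM_M; [exact: continuousSM_cst|exact: continuousSM_emon].
- apply: (@cintegrable_chord R (fun x => q%:R * emon (p, q.-1, k - 2) x)).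
  by apply: continuousSM_M; [exact: continuousSM_cst|exact: continuousSM_emon].
Qed.

End chord_monomials.

(** * Exponentials on the influx boundary *)

Section fan_functions.
Variable R : realType.
Local Notation leb1 := (@lebesgue_measure R).
Local Notation leb2 := (leb1 \x leb1)%E.
Local Notation LI := (L2 leb2 (@influx R)).
Implicit Types (p q k : int) (F G : R * R -> R[i]) (Q : int -> Prop).

Let mI := @measurable_influx R.

Definition fan p q (x : R * R) : R[i] := expi p x.1 * expi q x.2.

Lemma cmeas_fan p q : cmeas (@influx R : set (plane R)) (fan p q).
Proof.
apply: cmeasM => //; apply: cmeas_comp; try exact: cmeas_expi.
- by apply: measurable_funTS; exact: measurable_fst.
- by apply: measurable_funTS; exact: measurable_snd.
Qed.

Lemma fan_conj p q x : conjc (fan p q x) = fan (- p) (- q) x.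
Proof. by rewrite /fan rmorphM /= -!expi_conj. Qed.

Lemma L2_fan p q : LI (fan p q).
Proof.
have [] // := @bounded_L2 _ _ _ leb2 (@influx R) mI (@leb_influx_fin R) (fan p q) 1.
- exact: cmeas_fan.
- by move=> x _; rewrite nsqM !nsq_expi mulr1.
Qed.

(** The interval has length pi, a period of even exponentials only. This is why differences of
    frequencies in alpha have to be even. *)
Lemma integral_even_expi (j : int) : j != 0 ->
  cintegral leb1 `](- (pi / 2) : R), (pi / 2)[ (expi (2 * j)) = 0.
Proof.
move=> j0; have p0 := @pi_gt0 R.
rewrite cintegral_bndbnd; last exact: cintegrable_expi.
rewrite cintegral_expi; [|lra|by rewrite mulf_neq0].
have e : pi / 2 = - (pi / 2) + pi :> R by field.
have e1 : expi (2 * j) (pi : R) = 1.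
  by transitivity (expi j (2 * pi : R)); [rewrite /expi intrM -mulrA mulrCA|exact: expi_2pi].
by rewrite {1}e expi_add e1 mulr1 subrr mul0r.
Qed.

Lemma inner_fan p q p' q' : (p != p') \/ (exists2 j, j != 0 & q - q' = 2 * j) ->
  inner leb2 (@influx R) (fan p q) (fan p' q') = 0.
Proof.
move=> h; rewrite /inner.
have fi := inner_integrable mI (L2_fan p q) (L2_fan p' q').
have mc : measurable (@circle R : set (measurableTypeR R)) := @measurable_circle R.
have mi : measurable (`](- (pi / 2))%R, (pi / 2)%R[%classic : set (measurableTypeR R)).
  exact: measurable_itv.
rewrite (@cfubini_domains _ _ _ _ _ leb1 leb1 _ _ mc mi _ fi).
have E b a : fan p q (b, a) * conjc (fan p' q' (b, a)) = expi (p - p') b * expi (q - q') a.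
  by rewrite fan_conj /fan [(b, a).1]/= [(b, a).2]/= !expiD; ring.
have ie k : cintegrable leb1 `](- (pi / 2))%R, (pi / 2)%R[ (expi k).
  have [a b] := @cintegrable_expi R k (- (pi / 2)) (pi / 2).
  by split; [apply: integrableS a|apply: integrableS b] => //; exact: subset_itv_oo_cc.
transitivity (cintegral leb1 (@circle R)
    (fun b => cintegral leb1 `](- (pi / 2))%R, (pi / 2)%R[ (expi (q - q')) * expi (p - p') b)).
  apply: eq_cintegral => b _; rewrite [RHS]mulrC -cintegralZ//.
  by apply: eq_cintegral => a _; exact: E.
rewrite cintegralZ//; last exact: cintegrable_circle_expi.
case: h => [pp|[j j0 ->]]; last by rewrite integral_even_expi// mul0r.
by rewrite cintegral_circle_expi subr_eq0 (negbTE pp) mulr0.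
Qed.

(** One frequency [p] in beta, and frequencies satisfying [Q] in alpha. Equality is asked on the
    influx boundary only, since the formulas for transforms need cos alpha >= 0. *)
Definition fanspan p Q F := exists s : seq (R[i] * int),
  (forall t, t \in s -> Q t.2) /\ (forall x, influx x -> F x = lext (fan p) s x).

Lemma fanspanD p Q F G : fanspan p Q F -> fanspan p Q G -> fanspan p Q (fun x => F x + G x).
Proof.
move=> [s [hs es]] [t [ht et]]; exists (s ++ t); split.
  by move=> x; rewrite mem_cat => /orP[/hs|/ht].
by move=> x xi; rewrite lext_cat es// et.
Qed.

Lemma fanspanZ p Q F c : fanspan p Q F -> fanspan p Q (fun x => c * F x).
Proof.
move=> [s [hs es]]; exists [seq (c * t.1, t.2) | t <- s]; split.
  by move=> _ /mapP[t /hs h ->].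
move=> x xi; rewrite es// /lext big_map mulr_sumr; apply: eq_bigr => t _.
by rewrite mulrA.
Qed.

Lemma fanspan_conj p Q F : fanspan p Q F ->
  fanspan (- p) (fun q => Q (- q)) (fun x => conjc (F x)).
Proof.
move=> [s [hs es]]; exists [seq (conjc t.1, - t.2) | t <- s]; split.
  by move=> _ /mapP[t /hs h ->] /=; rewrite opprK.
move=> x xi; rewrite es// /lext big_map rmorph_sum; apply: eq_bigr => t _.
transitivity (conjc t.1 * conjc (fan p t.2 x)); first exact: rmorphM.
by rewrite fan_conj.
Qed.

Lemma fanspan_fan p q Q c : Q q -> fanspan p Q (fun x => c * fan p q x).
Proof.
move=> Qq; exists [:: (c, q)]; split; first by move=> t; rewrite inE => /eqP ->.
by move=> x _; rewrite lext_cons lext_nil addr0.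
Qed.

Lemma fanspanS p Q Q' F : (forall q, Q q -> Q' q) -> fanspan p Q F -> fanspan p Q' F.
Proof. by move=> h [s [hs es]]; exists s; split => // t /hs /h. Qed.

Lemma eq_fanspan p Q F G : (forall x, influx x -> F x = G x) -> fanspan p Q F -> fanspan p Q G.
Proof. by move=> h [s [hs es]]; exists s; split => // x xi; rewrite -h// es. Qed.

Lemma fanspan_inner0 p p' Q Q' F G : fanspan p Q F -> fanspan p' Q' G ->
  p != p' \/ (forall q q', Q q -> Q' q' -> exists2 j, j != 0 & q - q' = 2 * j) ->
  inner leb2 (@influx R) F G = 0.
Proof.
move=> [s [hs es]] [t [ht et]] h.
transitivity (inner leb2 (@influx R) (lext (fan p) s) (lext (fan p') t)).
  by apply: eq_cintegral => x xi; rewrite es// et.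
rewrite inner_lext//; [|exact: L2_fan..].
rewrite big_seq big1// => x /hs Qx; rewrite big_seq big1// => y /ht Qy.
by rewrite inner_fan ?mulr0//; case: h => h; [left|right; exact: h].
Qed.

End fan_functions.

Section xray_of_monomials.
Variable R : realType.
Local Notation leb1 := (@lebesgue_measure R).
Local Notation leb2 := (leb1 \x leb1)%E.
Implicit Types (a b c n : nat) (k q : int).

Lemma emon_conj a b k (p : R * R * R) : conjc (emon (a, b, k) p) = emon (b, a, - k) p.
Proof.
rewrite -[RHS]/(zc p.1 ^+ b * conjc (zc p.1) ^+ a * expi (- k) p.2) -expi_conj.
rewrite -[emon _ _]/(zc p.1 ^+ a * conjc (zc p.1) ^+ b * expi k p.2).
move: (zc p.1) => z; rewrite rmorphM rmorphM !rmorphXn /=; congr (_ * _).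
by rewrite conjcK mulrC.
Qed.

Lemma influx_cos (x : R * R) : influx x -> 0 <= cos x.2.
Proof. by case=> _; rewrite /= in_itv /= => /cos_gt0_pihalf /ltW. Qed.

Lemma natC0 n : (n.+1%:R : R[i]) != 0.
Proof. by rewrite pnatr_eq0. Qed.

Definition outer_freq c k : int -> Prop := fun q => exists i : nat,
  q = k - 1 - 2 * i%:Z \/ q = k + 2 * c%:Z + 1 + 2 * i%:Z.

(** [chord_zmon_ftc] with p = c + 1 and q = 0 leaves a single transform on the left; the two
    boundary points give the two frequencies in alpha. *)
Lemma fanspan_hol c k : fanspan (c%:Z + k)
  (fun q => q = k - 1 \/ q = k + 2 * c%:Z + 1) (xray_integral (@emon R (c, 0%N, k))).
Proof.
(* Phases due to the shifts by pi in the direction and in the exit point. *)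
pose w := expi (k - 1) (pi : R); pose w' := expi c.+1 (pi : R).
have h1 := @fanspan_fan R (c%:Z + k) (k + 2 * c%:Z + 1)
   (fun q => q = k - 1 \/ q = k + 2 * c%:Z + 1) (c.+1%:R^-1 * w * w') (or_intror erefl).
have h2 := @fanspan_fan R (c%:Z + k) (k - 1)
   (fun q => q = k - 1 \/ q = k + 2 * c%:Z + 1) (- (c.+1%:R^-1 * w)) (or_introl erefl).
apply: eq_fanspan (fanspanD h1 h2) => -[be al] /influx_cos /= c0.
have := @chord_zmon_ftc R c.+1 0 k be al c0; rewrite /= mul0r addr0 subr0 => E.
apply: (mulfI (natC0 c)); rewrite E /fan /=.
rewrite (expi_add _ (be + pi) al) (expi_add _ be pi) (expi_add _ (be + pi) (2 * al)) (expi_add _ be pi).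
rewrite -/w -/w'.
have -> : expi c.+1 (2 * al) = expi c.+1 al * expi c.+1 al by rewrite mulr_natl mulr2n expi_add.
have -> : c%:Z + k = (k - 1) + c.+1%:Z by rewrite intS; ring.
have -> : k + 2 * c%:Z + 1 = (k - 1) + c.+1%:Z + c.+1%:Z by rewrite intS; ring.
rewrite !expiD.
move: (natC0 c); move: (c.+1%:R : R[i]) => C C0; by field.
Qed.

(** Induction on b: [chord_zmon_ftc] for z^(a+1) conj(z)^(b+1) and for the holomorphic monomial of
    the same degree have the same right side. Hence the transform is a combination of a holomorphic
    one and of one with exponent b and frequency k - 2. *)
Lemma fanspan_emon_ge a b k : (b <= a)%N ->
  fanspan (a%:Z - b%:Z + k) (outer_freq (a - b) k) (xray_integral (@emon R (a, b, k))).
Proof.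
elim: b a k => [|b ih] a k ba.
  rewrite subr0 subn0; apply: fanspanS (fanspan_hol a k) => q [->|->]; exists 0%N.
  - by left; rewrite mulr0 subr0.
  - by right; rewrite mulr0 addr0.
have ih' := ih a.+1 (k - 2) (leq_trans (ltnW ba) (leqnSn a)).
have hol := fanspan_hol (a - b.+1) k.
have h1 : fanspan (a%:Z - b.+1%:Z + k) (outer_freq (a - b.+1) k)
    (xray_integral (@emon R (a.+1, b, k - 2))).
  rewrite (_ : a%:Z - b.+1%:Z + k = a.+1%:Z - b%:Z + (k - 2)); last by rewrite !intS; ring.
  apply: fanspanS ih' => q [i [->|->]]; exists i.+1; [left|right].
  - by rewrite intS; ring.
  - by rewrite -!subzn ?(leqW (ltnW ba))// !intS; ring.
have h2 : fanspan (a%:Z - b.+1%:Z + k) (outer_freq (a - b.+1) k)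
    (xray_integral (@emon R ((a - b.+1)%N, 0%N, k))).
  rewrite (_ : a%:Z - b.+1%:Z + k = (a - b.+1)%N%:Z + k) ?subzn//.
  apply: fanspanS hol => q [->|->]; exists 0%N; [left|right].
  - by rewrite mulr0 subr0.
  - by rewrite mulr0 addr0.
have h := fanspanD (fanspanZ ((a - b.+1).+1%:R / a.+1%:R) h2) (fanspanZ (- (b.+1%:R / a.+1%:R)) h1).
apply: eq_fanspan h => -[be al] /influx_cos /= c0.
have := @chord_zmon_ftc R a.+1 b.+1 k be al c0.
have := @chord_zmon_ftc R (a - b.+1).+1 0 k be al c0.
rewrite /= mul0r addr0 subr0.
have -> : (a - b.+1).+1%:Z = a.+1%:Z - b.+1%:Z by rewrite intS -subzn// !intS; ring.
move=> <- E; apply: (mulfI (natC0 a)).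
transitivity ((a - b.+1).+1%:R * xray_integral (emon ((a - b.+1)%N, 0%N, k)) (be, al)
  - b.+1%:R * xray_integral (emon (a.+1, b, k - 2)) (be, al) : R[i]).
  by move: (natC0 a); move: (a.+1%:R : R[i]) => C C0; field.
by rewrite -E; ring.
Qed.

Lemma fanspan_emon a b k :
  fanspan (a%:Z - b%:Z + k) (fun=> True) (xray_integral (@emon R (a, b, k))).
Proof.
have [ba|ab] := leqP b a; first exact: fanspanS (fanspan_emon_ge _ ba).
have h := fanspan_conj (fanspan_emon_ge (- k) (ltnW ab)).
rewrite (_ : a%:Z - b%:Z + k = - (b%:Z - a%:Z - k)); last by ring.
apply: eq_fanspan (fanspanS _ h) => // x _.
rewrite -xray_integral_conj; last exact: continuousSM_emon.
congr (xray_integral _ x); apply/funext => p.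
by rewrite emon_conj opprK.
Qed.

(** If the frequencies in beta agree, then a - b = n + 2 (j + 1). In particular b <= a, and both
    alpha-frequencies of the holomorphic transform lie strictly inside the gap left by the other
    one, at even distance from all its frequencies. *)
Lemma inner_emon0 a b n k (j : nat) :
  inner leb2 (@influx R) (xray_integral (@emon R (a, b, k)))
    (xray_integral (@emon R (n, 0%N, k + 2 * j.+1%:Z))) = 0.
Proof.
have hol := fanspan_hol n (k + 2 * j.+1%:Z).
have [e|ne] := eqVneq (a%:Z - b%:Z + k) (n%:Z + (k + 2 * j.+1%:Z)); last first.
  by apply: (fanspan_inner0 (fanspan_emon a b k) hol); left.
have ab : (b <= a)%N.
  rewrite -lez_nat -subr_ge0 (_ : a%:Z - b%:Z = n%:Z + 2 * j.+1%:Z)//; apply: (addIr k); rewrite e;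
    ring.
have ec : (a - b)%N%:Z = n%:Z + 2 * j.+1%:Z.
  by rewrite -subzn//; apply: (addIr k); rewrite e; ring.
apply: (fanspan_inner0 (fanspan_emon_ge k ab) hol); right => q q' [i [->|->]] [->|->].
- by exists (- (i%:Z + j.+1%:Z)); [rewrite oppr_eq0 -PoszD addnS|ring].
- by exists (- (i%:Z + j.+1%:Z + n.+1%:Z)); [rewrite oppr_eq0 -!PoszD addnS|rewrite [n.+1%:Z]intS;
  ring].
- by exists (n%:Z + j.+1%:Z + 1 + i%:Z); [rewrite -!PoszD !addnS|rewrite ec; ring].
- by exists (i%:Z + j.+1%:Z); [rewrite -!PoszD addnS|rewrite ec; ring].
Qed.

End xray_of_monomials.

(** * Orthogonality of transforms of different frequencies *)

Section orthogonality.
Variable R : realType.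
Local Notation leb1 := (@lebesgue_measure R).
Local Notation leb2 := (leb1 \x leb1)%E.
Local Notation leb3 := (leb2 \x leb1)%E.
Local Notation L2d := (L2 leb2 (@disk R)).
Local Notation Nd := (sqnorm leb2 (@disk R)).
Implicit Types (f g : R * R -> R[i]) (k : int).

Let mI := @measurable_influx R.

Let mD := @measurable_disk R.

Let mS := @measurable_SM R.

Definition holmon (c : nat) := @zmon R (c, 0%N).

(** The concrete side of the kernel of [delbar]: L^2 limits of polynomials in z. Orthogonality is
    proved for this class, and [weakly_hol_limit] brings the weak kernel into it. *)
Definition hol_limit g := exists sn : nat -> seq (R[i] * nat),
  limL2 leb2 (@disk R) (fun n => lext holmon (sn n)) g.

Lemma freqB f g k p : freq (fun x => f x - g x) k p = freq f k p - freq g k p.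
Proof. by rewrite /freq mulrBl. Qed.

Lemma limL2_freq (fn : nat -> R * R -> R[i]) f k : (forall n, L2d (fn n)) -> L2d f ->
  limL2 leb2 (@disk R) fn f -> limL2 leb3 (@SM R) (fun n => freq (fn n) k) (freq f k).
Proof.
move=> Ln Lf lf e e0; have p0 : 0 < 2 * pi :> R by rewrite mulr_gt0// pi_gt0.
have [n0 h] := lf (e / (2 * pi)) (divr_gt0 e0 p0); exists n0 => n /h {}h.
rewrite (_ : (fun p => _) = freq (fun x => fn n x - f x) k); last first.
  by apply/funext => p; rewrite freqB.
by rewrite sqnorm_freq; [rewrite mulrC -ler_pdivlMr|exact: L2B].
Qed.

Lemma freq_periodic f k : @periodicSM R (freq f k).
Proof. by move=> x t; rewrite /freq /= expi_periodic. Qed.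

Lemma L2SM_freq f k : L2d f -> L2SM (freq f k).
Proof. by move=> Lf; split; [exact: freq_periodic|exact: L2s_freq]. Qed.

Lemma xray_lim (un : nat -> R * R * R -> R[i]) (gn : nat -> R * R -> R[i]) u g :
  (forall n, xray (un n) (gn n)) -> xray u g ->
  limL2 leb3 (@SM R) un u -> limL2 leb2 (@influx R) gn g.
Proof.
move=> xn xu lu e e0; have e8 : 0 < e / 8 by lra.
have [n0 h] := lu _ e8; exists n0 => n /h {}h.
have := xray_bound (xrayB (xn n) xu); move: h; lra.
Qed.

Lemma xray_freq_lext (I : Type) (J : I -> nat * nat) (s : seq (R[i] * I)) k :
  xray (freq (lext (fun i => @zmon R (J i)) s) k)
    (lext (fun i => xray_integral (emon (J i, k))) s).
Proof.
have := xray_continuous (@continuousSM_lext R [seq (t.1, (J t.2, k)) | t <- s]).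
rewrite xray_integral_lext; congr xray; apply/funext => p.
- rewrite /lext big_map /freq mulr_suml; apply: eq_bigr => t _.
  by rewrite /emon mulrA.
- by rewrite /lext big_map.
Qed.

Lemma L2_xemon i : L2 leb2 (@influx R) (xray_integral (@emon R i)).
Proof. by have [[]] := xray_integral_bound (@continuousSM_emon R i). Qed.

(** Both arguments are approximated by polynomials, one after the other, [xray_bound] carrying the
    convergence to the transforms; the case of monomials is [inner_emon0]. *)
Lemma orthogonal_freq f g k (j : nat) F G : L2d f -> L2d g -> hol_limit g ->
  xray (freq f k) F -> xray (freq g (k + 2 * j.+1%:Z)) G ->
  inner leb2 (@influx R) F G = 0.
Proof.
set k' := k + _; move=> Lf Lg [tn lg] xF xG.
have [_ [_ LF] _] := xF; have [_ [_ LG] _] := xG.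
have [sn _ lf] := @limL2_of_approx _ _ _ leb2 (@disk R) _ (fun=> True)
  (lext (@zmon R)) f (density_disk Lf).
have Lz s : L2d (lext (@zmon R) s) by apply: L2d_lext.
have Lh s : L2d (lext holmon s) by apply: L2_lext => // i; exact: L2d_zmon.
pose Fn n := lext (fun i => xray_integral (emon (i, k))) (sn n).
pose Gn n := lext (fun c => xray_integral (@emon R ((c, 0%N), k'))) (tn n).
have xFn n : xray (freq (lext (@zmon R) (sn n)) k) (Fn n).
  exact: (@xray_freq_lext _ id).
have xGn n : xray (freq (lext holmon (tn n)) k') (Gn n).
  exact: (@xray_freq_lext _ (fun c => (c, 0%N))).
have lF := xray_lim xFn xF (limL2_freq k (fun n => Lz (sn n)) Lf lf).
have lG := xray_lim xGn xG (limL2_freq k' (fun n => Lh (tn n)) Lg lg).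
have LFi i := L2_xemon (i, k); have LGi c := L2_xemon ((c, 0%N), k').
have LFn n : L2 leb2 (@influx R) (Fn n) := L2_lext mI (sn n) LFi.
have LGn n : L2 leb2 (@influx R) (Gn n) := L2_lext mI (tn n) LGi.
have z n : inner leb2 (@influx R) F (Gn n) = 0.
  apply: (limL2_inner mI LFn LF (LGn n) lF) => l.
  rewrite (inner_lext mI (sn l) (tn n) LFi LGi) big1// => x _; rewrite big1// => y _.
  by case: x => c [a b]; rewrite inner_emon0 mulr0.
rewrite (innerC mI LG LF) (limL2_inner mI LGn LG LF lG (c := 0)) ?rmorph0// => n.
by rewrite (innerC mI LF (LGn n)) z rmorph0.
Qed.

End orthogonality.

(** * Smooth functions and integration by parts *)

Section smooth_functions.
Variable R : realType.
Implicit Types (f g : R * R -> R) (v x : R * R).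

Lemma smooth_differentiable f x : smooth f -> differentiable f x.
Proof. by move=> h; exact: (h [::]). Qed.

Lemma smooth_derive f v : smooth f -> smooth (fun x => 'D_v f x).
Proof. by move=> h s x; have := h (rcons s v) x; rewrite -cats1 foldr_cat. Qed.

(* The algebra generated by a family of functions is differentiated inside
   itself as soon as the generators are: this gives smoothness by induction. *)
Inductive alg (B : (R * R -> R) -> Prop) : (R * R -> R) -> Prop :=
| alg_gen f : B f -> alg B f
| alg_add f g : alg B f -> alg B g -> alg B (fun x => f x + g x)
| alg_mul f g : alg B f -> alg B g -> alg B (fun x => f x * g x).

Lemma alg_smooth B : (forall f, B f -> (forall x, differentiable f x) /\
    forall v, alg B (fun x => 'D_v f x)) -> forall f, alg B f -> smooth f.
Proof.
move=> HB.
have dif f : alg B f -> forall x, differentiable f x.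
  elim=> [{}f /HB[]//|{}f g _ hf _ hg x|{}f g _ hf _ hg x].
  - exact: differentiableD.
  - exact: differentiableM.
have der f v : alg B f -> alg B (fun x => 'D_v f x).
  elim=> [{}f /HB[]//|{}f g af hf ag hg|{}f g af hf ag hg].
  - rewrite (_ : (fun x => _) = fun x => 'D_v f x + 'D_v g x); first exact: alg_add.
    by apply/funext => x; rewrite deriveD//; apply: diff_derivable; exact: dif.
  - rewrite (_ : (fun x => _) = fun x => f x * 'D_v g x + g x * 'D_v f x).
      by apply: alg_add; apply: alg_mul.
    by apply/funext => x; rewrite deriveM//; apply: diff_derivable; exact: dif.
move=> f af s x; apply: dif; elim: s => //= v s ih; exact: der.
Qed.

Lemma smooth_alg f : alg (@smooth R) f -> smooth f.
Proof.
apply: alg_smooth => {}f sf; split; first by move=> x; exact: smooth_differentiable.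
by move=> v; apply: alg_gen; exact: smooth_derive.
Qed.

Lemma smoothD f g : smooth f -> smooth g -> smooth (fun x => f x + g x).
Proof. by move=> sf sg; apply: smooth_alg; apply: alg_add; exact: alg_gen. Qed.

Lemma smoothM f g : smooth f -> smooth g -> smooth (fun x => f x * g x).
Proof. by move=> sf sg; apply: smooth_alg; apply: alg_mul; exact: alg_gen. Qed.

Lemma smooth_cst c : smooth (fun=> c : R).
Proof.
move=> s x.
have [e ->] : exists e, foldr (fun v (psi : R * R -> R) => 'D_v psi) (fun=> c) s = (fun=> e).
  elim: s => [|v s [e /= ->]]; first by exists c.
  by exists 0; apply/funext => y; exact: derive_cst.
exact: differentiable_cst.
Qed.

Lemma differentiable_fst x : differentiable (@fst R R) x.
Proof. by apply: linear_differentiable => y; exact: cvg_fst. Qed.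

Lemma differentiable_snd x : differentiable (@snd R R) x.
Proof. by apply: linear_differentiable => y; exact: cvg_snd. Qed.

Lemma derive_fst v x : 'D_v (@fst R R) x = v.1.
Proof.
rewrite deriveE; last exact: differentiable_fst.
by rewrite diff_lin// => y; exact: cvg_fst.
Qed.

Lemma derive_snd v x : 'D_v (@snd R R) x = v.2.
Proof.
rewrite deriveE; last exact: differentiable_snd.
by rewrite diff_lin// => y; exact: cvg_snd.
Qed.

Lemma smooth_fst : smooth (@fst R R).
Proof.
move=> s x; case/lastP: s => [|s v]; first exact: differentiable_fst.
rewrite -cats1 foldr_cat /=; rewrite (_ : 'D_v fst = fun=> v.1); first exact: smooth_cst.
by apply/funext => y; exact: derive_fst.
Qed.

Lemma smooth_snd : smooth (@snd R R).
Proof.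
move=> s x; case/lastP: s => [|s v]; first exact: differentiable_snd.
rewrite -cats1 foldr_cat /=; rewrite (_ : 'D_v snd = fun=> v.2); first exact: smooth_cst.
by apply/funext => y; exact: derive_snd.
Qed.

Lemma derive_comp (r dr : R -> R) (u : R * R -> R) v x :
  is_derive (u x) 1 r (dr (u x)) -> differentiable u x ->
  differentiable (fun x => r (u x)) x /\ 'D_v (fun x => r (u x)) x = dr (u x) * 'D_v u x.
Proof.
move=> dru du; have dr' : differentiable r (u x) by apply/derivable1_diffP; case: dru.
have dc : differentiable (fun x => r (u x)) x by exact: (differentiable_comp du dr').
split => //; rewrite !deriveE// (diff_comp du dr') /= diff1E//.
rewrite /GRing.scale /= mulrC; congr (_ * _).
by rewrite derive1E; apply: derive_val.
Qed.

Lemma smooth_comp (r : nat -> R -> R) (u : R * R -> R) :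
  (forall k (t : R), is_derive t 1 (r k) (r k.+1 t)) -> smooth u ->
  forall k, smooth (fun x => r k (u x)).
Proof.
move=> hr su k.
pose B f := smooth f \/ exists k, f = fun x => r k (u x).
apply: (@alg_smooth B); last by apply: alg_gen; right; exists k.
move=> f [sf|[l ->]].
  split; first by move=> x; exact: smooth_differentiable.
  by move=> v; apply: alg_gen; left; exact: smooth_derive.
have key v x := @derive_comp (r l) (r l.+1) u v x (hr l (u x)) (smooth_differentiable x su).
split=> [x|v]; first by case: (key 0 x).
rewrite (_ : (fun x => _) = fun x => r l.+1 (u x) * 'D_v u x); last first.
  by apply/funext => x; case: (key v x).
apply: alg_mul; apply: alg_gen; first by right; exists l.+1.
by left; exact: smooth_derive.
Qed.

End smooth_functions.

(** * The flat function exp(-c/t) and its derivatives *)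

Section flat_exponential.
Variable R : realType.
Variable c : R.
Hypothesis c0 : 0 < c.
Implicit Types (P : {poly R}) (t : R).

(** The polynomial factor in 1/t makes the class stable under derivation, so that all derivatives of
    exp(-c/t) are handled at once. *)
Definition flat P t : R := if 0 < t then P.[t^-1] * expR (- (c * t^-1)) else 0.

(** The exponential series gives (cs)^(n+1) <= (n+1)! e^(cs) for s = 1/t, hence one factor t to
    spare. The extra power n is what the induction on [P] increases. *)
Lemma flat_bound P (n : nat) : exists C : R, forall t, 0 < t ->
  `|P.[t^-1] * t^-1 ^+ n * expR (- (c * t^-1))| <= C * t.
Proof.
elim/poly_ind: P n => [|P a ih] n.
  by exists 0 => t _; rewrite horner0 !mul0r normr0.
have [C hC] := ih n.+1; pose C' := `|a| * (n.+1)`!%:R * c^-1 ^+ n.+1.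
exists (C + C') => t t0; rewrite !hornerE /= mulrDl.
set s := t^-1; have s0 : 0 < s by rewrite invr_gt0.
have cs : 0 <= c * s by rewrite mulr_ge0 ?ltW.
have e0 := expR_gt0 (- (c * s)).
rewrite !mulrDl; apply: (le_trans (ler_normD _ _)); apply: lerD.
  by have := hC t t0; rewrite -/s exprS mulrA.
rewrite !normrM (gtr0_norm e0) normrX (gtr0_norm s0) /C' -!mulrA ler_wpM2l//.
have f0 : 0 < (n.+1)`!%:R :> R by rewrite ltr0n fact_gt0.
have := @expR_ge1Dxn _ (c * s) n cs => h.
have {}h : (c * s) ^+ n.+1 <= (n.+1)`!%:R * expR (c * s).
  rewrite -ler_pdivrMl// mulrC; apply: le_trans h; rewrite -[leLHS]add0r lerD2r//.
rewrite expRN ler_pdivrMr ?expR_gt0//.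
have cX : 0 < c ^+ n.+1 by exact: exprn_gt0.
rewrite -(ler_pM2l (mulr_gt0 s0 cX)).
have -> : s * c ^+ n.+1 * s ^+ n = (c * s) ^+ n.+1 by rewrite exprMn [s ^+ n.+1]exprS; ring.
apply: (le_trans h); rewrite le_eqVlt; apply/orP; left; apply/eqP.
have st : s * t = 1 by rewrite mulVf// gt_eqF.
have cc : c ^+ n.+1 * c^-1 ^+ n.+1 = 1 by rewrite -exprMn divff ?gt_eqF// expr1n.
transitivity ((s * t) * (c ^+ n.+1 * c^-1 ^+ n.+1) * ((n.+1)`!%:R * expR (c * s))).
  by rewrite st cc !mul1r.
by ring.
Qed.

Lemma flat_continuous0 P : {for 0, continuous (flat P)}.
Proof.
have [C hC] := flat_bound P 0.
have C0 : 0 <= C by have := le_trans (normr_ge0 _) (hC 1 ltr01); rewrite mulr1.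
have f00 : flat P 0 = 0 by rewrite /flat ltxx.
apply/cvgrPdist_le => e e0; rewrite f00.
have C1 : 0 < C + 1 by lra.
near=> t; rewrite sub0r normrN /flat; case: ifPn => t0; last by rewrite normr0 ltW.
have := hC t t0; rewrite expr0 mulr1 => /le_trans; apply.
have : t < e / (C + 1) by near: t; apply: lt_nbhsl; rewrite divr_gt0.
rewrite ltr_pdivlMr// => h; nra.
Unshelve. all: by end_near. Qed.

(** With s = 1/t, the derivative of P(s) e^(-cs) in t is s^2 (c P(s) - P'(s)) e^(-cs). *)
Definition flat_next P := 'X^2 * (c *: P - P^`()).

Lemma flat_derive P t : is_derive t 1 (flat P) (flat (flat_next P) t).
Proof.
have [t0|t0|<-] := ltgtP 0 t.
- apply: (@near_eq_is_derive _ _ _ (fun t => P.[t^-1] * expR (- (c * t^-1)))).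
    by near=> s; rewrite /flat ifT//; near: s; exact: lt_nbhsr.
  have tn : t != 0 by rewrite gt_eqF.
  have di := is_deriveV tn (is_derive_id t 1).
  have dc : is_derive t 1 (fun t => - (c * t^-1)) (- (c * (- t ^- 2 *: 1))).
    by apply: is_deriveN; exact: is_derive_cstM.
  have dp := is_derive1_comp (is_derive_poly P t^-1) di.
  have de := is_derive1_comp (is_derive_expR _) dc.
  apply: (is_derive_eq (is_deriveM dp de)); rewrite /flat t0 /flat_next /= !hornerE /GRing.scale /=.
  by rewrite exprVn; ring.
- rewrite /flat ifF; last by rewrite ltNge ltW.
  apply: (@near_eq_is_derive _ _ _ (cst (0 : R))).
  by near=> s; rewrite ifF//; apply/negbTE; rewrite -leNgt ltW//; near: s; exact: lt_nbhsl.
(* At 0 the difference quotient of [flat P] is again flat, with the polynomial multiplied by 1/t,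
   and such functions are continuous at 0. *)
- apply/is_derive1_caratheodory; exists (flat ('X * P)); split.
  + move=> z; rewrite {2}/flat ltxx !subr0 /flat; case: ifPn => z0; rewrite ?mul0r//.
    by rewrite !hornerE /=; field; rewrite gt_eqF.
  + exact: flat_continuous0.
  + by rewrite /flat ltxx.
Unshelve. all: by end_near. Qed.

Definition flat_iter (k : nat) t := flat (iter k flat_next 1) t.

Lemma flat_iter_derive k t : is_derive t 1 (flat_iter k) (flat_iter k.+1 t).
Proof. exact: flat_derive. Qed.

End flat_exponential.

Lemma Rfubini_zero2 d1 d2 (T1 : measurableType d1) (T2 : measurableType d2)
    (R : realType) (m1 : {sigma_finite_measure set T1 -> \bar R})
    (m2 : {sigma_finite_measure set T2 -> \bar R}) (D1 : set T1) (D2 : set T2)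
    (f : T1 * T2 -> R) : measurable D1 -> measurable D2 ->
  (m1 \x m2)%E.-integrable (D1 `*` D2) (EFin \o f) ->
  (forall y, D2 y -> (\int[m1]_(x in D1) (f (x, y))%:E = 0)%E) ->
  \int[(m1 \x m2)%E]_(p in D1 `*` D2) f p = 0.
Proof.
move=> mD1 mD2 fi f0; have mDD : measurable (D1 `*` D2) by exact: measurableX.
have fi' := (integrable_mkcond _ mDD).1 fi.
rewrite /Rintegral integral_mkcond -integral21_prod_meas1// integral0_eq// => y _.
rewrite /fubini_G; have [yD|yD] := boolP (y \in D2).
  rewrite -[RHS](f0 y (set_mem yD)) [RHS]integral_mkcond; apply: eq_integral => x _.
  by rewrite slice_restrict /patch yD.
by rewrite integral0_eq// => x _; rewrite slice_restrict /patch (negbTE yD); case: ifP.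
Qed.

(** * Integration by parts for functions supported in the disk *)

Section smooth_on_disk.
Variable R : realType.
Local Notation leb1 := (@lebesgue_measure R).
Local Notation leb2 := (leb1 \x leb1)%E.
Implicit Types (f g : R * R -> R) (v x : R * R).

Lemma continuous_measurable2 f (D : set (plane R)) : continuous f ->
  measurable_fun D f.
Proof.
move=> cf; apply: measurable_funTS.
have cF : {within setT, continuous (fun p : R * R * R => f p.1)}.
  apply: continuous_subspaceT => p; apply: (@continuous_comp _ _ _ fst f); last exact: cf.
  exact: cvg_fst.
have mF := measurable_fun_within3 openT cF.
have m : measurable_fun setT (fun p : plane R => (p, 0) : bundle R) by exact: measurable_fun_pair.
exact: (measurableT_comp mF m).
Qed.

Lemma smooth_continuous f : smooth f -> continuous f.
Proof. by move=> sf x; apply: differentiable_continuous; exact: smooth_differentiable. Qed.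

Let box : set (R * R) := `[(-1 : R), 1] `*` `[(-1 : R), 1].

Lemma disk_box : @closed_disk R `<=` box.
Proof.
move=> x; rewrite /closed_disk /= => h; split; rewrite /= in_itv /=;
  have := sqr_ge0 x.1; have := sqr_ge0 x.2 => h1 h2; rewrite -ler_norml -(@ler_pXn2r _ 2%N)// ?nnegrE//
    expr1n real_normK ?num_real//; lra.
Qed.

Lemma continuous_box_bounded f : continuous f -> exists M, forall x, box x -> `|f x| <= M.
Proof.
move=> cf; have cK : compact box by apply: compact_setX; exact: segment_compact.
have [M [_ hM]] := compact_bounded (continuous_compact (continuous_subspaceT cf) cK).
exists (`|M| + 1) => p pb; apply: (hM (`|M| + 1)); last by exists p.
by rewrite (le_lt_trans (ler_norm _))// ltrDl.
Qed.

Lemma measurable_box : measurable (box : set (plane R)).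
Proof. by apply: measurableX; exact: measurable_itv. Qed.

Lemma continuous_box_integrable f : continuous f -> leb2.-integrable box (EFin \o f).
Proof.
move=> cf; have [M hM] := continuous_box_bounded cf.
apply: measurable_bounded_integrable; first exact: measurable_box.
- have mi : measurable (`[(-1 : R), 1]%classic : set (measurableTypeR R)) by exact: measurable_itv.
  rewrite [X in (X < _)%E](leb2_setX mi mi).
  rewrite lebesgue_measure_itv /= lte_fin; case: ifP => _; last by rewrite mule0.
  by rewrite -EFinB -EFinM ltry.
- exact: continuous_measurable2.
- exists M; split; first exact: num_real.
  by move=> y My x /hM /le_trans; apply; exact: ltW.
Qed.

Lemma derive_snd_line f (x y : R) : differentiable f (x, y) ->
  is_derive y 1 (fun t : R => f (x, t)) ('D_(0, 1) f (x, y)).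
Proof.
move=> df; have E : (fun h : R => h^-1 *: ((f \o shift (x, y)) (h *: ((0, 1) : R * R)) - f (x, y))) =
    (fun h : R => h^-1 *: (((fun t => f (x, t)) \o shift y) (h *: (1 : R)) - f (x, y))).
  apply/funext => t /=; by congr (_ *: (f (_, _) - _)); rewrite -[LHS]/(t * 0 + x) mulr0 add0r.
have d : derivable (fun t : R => f (x, t)) y 1.
  by have : derivable f (x, y) ((0, 1) : R * R) := diff_derivable df; rewrite /derivable E.
by apply: (DeriveDef d); rewrite /derive E.
Qed.

Lemma derive_fst_line f (x y : R) : differentiable f (x, y) ->
  is_derive x 1 (fun t : R => f (t, y)) ('D_(1, 0) f (x, y)).
Proof.
move=> df; have E : (fun h : R => h^-1 *: ((f \o shift (x, y)) (h *: ((1, 0) : R * R)) - f (x, y))) =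
    (fun h : R => h^-1 *: (((fun t => f (t, y)) \o shift x) (h *: (1 : R)) - f (x, y))).
  apply/funext => t /=; by congr (_ *: (f (_, _) - _)); rewrite -[LHS]/(t * 0 + y) mulr0 add0r.
have d : derivable (fun t : R => f (t, y)) x 1.
  by have : derivable f (x, y) ((1, 0) : R * R) := diff_derivable df; rewrite /derivable E.
by apply: (DeriveDef d); rewrite /derive E.
Qed.

Lemma continuous_slice2 (x : R) : continuous (fun y : R => (x, y)).
Proof. by apply: continuous_pair => z; [exact: cvg_cst|exact: cvg_id]. Qed.

Lemma continuous_slice1 (y : R) : continuous (fun x : R => (x, y)).
Proof. by apply: continuous_pair => z; [exact: cvg_id|exact: cvg_cst]. Qed.

Section compact_support.
Variables (f : R * R -> R) (K : set (R * R)).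
Hypotheses (sf : smooth f) (cK : compact K) (Kd : K `<=` @disk R)
  (f0 : forall x, ~ K x -> f x = 0).

Lemma derive_support v x : ~ K x -> 'D_v f x = 0.
Proof.
move=> Kx; rewrite -(derive_cst (0 : R) x v); apply: near_eq_derive.
have oK : open (~` K).
  by apply: closed_openC; apply: compact_closed => //; exact: (@Rhausdorff_prod R).
have := open_nbhs_nbhs (conj oK Kx); apply: filterS => y /f0; exact.
Qed.

Lemma integral_disk_box g : (forall x, ~ @disk R x -> g x = 0) ->
  \int[leb2]_(x in @disk R) g x = \int[leb2]_(x in box) g x.
Proof.
move=> g0; rewrite /Rintegral integral_mkcond [in RHS]integral_mkcond.
congr fine; apply: eq_integral => x _; rewrite /patch; case: ifPn => xd.
  by rewrite ifT//; apply/mem_set/disk_box/ltW; exact: (set_mem xd).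
by case: ifP => // _; rewrite g0//; move/negP: xd => h /mem_set.
Qed.

Let out (x : R * R) : (`|x.1| = 1 \/ `|x.2| = 1) -> f x = 0.
Proof.
move=> h; apply: f0 => /Kd; rewrite /disk /= -(real_normK (num_real x.1)) -(real_normK (num_real x.2)).
case: h => ->; rewrite expr1n => h.
- have := sqr_ge0 `|x.2|; lra.
- have := sqr_ge0 `|x.1|; lra.
Qed.

Let dout v x : ~ @disk R x -> 'D_v f x = 0.
Proof. by move=> h; apply: derive_support => /Kd. Qed.

Let cont v : continuous (fun x => 'D_v f x).
Proof. by apply: smooth_continuous; exact: smooth_derive. Qed.

(** The disk is enlarged to the square [-1, 1]^2, where the fundamental theorem of calculus applies
    on each vertical line: the sides of the square miss the open disk, so [f] vanishes there. *)
Lemma integral_derive_snd : \int[leb2]_(x in @disk R) 'D_(0, 1) f x = 0.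
Proof.
rewrite integral_disk_box; last by move=> x; exact: dout.
have mi : measurable (`[(-1 : R), 1]%classic : set (measurableTypeR R)) by exact: measurable_itv.
rewrite (@Rfubini_domains _ _ _ _ _ leb1 leb1 _ _ mi mi); last first.
  exact: (@continuous_box_integrable (fun x => 'D_(0, 1) f x) (@cont (0, 1))).
rewrite /Rintegral integral0_eq// => x _.
have c : continuous (fun y : R => 'D_(0, 1) f (x, y)).
  move=> y; apply: (@continuous_comp _ _ _ (fun y : R => (x, y)) (fun p => 'D_(0, 1) f p));
    last exact: cont.
  exact: continuous_slice2.
have dr (t : R) : is_derive t 1 (fun y : R => f (x, y)) ('D_(0, 1) f (x, t)).
  by apply: derive_snd_line; exact: smooth_differentiable.
have le : -1 <= 1 :> R by lra.
congr EFin; apply: (etrans (Rintegral_ftc le dr c)).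
by rewrite !out ?subrr//=; right; rewrite ?normrN normr1.
Qed.

Lemma integral_derive_fst : \int[leb2]_(x in @disk R) 'D_(1, 0) f x = 0.
Proof.
rewrite integral_disk_box; last by move=> x; exact: dout.
have mi : measurable (`[(-1 : R), 1]%classic : set (measurableTypeR R)) by exact: measurable_itv.
apply: (@Rfubini_zero2 _ _ _ _ _ leb1 leb1 _ _ _ mi mi).
  exact: (@continuous_box_integrable (fun x => 'D_(1, 0) f x) (@cont (1, 0))).
move=> y _.
have c : continuous (fun x : R => 'D_(1, 0) f (x, y)).
  move=> x; apply: (@continuous_comp _ _ _ (fun x : R => (x, y)) (fun p => 'D_(1, 0) f p));
    last exact: cont.
  exact: continuous_slice1.
have dr (t : R) : is_derive t 1 (fun x : R => f (x, y)) ('D_(1, 0) f (t, y)).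
  by apply: derive_fst_line; exact: smooth_differentiable.
have le : -1 <= 1 :> R by lra.
have ci := @continuous_integrable_itv R _ (-1) 1 c.
rewrite -[LHS]fineK; last exact: integrable_fin_num ci.
congr EFin; apply: (etrans (Rintegral_ftc le dr c)).
by rewrite !out ?subrr//=; left; rewrite ?normrN normr1.
Qed.

End compact_support.

End smooth_on_disk.

Lemma inner_limit d (T : measurableType d) (R : realType) (mu : {measure set T -> \bar R})
    (D : set T) (mD : measurable D) (un gn : nat -> T -> R[i]) u g p q :
  (forall n, L2 mu D (un n)) -> (forall n, L2 mu D (gn n)) -> L2 mu D u -> L2 mu D g ->
  L2 mu D p -> L2 mu D q -> limL2 mu D un u -> limL2 mu D gn g ->
  (forall n, inner mu D (un n) p = - inner mu D (gn n) q) ->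
  inner mu D u p = - inner mu D g q.
Proof.
move=> Ln Lgn Lu Lg Lp Lq lu lg wn.
apply/eqP; rewrite -subr_eq0 opprK; apply/eqP/nsq_eq0/eqP.
rewrite eq_le nsq_ge0 andbT; apply/ler_addgt0Pl => e e0; rewrite addr0.
set A := sqnorm mu D p; set B := sqnorm mu D q.
have A0 : 0 <= A by exact: sqnorm_ge0.
have B0 : 0 <= B by exact: sqnorm_ge0.
have e1 : 0 < e / (4 * (A + B + 1)) by rewrite divr_gt0//; lra.
have [n1 h1] := lu _ e1; have [n2 h2] := lg _ e1; pose n := maxn n1 n2.
have {}h1 := h1 n (leq_maxl _ _); have {}h2 := h2 n (leq_maxr _ _).
have c1' := cauchy_schwarz mD (L2B mD (Ln n) Lu) Lp.
have c2' := cauchy_schwarz mD (L2B mD (Lgn n) Lg) Lq.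
rewrite -/A in c1'; rewrite -/B in c2'.
rewrite innerBl// in c1'; rewrite innerBl// in c2'.
move: c1' c2'; rewrite wn.
set a := inner _ _ u _; set b := inner _ _ g _; set w := inner _ _ (gn n) _.
move=> c1' c2'.
have -> : a + b = - ((- w - a) + (w - b)) by ring.
rewrite nsqN; apply: (le_trans (nsqD_le _ _)).
have k1 : nsq (- w - a) <= e / (4 * (A + B + 1)) * A by apply: (le_trans c1'); rewrite ler_wpM2r.
have k2 : nsq (w - b) <= e / (4 * (A + B + 1)) * B by apply: (le_trans c2'); rewrite ler_wpM2r.
have k3 : e / (4 * (A + B + 1)) * A + e / (4 * (A + B + 1)) * B <= e / 4.
  have AB : 0 < 4 * (A + B + 1) by lra.
  rewrite -mulrDr mulrAC ler_pdivrMr//.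
  rewrite (_ : e / 4 * (4 * (A + B + 1)) = e * (A + B + 1)); last by field.
  by rewrite ler_pM2l//; lra.
by move: k1 k2 k3; lra.
Qed.

(** * First-order operators and weak derivatives *)

Section complex_smooth.
Variable R : realType.
Local Notation leb1 := (@lebesgue_measure R).
Local Notation leb2 := (leb1 \x leb1)%E.
Local Notation L2d := (L2 leb2 (@disk R)).
Implicit Types (f g phi : R * R -> R[i]) (v x : R * R) (c : R[i]).

Let mD := @measurable_disk R.

Lemma csmoothD f g : csmooth f -> csmooth g -> csmooth (fun x => f x + g x).
Proof.
move=> [a b] [c d]; split.
- by under eq_fun do rewrite ReD; exact: smoothD.
- by under eq_fun do rewrite ImD; exact: smoothD.
Qed.

Lemma smoothN (h : R * R -> R) : smooth h -> smooth (fun x => - h x).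
Proof.
move=> sh; have := smoothM (smooth_cst (-1 : R)) sh.
by congr smooth; apply/funext => x; rewrite mulN1r.
Qed.

Lemma csmoothM f g : csmooth f -> csmooth g -> csmooth (fun x => f x * g x).
Proof.
move=> [a b] [c d]; split.
- under eq_fun do rewrite ReM; apply: smoothD; first exact: smoothM.
  by apply: smoothN; exact: smoothM.
- by under eq_fun do rewrite ImM; apply: smoothD; exact: smoothM.
Qed.

Lemma csmooth_cst c : csmooth (fun=> c).
Proof. by split; exact: smooth_cst. Qed.

Lemma csmooth_conj f : csmooth f -> csmooth (fun x => conjc (f x)).
Proof.
move=> [a b]; split.
- by under eq_fun do rewrite Re_conjc.
- by under eq_fun do rewrite Im_conjc; exact: smoothN.
Qed.

Lemma csmooth_real (h : R * R -> R) : smooth h -> csmooth (fun x => (h x)%:C).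
Proof. by move=> sh; split => //=; exact: smooth_cst. Qed.

Lemma csmooth_zc : csmooth (@zc R).
Proof. by split; [exact: smooth_fst|exact: smooth_snd]. Qed.

Lemma csmoothX f n : csmooth f -> csmooth (fun x => f x ^+ n).
Proof.
move=> sf; elim: n => [|n ih]; first by under eq_fun do rewrite expr0; exact: csmooth_cst.
by under eq_fun do rewrite exprS; exact: csmoothM.
Qed.

Lemma csmooth_zmon i : csmooth (@zmon R i).
Proof.
by apply: csmoothM; apply: csmoothX; [|apply: csmooth_conj]; exact: csmooth_zc.
Qed.

Lemma csmooth_lext I (F : I -> R * R -> R[i]) s : (forall i, csmooth (F i)) ->
  csmooth (lext F s).
Proof.
move=> sF; elim: s => [|t s ih].
  by rewrite (_ : lext F [::] = fun=> 0); [exact: csmooth_cst|apply/funext => x; rewrite lext_nil].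
rewrite (_ : lext F (t :: s) = fun x => t.1 * F t.2 x + lext F s x).
  by apply: csmoothD => //; apply: csmoothM => //; exact: csmooth_cst.
by apply/funext => x; rewrite lext_cons.
Qed.

Lemma partialD v f g x : csmooth f -> csmooth g ->
  partial v (fun x => f x + g x) x = partial v f x + partial v g x.
Proof.
move=> [a b] [c d]; rewrite /partial; apply: complex_eq; rewrite !ReImE /=.
- rewrite (_ : (fun y => _) = (fun x => complex.Re (f x)) \+ (fun x => complex.Re (g x))); last first.
    by apply/funext => y; rewrite ReD.
  by rewrite deriveD//; apply: diff_derivable; exact: smooth_differentiable.
- rewrite (_ : (fun y => _) = (fun x => complex.Im (f x)) \+ (fun x => complex.Im (g x))); last first.
    by apply/funext => y; rewrite ImD.
  by rewrite deriveD//; apply: diff_derivable; exact: smooth_differentiable.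
Qed.

Lemma derive_prod v (f g : R * R -> R) x : smooth f -> smooth g ->
  'D_v (fun x => f x * g x) x = f x * 'D_v g x + g x * 'D_v f x.
Proof. by move=> sf sg; rewrite deriveM//; apply: diff_derivable; exact: smooth_differentiable. Qed.

Lemma derive_addf v (f g : R * R -> R) x : smooth f -> smooth g ->
  'D_v (fun x => f x + g x) x = 'D_v f x + 'D_v g x.
Proof. by move=> sf sg; rewrite deriveD//; apply: diff_derivable; exact: smooth_differentiable. Qed.

Lemma derive_subf v (f g : R * R -> R) x : smooth f -> smooth g ->
  'D_v (fun x => f x - g x) x = 'D_v f x - 'D_v g x.
Proof. by move=> sf sg; rewrite deriveB//; apply: diff_derivable; exact: smooth_differentiable. Qed.

Lemma partialM v f g x : csmooth f -> csmooth g ->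
  partial v (fun x => f x * g x) x = partial v f x * g x + f x * partial v g x.
Proof.
move=> [a b] [c d]; rewrite /partial; apply: complex_eq.
- rewrite ReD !ReM [LHS]/= (_ : (fun y => _) = fun x => complex.Re (f x) * complex.Re (g x) -
  complex.Im (f x) * complex.Im (g x)).
    rewrite derive_subf ?derive_prod//; try exact: smoothM.
    by rewrite /=; ring.
  by apply/funext => y; rewrite ReM.
- rewrite ImD !ImM [LHS]/= (_ : (fun y => _) = fun x => complex.Re (f x) * complex.Im (g x) +
  complex.Im (f x) * complex.Re (g x)).
    rewrite derive_addf ?derive_prod//; try exact: smoothM.
    by rewrite /=; ring.
  by apply/funext => y; rewrite ImM.
Qed.

Lemma partial_cst v c x : partial v (fun=> c) x = 0.
Proof. by rewrite /partial !derive_cst. Qed.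

Lemma partial_zc v x : partial v (@zc R) x = v.1 +i* v.2.
Proof. by rewrite /partial derive_fst derive_snd. Qed.

Lemma partial_conj v f x : csmooth f ->
  partial v (fun x => conjc (f x)) x = conjc (partial v f x).
Proof.
move=> [a b]; rewrite /partial; apply: complex_eq; rewrite ?Re_conjc ?Im_conjc /=.
- by congr ('D_v _ x); apply/funext => y; rewrite Re_conjc.
- rewrite (_ : (fun y => _) = - (fun x => complex.Im (f x))).
    by rewrite deriveN//; apply: diff_derivable; exact: smooth_differentiable.
  by apply/funext => y; rewrite Im_conjc.
Qed.

Lemma csmooth_partial v f : csmooth f -> csmooth (partial v f).
Proof. by move=> [a b]; split; exact: smooth_derive. Qed.

Lemma csmooth_continuous f : csmooth f ->
  continuous (fun x => complex.Re (f x)) /\ continuous (fun x => complex.Im (f x)).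
Proof. by move=> [a b]; split; exact: smooth_continuous. Qed.

Lemma csmooth_cmeas f : csmooth f -> cmeas (@disk R : set (plane R)) f.
Proof.
by move=> /csmooth_continuous[a b]; split; exact: continuous_measurable2.
Qed.

Lemma csmooth_bounded f : csmooth f -> exists M, forall x, disk x -> nsq (f x) <= M.
Proof.
move=> /csmooth_continuous[a b].
have c : continuous (fun x => complex.Re (f x) * complex.Re (f x) + complex.Im (f x) * complex.Im
  (f x)).
  by move=> x; apply: cvgD; apply: cvgM; first [exact: a|exact: b].
have [M hM] := continuous_box_bounded c.
exists M => x /ltW /disk_box /hM; apply: le_trans; rewrite /nsq !expr2; exact: ler_norm.
Qed.

Lemma csmooth_L2 f : csmooth f -> L2d f.
Proof.
move=> sf; have [M hM] := csmooth_bounded sf.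
have fin : (leb2 (@disk R) < +oo)%E by exact: leb_disk_fin.
by have [] := bounded_L2 mD fin (csmooth_cmeas sf) hM.
Qed.

(** The operators [del], [delbar], [partialx], [partialy] are instances. *)
Definition fstorder c1 c2 f : R * R -> R[i] := fun x => c1 * partialx f x + c2 * partialy f x.

Section first_order.
Variables c1 c2 : R[i].
Local Notation P := (fstorder c1 c2).

Lemma fstorderM f g x : csmooth f -> csmooth g ->
  P (fun x => f x * g x) x = P f x * g x + f x * P g x.
Proof.
move=> sf sg; rewrite /fstorder /partialx /partialy !partialM//.
by move: (partial _ f x) (partial _ f x) (partial _ g x) (partial _ g x) => *; ring.
Qed.

Lemma fstorderD f g x : csmooth f -> csmooth g ->
  P (fun x => f x + g x) x = P f x + P g x.
Proof.
move=> sf sg; rewrite /fstorder /partialx /partialy !partialD//.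
by move: (partial _ f x) (partial _ f x) (partial _ g x) (partial _ g x) => *; ring.
Qed.

Lemma fstorder_cst c x : P (fun=> c) x = 0.
Proof. by rewrite /fstorder /partialx /partialy !partial_cst !mulr0 addr0. Qed.

Lemma fstorderZ c f x : csmooth f -> P (fun x => c * f x) x = c * P f x.
Proof.
by move=> sf; rewrite fstorderM//; [rewrite fstorder_cst mul0r add0r|exact: csmooth_cst].
Qed.

Lemma fstorderX f n x : csmooth f -> P (fun x => f x ^+ n) x = n%:R * f x ^+ n.-1 * P f x.
Proof.
move=> sf; elim: n => [|n ih].
  by under eq_fun do rewrite expr0; rewrite fstorder_cst !mul0r.
under eq_fun do rewrite exprS; rewrite fstorderM//; last exact: csmoothX.
rewrite ih; case: n {ih} => [|n]; first by rewrite expr0; ring.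
by rewrite /= exprS -[n.+2%:R]natr1; ring.
Qed.

Lemma csmooth_fstorder f : csmooth f -> csmooth (P f).
Proof.
move=> sf; apply: csmoothD; apply: csmoothM; try exact: csmooth_cst; exact: csmooth_partial.
Qed.

Lemma fstorder_zmon a b x : P (@zmon R (a, b)) x =
  a%:R * zmon (a.-1, b) x * P (@zc R) x + b%:R * zmon (a, b.-1) x * P (fun x => conjc (zc x)) x.
Proof.
have sz := csmooth_zc; have szc := csmooth_conj sz.
rewrite /zmon /= fstorderM; [|exact: csmoothX..].
by rewrite !fstorderX//; ring.
Qed.

Lemma fstorder_lext I (F : I -> R * R -> R[i]) s x : (forall i, csmooth (F i)) ->
  P (lext F s) x = lext (fun i => P (F i)) s x.
Proof.
move=> sF; elim: s => [|t s ih].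
  by rewrite (_ : lext F [::] = fun=> 0) ?fstorder_cst ?lext_nil//; apply/funext => y; rewrite lext_nil.
rewrite (_ : lext F (t :: s) = fun x => t.1 * F t.2 x + lext F s x); last first.
  by apply/funext => y; rewrite lext_cons.
rewrite fstorderD; [|by apply: csmoothM => //; exact: csmooth_cst|exact: csmooth_lext].
by rewrite lext_cons ih fstorderZ.
Qed.

Lemma test_L2 phi : test_function phi -> L2d phi /\ L2d (P phi).
Proof. by move=> [sp _]; split; apply: csmooth_L2 => //; exact: csmooth_fstorder. Qed.

Lemma integral_test phi : test_function phi -> cintegral leb2 (@disk R) (P phi) = 0.
Proof.
move=> [sp [K [cK Kd p0]]]; have [sR sI] := sp.
have pR x : ~ K x -> complex.Re (phi x) = 0 by move/p0 => ->.
have pI x : ~ K x -> complex.Im (phi x) = 0 by move/p0 => ->.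
have Lp v : cintegrable leb2 (@disk R) (partial v phi).
  have L1 : L2d (fun=> 1) by apply: csmooth_L2; exact: csmooth_cst.
  have := L2M_integrable mD (csmooth_L2 (csmooth_partial v sp)) L1.
  by under eq_fun do rewrite mulr1.
have zx : cintegral leb2 (@disk R) (partialx phi) = 0.
  by rewrite /cintegral /partialx /partial /= (integral_derive_fst sR cK Kd pR)
    (integral_derive_fst sI cK Kd pI).
have zy : cintegral leb2 (@disk R) (partialy phi) = 0.
  by rewrite /cintegral /partialy /partial /= (integral_derive_snd sR cK Kd pR)
    (integral_derive_snd sI cK Kd pI).
rewrite /fstorder cintegralD//; [|exact: (cintegrableZ mD _ (Lp _))..].
by rewrite (cintegralZ mD _ (Lp _)) (cintegralZ mD _ (Lp _)) zx zy !mulr0 addr0.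
Qed.

Lemma test_mul u phi : csmooth u -> test_function phi -> test_function (fun x => u x * phi x).
Proof.
move=> su [sp [K [cK Kd p0]]]; split; first exact: csmoothM.
by exists K; split => // x Kx; rewrite p0// mulr0.
Qed.

Lemma weakly_smooth u : csmooth u -> weakly P u (P u).
Proof.
move=> su phi tp; have [Lphi LP] := test_L2 tp; have [sp _] := tp.
have Lu := csmooth_L2 su; have LPu := csmooth_L2 (csmooth_fstorder su).
have i1 := L2M_integrable mD LPu Lphi; have i2 := L2M_integrable mD Lu LP.
have E : cintegral leb2 (@disk R) (P (fun x => u x * phi x)) =
    cintegral leb2 (@disk R) (fun x => P u x * phi x + u x * P phi x).
  by apply: eq_cintegral => x _; exact: fstorderM.
have := integral_test (test_mul su tp); rewrite E (cintegralD mD i1 i2).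
by move=> /eqP; rewrite addr_eq0 => /eqP ->; rewrite opprK.
Qed.

(** Weak derivatives are closed under L^2 limits: for a fixed test function, both sides are inner
    products against a fixed L^2 function. All membership in H^1 is obtained in this way. *)
Lemma weakly_limit (un gn : nat -> R * R -> R[i]) u g :
  (forall n, csmooth (un n)) -> (forall n x, disk x -> P (un n) x = gn n x) ->
  (forall n, L2d (gn n)) -> L2d u -> L2d g ->
  limL2 leb2 (@disk R) un u -> limL2 leb2 (@disk R) gn g -> weakly P u g.
Proof.
move=> sn Pn Lgn Lu Lg lu lg phi tp; have [Lphi LP] := test_L2 tp.
have Ln n := csmooth_L2 (sn n).
have E f h : cintegral leb2 (@disk R) (fun x => f x * h x) = inner leb2 (@disk R) f (fun x => conjc
  (h x)).
  by apply: eq_cintegral => x _; rewrite conjcK.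
have Lc : L2d (fun x => conjc (phi x)) := L2conj mD Lphi.
have LPc : L2d (fun x => conjc (P phi x)) := L2conj mD LP.
(* both pairings are limits of those of [un n], which agree by parts *)
have wn n : inner leb2 (@disk R) (un n) (fun x => conjc (P phi x)) =
    - inner leb2 (@disk R) (gn n) (fun x => conjc (phi x)).
  rewrite -!E (weakly_smooth (sn n) tp); congr (- _).
  by apply: eq_cintegral => x xd; rewrite Pn.
rewrite !E; exact: (inner_limit mD Ln Lgn Lu Lg LPc Lc lu lg wn).
Qed.

End first_order.

Lemma delE : @del R = fstorder 2^-1 (- (2^-1 * (0 +i* 1))).
Proof. by apply/funext => f; apply/funext => x; rewrite /del /fstorder; ring. Qed.

Lemma delbarE : @delbar R = fstorder 2^-1 (2^-1 * (0 +i* 1)).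
Proof. by apply/funext => f; apply/funext => x; rewrite /delbar /fstorder; ring. Qed.

Lemma partialxE : @partialx R = fstorder 1 0.
Proof. by apply/funext => f; apply/funext => x; rewrite /fstorder; ring. Qed.

Lemma partialyE : @partialy R = fstorder 0 1.
Proof. by apply/funext => f; apply/funext => x; rewrite /fstorder; ring. Qed.

Lemma fstorder_zc c1 c2 x : fstorder c1 c2 (@zc R) x = c1 + c2 * (0 +i* 1).
Proof.
by rewrite /fstorder /partialx /partialy !partial_zc /=; congr (_ + _); rewrite -[RHS]mulr1.
Qed.

Lemma fstorder_zcc c1 c2 x : fstorder c1 c2 (fun x => conjc (@zc R x)) x = c1 - c2 * (0 +i* 1).
Proof.
rewrite /fstorder /partialx /partialy !partial_conj; [|exact: csmooth_zc..].
by rewrite !partial_zc; apply: complex_eq; rewrite !ReImE /=; ring.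
Qed.

Lemma del_zmon a b x : del (@zmon R (a, b)) x = a%:R * zmon (a.-1, b) x.
Proof.
rewrite delE fstorder_zmon fstorder_zc fstorder_zcc.
have ii : (0 +i* 1) * (0 +i* 1) = - 1 :> R[i] by apply: complex_eq; rewrite !ReImE /=; ring.
have -> : 2^-1 + - (2^-1 * (0 +i* 1)) * (0 +i* 1) = 1 :> R[i].
  by rewrite mulNr -mulrA ii; field.
have -> : 2^-1 - - (2^-1 * (0 +i* 1)) * (0 +i* 1) = 0 :> R[i].
  by rewrite mulNr -mulrA ii; field.
by rewrite mulr1 mulr0 addr0.
Qed.

Lemma delbar_zmon a b x : delbar (@zmon R (a, b)) x = b%:R * zmon (a, b.-1) x.
Proof.
rewrite delbarE fstorder_zmon fstorder_zc fstorder_zcc.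
have ii : (0 +i* 1) * (0 +i* 1) = - 1 :> R[i] by apply: complex_eq; rewrite !ReImE /=; ring.
have -> : 2^-1 + 2^-1 * (0 +i* 1) * (0 +i* 1) = 0 :> R[i] by rewrite -mulrA ii; field.
have -> : 2^-1 - 2^-1 * (0 +i* 1) * (0 +i* 1) = 1 :> R[i] by rewrite -mulrA ii; field.
by rewrite mulr1 mulr0 add0r.
Qed.

End complex_smooth.

(** * The Bergman projection *)

Section bounded_convergence.
Context d (T : measurableType d) (R : realType).
Variables (mu : {measure set T -> \bar R}) (D : set T).
Hypotheses (mD : measurable D) (muD : (mu D < +oo)%E).

Lemma bounded_limL2 (fn : nat -> T -> R[i]) f (C : R) :
  (forall n, cmeas D (fn n)) -> cmeas D f ->
  (forall n x, D x -> nsq (fn n x - f x) <= C) ->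
  (forall x (e : R), D x -> 0 < e -> exists n0, forall n, (n0 <= n)%N -> nsq (fn n x - f x) <= e) ->
  limL2 mu D fn f.
Proof.
move=> mfn mf bd pt e e0.
pose k n x := (nsq (fn n x - f x))%:E.
have mk n : measurable_fun D (k n).
  by apply/measurable_EFinP; apply: measurable_nsq; exact: cmeasB.
have k0 x : D x -> (k n x @[n --> \oo] --> 0%E).
  move=> Dx; apply: cvg_EFin; first exact: nearW.
  apply/cvgrPdist_le => r r0; have [n0 h] := pt x r Dx r0.
  by exists n0 => // n /= /h; rewrite sub0r normrN ger0_norm ?nsq_ge0.
have gi : mu.-integrable D (fun x => `|C|%:E).
  apply/integrableP; split; first exact: measurable_cst.
  by rewrite integral_cst//= lte_mul_pinfty// lee_fin.
have kg x n : D x -> (`|k n x| <= `|C|%:E)%E.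
  by move=> Dx; rewrite lee_fin ger0_norm ?nsq_ge0// (le_trans (bd n x Dx))// ler_norm.
have [_ _] := dominated_convergence mD mk (measurable_cst _) (aeW _ k0) gi
  (aeW _ (fun x n => kg x n)).
rewrite integral0.
move=> /fine_cvgP[_] /cvgrPdist_le /(_ e e0) [n0 _ h]; exists n0 => n /h /=.
by rewrite sub0r normrN => /(le_trans (ler_norm _)).
Qed.

End bounded_convergence.

(** * Test functions approaching (1 - |z|^2) z^a conj(z)^b *)

Section holomorphic_moments.
Variable R : realType.
Local Notation leb1 := (@lebesgue_measure R).
Local Notation leb2 := (leb1 \x leb1)%E.
Local Notation L2d := (L2 leb2 (@disk R)).
Local Notation Nd := (sqnorm leb2 (@disk R)).
Local Notation innd := (inner leb2 (@disk R)).
Implicit Types (f g h : R * R -> R[i]) (x : R * R) (a b n : nat).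

Let mD := @measurable_disk R.

Let r2 x : R := x.1 ^+ 2 + x.2 ^+ 2.

Section cutoff.
Variable c : R.
Hypothesis c0 : 0 < c.

(** t e^(-c/t) for t > 0: a smooth version of max(t, 0) at distance at most c, whose derivative
    [dcutoff] stays between 0 and 1 and tends to 1 at every t > 0 as c tends to 0. *)
Definition cutoff (t : R) := t * flat_iter c 0 t.

Definition dcutoff (t : R) := flat_iter c 0 t + t * flat_iter c 1 t.

Lemma cutoff_le0 t : t <= 0 -> cutoff t = 0.
Proof. by move=> t0; rewrite /cutoff /flat_iter /flat ltNge t0 mulr0. Qed.

Lemma dcutoff_le0 t : t <= 0 -> dcutoff t = 0.
Proof. by move=> t0; rewrite /dcutoff /flat_iter /flat ltNge t0 mulr0 addr0. Qed.

Lemma cutoffE t : 0 < t -> cutoff t = t * expR (- (c / t)).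
Proof. by move=> t0; rewrite /cutoff /flat_iter /flat t0 /= hornerC mul1r. Qed.

Lemma dcutoffE t : 0 < t -> dcutoff t = (1 + c / t) * expR (- (c / t)).
Proof.
move=> t0; have h0 : flat_iter c 0 t = expR (- (c / t)).
  by rewrite /flat_iter /flat t0 /= hornerC mul1r.
have h1 : flat_iter c 1 t = t^-1 ^+ 2 * c * expR (- (c / t)).
  rewrite /flat_iter /flat t0 /= /flat_next -polyC1 derivC subr0.
  by rewrite hornerM hornerXn hornerZ hornerC mulr1.
by rewrite /dcutoff h0 h1; field; rewrite gt_eqF.
Qed.

Lemma cutoff_near t : `|cutoff t - Num.max t 0| <= c.
Proof.
have [t0|t0] := leP t 0; first by rewrite cutoff_le0// subrr normr0 ltW.
rewrite cutoffE// -[X in _ - X]mulr1 -mulrBr normrM gtr0_norm//.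
have ct : 0 < c / t by rewrite divr_gt0.
have h1 : 1 - c / t <= expR (- (c / t)) by exact: expR_ge1Dx.
have h2 : expR (- (c / t)) <= 1 by rewrite expR_le1 oppr_le0 ltW.
rewrite distrC ger0_norm ?subr_ge0//.
have e : t * (c / t) = c by rewrite mulrC divfK// gt_eqF.
by rewrite -[leRHS]e ler_pM2l//; lra.
Qed.

Lemma dcutoff_itv t : 0 <= dcutoff t <= 1.
Proof.
have [t0|t0] := leP t 0; first by rewrite dcutoff_le0// lexx ler01.
have ct : 0 < c / t by rewrite divr_gt0.
rewrite dcutoffE// mulr_ge0 ?expR_ge0//=; last lra.
by rewrite expRN ler_pdivrMr ?expR_gt0// mul1r expR_ge1Dx.
Qed.

Lemma dcutoff_near t : 0 < t -> `|dcutoff t - 1| <= (c / t) ^+ 2.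
Proof.
move=> t0; have ct : 0 < c / t by rewrite divr_gt0.
have /andP[_ h] := dcutoff_itv t; rewrite ler0_norm ?subr_le0// dcutoffE//.
have h1 : 1 - c / t <= expR (- (c / t)) by exact: expR_ge1Dx.
have : (1 + c / t) * (1 - c / t) <= (1 + c / t) * expR (- (c / t)).
  by rewrite ler_pM2l//; lra.
by rewrite (_ : (1 + c / t) * (1 - c / t) = 1 - (c / t) ^+ 2); [lra|ring].
Qed.

(** The shift by [c] confines the support of [cutoff (cut x)] to |z|^2 <= 1 - c, a compact subset of
    the open disk. *)
Definition cut x : R := 1 - c - r2 x.

Lemma smooth_cut : smooth cut.
Proof.
have sr : smooth r2.
  rewrite (_ : r2 = fun x => x.1 * x.1 + x.2 * x.2).
    by apply: smoothD; apply: smoothM; first [exact: smooth_fst|exact: smooth_snd].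
  by apply/funext => x; rewrite /r2 !expr2.
by apply: smoothD; [exact: smooth_cst|exact: smoothN].
Qed.

Lemma smooth_flat k : smooth (fun x => flat_iter c k (cut x)).
Proof. by apply: smooth_comp; [exact: flat_iter_derive|exact: smooth_cut]. Qed.

Lemma smooth_cutoff : smooth (fun x => cutoff (cut x)).
Proof. by apply: smoothM; [exact: smooth_cut|exact: smooth_flat]. Qed.

Lemma derive_cutoff v x : 'D_v (fun x => cutoff (cut x)) x = dcutoff (cut x) * 'D_v cut x.
Proof.
rewrite derive_prod; [|exact: smooth_cut|exact: smooth_flat].
have [_ ->] := derive_comp v (flat_iter_derive c0 0 (cut x)) (smooth_differentiable x smooth_cut).
by rewrite /dcutoff; ring.
Qed.

Lemma delbar_cut x : delbar (fun x => (cut x)%:C) x = - @zmon R (1, 0) x.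
Proof.
have E : (fun x => (cut x)%:C) = fun x => (1 - c)%:C + (-1) * @zmon R (1%N, 1%N) x.
  apply/funext => y; rewrite /zmon /= !expr1; apply: complex_eq; rewrite !ReImE /= /cut /r2 ?expr2;
    ring.
have sz := @csmooth_zmon R (1%N, 1%N).
have smz : csmooth (fun x => (-1) * @zmon R (1%N, 1%N) x) by apply: csmoothM => //; exact: csmooth_cst.
rewrite E delbarE fstorderD//; last exact: csmooth_cst.
by rewrite fstorder_cst fstorderZ// -delbarE delbar_zmon mul1r add0r mulN1r.
Qed.

Lemma delbar_cutoff x : delbar (fun x => (cutoff (cut x))%:C) x = - ((dcutoff (cut x))%:C * @zmon R
  (1, 0) x).
Proof.
have E v : partial v (fun x => (cutoff (cut x))%:C) x =
    (dcutoff (cut x))%:C * partial v (fun x => (cut x)%:C) x.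
  by rewrite /partial /= derive_cutoff !derive_cst; apply: complex_eq;
    rewrite !ReImE /= ?mulr0 ?mul0r ?addr0 ?subr0.
rewrite -mulrN -delbar_cut /delbar /partialx /partialy !E.
move: (partial _ _ x) (partial _ _ x) => p q; ring.
Qed.

Definition test_zmon a b x : R[i] := (cutoff (cut x))%:C * zmon (a, b) x.

Lemma test_zmon_test a b : c < 1 -> test_function (test_zmon a b).
Proof.
move=> c1; split.
  by apply: csmoothM; [exact: csmooth_real smooth_cutoff|exact: csmooth_zmon].
exists [set x | x.1 ^+ 2 + x.2 ^+ 2 <= 1 - c]; split.
- have cc : continuous (fun x : R * R => x.1 * x.1 + x.2 * x.2).
    by move=> x; apply: cvgD; apply: cvgM; first [exact: cvg_fst|exact: cvg_snd].
  apply: (subclosed_compact _ (@compact_closed_disk R)).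
    have := (continuous_closedP _).1 cc `]-oo, (1 - c)]%classic (@interval_closed _ -oo%O (BRight
      (1 - c)) isT isT).
    by congr closed; apply/seteqP; split => x /=; rewrite in_itv /= !expr2.
  by move=> x /= h; apply: (le_trans h); rewrite gerBl ltW.
- by move=> x /= h; apply: (le_lt_trans h); rewrite gtrBl.
- move=> x /= /negP; rewrite -ltNge => h.
  by rewrite /test_zmon cutoff_le0 ?mul0r// /cut /r2; move: h; lra.
Qed.

Lemma delbar_test a b x : delbar (test_zmon a b) x =
  b%:R * (cutoff (cut x))%:C * zmon (a, b.-1) x - (dcutoff (cut x))%:C * zmon (a.+1, b) x.
Proof.
rewrite /test_zmon delbarE fstorderM; [|exact: csmooth_real smooth_cutoff|exact: csmooth_zmon].
rewrite -delbarE delbar_cutoff delbar_zmon /zmon /= exprS expr1 expr0; ring.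
Qed.

End cutoff.

Lemma zmon_disk_bd i x : disk x -> nsq (@zmon R i x) <= 1.
Proof. by case: i => a b /ltW h; apply: nsq_zmon. Qed.

(** The limit is [delbar] of (1 - |z|^2) z^a conj(z)^b: on the disk, the cutoff tends to 1 - |z|^2
    and its derivative to 1, boundedly. *)
Lemma test_limit a b : limL2 leb2 (@disk R)
  (fun n => delbar (test_zmon (n.+2%:R^-1) a b))
  (fun x => b%:R * zmon (a, b.-1) x - b%:R * zmon (a.+1, b) x - zmon (a.+1, b) x).
Proof.
pose c n : R := n.+2%:R^-1.
have c0 n : 0 < c n by rewrite invr_gt0.
have c1 n : c n < 1 by rewrite invf_lt1// ltr1n.
have cs n : csmooth (test_zmon (c n) a b).
  by case: (test_zmon_test (c0 n) a b (c1 n)).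
have cg : csmooth (fun x => b%:R * zmon (a, b.-1) x - b%:R * zmon (a.+1, b) x - zmon (a.+1, b) x :
  R[i]).
  have sz i : csmooth (@zmon R i) := @csmooth_zmon R i.
  have N' f : csmooth f -> csmooth (fun x => - f x).
    move=> sf; have := csmoothM (csmooth_cst (-1)) sf.
    by congr csmooth; apply/funext => x; rewrite mulN1r.
  apply: csmoothD; last exact: N'.
  by apply: csmoothD; [|apply: N']; apply: csmoothM => //; exact: csmooth_cst.
have fin : (leb2 (@disk R) < +oo)%E by exact: leb_disk_fin.
have rd x : disk x -> 0 < 1 - r2 x by rewrite subr_gt0.
have E n x : delbar (test_zmon (c n) a b) x -
    (b%:R * zmon (a, b.-1) x - b%:R * zmon (a.+1, b) x - zmon (a.+1, b) x) =
    b%:R * (cutoff (c n) (cut (c n) x) - (1 - r2 x))%:C * zmon (a, b.-1) x -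
    (dcutoff (c n) (cut (c n) x) - 1)%:C * zmon (a.+1, b) x.
  rewrite delbar_test// !rmorphB /= rmorph1.
  have -> : b%:R * zmon (a.+1, b) x = (r2 x)%:C * (b%:R * zmon (a, b.-1) x) :> R[i].
    case: (b) => [|b']; first by rewrite !mul0r mulr0.
    rewrite /zmon [(a.+1, _).1]/= [(a.+1, _).2]/= [(a, _).1]/= [(a, _).2]/= exprS exprSr.
    have -> : (r2 x)%:C = zc x * conjc (zc x).
      by apply: complex_eq; rewrite !ReImE /= /r2 ?expr2; ring.
    by ring.
  by ring.
have bd n x : disk x -> nsq (delbar (test_zmon (c n) a b) x -
    (b%:R * zmon (a, b.-1) x - b%:R * zmon (a.+1, b) x - zmon (a.+1, b) x)) <=
    2 * b%:R ^+ 2 * (2 * c n) ^+ 2 + 2 * (dcutoff (c n) (cut (c n) x) - 1) ^+ 2.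
  move=> xd; rewrite E; apply: (le_trans (nsqD_le _ _)); apply: lerD.
    rewrite -[leRHS]mulrA ler_pM2l// nsqM nsqM nsq_real (_ : nsq b%:R = b%:R ^+ 2); last first.
      by rewrite -(rmorph_nat (real_complex R)) nsq_real.
    rewrite -[leRHS]mulr1; apply: ler_pM; [by apply: mulr_ge0;
      exact: sqr_ge0|exact: nsq_ge0| |exact: zmon_disk_bd].
    rewrite ler_wpM2l ?sqr_ge0// -[leLHS]real_normK ?num_real// lerXn2r ?nnegrE//.
      by rewrite mulr_ge0// ltW.
    have h1 := cutoff_near (c0 n) (cut (c n) x).
    have h2 : `|Num.max (cut (c n) x) 0 - (1 - r2 x)| <= c n.
      have h4 := rd x xd; have h5 := c0 n; rewrite /cut; have [h3|h3] := leP (1 - c n - r2 x) 0.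
        by rewrite sub0r normrN ger0_norm; lra.
      by rewrite (_ : _ - _ = - c n) ?normrN ?ger0_norm//; [lra|ring].
    rewrite (_ : _ - (1 - r2 x) = (cutoff (c n) (cut (c n) x) - Num.max (cut (c n) x) 0) +
      (Num.max (cut (c n) x) 0 - (1 - r2 x))); last by ring.
    by apply: (le_trans (ler_normD _ _)); lra.
  rewrite nsqN nsqM nsq_real ler_pM2l//.
  by rewrite ler_piMr ?sqr_ge0//; exact: zmon_disk_bd.
apply: (@bounded_limL2 _ _ _ _ _ mD fin _ _ (8 * b%:R ^+ 2 + 2)).
- move=> n; apply: csmooth_cmeas; rewrite delbarE; exact: (csmooth_fstorder _ _ (cs n)).
- exact: csmooth_cmeas.
- move=> n x xd; apply: (le_trans (bd n x xd)); apply: lerD.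
    have b0 : 0 <= b%:R ^+ 2 :> R by exact: sqr_ge0.
    have : (2 * c n) ^+ 2 <= 4 by have := c0 n; have := c1 n; rewrite expr2; nra.
    move=> h; rewrite (_ : 8 * b%:R ^+ 2 = 2 * b%:R ^+ 2 * 4); last by ring.
    by rewrite ler_wpM2l// mulr_ge0.
  have /andP[h1 h2] := dcutoff_itv (c0 n) (cut (c n) x).
  by rewrite ler_piMr// expr2; nra.
- move=> x e xd e0; have := rd x xd; set u := 1 - r2 x => u0.
  have b0 : 0 <= b%:R ^+ 2 :> R by exact: sqr_ge0.
  (* The final error is at most [c n * K]: the first term of [bd] gives 8 b^2 c because (2c)^2 <=
     4c, the second gives 2s = 4c/u. *)
  pose K : R := 8 * b%:R ^+ 2 + 4 / u.
  have K0 : 0 < K by rewrite /K ltr_wpDl ?divr_gt0// mulr_ge0.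
  have m0 : 0 < Num.min (u / 2) (e / K) by rewrite lt_min !divr_gt0.
  have [n0 _ hn0] := near_infty_natSinv_lt (PosNum m0); exists n0 => n nn.
  have cn : c n < Num.min (u / 2) (e / K).
    apply: le_lt_trans (hn0 n nn); rewrite /c lef_pV2 ?posrE//.
    by rewrite ler_nat.
  move: cn; rewrite lt_min => /andP[cu ce].
  have cp := c0 n; have c1n := c1 n.
  apply: (le_trans (bd n x xd)).
  have cut0 : u / 2 <= cut (c n) x by rewrite /cut -addrAC -/u; lra.
  have cutp : 0 < cut (c n) x by apply: lt_le_trans cut0; rewrite divr_gt0.
  pose s := 2 * c n / u.
  have s0 : 0 <= s by rewrite divr_ge0 ?mulr_ge0// ltW.
  have s1 : s <= 1 by rewrite ler_pdivrMr//; lra.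
  have k1 : c n / cut (c n) x <= s.
    rewrite /s ler_pdivrMr// mulrAC ler_pdivlMr//; nra.
  have k0 : 0 <= c n / cut (c n) x by rewrite divr_ge0// ltW.
  have k2 : (dcutoff (c n) (cut (c n) x) - 1) ^+ 2 <= s.
    have h := dcutoff_near cp cutp.
    rewrite -real_normK ?num_real//.
    have h2 : `|dcutoff (c n) (cut (c n) x) - 1| <= s by apply: (le_trans h); rewrite expr2; nra.
    have h3 := normr_ge0 (dcutoff (c n) (cut (c n) x) - 1).
    by rewrite expr2; nra.
  have k3 : (2 * c n) ^+ 2 <= 4 * c n by rewrite expr2; nra.
  have k4 : c n * K <= e by rewrite -ler_pdivlMr// ltW.
  apply: le_trans k4; rewrite /K mulrDr; apply: lerD.
    rewrite (_ : c n * (8 * b%:R ^+ 2) = 2 * b%:R ^+ 2 * (4 * c n)); last by ring.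
    by rewrite ler_wpM2l// mulr_ge0.
  rewrite (_ : c n * (4 / u) = 2 * s); last by rewrite /s; ring.
  by rewrite ler_pM2l.
Qed.

End holomorphic_moments.

(** * Moments of holomorphic functions and projection onto them *)

Section bergman_projection.
Variable R : realType.
Local Notation leb1 := (@lebesgue_measure R).
Local Notation leb2 := (leb1 \x leb1)%E.
Local Notation L2d := (L2 leb2 (@disk R)).
Local Notation Nd := (sqnorm leb2 (@disk R)).
Local Notation innd := (inner leb2 (@disk R)).
Implicit Types (f g h : R * R -> R[i]) (x : R * R) (a b n : nat).

Let mD := @measurable_disk R.

Let Lz i : L2d (@zmon R i) := L2d_zmon R i.

Lemma zmon_conj a b x : conjc (@zmon R (a, b) x) = zmon (b, a) x.
Proof.
rewrite -[RHS]/(zc x ^+ b * conjc (zc x) ^+ a) -[zmon _ _]/(zc x ^+ a * conjc (zc x) ^+ b).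
by move: (zc x) => z;
  rewrite -[conjc (_ * _)]/((z ^+ a * conjc z ^+ b)^*)%C rmorphM !rmorphXn -[RHS]mulrC;
  congr (_ * _); rewrite [X in X ^+ b](conjcK z).
Qed.

Lemma conjc_nat n : conjc (n%:R : R[i]) = n%:R.
Proof. exact: rmorph_nat. Qed.

Lemma conjc_comb n (p q : R[i]) :
  conjc (n%:R * p - n%:R * q - q) = n%:R * conjc p - n%:R * conjc q - conjc q.
Proof. by rewrite !rmorphB !rmorphM !rmorph_nat. Qed.

(** The weak equation tested against (1 - |z|^2) z^a conj(z)^b. The exponents are exchanged because
    [inner] conjugates its second argument. *)
Lemma weakly_hol_moment f a b : L2d f -> weakly (@delbar R) f (fun=> 0) ->
  b%:R * innd f (zmon (b.-1, a)) = b.+1%:R * innd f (zmon (b, a.+1)).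
Proof.
move=> Lf wf.
pose t n := test_zmon (n.+2%:R^-1 : R) a b.
have c0 n : 0 < (n.+2%:R^-1 : R) by rewrite invr_gt0.
have c1 n : (n.+2%:R^-1 : R) < 1 by rewrite invf_lt1// ltr1n.
have tt n : test_function (t n) := test_zmon_test (c0 n) a b (c1 n).
have Lt n : L2d (delbar (t n)) by rewrite delbarE; case: (test_L2 2^-1 (2^-1 * (0 +i* 1)) (tt n)).
pose G x := b%:R * zmon (a, b.-1) x - b%:R * zmon (a.+1, b) x - zmon (a.+1, b) x : R[i].
pose Gc x := b%:R * zmon (b.-1, a) x - b%:R * zmon (b, a.+1) x - zmon (b, a.+1) x : R[i].
have GE x : conjc (G x) = Gc x.
  rewrite /Gc -(zmon_conj a b.-1 x) -(zmon_conj a.+1 b x) /G.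
  exact: conjc_comb.
have L1 : L2d (fun x => b%:R * @zmon R (b.-1, a) x) := L2Z mD _ (Lz _).
have L2' : L2d (fun x => b%:R * @zmon R (b, a.+1) x) := L2Z mD _ (Lz _).
have LGc : L2d Gc by apply: L2B => //; exact: L2B.
have lim : limL2 leb2 (@disk R) (fun n x => conjc (delbar (t n) x)) Gc.
  have <- : (fun x => conjc (G x)) = Gc by apply/funext.
  exact: (limL2_conj (@test_limit R a b)).
have z n : innd (fun x => conjc (delbar (t n) x)) f = 0.
  have := wf _ (tt n); have -> : cintegral leb2 (@disk R) (fun x => 0 * t n x) = 0.
    by transitivity (cintegral leb2 (@disk R) (fun=> 0)); [apply: eq_cintegral => x _;
      rewrite mul0r|exact: cintegral0].
  rewrite oppr0.
  move=> E; rewrite innerC//; last exact: L2conj.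
  rewrite (_ : innd f _ = 0) ?rmorph0// -E.
  by apply: eq_cintegral => x _; rewrite conjcK.
have := limL2_inner mD (fun n => L2conj mD (Lt n)) LGc Lf lim z.
move=> z0; have {}z0 : innd f Gc = 0 by rewrite (innerC mD LGc Lf) z0 rmorph0.
move: z0; rewrite /Gc (innerBr mD (L2B mD L1 L2') (Lz _) Lf) (innerBr mD L1 L2' Lf).
rewrite (innerZr mD _ (Lz _) Lf) (innerZr mD _ (Lz _) Lf) !conjc_nat => /eqP.
by rewrite subr_eq0 subr_eq => /eqP ->; rewrite -natr1 mulrDl mul1r addrC.
Qed.

(** The ratio of the squared norms of z^a and z^(a-b), which is the coefficient of z^a conj(z)^b
    along z^(a-b). If b > a, the monomial is orthogonal to all powers of z. *)
Definition gcoef (i : nat * nat) : R[i] :=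
  if (i.2 <= i.1)%N then (i.1 - i.2).+1%:R / i.1.+1%:R else 0.

Lemma gcoef_conj i : conjc (gcoef i) = gcoef i.
Proof.
by rewrite /gcoef; case: ifP => _; rewrite ?rmorph0// fmorph_div /= !conjc_nat.
Qed.

(* The Bergman projection of a monomial. *)
Definition gmon (i : nat * nat) : R * R -> R[i] := fun x => gcoef i * holmon (i.1 - i.2)%N x.

Lemma L2_holmon n : L2d (@holmon R n). Proof. exact: Lz. Qed.

Lemma L2_gmon i : L2d (gmon i). Proof. exact: L2Z (L2_holmon _). Qed.

(** Orthogonality to every monomial minus its projection: the only feature of holomorphic functions
    that the projection estimates use. *)
Definition hol_moments h := L2d h /\ forall i, innd h (zmon i) = innd h (gmon i).

(** Induction on b: [weakly_hol_moment] lowers both exponents by 1 until b = 0, or until a = 0 < b,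
    where the moment vanishes; [gcoef] is the product of the ratios met on the way. *)
Lemma weakly_hol_moments f : L2d f -> weakly (@delbar R) f (fun=> 0) -> hol_moments f.
Proof.
move=> Lf wf; split => // -[a b]; rewrite /gmon innerZr//; last exact: L2_holmon.
rewrite gcoef_conj; elim: b a => [|b ih] a.
  by rewrite /gcoef /= subn0 divff ?natC0// mul1r.
have h := weakly_hol_moment b a Lf wf.
apply: (mulfI (natC0 R a)); rewrite -h {h}.
case: a => [|a].
  by rewrite /gcoef /= mul0r mul0r mulr0.
rewrite [a.+1.-1]/= ih /gcoef /= ltnS subSS; case: ifP => // ba; last by rewrite !mul0r !mulr0.
rewrite /holmon; move: (natC0 R a) (natC0 R a.+1); move: (innd f _) => I.
move: (a.+1%:R : R[i]) (a.+2%:R : R[i]) => A B A0 B0; field.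
by rewrite A0 B0.
Qed.

Lemma delbar_holmon n x : delbar (@holmon R n) x = 0.
Proof. by rewrite /holmon delbar_zmon mul0r. Qed.

Lemma hol_moments_holmon n : hol_moments (@holmon R n).
Proof.
apply: weakly_hol_moments; first exact: L2_holmon.
have := weakly_smooth 2^-1 (2^-1 * (0 +i* 1)) (@csmooth_zmon R (n, 0%N)).
rewrite -delbarE => h phi /h ->; congr (- _); apply: eq_cintegral => x _.
by rewrite -/(holmon n) delbar_holmon.
Qed.

Lemma hol_moments_lext h s : hol_moments h -> innd h (lext (@zmon R) s) = innd h (lext gmon s).
Proof.
move=> [Lh hm].
have LB s' : L2d (lext (@zmon R) s') := L2_lext mD s' Lz.
have LG s' : L2d (lext gmon s') := L2_lext mD s' L2_gmon.
rewrite (innerC mD (LB s) Lh) (innerC mD (LG s) Lh); congr conjc.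
rewrite /lext (inner_suml mD s (fun t => L2Z mD t.1 (Lz t.2)) Lh).
rewrite (inner_suml mD s (fun t => L2Z mD t.1 (L2_gmon t.2)) Lh); apply: eq_bigr => t _;
  rewrite (innerZl mD t.1 (Lz _) Lh) (innerZl mD t.1 (L2_gmon _) Lh).
by rewrite (innerC mD Lh (Lz _)) (innerC mD Lh (L2_gmon _)) hm.
Qed.

Definition glist (s : seq (R[i] * (nat * nat))) : seq (R[i] * nat) :=
  [seq (t.1 * gcoef t.2, (t.2.1 - t.2.2)%N) | t <- s].

Lemma lext_gmon s : lext gmon s = lext (@holmon R) (glist s).
Proof.
by apply/funext => x; rewrite /lext big_map; apply: eq_bigr => t _; rewrite /gmon mulrA.
Qed.

Lemma hol_moments_B f g : hol_moments f -> hol_moments g -> hol_moments (fun x => f x - g x).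
Proof.
move=> [Lf hf] [Lg hg]; split; first exact: L2B.
by move=> i; rewrite (innerBl mD Lf Lg (Lz i)) (innerBl mD Lf Lg (L2_gmon i)) hf hg.
Qed.

Lemma hol_moments_hlext (s : seq (R[i] * nat)) : hol_moments (lext (@holmon R) s).
Proof.
have LH (t : R[i] * nat) : L2d (fun x => t.1 * @holmon R t.2 x) := L2Z mD t.1 (L2_holmon t.2).
split; first exact: (L2_lext mD s L2_holmon).
move=> i; rewrite /lext (inner_suml mD s LH (Lz i)) (inner_suml mD s LH (L2_gmon i)).
apply: eq_bigr => t _; rewrite (innerZl mD t.1 (L2_holmon t.2) (Lz i)).
rewrite (innerZl mD t.1 (L2_holmon t.2) (L2_gmon i)).
by case: (hol_moments_holmon t.2) => _ ->.
Qed.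

Lemma hol_moments_gext s : hol_moments (lext gmon s).
Proof. by rewrite lext_gmon; exact: hol_moments_hlext. Qed.

(** The contraction property of an orthogonal projection [f] of [g], in a form that requires neither
    a closed subspace nor a projection operator. *)
Lemma sqnorm_le_of_inner f g : L2d f -> L2d g -> innd f f = innd f g -> Nd f <= Nd g.
Proof.
move=> Lf Lg E; have := cauchy_schwarz mD Lf Lg; rewrite -E inner_self// nsq_real.
have := sqnorm_ge0 leb2 (@disk R) f; rewrite le_eqVlt => /orP[/eqP <-|n0]; first by rewrite sqnorm_ge0.
by rewrite expr2 ler_pM2l.
Qed.

Lemma projection_le s : Nd (lext gmon s) <= Nd (lext (@zmon R) s).
Proof.
have LB : L2d (lext (@zmon R) s) := L2_lext mD s Lz.
have LG : L2d (lext gmon s) := L2_lext mD s L2_gmon.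
apply: sqnorm_le_of_inner => //.
by rewrite (hol_moments_lext s (hol_moments_gext s)).
Qed.

Lemma projection_sub_le s :
  Nd (fun x => lext (@zmon R) s x - lext gmon s x) <= Nd (lext (@zmon R) s).
Proof.
have LB : L2d (lext (@zmon R) s) := L2_lext mD s Lz.
have LG : L2d (lext gmon s) := L2_lext mD s L2_gmon.
have LD := L2B mD LB LG; apply: sqnorm_le_of_inner => //.
rewrite (innerBr mD LB LG LD); apply/eqP; rewrite subr_eq -subr_eq0; apply/eqP.
rewrite -[LHS]addr0 opprD addrA subrr add0r addr0; apply/eqP; rewrite oppr_eq0; apply/eqP.
rewrite innerBl// (innerC mD LG LB) (hol_moments_lext s (hol_moments_gext s)) inner_self//.
by rewrite (_ : conjc (Nd (lext gmon s))%:C = (Nd (lext gmon s))%:C) ?subrr//; apply: complex_eq;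
  rewrite /= ?oppr0.
Qed.

(** Approximate [f] by polynomials in z and conj(z) and project them: since [f] and the projections
    have holomorphic moments, the projection is at least as close to [f]. *)
Theorem weakly_hol_limit f : L2d f -> weakly (@delbar R) f (fun=> 0) -> hol_limit f.
Proof.
move=> Lf wf; have hf := weakly_hol_moments Lf wf.
have [sn _ lf] := @limL2_of_approx _ _ _ leb2 (@disk R) _ (fun=> True)
  (lext (@zmon R)) f (density_disk Lf).
exists (fun n => glist (sn n)) => e /lf[n0 h]; exists n0 => n /h {}h.
apply: le_trans h; rewrite -lext_gmon sqnormBC [leRHS]sqnormBC.
set s := sn n.
have LB : L2d (lext (@zmon R) s) := L2_lext mD s Lz.
have LG : L2d (lext gmon s) := L2_lext mD s L2_gmon.
have hd := hol_moments_B hf (hol_moments_gext s); have [Ld _] := hd.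
have Lp := L2B mD Lf LB.
apply: (sqnorm_le_of_inner Ld Lp); rewrite (innerBr mD Lf LG Ld) (innerBr mD Lf LB Ld).
by rewrite (hol_moments_lext s hd).
Qed.

Theorem hol_limit_weakly f : L2d f -> hol_limit f -> weakly (@delbar R) f (fun=> 0).
Proof.
move=> Lf [sn lf]; rewrite delbarE.
apply: (@weakly_limit _ _ _ (fun n => lext (@holmon R) (sn n)) (fun n x => 0)) => //.
- by move=> n; apply: csmooth_lext => i; exact: csmooth_zmon.
- move=> n x _; rewrite fstorder_lext; last by move=> i; exact: csmooth_zmon.
  by rewrite /lext big1// => t _; rewrite -delbarE delbar_holmon mulr0.
- by move=> n; exact: L2_0.
- exact: L2_0.
- by apply: limL2_const; rewrite (eq_sqnorm _ (g := fun=> 0)) ?sqnorm0// => x _; rewrite subrr.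
Qed.

End bergman_projection.

(** * Lowering the frequency *)

Section gram_forms.
Context d (T : measurableType d) d' (T' : measurableType d') (R : realType).
Variables (mu : {measure set T -> \bar R}) (D : set T).
Variables (mu' : {measure set T' -> \bar R}) (D' : set T').
Hypotheses (mD : measurable D) (mD' : measurable D').
Local Notation L2m := (L2 mu D).
Local Notation Nm := (sqnorm mu D).
Local Notation innm := (inner mu D).

Lemma real_complex_inj (a b : R) : a%:C = b%:C -> a = b.
Proof. by case. Qed.

Lemma inner_diff (c e : R[i]) f1 f2 g1 g2 : L2m f1 -> L2m f2 -> L2m g1 -> L2m g2 ->
  innm (fun x => c * (f1 x - f2 x)) (fun x => e * (g1 x - g2 x)) =
  c * conjc e * (innm f1 g1 - innm f2 g1 - (innm f1 g2 - innm f2 g2)).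
Proof.
move=> L1 L2' M1 M2; have Lf := L2B mD L1 L2'; have Lg := L2B mD M1 M2.
rewrite (innerZl mD _ Lf (L2Z mD _ Lg)) (innerZr mD _ Lg Lf).
by rewrite (innerBr mD M1 M2 Lf) (innerBl mD L1 L2' M1) (innerBl mD L1 L2' M2) mulrA.
Qed.

Variables (I : Type).
Implicit Types s : seq (R[i] * I).

(** The norm of a combination depends on the Gram matrix alone, so an identity between pairs of
    monomials becomes an identity of norms. *)
Lemma gram_eq (B : I -> T -> R[i]) (F : I -> T' -> R[i]) s :
  (forall i, L2m (B i)) -> (forall i, L2 mu' D' (F i)) ->
  (forall i j, innm (B i) (B j) = inner mu' D' (F i) (F j)) ->
  Nm (lext B s) = sqnorm mu' D' (lext F s).
Proof.
move=> LB LF E; apply: real_complex_inj.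
rewrite -(inner_self mD (L2_lext mD s LB)) -(inner_self mD' (L2_lext mD' s LF)).
rewrite (inner_lext mD s s LB LB) (inner_lext mD' s s LF LF).
by apply: eq_bigr => x _; apply: eq_bigr => y _; rewrite E.
Qed.

(** A Poincare inequality from a Gram identity. The model is the integral of del(z |v|^2), which
    vanishes when v does on the boundary, with U = z del v, Z = z v and W = delbar v. Cauchy-Schwarz
    on the last two terms gives |v|^4 <= 4 K |v|^2. *)
Lemma gram_poincare (V U Z W : I -> T -> R[i]) s (K : R) :
  (forall i, L2m (V i)) -> (forall i, L2m (U i)) ->
  (forall i, L2m (Z i)) -> (forall i, L2m (W i)) ->
  (forall i j, innm (V i) (V j) + innm (U i) (V j) + innm (Z i) (W j) = 0) ->
  Nm (lext U s) <= K -> Nm (lext Z s) <= Nm (lext V s) -> Nm (lext W s) <= K ->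
  Nm (lext V s) <= 4 * K.
Proof.
move=> LV LU LZ LW E hU hZ hW.
have lV := L2_lext mD s LV; have lU := L2_lext mD s LU.
have lZ := L2_lext mD s LZ; have lW := L2_lext mD s LW.
have E0 : innm (lext V s) (lext V s) + innm (lext U s) (lext V s) + innm (lext Z s) (lext W s) = 0.
  rewrite (inner_lext mD s s LV LV) (inner_lext mD s s LU LV) (inner_lext mD s s LZ LW).
  rewrite -!big_split big1// => x _; rewrite -!big_split big1// => y _ /=.
  by rewrite -!mulrDr E mulr0.
have c1 := cauchy_schwarz mD lU lV; have c2 := cauchy_schwarz mD lZ lW.
have /(congr1 (@nsq R)) : innm (lext V s) (lext V s) =
    - (innm (lext U s) (lext V s) + innm (lext Z s) (lext W s)).
  by apply/eqP; rewrite -subr_eq0 opprK addrA E0.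
rewrite inner_self// nsq_real nsqN => e2.
have := nsqD_le (innm (lext U s) (lext V s)) (innm (lext Z s) (lext W s)); rewrite -e2.
have := sqnorm_ge0 mu D (lext V s); have := sqnorm_ge0 mu D (lext U s);
  have := sqnorm_ge0 mu D (lext W s).
have := sqnorm_ge0 mu D (lext Z s).
move: (Nm (lext U s)) (Nm (lext Z s)) (Nm (lext V s)) (Nm (lext W s)) hU hZ hW c1 c2 => nU nZ nV nW.
move=> hU hZ hW c1 c2 z0 w0 u0 v0 h.
have h1 : nU * nV <= K * nV by rewrite ler_wpM2r.
have h2 : nZ * nW <= nV * K by rewrite ler_pM.
have h3 : nV * nV <= 4 * K * nV by move: h; rewrite expr2; lra.
move: v0; rewrite le_eqVlt => /orP[/eqP <-|v0]; last by rewrite -(ler_pM2r v0).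
by rewrite mulr_ge0// (le_trans u0).
Qed.

End gram_forms.

Section diagonal_forms.
Variable R : realType.
Implicit Types (s : seq (R[i] * nat)) (phi : nat -> R).

(** A list may repeat an index, so coefficients have to be collected before an orthogonal family can
    be used. *)
Definition coefsum s n : R[i] := \sum_(t <- s | t.2 == n) t.1.

Lemma diagonal_form s phi (M : nat) : (forall t, t \in s -> (t.2 < M)%N) ->
  \sum_(x <- s) \sum_(y <- s) x.1 * conjc y.1 * (if x.2 == y.2 then (phi x.2)%:C else 0) =
  (\sum_(n < M) phi n * nsq (coefsum s n))%:C.
Proof.
move=> sM; have E x y : x \in s -> x.1 * conjc y.1 * (if x.2 == y.2 then (phi x.2)%:C else 0) =
    \sum_(n < M) (phi n)%:C * ((if x.2 == n then x.1 else 0) * conjc (if y.2 == n then y.1 else 0))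
      :> R[i].
  move=> xs; rewrite (bigD1 (Ordinal (sM _ xs)))//= eqxx big1 ?addr0; last first.
    by move=> n nx; rewrite ifN ?mul0r ?mulr0//; apply: contra nx => /eqP e; apply/eqP/val_inj.
  by rewrite (eq_sym x.2); case: ifP => _; rewrite ?rmorph0 ?mulr0// mulrC.
transitivity (\sum_(x <- s) \sum_(y <- s) \sum_(n < M)
    (phi n)%:C * ((if x.2 == n then x.1 else 0) * conjc (if y.2 == n then y.1 else 0)) : R[i]).
  by apply: eq_big_seq => x xs; apply: eq_bigr => y _; exact: E.
under eq_bigr do rewrite exchange_big /=.
rewrite exchange_big rmorph_sum; apply: eq_bigr => n _ /=.
have -> : (phi n * nsq (coefsum s n))%:C = (phi n)%:C * (coefsum s n * conjc (coefsum s n)).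
  move: (coefsum s n) => z; apply: complex_eq; rewrite !ReImE /= /nsq; ring.
rewrite /coefsum (big_mkcond (fun t : R[i] * nat => t.2 == n)) rmorph_sum mulr_suml mulr_sumr.
apply: eq_bigr => x _; rewrite !mulr_sumr; apply: eq_bigr => y _ //.
Qed.

Context d (T : measurableType d) d' (T' : measurableType d').
Variables (mu : {measure set T -> \bar R}) (D : set T).
Variables (mu' : {measure set T' -> \bar R}) (D' : set T').
Hypotheses (mD : measurable D) (mD' : measurable D').

Lemma diagonal_le (F : nat -> T -> R[i]) (G : nat -> T' -> R[i]) phi gam (C : R) s :
  (forall n, L2 mu D (F n)) -> (forall n, L2 mu' D' (G n)) ->
  (forall i j, inner mu D (F i) (F j) = if i == j then (phi i)%:C else 0) ->
  (forall i j, inner mu' D' (G i) (G j) = if i == j then (gam i)%:C else 0) ->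
  (forall n, gam n <= C * phi n) ->
  sqnorm mu' D' (lext G s) <= C * sqnorm mu D (lext F s).
Proof.
move=> LF LG EF EG le; pose M := (\max_(t <- s) t.2).+1.
have sM t : t \in s -> (t.2 < M)%N by move=> ts; rewrite ltnS;
  apply: (@leq_bigmax_seq _ s predT (fun t : R[i] * nat => t.2) t ts).
have NF : sqnorm mu D (lext F s) = \sum_(n < M) phi n * nsq (coefsum s n).
  apply: real_complex_inj; rewrite -(inner_self mD (L2_lext mD s LF)) (inner_lext mD s s LF LF).
  rewrite -(diagonal_form phi sM); apply: eq_bigr => x _; apply: eq_bigr => y _; by rewrite EF.
have NG : sqnorm mu' D' (lext G s) = \sum_(n < M) gam n * nsq (coefsum s n).
  apply: real_complex_inj; rewrite -(inner_self mD' (L2_lext mD' s LG)) (inner_lext mD' s s LG LG).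
  rewrite -(diagonal_form gam sM); apply: eq_bigr => x _; apply: eq_bigr => y _; by rewrite EG.
rewrite NF NG mulr_sumr; apply: ler_sum => n _.
by rewrite mulrA ler_wpM2r// nsq_ge0.
Qed.

End diagonal_forms.

(** * Gram matrices of monomials and of their derivatives *)

Section monomial_forms.
Variable R : realType.
Local Notation leb1 := (@lebesgue_measure R).
Local Notation leb2 := (leb1 \x leb1)%E.
Local Notation L2d := (L2 leb2 (@disk R)).
Local Notation Nd := (sqnorm leb2 (@disk R)).
Local Notation innd := (inner leb2 (@disk R)).
Implicit Types (f g h : R * R -> R[i]) (x : R * R) (i j : nat * nat) (a b m n : nat).

Let mD := @measurable_disk R.

Let Lz i : L2d (@zmon R i) := L2d_zmon R i.

Definition disk_area : R := Nd (fun=> 1).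

Lemma holmon0 x : @holmon R 0 x = 1.
Proof. by rewrite /holmon /zmon [X in X * _]expr0 [X in _ * X]expr0 mulr1. Qed.

Lemma zmonM i j x : @zmon R i x * conjc (zmon j x) = zmon ((i.1 + j.2)%N, (i.2 + j.1)%N) x.
Proof.
case: i j => a b [c e]; rewrite (zmon_conj c e x).
by rewrite /zmon [RHS]/= /= !exprD mulrACA.
Qed.

Lemma inner_zmonE i j : innd (zmon i) (zmon j) = innd (@zmon R ((i.1 + j.2)%N, (i.2 + j.1)%N))
  (holmon 0).
Proof.
apply: eq_cintegral => x _; rewrite zmonM.
by rewrite holmon0 rmorph1 mulr1.
Qed.

Lemma inner_holmon0 : innd (@holmon R 0) (holmon 0) = disk_area%:C.
Proof.
rewrite inner_self//; last exact: Lz.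
by congr (_%:C); apply: eq_sqnorm => x _; rewrite holmon0.
Qed.

(** The constant 1 has holomorphic moments, so the recursion already proved computes integrals of
    monomials and takes the place of polar coordinates. *)
Lemma inner_holmon0_zmon a b : innd (@holmon R 0) (zmon (a, b)) =
  gcoef R (a, b) * innd (@holmon R 0) (holmon (a - b)).
Proof.
have [_ h] := hol_moments_holmon R 0; transitivity (innd (@holmon R 0) (gmon (a, b))); first exact: h.
transitivity (conjc (gcoef R (a, b)) * innd (@holmon R 0) (holmon (a - b))).
  exact: (innerZr mD (gcoef R (a, b)) (L2_holmon R (a - b)) (L2_holmon R 0)).
by congr (_ * _); exact: gcoef_conj.
Qed.

Lemma inner_holmon0_holmon n : innd (@holmon R 0) (holmon n) = if n == 0%N then disk_area%:C else 0.
Proof.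
case: n => [|n]; first exact: inner_holmon0.
transitivity (conjc (innd (@holmon R n.+1) (holmon 0))).
  exact: (innerC mD (Lz (n.+1, 0%N)) (Lz (0%N, 0%N))).
have -> : innd (@holmon R n.+1) (holmon 0) = innd (@holmon R 0) (zmon (0, n.+1)%N).
  have := inner_zmonE (n.+1, 0%N) (0%N, 0%N); have := inner_zmonE (0%N, 0%N) (0%N, n.+1).
  move: n.+1 => m; rewrite [((0%N, 0%N).1 + _)%N]add0n [((m, 0%N).1 + _)%N]addn0 => <- h.
  exact: h.
have -> : innd (@holmon R 0) (zmon (0, n.+1)%N) = 0.
  by rewrite (inner_holmon0_zmon 0 n.+1) mul0r.
by rewrite rmorph0.
Qed.

Lemma inner_zmon i j : innd (zmon i) (zmon j) =
  if (i.1 + j.2 == i.2 + j.1)%N then disk_area%:C / (i.1 + j.2).+1%:R else 0.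
Proof.
rewrite inner_zmonE; move: (i.1 + j.2)%N (i.2 + j.1)%N => a b.
transitivity (conjc (innd (@holmon R 0) (zmon (a, b)))).
  exact: (innerC mD (L2_holmon R 0) (Lz (a, b))).
rewrite inner_holmon0_zmon inner_holmon0_holmon subn_eq0 /gcoef [(a, b).1]/= [(a, b).2]/=.
have [-> | ab] := eqVneq a b.
  rewrite leqnn subnn rmorphM fmorph_div !rmorph_nat mul1r mulrC; congr (_ * _).
  by apply: complex_eq; rewrite !ReImE /= ?oppr0.
have [ba|ba] := leqP b a; last by rewrite mul0r rmorph0.
by rewrite leqNgt ltn_neqAle eq_sym ab ba /= mulr0 rmorph0.
Qed.

Lemma disk_area_gt0 : 0 < disk_area.
Proof.
have S0 : `[0, 2^-1]%classic `*` `[0, 2^-1]%classic `<=` @disk R.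
  move=> -[x y] [/= hx hy]; rewrite /disk /=; move: hx hy;
    rewrite !in_itv /= => /andP[x0 x1] /andP[y0 y1].
  by rewrite !expr2; nra.
have E : sqnorm2 leb2 (@disk R) (fun=> 1) = leb2 (@disk R).
  by rewrite sqnorm2E /= (_ : (fun=> _) = cst 1%:E) ?integral_cst ?mul1e//; apply/funext => x;
    rewrite /nsq /= expr1n expr0n addr0.
have L1 : L2d (fun=> 1).
  have := Lz (0%N, 0%N); congr (L2 _ _ _); apply/funext => x; exact: holmon0.
rewrite -lte_fin -(sqnormE L1) E;
  apply: (@lt_le_trans _ _ (leb2 (`[0, 2^-1]%classic `*` `[0, 2^-1]%classic))).
  rewrite leb2_setX; [|exact: measurable_itv|exact: measurable_itv].
  by rewrite !lebesgue_measure_itv /= lte_fin invr_gt0 ltr0n /= sube0 -EFinM lte_fin mulr_gt0 ?invr_gt0.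
by apply: le_measure => //; rewrite inE//; apply: measurableX; exact: measurable_itv.
Qed.

Definition deg i : int := i.1%:Z - i.2%:Z.

Definition dzmon i x : R[i] := i.1%:R * zmon (i.1.-1, i.2) x.

Definition dbmon i x : R[i] := i.2%:R * zmon (i.1, i.2.-1) x.

Lemma L2_dzmon i : L2d (dzmon i). Proof. exact: L2Z. Qed.

Lemma L2_dbmon i : L2d (dbmon i). Proof. exact: L2Z. Qed.

Lemma eq_deg i j : (i.1 + j.2 == i.2 + j.1)%N = (deg i == deg j).
Proof.
case: i j => m n [p q]; rewrite /deg /= subr_eq addrAC [RHS]eq_sym subr_eq.
by rewrite -!PoszD eqz_nat (addnC p) eq_sym.
Qed.

Local Notation A := (disk_area%:C).

Lemma inner_dzmon i j : innd (dzmon i) (dzmon j) =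
  if deg i == deg j then A * (i.1%:R * j.1%:R / (i.1 + j.2)%:R) else 0.
Proof.
transitivity (i.1%:R * conjc j.1%:R * innd (@zmon R (i.1.-1, i.2)) (zmon (j.1.-1, j.2))).
  rewrite -mulrA -(innerZr mD j.1%:R (Lz (j.1.-1, j.2)) (Lz (i.1.-1, i.2))).
  exact: (innerZl mD i.1%:R (Lz (i.1.-1, i.2)) (L2_dzmon j)).
rewrite conjc_nat inner_zmon -eq_deg; case: i j => [m n] [p q] /=.
case: m => [|m]; first by rewrite !mul0r mulr0; case: ifP.
case: p => [|p]; first by rewrite mulr0 !mul0r mulr0; case: ifP.
rewrite /= addSn addnS eqSS; case: ifP => _; last by rewrite mulr0.
by rewrite mulrA [RHS]mulrCA mulrA.
Qed.

Lemma inner_dbmon i j : innd (dbmon i) (dbmon j) =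
  if deg i == deg j then A * (i.2%:R * j.2%:R / (i.1 + j.2)%:R) else 0.
Proof.
transitivity (i.2%:R * conjc j.2%:R * innd (@zmon R (i.1, i.2.-1)) (zmon (j.1, j.2.-1))).
  rewrite -mulrA -(innerZr mD j.2%:R (Lz (j.1, j.2.-1)) (Lz (i.1, i.2.-1))).
  exact: (innerZl mD i.2%:R (Lz (i.1, i.2.-1)) (L2_dbmon j)).
rewrite conjc_nat inner_zmon -eq_deg; case: i j => [m n] [p q] /=.
case: n => [|n]; first by rewrite !mul0r mulr0; case: ifP.
case: q => [|q]; first by rewrite mulr0 !mul0r mulr0; case: ifP.
rewrite /= addSn addnS eqSS; case: ifP => _; last by rewrite mulr0.
by rewrite mulrA [RHS]mulrCA mulrA.
Qed.

(** The difference of the two Dirichlet forms is a boundary term, hence it sees a monomial only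
    through its degree, the frequency of its restriction to the circle. *)
Lemma inner_dzmon_dbmon i j : innd (dzmon i) (dzmon j) - innd (dbmon i) (dbmon j) =
  if deg i == deg j then A * (deg i)%:~R else 0.
Proof.
rewrite inner_dzmon inner_dbmon; case: ifP => [/eqP e|_]; last by rewrite subrr.
rewrite -mulrBr; congr (_ * _).
have : (i.1 + j.2 = i.2 + j.1)%N by apply/eqP; rewrite eq_deg e.
rewrite /deg; case: i j {e} => m n [p q] /= e.
have [/eqP|S0] := eqVneq (m + q)%N 0%N.
  rewrite addn_eq0 => /andP[/eqP m0 /eqP q0]; move: e; rewrite m0 q0 => /esym/eqP.
  by rewrite addn_eq0 => /andP[/eqP -> /eqP ->]; rewrite !mul0r !subrr.
have {S0} S0 : (m + q)%:R != 0 :> R[i] by rewrite pnatr_eq0.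
rewrite -mulrBl; apply: (mulIf S0); rewrite mulfVK// rmorphB /= -!pmulrn.
have /(congr1 (fun k : nat => k%:R : R[i])) := e; rewrite !natrD => e2.
have -> : p%:R = m%:R + q%:R - n%:R :> R[i] by rewrite e2; ring.
by ring.
Qed.

(* The boundary values of [zmon (a.+1, b)] agree with those of [zmon (bal (a, b))]. *)
Definition bal i : nat * nat := ((i.1.+1 - i.2)%N, (i.2 - i.1.+1)%N).

Lemma deg_bal a b : deg (bal (a, b)) = deg (a.+1, b).
Proof.
rewrite /deg /bal /=; have [h|h] := leqP b a.+1.
  by rewrite (_ : (b - a.+1)%N = 0%N) ?subr0 ?subzn//; apply/eqP.
by rewrite (_ : (a.+1 - b)%N = 0%N) ?sub0r -?subzn ?opprB ?(ltnW h)//; apply/eqP; exact: ltnW.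
Qed.

Lemma bal_deg i : deg (bal i) = deg (i.1.+1, i.2).
Proof. by case: i => a b; exact: deg_bal. Qed.

(** A [del]-primitive of the monomial, corrected so as to vanish on the circle; [umon] and [wmon]
    are its images under [del] and [delbar]. *)
Definition vmon i x : R[i] := i.1.+1%:R^-1 * (zmon (i.1.+1, i.2) x - zmon (bal i) x).

Definition umon i x : R[i] := i.1.+1%:R^-1 * (dzmon (i.1.+1, i.2) x - dzmon (bal i) x).

Definition wmon i x : R[i] := i.1.+1%:R^-1 * (dbmon (i.1.+1, i.2) x - dbmon (bal i) x).

Lemma L2_vmon i : L2d (vmon i). Proof. exact: (L2Z mD _ (L2B mD (Lz _) (Lz _))). Qed.

Lemma L2_umon i : L2d (umon i).
Proof. exact: (L2Z mD _ (L2B mD (L2_dzmon _) (L2_dzmon _))). Qed.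

Lemma L2_wmon i : L2d (wmon i).
Proof. exact: (L2Z mD _ (L2B mD (L2_dbmon _) (L2_dbmon _))). Qed.

(** The correction z^(a+1-b)/(a+1) has for derivative the Bergman projection. If b > a it is
    constant or antiholomorphic, and both vanish. *)
Lemma umonE i x : umon i x = zmon i x - gmon i x.
Proof.
case: i => a b; rewrite /umon mulrBr /dzmon [(a.+1, b).1]/= [(a.+1, b).2]/= [a.+1.-1]/=.
rewrite mulrA mulVf ?natC0// mul1r; congr (_ - _); rewrite /gmon /gcoef /bal /holmon.
rewrite [(a, b).1]/= [(a, b).2]/= [(_, _).1]/= [(_, _).2]/=.
have [ba|ab] := leqP b a; last first.
  have -> : (a.+1 - b)%N = 0%N by apply/eqP; rewrite subn_eq0.
  by rewrite !mul0r mulr0.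
have -> : (b - a.+1)%N = 0%N by apply/eqP; rewrite subn_eq0 leqW.
by rewrite subSn// mulrA (mulrC _^-1).
Qed.

Lemma cross_diff_congr (K a1 a2 a3 a4 b1 b2 b3 b4 : R[i]) :
  a1 - b1 = K -> a2 - b2 = K -> a3 - b3 = K -> a4 - b4 = K ->
  a1 - a2 - (a3 - a4) = b1 - b2 - (b3 - b4).
Proof.
by move=> /(canRL (subrK _)) -> /(canRL (subrK _)) -> /(canRL (subrK _)) -> /(canRL (subrK _)) ->; ring.
Qed.

Lemma cross_sum_eq0 (c1 c2 c3 c4 b1 b2 b3 b4 a1 a2 a3 a4 : R[i]) :
  a2 + b2 + c2 = a1 + b1 + c1 -> a3 + b3 + c3 = a1 + b1 + c1 -> a4 + b4 + c4 = a1 + b1 + c1 ->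
  a1 - a2 - (a3 - a4) + (b1 - b2 - (b3 - b4)) + (c1 - c2 - (c3 - c4)) = 0.
Proof.
move=> h2 h3 h4; rewrite (_ : _ + _ = (a1 + b1 + c1) - (a2 + b2 + c2) - ((a3 + b3 + c3) - (a4 + b4
  + c4))).
  by rewrite h2 h3 h4 !subrr.
by ring.
Qed.

(** Both monomials of a [vmon] have the same degree, so by [inner_dzmon_dbmon] the four products all
    carry the same discrepancy, which cancels in the double difference. *)
Lemma inner_umon_wmon i j : innd (umon i) (umon j) = innd (wmon i) (wmon j).
Proof.
apply/eqP; rewrite -subr_eq0; apply/eqP.
have F1 := inner_diff mD i.1.+1%:R^-1 j.1.+1%:R^-1 (L2_dzmon (i.1.+1, i.2)) (L2_dzmon (bal i))
  (L2_dzmon (j.1.+1, j.2)) (L2_dzmon (bal j)).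
have F2 := inner_diff mD i.1.+1%:R^-1 j.1.+1%:R^-1 (L2_dbmon (i.1.+1, i.2)) (L2_dbmon (bal i))
  (L2_dbmon (j.1.+1, j.2)) (L2_dbmon (bal j)).
transitivity (i.1.+1%:R^-1 * conjc j.1.+1%:R^-1 *
  (innd (dzmon (i.1.+1, i.2)) (dzmon (j.1.+1, j.2)) - innd (dzmon (bal i)) (dzmon (j.1.+1, j.2)) -
    (innd (dzmon (i.1.+1, i.2)) (dzmon (bal j)) - innd (dzmon (bal i)) (dzmon (bal j)))) -
  i.1.+1%:R^-1 * conjc j.1.+1%:R^-1 *
  (innd (dbmon (i.1.+1, i.2)) (dbmon (j.1.+1, j.2)) - innd (dbmon (bal i)) (dbmon (j.1.+1, j.2)) -
    (innd (dbmon (i.1.+1, i.2)) (dbmon (bal j)) - innd (dbmon (bal i)) (dbmon (bal j))))).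
  by congr (_ - _); [exact: F1|exact: F2].
rewrite -mulrBr; apply/eqP; rewrite mulf_eq0; apply/orP; right; rewrite subr_eq0; apply/eqP.
apply: (@cross_diff_congr (if deg (i.1.+1, i.2) == deg (j.1.+1, j.2) then A * (deg (i.1.+1,
  i.2))%:~R else 0));
  by rewrite inner_dzmon_dbmon ?bal_deg.
Qed.

Definition zdzmon i x : R[i] := i.1%:R * zmon i x.

Definition zzmon i x : R[i] := zmon (i.1.+1, i.2) x.

Lemma L2_zdzmon i : L2d (zdzmon i). Proof. exact: L2Z. Qed.

Lemma L2_zzmon i : L2d (zzmon i). Proof. exact: Lz. Qed.

(** The three terms are the product rule for [del] applied to z m conj(m'); its integral is a
    boundary term, which depends on the degrees alone and cancels for [vmon]. *)
Lemma inner_poincare i j :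
  innd (zmon i) (zmon j) + innd (zdzmon i) (zmon j) + innd (zzmon i) (dbmon j) =
  if deg i == deg j then A else 0.
Proof.
have -> : innd (zdzmon i) (zmon j) = i.1%:R * innd (zmon i) (zmon j).
  exact: (innerZl mD i.1%:R (Lz i) (Lz j)).
have -> : innd (zzmon i) (dbmon j) = j.2%:R * innd (@zmon R (i.1.+1, i.2)) (zmon (j.1, j.2.-1)).
  transitivity (conjc j.2%:R * innd (@zmon R (i.1.+1, i.2)) (zmon (j.1, j.2.-1))).
    exact: (innerZr mD j.2%:R (Lz (j.1, j.2.-1)) (Lz (i.1.+1, i.2))).
  by rewrite conjc_nat.
have -> : j.2%:R * innd (@zmon R (i.1.+1, i.2)) (zmon (j.1, j.2.-1)) =
    if deg i == deg j then A * (j.2%:R / (i.1 + j.2).+1%:R) else 0.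
  rewrite inner_zmon -eq_deg; case: i j => [m n] [p q] /=.
  case: q => [|q]; first by rewrite !mul0r mulr0; case: ifP.
  by rewrite /= !addnS !addSn; case: ifP => _; rewrite ?mulr0// mulrCA.
rewrite inner_zmon eq_deg; case: ifP => _; last by rewrite mulr0 !addr0.
have S0 := natC0 R (i.1 + j.2); apply: (mulIf S0).
rewrite -(natr1 (i.1 + j.2)) natrD; rewrite -natr1 natrD in S0; field.
exact: S0.
Qed.

Definition zumon i x : R[i] := i.1.+1%:R^-1 * (zdzmon (i.1.+1, i.2) x - zdzmon (bal i) x).

Definition zvmon i x : R[i] := i.1.+1%:R^-1 * (zzmon (i.1.+1, i.2) x - zzmon (bal i) x).

Lemma L2_zumon i : L2d (zumon i).
Proof. exact: (L2Z mD _ (L2B mD (L2_zdzmon _) (L2_zdzmon _))). Qed.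

Lemma L2_zvmon i : L2d (zvmon i).
Proof. exact: (L2Z mD _ (L2B mD (L2_zzmon _) (L2_zzmon _))). Qed.

Lemma zumonE i x : zumon i x = zc x * umon i x.
Proof.
have h m n : zdzmon (m, n) x = zc x * dzmon (m, n) x.
  rewrite /zdzmon /dzmon /zmon [(m, n).1]/= [(m, n).2]/= [(_, _).1]/= [(_, _).2]/=.
  by case: m => [|m]; [rewrite !mul0r mulr0|rewrite exprS; ring].
by rewrite /zumon /umon !h; ring.
Qed.

Lemma zvmonE i x : zvmon i x = zc x * vmon i x.
Proof.
have h m n : zzmon (m, n) x = zc x * zmon (m, n) x.
  by rewrite /zzmon /zmon [(m, n).1]/= [(m, n).2]/= [(_, _).1]/= [(_, _).2]/= exprS mulrA.
by rewrite /zvmon /vmon !h; ring.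
Qed.

Lemma vmon_poincare i j :
  innd (vmon i) (vmon j) + innd (zumon i) (vmon j) + innd (zvmon i) (wmon j) = 0.
Proof.
set c : R[i] := i.1.+1%:R^-1; set e : R[i] := j.1.+1%:R^-1.
pose i1 := (i.1.+1, i.2); pose j1 := (j.1.+1, j.2); pose i2 := bal i; pose j2 := bal j.
transitivity (c * conjc e * (innd (zmon i1) (zmon j1) - innd (zmon i2) (zmon j1) - (innd (zmon i1)
  (zmon j2) - innd (zmon i2) (zmon j2))) +
  c * conjc e * (innd (zdzmon i1) (zmon j1) - innd (zdzmon i2) (zmon j1) - (innd (zdzmon i1) (zmon
    j2) - innd (zdzmon i2) (zmon j2))) +
  c * conjc e * (innd (zzmon i1) (dbmon j1) - innd (zzmon i2) (dbmon j1) - (innd (zzmon i1) (dbmon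
    j2) - innd (zzmon i2) (dbmon j2)))).
  congr (_ + _ + _).
  - exact: (inner_diff mD c e (Lz i1) (Lz i2) (Lz j1) (Lz j2)).
  - exact: (inner_diff mD c e (L2_zdzmon i1) (L2_zdzmon i2) (Lz j1) (Lz j2)).
  - exact: (inner_diff mD c e (L2_zzmon i1) (L2_zzmon i2) (L2_dbmon j1) (L2_dbmon j2)).
rewrite -!mulrDr; apply/eqP; rewrite mulf_eq0; apply/orP; right; apply/eqP.
have K1 := inner_poincare i1 j1; have K2 := inner_poincare i2 j1.
have K3 := inner_poincare i1 j2; have K4 := inner_poincare i2 j2.
rewrite /i2 bal_deg -/i1 in K2; rewrite /j2 bal_deg -/j1 in K3.
rewrite /i2 /j2 !bal_deg -/i1 -/j1 in K4.
rewrite -K1 in K2 K3 K4; move: K2 K3 K4; rewrite -/i2 -/j2.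
move: (innd (zmon i1) (zmon j1)) (innd (zmon i2) (zmon j1)) (innd (zmon i1) (zmon j2)) (innd (zmon
  i2) (zmon j2)).
move: (innd (zdzmon i1) (zmon j1)) (innd (zdzmon i2) (zmon j1)) (innd (zdzmon i1) (zmon j2)) (innd
  (zdzmon i2) (zmon j2)).
move: (innd (zzmon i1) (dbmon j1)) (innd (zzmon i2) (dbmon j1)) (innd (zzmon i1) (dbmon j2)) (innd
  (zzmon i2) (dbmon j2)).
exact: cross_sum_eq0.
Qed.

End monomial_forms.

(** * Norm bounds for the primitives and their traces *)

Section lext_bounds.
Variable R : realType.
Local Notation leb1 := (@lebesgue_measure R).
Local Notation leb2 := (leb1 \x leb1)%E.
Local Notation L2d := (L2 leb2 (@disk R)).
Local Notation Nd := (sqnorm leb2 (@disk R)).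
Local Notation innd := (inner leb2 (@disk R)).
Local Notation L2c := (L2 leb1 (@circle R)).
Local Notation Nc := (sqnorm leb1 (@circle R)).
Local Notation innc := (inner leb1 (@circle R)).
Implicit Types (f g h : R * R -> R[i]) (x : R * R) (i j : nat * nat) (a b m n : nat).
Implicit Types s : seq (R[i] * (nat * nat)).

Let mD := @measurable_disk R.

Let mC := @measurable_circle R.

Let Lz i : L2d (@zmon R i) := L2d_zmon R i.

Lemma lext_zc (F G : nat * nat -> R * R -> R[i]) s x :
  (forall i, F i x = zc x * G i x) -> lext F s x = zc x * lext G s x.
Proof.
by move=> FG; rewrite /lext mulr_sumr; apply: eq_bigr => t _; rewrite FG mulrCA.
Qed.

Lemma lext_umon s x : lext (@umon R) s x = lext (@zmon R) s x - lext (@gmon R) s x.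
Proof. by rewrite /lext -sumrB; apply: eq_bigr => t _; rewrite umonE mulrBr. Qed.

Lemma sqnorm_umon_le s : Nd (lext (@umon R) s) <= Nd (lext (@zmon R) s).
Proof.
apply: le_trans (projection_sub_le s); rewrite le_eqVlt; apply/orP; left; apply/eqP.
by apply: eq_sqnorm => x _; rewrite lext_umon.
Qed.

Lemma sqnorm_wmon s : Nd (lext (@wmon R) s) = Nd (lext (@umon R) s).
Proof.
apply: (gram_eq mD mD) => [i|i|i j]; first exact: L2_wmon; first exact: L2_umon.
by rewrite inner_umon_wmon.
Qed.

Lemma sqnorm_zc_le f : L2d f -> L2d (fun x => zc x * f x) -> Nd (fun x => zc x * f x) <= Nd f.
Proof.
move=> Lf Lzf; rewrite -lee_fin -(sqnormE Lf) -(sqnormE Lzf).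
have := @sqnorm2_le _ _ _ leb2 (@disk R) mD (fun x => zc x * f x) f 1 ler01 (L2_meas Lzf) (L2_meas Lf).
rewrite mul1e; apply => x xd; rewrite mul1r nsqM ler_piMl ?nsq_ge0//.
exact: ltW.
Qed.

(** [gram_poincare] with K the squared norm of the combination of monomials: |z| <= 1 on the disk,
    del v is a projection of this combination, and delbar v has the same norm as del v. *)
Lemma sqnorm_vmon_le s : Nd (lext (@vmon R) s) <= 4 * Nd (lext (@zmon R) s).
Proof.
have Lext F : (forall i, L2d (F i)) -> L2d (lext F s) by move=> h; exact: (L2_lext mD s h).
have zu : lext (@zumon R) s = fun x => zc x * lext (@umon R) s x.
  by apply/funext => x; apply: lext_zc => i; exact: zumonE.
have zv : lext (@zvmon R) s = fun x => zc x * lext (@vmon R) s x.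
  by apply/funext => x; apply: lext_zc => i; exact: zvmonE.
apply: (@gram_poincare _ _ _ leb2 (@disk R) mD _ (@vmon R) (@zumon R) (@zvmon R) (@wmon R)).
- exact: L2_vmon.
- exact: L2_zumon.
- exact: L2_zvmon.
- exact: L2_wmon.
- exact: vmon_poincare.
- rewrite zu; apply: le_trans (sqnorm_umon_le s); apply: sqnorm_zc_le; first exact: Lext (@L2_umon R).
  by rewrite -zu; exact: Lext (@L2_zumon R).
- rewrite zv; apply: sqnorm_zc_le; first exact: Lext (@L2_vmon R).
  by rewrite -zv; exact: Lext (@L2_zvmon R).
- by rewrite sqnorm_wmon; exact: sqnorm_umon_le.
Qed.

(** The primitive of z^n that vanishes at the origin, so that its boundary values have mean zero. *)
Definition prim n x : R[i] := n.+1%:R^-1 * holmon n.+1 x.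

Definition prim_bd n (t : R) : R[i] := n.+1%:R^-1 * expi n.+1 t.

Lemma zc_circle t : zc (cos t, sin t) = expi 1 t :> R[i].
Proof. by rewrite /expi mul1r. Qed.

Lemma prim_circle n t : prim n (cos t, sin t) = prim_bd n t.
Proof.
rewrite /prim /prim_bd /holmon /zmon [(_, _).1]/= [(n.+1, 0%N).2]/= [X in _ * (_ * X)]expr0 mulr1.
by rewrite zc_circle -expi_nat.
Qed.

Lemma L2_prim n : L2d (prim n). Proof. exact: (L2Z mD _ (L2_holmon R _)). Qed.

Lemma L2_expi k : L2c (expi k).
Proof.
have [] // := @bounded_L2 _ _ _ leb1 (@circle R) mC _ (expi k) 1.
- by apply: (@le_lt_trans _ _ (2 * pi)%:E); [rewrite le_eqVlt; apply/orP; left; apply/eqP;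
  exact: leb_circle|exact: ltry].
- exact: cmeas_expi.
- by move=> x _; rewrite nsq_expi.
Qed.

Lemma L2_prim_bd n : L2c (prim_bd n). Proof. exact: (L2Z mC _ (L2_expi _)). Qed.

Lemma nat_real_complex (c : R) n : c%:C / n%:R = (c / n%:R)%:C :> R[i].
Proof. by rewrite rmorphM fmorphV rmorph_nat. Qed.

Lemma inner_holmon m n : innd (@holmon R m) (holmon n) =
  if m == n then (disk_area R / n.+1%:R)%:C else 0.
Proof.
have E := inner_zmon R (m, 0%N) (n, 0%N); transitivity (innd (@zmon R (m, 0%N)) (zmon (n, 0%N))) => //.
rewrite {}E /= addn0 add0n; have [->|] := eqVneq m n; last by [].
by rewrite nat_real_complex.
Qed.

Lemma inner_prim m n : innd (prim m) (prim n) =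
  if m == n then (disk_area R / n.+2%:R / n.+1%:R / n.+1%:R)%:C else 0.
Proof.
transitivity (m.+1%:R^-1 * (conjc n.+1%:R^-1 * innd (@holmon R m.+1) (holmon n.+1))).
  rewrite -(innerZr mD n.+1%:R^-1 (L2_holmon R n.+1) (L2_holmon R m.+1)).
  exact: (innerZl mD m.+1%:R^-1 (L2_holmon R m.+1) (L2_prim n)).
rewrite inner_holmon eqSS; case: eqVneq => [->|_]; last by rewrite !mulr0.
by rewrite -!nat_real_complex (_ : conjc n.+1%:R^-1 = n.+1%:R^-1) ?fmorphV ?rmorph_nat//; ring.
Qed.

Lemma inner_prim_bd m n : innc (prim_bd m) (prim_bd n) =
  if m == n then (2 * pi / n.+1%:R / n.+1%:R)%:C else 0.
Proof.
transitivity (m.+1%:R^-1 * (conjc n.+1%:R^-1 * innc (expi m.+1) (expi n.+1))).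
  rewrite -(innerZr mC n.+1%:R^-1 (L2_expi n.+1) (L2_expi m.+1)).
  exact: (innerZl mC m.+1%:R^-1 (L2_expi m.+1) (L2_prim_bd n)).
have -> : innc (expi m.+1) (expi n.+1) = if m == n then (2 * pi)%:C else 0.
  transitivity (cintegral leb1 (@circle R) (expi (m.+1%:Z - n.+1%:Z))).
    by apply: eq_cintegral => t _; rewrite expi_conj -expiD.
  rewrite cintegral_circle_expi subr_eq0 eqz_nat eqSS.
  by case: eqVneq.
case: eqVneq => [->|_]; last by rewrite !mulr0.
by rewrite -!nat_real_complex (_ : conjc n.+1%:R^-1 = n.+1%:R^-1) ?fmorphV ?rmorph_nat//; ring.
Qed.

Lemma sqnorm_prim_le (t : seq (R[i] * nat)) : Nd (lext prim t) <= Nd (lext (@holmon R) t).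
Proof.
rewrite -[leRHS]mul1r; apply: (@diagonal_le R _ _ _ _ leb2 (@disk R) leb2 (@disk R) mD mD
  (@holmon R) prim (fun n => disk_area R / n.+1%:R) (fun n => disk_area R / n.+2%:R / n.+1%:R /
    n.+1%:R)).
- exact: L2_holmon.
- exact: L2_prim.
- by move=> i j; rewrite inner_holmon; case: eqVneq => [->|].
- by move=> i j; rewrite inner_prim; case: eqVneq => [->|].
move=> n.
rewrite mul1r; have A0 : 0 <= disk_area R / n.+1%:R by rewrite divr_ge0// ltW// disk_area_gt0.
have h1 : 0 <= (n.+1%:R^-1 : R) <= 1 by rewrite invr_ge0 invf_le1 ?ler0n ?ler1n//= ltr0n.
have h2 : 0 <= (n.+2%:R^-1 : R) <= 1 by rewrite invr_ge0 invf_le1 ?ler0n ?ler1n//= ltr0n.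
have -> : disk_area R / n.+2%:R / n.+1%:R / n.+1%:R = disk_area R / n.+1%:R * (n.+2%:R^-1 *
  n.+1%:R^-1) by ring.
rewrite ler_piMr//; case/andP: h1 => ? ?; case/andP: h2 => ? ?.
by rewrite mulr_ile1.
Qed.

(** A trace estimate by comparison of diagonals: the powers are orthogonal in the disk and on the
    circle, with squared norms [disk_area / (n + 1)] for z^n and 2 pi/(n + 1)^2 for the trace of its
    primitive. *)
Lemma sqnorm_prim_bd_le (t : seq (R[i] * nat)) :
  Nc (lext prim_bd t) <= (2 * pi / disk_area R) * Nd (lext (@holmon R) t).
Proof.
apply: (@diagonal_le R _ _ _ _ leb2 (@disk R) leb1 (@circle R) mD mC
  (@holmon R) prim_bd (fun n => disk_area R / n.+1%:R) (fun n => 2 * pi / n.+1%:R / n.+1%:R)).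
- exact: L2_holmon.
- exact: L2_prim_bd.
- by move=> i j; rewrite inner_holmon; case: eqVneq => [->|].
- by move=> i j; rewrite inner_prim_bd; case: eqVneq => [->|].
move=> n.
have A0 := disk_area_gt0 R; rewrite mulrA divfK ?gt_eqF//.
have p0 : 0 <= 2 * pi / n.+1%:R :> R by rewrite divr_ge0// mulr_ge0// pi_ge0.
by rewrite ler_piMr// invf_le1 ?ltr0n// ler1n.
Qed.

Definition pmon i x : R[i] := gcoef R i * prim (i.1 - i.2) x.

Definition pmon_bd i t : R[i] := gcoef R i * prim_bd (i.1 - i.2) t.

Lemma lext_glist T (F : nat -> T -> R[i]) s :
  lext (fun i t => gcoef R i * F (i.1 - i.2)%N t) s = lext F (glist s).
Proof.
by apply/funext => x; rewrite /lext big_map; apply: eq_bigr => t _; rewrite mulrA.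
Qed.

Lemma L2_pmon i : L2d (pmon i). Proof. exact: (L2Z mD _ (L2_prim _)). Qed.

Lemma L2_pmon_bd i : L2c (pmon_bd i). Proof. exact: (L2Z mC _ (L2_prim_bd _)). Qed.

Lemma sqnorm_pmon_le s : Nd (lext pmon s) <= Nd (lext (@zmon R) s).
Proof.
rewrite (lext_glist prim s); apply: (le_trans (sqnorm_prim_le _)).
by rewrite -lext_gmon; exact: projection_le.
Qed.

Lemma sqnorm_pmon_bd_le s : Nc (lext pmon_bd s) <= (2 * pi / disk_area R) * Nd (lext (@zmon R) s).
Proof.
rewrite (lext_glist prim_bd s); apply: (le_trans (sqnorm_prim_bd_le _)).
rewrite -lext_gmon ler_wpM2l ?projection_le// divr_ge0 // ltW// ?disk_area_gt0//.
exact: pi2_gt0.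
Qed.

End lext_bounds.

(** * Elements of the kernel of the transform, and descent in frequency *)

Section xray_primitives.
Variable R : realType.
Local Notation leb1 := (@lebesgue_measure R).
Local Notation leb2 := (leb1 \x leb1)%E.
Local Notation leb3 := (leb2 \x leb1)%E.
Local Notation L2d := (L2 leb2 (@disk R)).
Local Notation Nd := (sqnorm leb2 (@disk R)).
Local Notation NI := (sqnorm leb2 (@influx R)).
Local Notation NS := (sqnorm leb3 (@SM R)).
Local Notation L2c := (L2 leb1 (@circle R)).
Local Notation limd := (limL2 leb2 (@disk R)).
Local Notation limc := (limL2 leb1 (@circle R)).
Implicit Types (f g h : R * R -> R[i]) (x : R * R) (i j : nat * nat) (a b m n : nat) (k : int).
Implicit Types s : seq (R[i] * (nat * nat)).

Let mD := @measurable_disk R.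

Let mC := @measurable_circle R.

Let mS := @measurable_SM R.

Let Lz i : L2d (@zmon R i) := L2d_zmon R i.

Lemma L2influx_0 : @L2influx R (fun=> 0).
Proof. by split => //; exact: L2_0. Qed.

Lemma xray_null u g : xray u g -> (forall q, influx q -> g q = 0) -> xray u (fun=> 0).
Proof.
move=> xu g0; have [Lu _ _] := xu; apply: (xray_ext xu Lu L2influx_0).
  by transitivity (NS (fun=> 0)); [apply: eq_sqnorm => p _; rewrite subrr|exact: sqnorm0].
by transitivity (NI (fun=> 0)); [apply: eq_sqnorm => q /g0 ->; rewrite subrr|exact: sqnorm0].
Qed.

(** The boundary term of [chord_zmon_ftc], in which a monomial is represented by its degree [e]
    only. *)
Definition bd_deg k (e : int) (q : R * R) : R[i] :=
  expi (k - 1) (q.1 + pi + q.2) * (expi e (q.1 + pi + 2 * q.2) - expi e q.1).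

Lemma xray_dzmon k i : exists2 g, xray (fun p => freq (@dzmon R i) k p + freq (@dbmon R i) (k - 2)
  p) g &
  forall q, influx q -> g q = bd_deg k (deg i) q.
Proof.
case: i => m n; have x1 := xrayZ m%:R (xray_continuous (@continuousSM_emon R (m.-1, n, k))).
have x2 := xrayZ n%:R (xray_continuous (@continuousSM_emon R (m, n.-1, k - 2))).
exists (fun q => m%:R * xray_integral (@emon R (m.-1, n, k)) q +
    n%:R * xray_integral (@emon R (m, n.-1, k - 2)) q).
  have := xrayD x1 x2; congr (xray _ _); apply/funext => p.
  by rewrite /freq /dzmon /dbmon /emon /= !mulrA.
by move=> [be al] /influx_cos c0; exact: chord_zmon_ftc.
Qed.

Lemma freq_lin k (c : R[i]) f g p : freq (fun x => c * (f x - g x)) k p = c * (freq f k p - freq g k p).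
Proof. by rewrite /freq; ring. Qed.

(** The left function is X(v e^(i (k - 1) theta)) for v = [vmon i]. The two monomials of v have
    equal degrees, so their boundary terms cancel. *)
Lemma xray_tmon k i :
  xray (fun p => freq (@umon R i) k p + freq (@wmon R i) (k - 2) p) (fun=> 0).
Proof.
have [g1 x1 e1] := xray_dzmon k (i.1.+1, i.2); have [g2 x2 e2] := xray_dzmon k (bal i).
have := xrayZ i.1.+1%:R^-1 (xrayB x1 x2) => x3.
suff : xray (fun p => freq (@umon R i) k p + freq (@wmon R i) (k - 2) p)
    (fun q => i.1.+1%:R^-1 * (g1 q - g2 q)).
  by move/xray_null; apply => q qi; rewrite e1// e2// bal_deg subrr mulr0.
move: x3; congr (xray _ _); apply/funext => p; rewrite /umon /wmon !freq_lin; ring.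
Qed.

Lemma xray_0 : xray (fun=> 0 : R[i]) (fun=> 0).
Proof.
have := xrayZ 0 (xray_tmon 0 (0, 0)%N).
by congr (xray _ _); apply/funext => p; rewrite mul0r.
Qed.

Lemma freq_lext_cons (F : nat * nat -> R * R -> R[i]) t s k p :
  freq (lext F (t :: s)) k p = t.1 * freq (F t.2) k p + freq (lext F s) k p.
Proof. by rewrite /freq lext_cons; ring. Qed.

Lemma xray_tlext k s :
  xray (fun p => freq (lext (@umon R) s) k p + freq (lext (@wmon R) s) (k - 2) p) (fun=> 0).
Proof.
elim: s => [|t s ih].
  by have := xray_0; congr (xray _ _); apply/funext => p; rewrite /freq !lext_nil !mul0r addr0.
have := xrayD (xrayZ t.1 (xray_tmon k t.2)) ih.
congr (xray _ _); apply/funext => p; last by rewrite mulr0 addr0.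
by rewrite !freq_lext_cons; ring.
Qed.

Lemma L2d_lextF F s : (forall i, L2d (F i)) -> L2d (lext F s).
Proof. by move=> LF; exact: (L2_lext mD s LF). Qed.

Lemma limL2_umon f g (sn : nat -> seq (R[i] * (nat * nat))) : L2d f -> L2d g ->
  limd (fun n => lext (@zmon R) (sn n)) f -> limd (fun n => lext (@gmon R) (sn n)) g ->
  limd (fun n => lext (@umon R) (sn n)) (fun x => f x - g x).
Proof.
move=> Lf Lg lf lg; have Lzs n := L2d_lextF (sn n) Lz; have Lgs n := L2d_lextF (sn n) (@L2_gmon R).
have := limL2_D mD Lzs (fun n => L2N mD (Lgs n)) Lf (L2N mD Lg) lf (limL2_N mD Lgs Lg lg).
have <- : (fun n x => lext (@zmon R) (sn n) x + - lext (@gmon R) (sn n) x) = (fun n => lext (@umon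
  R) (sn n)).
  by apply/funext => n; apply/funext => x; rewrite lext_umon.
exact.
Qed.

(* [v + P] is a primitive of [f] for [del], with [v] vanishing on the boundary,
   [w = delbar v] and [g = del P] the Bergman projection of [f]. *)
Lemma disk_primitive f : L2d f -> exists sn : nat -> seq (R[i] * (nat * nat)), exists g w v P tau,
  [/\ [/\ L2d g, L2d w, L2d v & L2d P], L2c tau /\ (forall t, tau (t + 2 * pi) = tau t),
    [/\ limd (fun n => lext (@umon R) (sn n)) (fun x => f x - g x),
        limd (fun n => lext (@gmon R) (sn n)) g,
        limd (fun n => lext (@wmon R) (sn n)) w & limd (fun n => lext (@vmon R) (sn n)) v],
    limd (fun n => lext (@pmon R) (sn n)) P & limc (fun n => lext (@pmon_bd R) (sn n)) tau].
Proof.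
move=> Lf; have [sn _ lf] := @limL2_of_approx _ _ _ leb2 (@disk R) _ (fun=> True)
  (lext (@zmon R)) f (density_disk Lf).
(* Every family is evaluated on the same lists [sn], so the relations between u, w, v and P persist
   in the limit. *)
have lim F (C : R) : (forall i, L2d (F i)) -> 0 <= C ->
    (forall s, Nd (lext F s) <= C * Nd (lext (@zmon R) s)) ->
    exists g, L2d g /\ limd (fun n => lext F (sn n)) g.
  move=> LF C0 bd; have [k [Lk lk]] := lext_limit mD mD Lz LF C0 bd Lf lf.
  by exists (fun x => climit (fun m => lext F (sn (k m)) x)).
have [g [Lg lg]] : exists g, L2d g /\ limd (fun n => lext (@gmon R) (sn n)) g.
  by apply: (lim _ 1 (@L2_gmon R) ler01) => s; rewrite mul1r projection_le.
have [w [Lw lw]] : exists g, L2d g /\ limd (fun n => lext (@wmon R) (sn n)) g.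
  by apply: (lim _ 1 (@L2_wmon R) ler01) => s; rewrite mul1r sqnorm_wmon sqnorm_umon_le.
have [v [Lv lv]] : exists g, L2d g /\ limd (fun n => lext (@vmon R) (sn n)) g.
  by apply: (lim _ 4 (@L2_vmon R)) => // s; exact: sqnorm_vmon_le.
have [P [LP lP]] : exists g, L2d g /\ limd (fun n => lext (@pmon R) (sn n)) g.
  by apply: (lim _ 1 (@L2_pmon R) ler01) => s; rewrite mul1r sqnorm_pmon_le.
have c0 : 0 <= 2 * pi / disk_area R.
  by rewrite divr_ge0// ltW// ?disk_area_gt0// pi2_gt0.
have [k [Lk lk]] := lext_limit mD mC Lz (@L2_pmon_bd R) c0 (@sqnorm_pmon_bd_le R) Lf lf.
exists sn, g, w, v, P, (fun t => climit (fun m => lext (@pmon_bd R) (sn (k m)) t)); split => //.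
- split => // t; congr climit; apply/funext => m; apply: eq_bigr => u _.
  by rewrite /pmon_bd /prim_bd expi_periodic.
- by split => //; exact: limL2_umon.
Qed.

Lemma L2d_B f g : L2d f -> L2d g -> L2d (fun x => f x - g x).
Proof. exact: L2B. Qed.

Lemma xray_step k f g w (sn : nat -> seq (R[i] * (nat * nat))) : L2d f -> L2d g -> L2d w ->
  limd (fun n => lext (@umon R) (sn n)) (fun x => f x - g x) ->
  limd (fun n => lext (@wmon R) (sn n)) w ->
  xray (fun p => freq (fun x => f x - g x) k p + freq w (k - 2) p) (fun=> 0).
Proof.
move=> Lf Lg Lw lu lw; have Ld := L2d_B Lf Lg.
pose U n := lext (@umon R) (sn n); pose W n := lext (@wmon R) (sn n).
have LU n : L2d (U n) := L2d_lextF (sn n) (@L2_umon R).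
have LW n : L2d (W n) := L2d_lextF (sn n) (@L2_wmon R).
have lU := @limL2_freq R U (fun x => f x - g x) k LU Ld lu.
have lW := @limL2_freq R W w (k - 2) LW Lw lw.
have lS := limL2_D mS (fun n => L2s_freq k (LU n)) (fun n => L2s_freq (k - 2) (LW n))
  (L2s_freq k Ld) (L2s_freq (k - 2) Lw) lU lW.
have l0 : limL2 leb2 (@influx R) (fun=> fun=> 0) (fun=> 0).
  apply: limL2_const; transitivity (NI (fun=> 0)); last exact: sqnorm0.
  by apply: eq_sqnorm => q _; rewrite subrr.
have LS := L2SM_D (L2SM_freq k Ld) (L2SM_freq (k - 2) Lw).
exact: (xray_closed LS L2influx_0 (fun n => xray_tlext k (sn n)) lS l0).
Qed.

Lemma hol_limit_gmon g (sn : nat -> seq (R[i] * (nat * nat))) :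
  limd (fun n => lext (@gmon R) (sn n)) g -> hol_limit g.
Proof.
move=> lg; exists (fun n => glist (sn n)).
have <- : (fun n => lext (@gmon R) (sn n)) = (fun n => lext (@holmon R) (glist (sn n))); last exact: lg.
by apply/funext => n; exact: lext_gmon.
Qed.

Theorem xray_descent k f : L2d f -> exists g w,
  [/\ L2d g, L2d w, hol_limit g &
    xray (fun p => freq (fun x => f x - g x) k p + freq w (k - 2) p) (fun=> 0)].
Proof.
move=> Lf; have [sn [g [w [v [P [tau]]]]]] := disk_primitive Lf.
move=> [[Lg Lw _ _] _ [lu lg lw _] _ _]; exists g, w; split => //.
  exact: hol_limit_gmon lg.
exact: xray_step lu lw.
Qed.

End xray_primitives.

(** * The frequencies 1 and -1 *)

Section L2_limits.
Context d (T : measurableType d) (R : realType).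
Variables (mu : {measure set T -> \bar R}) (D : set T).
Hypothesis mD : measurable D.
Implicit Types (fn gn : nat -> T -> R[i]) (f g : T -> R[i]).

Definition L2lim fn f := [/\ forall n, L2 mu D (fn n), L2 mu D f & limL2 mu D fn f].

Lemma L2lim_D fn gn f g : L2lim fn f -> L2lim gn g ->
  L2lim (fun n x => fn n x + gn n x) (fun x => f x + g x).
Proof.
move=> [Ln Lf lf] [Mn Lg lg]; split; [by move=> n; exact: L2D|exact: L2D|exact: limL2_D].
Qed.

Lemma L2lim_Z (c : R[i]) fn f : L2lim fn f -> L2lim (fun n x => c * fn n x) (fun x => c * f x).
Proof. by move=> [Ln Lf lf]; split; [move=> n; exact: L2Z|exact: L2Z|exact: limL2_Z]. Qed.

Lemma L2lim_B fn gn f g : L2lim fn f -> L2lim gn g ->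
  L2lim (fun n x => fn n x - gn n x) (fun x => f x - g x).
Proof.
move=> [Ln Lf lf] [Mn Lg lg]; split; [by move=> n; exact: L2B|exact: L2B|].
by apply: limL2_D => //; [move=> n; exact: L2N|exact: L2N|exact: limL2_N].
Qed.

Lemma L2lim_conj fn f : L2lim fn f -> L2lim (fun n x => conjc (fn n x)) (fun x => conjc (f x)).
Proof. by move=> [Ln Lf lf]; split; [move=> n; exact: L2conj|exact: L2conj|exact: limL2_conj]. Qed.

Lemma L2lim_cvg fn f : L2lim fn f -> cvgL2 mu D fn f.
Proof. by move=> [Ln Lf lf]; apply/cvgL2_limL2. Qed.

End L2_limits.

Section smooth_primitives.
Variable R : realType.
Implicit Types (f g h : R * R -> R[i]) (x : R * R) (i j : nat * nat).

Lemma csmoothB f g : csmooth f -> csmooth g -> csmooth (fun x => f x - g x).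
Proof.
move=> sf sg; have := csmoothD sf (csmoothM (csmooth_cst (-1)) sg).
by congr csmooth; apply/funext => x; rewrite mulN1r.
Qed.

Lemma csmoothZ (c : R[i]) f : csmooth f -> csmooth (fun x => c * f x).
Proof. by move=> sf; apply: csmoothM => //; exact: csmooth_cst. Qed.

Lemma fstorderB (c1 c2 : R[i]) f g x : csmooth f -> csmooth g ->
  fstorder c1 c2 (fun x => f x - g x) x = fstorder c1 c2 f x - fstorder c1 c2 g x.
Proof.
move=> sf sg; have sg' := csmoothZ (-1) sg.
rewrite (_ : (fun x => f x - g x) = fun x => f x + (-1) * g x).
  by rewrite fstorderD// fstorderZ// mulN1r.
by apply/funext => y; rewrite mulN1r.
Qed.

Lemma del_conj f x : csmooth f -> del (fun x => conjc (f x)) x = conjc (delbar f x).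
Proof.
move=> sf; rewrite /del /delbar /partialx /partialy !partial_conj//.
move: (partial _ _ _) (partial _ _ _) => q p.
have -> : conjc (2^-1 * (p + (0 +i* 1) * q)) = conjc 2^-1 * (conjc p + conjc (0 +i* 1) * conjc q).
  by rewrite !(rmorphM, rmorphD).
have -> : conjc 2^-1 = 2^-1 :> R[i] by rewrite fmorphV rmorph_nat.
have -> : conjc (0 +i* 1) = - (0 +i* 1) :> R[i] by apply: complex_eq; rewrite /= ?oppr0.
by ring.
Qed.

Lemma delbar_conj f x : csmooth f -> delbar (fun x => conjc (f x)) x = conjc (del f x).
Proof.
move=> sf; have := del_conj x (csmooth_conj sf).
rewrite (_ : (fun x => conjc (conjc (f x))) = f) => [->|]; first by rewrite conjcK.
by apply/funext => y; rewrite conjcK.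
Qed.

Lemma csmooth_vmon i : csmooth (@vmon R i).
Proof. by apply: csmoothZ; apply: csmoothB; exact: csmooth_zmon. Qed.

Lemma csmooth_pmon i : csmooth (@pmon R i).
Proof. by do 2 apply: csmoothZ; exact: csmooth_zmon. Qed.

Lemma del_vmon i x : del (@vmon R i) x = umon i x.
Proof.
rewrite delE fstorderZ; last by apply: csmoothB; exact: csmooth_zmon.
by rewrite fstorderB; [rewrite -delE !del_zmon|exact: csmooth_zmon..].
Qed.

Lemma delbar_vmon i x : delbar (@vmon R i) x = wmon i x.
Proof.
rewrite delbarE fstorderZ; last by apply: csmoothB; exact: csmooth_zmon.
by rewrite fstorderB; [rewrite -delbarE !delbar_zmon|exact: csmooth_zmon..].
Qed.

Lemma del_pmon i x : del (@pmon R i) x = gmon i x.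
Proof.
rewrite delE fstorderZ; last by apply: csmoothZ; exact: csmooth_zmon.
rewrite fstorderZ; last exact: csmooth_zmon.
rewrite -delE [del _ _](del_zmon (i.1 - i.2).+1 0) [_.+1.-1]/= mulrA mulrA -(mulrA (gcoef _ _))
  mulVf ?natC0//.
by rewrite mulr1.
Qed.

Lemma delbar_pmon i x : delbar (@pmon R i) x = 0.
Proof.
rewrite delbarE fstorderZ; last by apply: csmoothZ; exact: csmooth_zmon.
rewrite fstorderZ; last exact: csmooth_zmon.
by rewrite -delbarE [delbar _ _](delbar_zmon (i.1 - i.2).+1 0) mul0r !mulr0.
Qed.

Lemma vmon_circle i t : @vmon R i (cos t, sin t) = 0.
Proof.
have zt j : @zmon R j (cos t, sin t) = expi (deg j) t.
  by rewrite -expi_pow /zmon zc_circle.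
by rewrite /vmon !zt bal_deg subrr mulr0.
Qed.

Lemma pmon_circle i t : @pmon R i (cos t, sin t) = pmon_bd i t.
Proof. by rewrite /pmon prim_circle. Qed.

Lemma partialx_del f x : partialx f x = del f x + delbar f x.
Proof. rewrite /del /delbar; field; exact: isT. Qed.

Lemma partialy_del f x : partialy f x = (0 +i* 1) * (del f x - delbar f x).
Proof.
rewrite /del /delbar; move: (partialx _ _) (partialy _ _) => p q.
have ii : (0 +i* 1) * (0 +i* 1) = - 1 :> R[i] by apply: complex_eq; rewrite !ReImE /=; ring.
rewrite (_ : _ * _ = - ((0 +i* 1) * (0 +i* 1)) * q); last by field.
by rewrite ii opprK mul1r.
Qed.

End smooth_primitives.

Section odd_descent.
Variable R : realType.
Local Notation leb1 := (@lebesgue_measure R).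
Local Notation leb2 := (leb1 \x leb1)%E.
Local Notation leb3 := (leb2 \x leb1)%E.
Local Notation L2d := (L2 leb2 (@disk R)).
Local Notation L2c := (L2 leb1 (@circle R)).
Local Notation innc := (inner leb1 (@circle R)).
Local Notation limd := (L2lim leb2 (@disk R)).
Local Notation limc := (L2lim leb1 (@circle R)).
Implicit Types (f g h : R * R -> R[i]) (x : R * R) (i j : nat * nat) (a b m n : nat) (k : int).
Implicit Types s : seq (R[i] * (nat * nat)).

Let mD := @measurable_disk R.

Let mC := @measurable_circle R.

Local Notation ii := (0 +i* 1 : R[i]).

(** With f1 = del(v + P) and conj(f2) = del(v' + P'), this h and phi = (v + conj(v'))/2 solve f1 =
    del phi + del h / i and f2 = delbar phi - delbar h / i, that is, f1 e^(i theta) + f2 e^(-i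
    theta) = X phi + X_perp h. The type [T] is arbitrary because the derivatives and the trace of h
    are given by the same formula with other arguments. *)
Definition perp_mix (T : Type) (v v' P P' : T -> R[i]) : T -> R[i] :=
  fun y => ii * (2^-1 * (v y - conjc (v' y)) + (P y - conjc (P' y))).

Lemma perp_mix_lim d (T : measurableType d) (mu : {measure set T -> \bar R}) (D : set T)
    (mD0 : measurable D) (vn v'n Pn P'n : nat -> T -> R[i]) v v' P P' :
  L2lim mu D vn v -> L2lim mu D v'n v' -> L2lim mu D Pn P -> L2lim mu D P'n P' ->
  L2lim mu D (fun n => perp_mix (vn n) (v'n n) (Pn n) (P'n n)) (perp_mix v v' P P').
Proof.
move=> h1 h2 h3 h4; apply: (L2lim_Z mD0); apply: (L2lim_D mD0).
  by apply: (L2lim_Z mD0); apply: (L2lim_B mD0) => //; exact: (L2lim_conj mD0).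
by apply: (L2lim_B mD0) => //; exact: (L2lim_conj mD0).
Qed.

Definition perp_pot s s' := perp_mix (lext (@vmon R) s) (lext (@vmon R) s') (lext (@pmon R) s)
  (lext (@pmon R) s').

Lemma csmooth_perp_pot s s' : csmooth (perp_pot s s').
Proof.
have sv t := csmooth_lext t (@csmooth_vmon R); have sp t := csmooth_lext t (@csmooth_pmon R).
apply: csmoothZ; apply: csmoothD; [apply: csmoothZ|]; apply: csmoothB => //; exact: csmooth_conj.
Qed.

Lemma fstorder_perp_pot c1 c2 s s' x : fstorder c1 c2 (perp_pot s s') x =
  ii * (2^-1 * (fstorder c1 c2 (lext (@vmon R) s) x - fstorder c1 c2 (fun x => conjc (lext (@vmon
    R) s' x)) x) +
    (fstorder c1 c2 (lext (@pmon R) s) x - fstorder c1 c2 (fun x => conjc (lext (@pmon R) s' x)) x)).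
Proof.
have sv t := csmooth_lext t (@csmooth_vmon R); have sp t := csmooth_lext t (@csmooth_pmon R).
have svc t := csmooth_conj (sv t); have spc t := csmooth_conj (sp t).
have s1 := csmoothB (sv s) (svc s'); have s2 := csmoothB (sp s) (spc s').
rewrite /perp_pot /perp_mix (fstorderZ _ _ _ _ (csmoothD (csmoothZ 2^-1 s1) s2)).
rewrite (fstorderD _ _ _ (csmoothZ 2^-1 s1) s2) (fstorderZ _ _ _ _ s1).
by rewrite (fstorderB _ _ _ (sv s) (svc s')) (fstorderB _ _ _ (sp s) (spc s')).
Qed.

Lemma del_lext (F G : nat * nat -> R * R -> R[i]) s x : (forall i, csmooth (F i)) ->
  (forall i x, del (F i) x = G i x) -> del (lext F s) x = lext G s x.
Proof.
move=> sF FG; rewrite delE fstorder_lext//; apply: eq_bigr => t _.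
by rewrite -FG delE.
Qed.

Lemma delbar_lext (F G : nat * nat -> R * R -> R[i]) s x : (forall i, csmooth (F i)) ->
  (forall i x, delbar (F i) x = G i x) -> delbar (lext F s) x = lext G s x.
Proof.
move=> sF FG; rewrite delbarE fstorder_lext//; apply: eq_bigr => t _.
by rewrite -FG delbarE.
Qed.

Lemma delbar_pext s x : delbar (lext (@pmon R) s) x = 0.
Proof.
rewrite (@delbar_lext _ (fun _ _ => 0)); [|exact: csmooth_pmon|exact: delbar_pmon].
by rewrite /lext big1// => t _; rewrite mulr0.
Qed.

Lemma del_perp_pot s s' x : del (perp_pot s s') x =
  perp_mix (lext (@umon R) s) (lext (@wmon R) s') (lext (@gmon R) s) (fun=> 0) x.
Proof.
have sv t := csmooth_lext t (@csmooth_vmon R); have sp t := csmooth_lext t (@csmooth_pmon R).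
rewrite delE fstorder_perp_pot -delE (del_conj _ (sv s')) (del_conj _ (sp s')) delbar_pext.
rewrite (del_lext s x (@csmooth_vmon R) (@del_vmon R)) (del_lext s x (@csmooth_pmon R) (@del_pmon R)).
by rewrite (delbar_lext s' x (@csmooth_vmon R) (@delbar_vmon R)).
Qed.

Lemma delbar_perp_pot s s' x : delbar (perp_pot s s') x =
  perp_mix (lext (@wmon R) s) (lext (@umon R) s') (fun=> 0) (lext (@gmon R) s') x.
Proof.
have sv t := csmooth_lext t (@csmooth_vmon R); have sp t := csmooth_lext t (@csmooth_pmon R).
rewrite delbarE fstorder_perp_pot -delbarE (delbar_conj _ (sv s')) (delbar_conj _ (sp s')) delbar_pext.
rewrite (delbar_lext s x (@csmooth_vmon R) (@delbar_vmon R)) (del_lext s' x (@csmooth_pmon R)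
  (@del_pmon R)).
by rewrite (del_lext s' x (@csmooth_vmon R) (@del_vmon R)).
Qed.

Lemma perp_pot_circle s s' t : perp_pot s s' (cos t, sin t) =
  perp_mix (fun=> 0) (fun=> 0) (lext (@pmon_bd R) s) (lext (@pmon_bd R) s') t.
Proof.
have v0 r : lext (@vmon R) r (cos t, sin t) = 0.
  by rewrite /lext big1// => u _; rewrite vmon_circle mulr0.
have pc r : lext (@pmon R) r (cos t, sin t) = lext (@pmon_bd R) r t.
  by rewrite /lext; apply: eq_bigr => u _; rewrite pmon_circle.
by rewrite /perp_pot /perp_mix !v0 !pc.
Qed.

Lemma L2c_1 : L2c (fun=> 1).
Proof. by have := L2_expi R 0; congr (L2 _ _ _); apply/funext => t; exact: expi0. Qed.

Lemma cintegral_inner1 (r : R -> R[i]) : cintegral leb1 (@circle R) r = innc r (fun=> 1).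
Proof. by apply: eq_cintegral => t _; rewrite rmorph1 mulr1. Qed.

(** All boundary frequencies are at least 1. Together with v = 0 on the circle, this is how the zero
    mean in [H1dot] is secured. *)
Lemma cintegral_pmon_bd s : cintegral leb1 (@circle R) (lext (@pmon_bd R) s) = 0.
Proof.
have L1 := L2c_1; rewrite cintegral_inner1.
rewrite /lext (inner_suml mC s (fun t => L2Z mC t.1 (L2_pmon_bd R t.2)) L1) big1// => u _.
rewrite (innerZl mC u.1 (L2_pmon_bd R u.2) L1).
rewrite [innc _ _](innerZl mC (gcoef R u.2) (L2_prim_bd R _) L1).
rewrite [innc _ _](innerZl mC (_.+1%:R^-1) (L2_expi R _) L1).
have -> : innc (expi (u.2.1 - u.2.2).+1) (fun=> 1) = 0.
  transitivity (cintegral leb1 (@circle R) (expi (u.2.1 - u.2.2).+1)).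
    by apply: eq_cintegral => t _; rewrite rmorph1 mulr1.
  by rewrite cintegral_circle_expi.
by rewrite !mulr0.
Qed.

Lemma L2lim0 d (T : measurableType d) (mu : {measure set T -> \bar R}) (D : set T) :
  L2lim mu D (fun=> fun=> 0 : R[i]) (fun=> 0).
Proof.
split; [by move=> n; exact: L2_0|exact: L2_0|apply: limL2_const].
by transitivity (sqnorm mu D (fun=> 0)); [apply: eq_sqnorm => q _; rewrite subrr|exact: sqnorm0].
Qed.

Lemma perp_mix_mean (tau tau' : R -> R[i]) : L2c tau -> L2c tau' ->
  cintegral leb1 (@circle R) tau = 0 -> cintegral leb1 (@circle R) tau' = 0 ->
  cintegral leb1 (@circle R) (perp_mix (fun=> 0) (fun=> 0) tau tau') = 0.
Proof.
move=> L1 L2' t0 t'0; have int r : L2c r -> cintegrable leb1 (@circle R) r.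
  move=> Lr; have := L2M_integrable mC Lr L2c_1; congr (cintegrable _ _ _).
  by apply/funext => t; rewrite mulr1.
transitivity (cintegral leb1 (@circle R) (fun t => ii * (tau t - conjc (tau' t)))).
  by apply: eq_cintegral => t _; rewrite /perp_mix rmorph0 subrr mulr0 add0r.
rewrite (cintegralZ mC); last by apply: cintegrableB => //; [exact: int|apply: int; exact: (L2conj mC)].
rewrite cintegralB//; [|exact: int|by apply: int; exact: (L2conj mC)].
by rewrite cintegral_conj ?t0 ?t'0 ?rmorph0 ?subrr ?mulr0//; exact: int.
Qed.

(** The polynomials [perp_pot (sn n) (s'n n)] are at once the smooth approximants for the weak
    gradient and the witnesses for the trace. *)
Lemma H1dot_perp_pot (sn s'n : nat -> seq (R[i] * (nat * nat))) v v' P P' u u' w w' g g' tau tau' :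
  limd (fun n => lext (@vmon R) (sn n)) v -> limd (fun n => lext (@vmon R) (s'n n)) v' ->
  limd (fun n => lext (@pmon R) (sn n)) P -> limd (fun n => lext (@pmon R) (s'n n)) P' ->
  limd (fun n => lext (@umon R) (sn n)) u -> limd (fun n => lext (@umon R) (s'n n)) u' ->
  limd (fun n => lext (@wmon R) (sn n)) w -> limd (fun n => lext (@wmon R) (s'n n)) w' ->
  limd (fun n => lext (@gmon R) (sn n)) g -> limd (fun n => lext (@gmon R) (s'n n)) g' ->
  limc (fun n => lext (@pmon_bd R) (sn n)) tau -> limc (fun n => lext (@pmon_bd R) (s'n n)) tau' ->
  (forall t, tau (t + 2 * pi) = tau t) -> (forall t, tau' (t + 2 * pi) = tau' t) ->
  let dh := perp_mix u w' g (fun=> 0) in let dbh := perp_mix w u' (fun=> 0) g' in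
  H1dot (perp_mix v v' P P') (fun x => dh x + dbh x) (fun x => ii * (dh x - dbh x)).
Proof.
move=> lv lv' lP lP' lu lu' lw lw' lg lg' lt lt' pt pt' dh dbh.
pose hn n := perp_pot (sn n) (s'n n).
have sh n : csmooth (hn n) := csmooth_perp_pot (sn n) (s'n n).
have l0d := @L2lim0 _ _ leb2 (@disk R); have l0c := @L2lim0 _ _ leb1 (@circle R).
have lh := perp_mix_lim mD lv lv' lP lP'.
have ldh := perp_mix_lim mD lu lw' lg l0d; have ldbh := perp_mix_lim mD lw lu' l0d lg'.
have ltau := perp_mix_lim mC l0c l0c lt lt'.
have lx := L2lim_D mD ldh ldbh; have ly := L2lim_Z mD ii (L2lim_B mD ldh ldbh).
have ex n x : partialx (hn n) x = del (hn n) x + delbar (hn n) x by exact: partialx_del.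
have ey n x : partialy (hn n) x = ii * (del (hn n) x - delbar (hn n) x) by exact: partialy_del.
exists (perp_mix (fun=> 0) (fun=> 0) tau tau').
- split.
  + case: lh => _ Lh lh; case: lx => Lxn Lx lx; case: ly => Lyn Ly ly; split => //.
    * rewrite partialxE; apply: (weakly_limit (un := hn) _ _ Lxn Lh Lx lh lx) => // n x _.
      by rewrite -partialxE ex del_perp_pot delbar_perp_pot.
    * rewrite partialyE; apply: (weakly_limit (un := hn) _ _ Lyn Lh Ly lh ly) => // n x _.
      by rewrite -partialyE ey del_perp_pot delbar_perp_pot.
  + split; last by case: ltau.
    by move=> t; rewrite /perp_mix pt pt'.
  + exists hn; split => //; first split.
    * exact: L2lim_cvg lh.
    * have <- : (fun n x => perp_mix (lext (@umon R) (sn n)) (lext (@wmon R) (s'n n)) (lext (@gmon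
      R) (sn n)) (fun=> 0) x +
        perp_mix (lext (@wmon R) (sn n)) (lext (@umon R) (s'n n)) (fun=> 0) (lext (@gmon R) (s'n
          n)) x) = (fun n => partialx (hn n)).
        by apply/funext => n; apply/funext => x; rewrite ex del_perp_pot delbar_perp_pot.
      exact: L2lim_cvg lx.
    * have <- : (fun n x => ii * (perp_mix (lext (@umon R) (sn n)) (lext (@wmon R) (s'n n)) (lext
      (@gmon R) (sn n)) (fun=> 0) x -
        perp_mix (lext (@wmon R) (sn n)) (lext (@umon R) (s'n n)) (fun=> 0) (lext (@gmon R) (s'n
          n)) x)) = (fun n => partialy (hn n)).
        by apply/funext => n; apply/funext => x; rewrite ey del_perp_pot delbar_perp_pot.
      exact: L2lim_cvg ly.
    * have <- : (fun n => perp_mix (fun=> 0) (fun=> 0) (lext (@pmon_bd R) (sn n)) (lext (@pmon_bd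
      R) (s'n n))) = (fun n t => hn n (cos t, sin t)).
        by apply/funext => n; apply/funext => t; rewrite /hn perp_pot_circle.
      exact: L2lim_cvg ltau.
have mean r (rn : nat -> seq (R[i] * (nat * nat))) : limc (fun n => lext (@pmon_bd R) (rn n)) r ->
    cintegral leb1 (@circle R) r = 0.
  move=> [Ln Lr lr]; rewrite cintegral_inner1.
  apply: (limL2_inner mC Ln Lr L2c_1 lr) => n; rewrite -cintegral_inner1; exact: cintegral_pmon_bd.
apply: perp_mix_mean; [by case: lt|by case: lt'|exact: mean lt|exact: mean lt'].
Qed.

Lemma X_perp_freq (hx hy : R * R -> R[i]) p : @X_perp R hx hy p =
  freq (fun x => 2^-1 * (- ii * hx x - hy x)) 1 p + freq (fun x => 2^-1 * (ii * hx x - hy x)) (-1) p.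
Proof.
have e1 t : expi 1 t = (cos t)%:C + ii * (sin t)%:C :> R[i].
  by rewrite /expi mul1r; apply: complex_eq; rewrite !ReImE /=; ring.
have e2 t : expi (-1) t = (cos t)%:C - ii * (sin t)%:C :> R[i].
  by rewrite -expi_conj e1; apply: complex_eq; rewrite !ReImE /=; ring.
have i2 : ii * ii = - 1 :> R[i] by apply: complex_eq; rewrite !ReImE /=; ring.
rewrite /X_perp /freq e1 e2; move: (hx p.1) (hy p.1) (cos p.2)%:C (sin p.2)%:C => X Y C S.
transitivity (- (ii * ii) * S * X - C * Y); first by rewrite i2; ring.
(* The factor -i^2 = 1 has been inserted so that the identity holds with i as an indeterminate. *)
by field.
Qed.

Lemma X_perp_mix (dh dbh : R * R -> R[i]) p :
  @X_perp R (fun x => dh x + dbh x) (fun x => ii * (dh x - dbh x)) p =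
  ii * (freq dbh (-1) p - freq dh 1 p).
Proof.
rewrite X_perp_freq /freq; move: (dh p.1) (dbh p.1) (expi 1 p.2) (expi (-1) p.2) => X Y C S.
by field.
Qed.

Lemma perp_mix_conj (F W : R[i]) t :
  conjc (F * expi 1 t + W * expi (-1) t) = conjc F * expi (-1) t + conjc W * expi 1 t.
Proof. by rewrite rmorphD !rmorphM -[in RHS](expi_conj 1) -[X in _ = _ + _ * X](expi_conj (-1)). Qed.

Theorem odd_descent f1 f2 : L2d f1 -> L2d f2 -> exists h hx hy, H1dot h hx hy /\
  xray (fun p => freq f1 1 p + freq f2 (-1) p - X_perp hx hy p) (fun=> 0).
Proof.
(* [f2] enters through its conjugate, because [disk_primitive] inverts [del] and not [delbar]. *)
move=> L1 L2'; have L2c' := L2conj mD L2'.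
have [sn [g [w [v [P [tau]]]]]] := disk_primitive L1.
move=> [[Lg Lw Lv LP] [Lt pt] [lu lg lw lv] lP lt].
have [s'n [g' [w' [v' [P' [tau']]]]]] := disk_primitive L2c'.
move=> [[Lg' Lw' Lv' LP'] [Lt' pt'] [lu' lg' lw' lv'] lP' lt'].
have mk F r f : (forall i, L2d (F i)) -> L2d f -> limL2 leb2 (@disk R) (fun n => lext F (r n)) f ->
    limd (fun n => lext F (r n)) f.
  by move=> LF Lf lf; split => // n; exact: L2d_lextF.
have mkc F r q : (forall i, L2c (F i)) -> L2c q -> limL2 leb1 (@circle R) (fun n => lext F (r n)) q ->
    limc (fun n => lext F (r n)) q.
  by move=> LF Lf lf; split => // n; exact: (L2_lext mC _ LF).
have Lu := L2d_B L1 Lg; have Lu' := L2d_B L2c' Lg'.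
have H := H1dot_perp_pot (mk _ _ _ (@L2_vmon R) Lv lv) (mk _ _ _ (@L2_vmon R) Lv' lv')
  (mk _ _ _ (@L2_pmon R) LP lP) (mk _ _ _ (@L2_pmon R) LP' lP')
  (mk _ _ _ (@L2_umon R) Lu lu) (mk _ _ _ (@L2_umon R) Lu' lu')
  (mk _ _ _ (@L2_wmon R) Lw lw) (mk _ _ _ (@L2_wmon R) Lw' lw')
  (mk _ _ _ (@L2_gmon R) Lg lg) (mk _ _ _ (@L2_gmon R) Lg' lg')
  (mkc _ _ _ (@L2_pmon_bd R) Lt lt) (mkc _ _ _ (@L2_pmon_bd R) Lt' lt') pt pt'.
have x1 := xray_step 1 L1 Lg Lw lu lw.
have x2 := xray_conj (xray_step 1 L2c' Lg' Lw' lu' lw').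
(* Half the sum is X phi for phi = (v + conj(v'))/2, which vanishes on the boundary. *)
have := xrayZ 2^-1 (xrayD x1 x2) => x3.
eexists; eexists; eexists; split; first exact: H.
move: x3; congr (xray _ _); apply/funext => p; last by rewrite rmorph0 addr0 mulr0.
rewrite [X_perp _ _ p]X_perp_mix /perp_mix /freq -[1 - 2]/(-1 : int) perp_mix_conj rmorph0.
rewrite (_ : conjc (conjc (f2 p.1) - g' p.1) = f2 p.1 - conjc (g' p.1)); last by rewrite rmorphB;
  congr (_ - _); exact: conjcK.
have i2 : ii * ii = - 1 :> R[i] by apply: complex_eq; rewrite !ReImE /=; ring.
move: (f1 p.1) (f2 p.1) (g p.1) (conjc (g' p.1)) (w p.1) (conjc (w' p.1)) => F1 F2 G G' W W'.
move: (expi 1 p.2) (expi (-1) p.2) => E E'; move: i2; set k := ii => i2.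
transitivity (F1 * E + F2 * E' + (k * k) * ((2^-1 * (F1 - G - W') + G) * E - (2^-1 * (W - (F2 -
  G')) - G') * E')).
  by rewrite i2; field.
by ring.
Qed.

End odd_descent.

(** * The range decompositions *)

Section orthogonal_uniqueness.
Context d (T : measurableType d) (R : realType).
Variables (mu : {measure set T -> \bar R}) (D : set T).
Hypothesis mD : measurable D.
Local Notation L2m := (L2 mu D).
Local Notation Nm := (sqnorm mu D).
Local Notation innm := (inner mu D).

Lemma inner_null f g h : L2m f -> L2m g -> L2m h -> Nm (fun x => f x - g x) = 0 ->
  innm f h = innm g h.
Proof.
move=> Lf Lg Lh z; apply/eqP; rewrite -subr_eq0 -(innerBl mD Lf Lg Lh); apply/eqP/nsq_eq0.
apply/eqP; rewrite eq_le nsq_ge0 andbT.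
by have := cauchy_schwarz mD (L2B mD Lf Lg) Lh; rewrite z mul0r.
Qed.

(** The differences w j - w' j are pairwise orthogonal with null sum; the product of this sum with
    one of them is its squared norm. *)
Lemma orthogonal_unique (J : finType) (w w' : J -> T -> R[i]) :
  (forall j, L2m (w j)) -> (forall j, L2m (w' j)) ->
  (forall i j, i != j -> [/\ innm (w i) (w j) = 0, innm (w i) (w' j) = 0,
    innm (w' i) (w j) = 0 & innm (w' i) (w' j) = 0]) ->
  Nm (fun x => \sum_j w j x - \sum_j w' j x) = 0 ->
  forall j, Nm (fun x => w j x - w' j x) = 0.
Proof.
move=> Lw Lw' oW z j; pose e i x := w i x - w' i x.
have Le i : L2m (e i) := L2B mD (Lw i) (Lw' i).
have oe i : i != j -> innm (e i) (e j) = 0.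
  move=> ij; have [p1 p2 p3 p4] := oW _ _ ij.
  rewrite (innerBl mD (Lw i) (Lw' i) (Le j)) (innerBr mD (Lw j) (Lw' j) (Lw i)).
  by rewrite (innerBr mD (Lw j) (Lw' j) (Lw' i)) p1 p2 p3 p4 !subrr.
have Ls : L2m (fun x => \sum_i e i x) by exact: L2_sum.
have E : innm (fun x => \sum_i e i x) (e j) = (Nm (e j))%:C.
  rewrite (inner_suml mD _ Le (Le j)) (bigD1 j)//= big1 ?addr0 ?inner_self//.
have zs : Nm (fun x => \sum_i e i x) = 0.
  by rewrite -z; apply: eq_sqnorm => x _; rewrite sumrB.
have := cauchy_schwarz mD Ls (Le j); rewrite E zs mul0r nsq_real => h.
by apply/eqP; rewrite -sqrf_eq0 eq_le h sqr_ge0.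
Qed.

End orthogonal_uniqueness.

(** * Images of the kernels and conjugation between them *)

Section kernels.
Variable R : realType.
Local Notation leb1 := (@lebesgue_measure R).
Local Notation leb2 := (leb1 \x leb1)%E.
Local Notation leb3 := (leb2 \x leb1)%E.
Local Notation L2d := (L2 leb2 (@disk R)).
Local Notation L2i := (L2 leb2 (@influx R)).
Local Notation NI := (sqnorm leb2 (@influx R)).
Local Notation NS := (sqnorm leb3 (@SM R)).
Local Notation inni := (inner leb2 (@influx R)).
Implicit Types (f g h : R * R -> R[i]) (x : R * R) (u : R * R * R -> R[i]) (e k : int) (m n q : nat).

Let mD := @measurable_disk R.

Let mI := @measurable_influx R.

Let mS := @measurable_SM R.

Lemma test_conj phi : test_function phi -> test_function (fun x => conjc (phi x) : R[i]).
Proof.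
move=> [sp [K [cK Kd p0]]]; split; first exact: csmooth_conj.
by exists K; split => // x /p0 ->; rewrite rmorph0.
Qed.

Lemma weakly_conj c1 c2 c1' c2' f : L2d f ->
  (forall phi x, csmooth phi -> fstorder c1 c2 (fun x => conjc (phi x)) x = conjc (fstorder c1' c2'
    phi x)) ->
  weakly (fstorder c1 c2) f (fun=> 0) -> weakly (fstorder c1' c2') (fun x => conjc (f x)) (fun=> 0).
Proof.
move=> Lf cj wf phi tp; have := wf _ (test_conj tp).
have z (r : R * R -> R[i]) : cintegral leb2 (@disk R) (fun x => 0 * r x) = 0.
  by transitivity (cintegral leb2 (@disk R) (fun=> 0)); [apply: eq_cintegral => x _;
    rewrite mul0r|exact: cintegral0].
rewrite !z oppr0 => h; have [_ LP] := test_L2 c1 c2 (test_conj tp).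
transitivity (conjc (cintegral leb2 (@disk R) (fun x => f x * fstorder c1 c2 (fun x => conjc (phi
  x)) x))).
  rewrite -(cintegral_conj mD (L2M_integrable mD Lf LP)); apply: eq_cintegral => x _.
  have [sp _] := tp; rewrite (cj phi x sp).
  by move: (f x) (fstorder _ _ _ _) => a b; rewrite [RHS]rmorphM; congr (_ * _); rewrite [RHS]conjcK.
by rewrite h rmorph0.
Qed.

Lemma weakly_del_conj f : L2d f -> weakly (@del R) f (fun=> 0) ->
  weakly (@delbar R) (fun x => conjc (f x)) (fun=> 0).
Proof.
move=> Lf; rewrite delE delbarE; apply: weakly_conj => // phi x sp.
by rewrite -delE -delbarE del_conj.
Qed.

Lemma weakly_delbar_conj f : L2d f -> weakly (@delbar R) f (fun=> 0) ->
  weakly (@del R) (fun x => conjc (f x)) (fun=> 0).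
Proof.
move=> Lf; rewrite delE delbarE; apply: weakly_conj => // phi x sp.
by rewrite -delE -delbarE delbar_conj.
Qed.

Lemma xray_null_diff u g g' : xray u g -> xray u g' -> NI (fun p => g p - g' p) = 0.
Proof.
move=> xg xg'; have := xray_bound (xrayB xg xg').
have -> : NS (fun p => u p - u p) = 0.
  by transitivity (NS (fun=> 0)); [apply: eq_sqnorm => p _; rewrite subrr|exact: sqnorm0].
by rewrite mulr0 => h; apply/eqP; rewrite eq_le h sqnorm_ge0.
Qed.

Lemma freq_conj f k p : conjc (freq f k p) = freq (fun x => conjc (f x)) (- k) p.
Proof. by rewrite /freq -expi_conj; move: (f _) (expi _ _) => a b; rewrite [LHS]rmorphM. Qed.

Lemma xray_freq_conj f k g : xray (freq f k) g ->
  xray (freq (fun x => conjc (f x)) (- k)) (fun p => conjc (g p)).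
Proof.
by move=> /xray_conj; congr (xray _ _); apply/funext => p; exact: freq_conj.
Qed.

Definition freq_image e g := exists2 f, L2d f & xray (freq f e) g.

Definition minus_image e := xray_image (@ker_eta_minus R e).

Definition plus_image e := xray_image (@ker_eta_plus R e).

Lemma minus_imageE e g : minus_image e g <->
  exists f, [/\ L2d f, weakly (@delbar R) f (fun=> 0) & xray (freq f e) g].
Proof.
split; first by move=> [u [f [Lf wf ->]] xg]; exists f.
by move=> [f [Lf wf xg]]; exists (freq f e) => //; exists f.
Qed.

Lemma plus_imageE e g : plus_image e g <->
  exists f, [/\ L2d f, weakly (@del R) f (fun=> 0) & xray (freq f e) g].
Proof.
split; first by move=> [u [f [Lf wf ->]] xg]; exists f.
by move=> [f [Lf wf xg]]; exists (freq f e) => //; exists f.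
Qed.

Lemma minus_image_freq e g : minus_image e g -> freq_image e g.
Proof. by move=> /minus_imageE[f [Lf _ xg]]; exists f. Qed.

Lemma plus_image_freq e g : plus_image e g -> freq_image e g.
Proof. by move=> /plus_imageE[f [Lf _ xg]]; exists f. Qed.

Lemma xray_L2i u g : xray u g -> L2i g. Proof. by case=> _ []. Qed.

Lemma freq_image_L2 e g : freq_image e g -> L2i g.
Proof. by case=> f _ /xray_L2i. Qed.

Lemma orthogonal_minus e (j : nat) g h : freq_image e g -> minus_image (e + 2 * j.+1%:Z) h ->
  inni g h = 0.
Proof.
move=> [f Lf xg] /minus_imageE[f' [Lf' wf' xh]].
exact: (orthogonal_freq Lf Lf' (weakly_hol_limit Lf' wf') xg xh).
Qed.

(** Conjugation exchanges the kernels of [del] and [delbar] and reverses the sign of frequencies,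
    which reduces this case to [orthogonal_minus]. *)
Lemma orthogonal_plus e (j : nat) g h : freq_image e g -> plus_image (e - 2 * j.+1%:Z) h ->
  inni g h = 0.
Proof.
move=> fg ph; have Lg := freq_image_L2 fg; have Lh := freq_image_L2 (plus_image_freq ph).
move: fg ph => [f Lf xg] /plus_imageE[f' [Lf' wf' xh]].
have : inni (fun p => conjc (g p)) (fun p => conjc (h p)) = 0.
  apply: (@orthogonal_minus (- e) j).
    by exists (fun x => conjc (f x)); [exact: (L2conj mD)|exact: xray_freq_conj].
  apply/minus_imageE; exists (fun x => conjc (f' x)); split; first exact: (L2conj mD).
    exact: weakly_del_conj.
  by have := xray_freq_conj xh; rewrite opprB addrC.
move=> z; rewrite -[LHS]conjcK -[RHS](rmorph0 (@conjc R)) -z; congr conjc.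
rewrite /inner -(cintegral_conj mI (inner_integrable mI Lg Lh)).
by apply: eq_cintegral => x _; move: (g x) (h x) => a b; rewrite [LHS]rmorphM.
Qed.

(** Common form of the two leading summands: [range_I0E] for q = 0, where both frequencies coincide,
    and [range_IperpE] for q = 1. It lets both parities share one proof. *)
Definition low_image q g := exists f1 f2, [/\ L2d f1, L2d f2 &
  xray (fun p => freq f1 q p + freq f2 (- q%:Z) p) g].

(** The relation gives an image of the sum only. Images of the two terms come from [xray_total], and
    their sum agrees with [g] almost everywhere. *)
Lemma orthogonal_low q g h : low_image q g -> L2i h ->
  (forall a, freq_image q a -> inni a h = 0) -> (forall a, freq_image (- q%:Z) a -> inni a h = 0) ->
  inni g h = 0.
Proof.
move=> [f1 [f2 [L1 L2' xg]]] Lh o1 o2.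
have [a1 x1] := xray_total (L2SM_freq q L1); have [a2 x2] := xray_total (L2SM_freq (- q%:Z) L2').
have La1 := xray_L2i x1; have La2 := xray_L2i x2.
rewrite (inner_null mI (xray_L2i xg) (L2D mI La1 La2) Lh (xray_null_diff xg (xrayD x1 x2))).
rewrite (innerDl mI La1 La2 Lh) o1 ?o2 ?addr0//; first by exists f2.
by exists f1.
Qed.

End kernels.

Section range_decomposition.
Variable R : realType.
Local Notation leb1 := (@lebesgue_measure R).
Local Notation leb2 := (leb1 \x leb1)%E.
Local Notation leb3 := (leb2 \x leb1)%E.
Local Notation L2d := (L2 leb2 (@disk R)).
Local Notation L2i := (L2 leb2 (@influx R)).
Local Notation NI := (sqnorm leb2 (@influx R)).
Local Notation NS := (sqnorm leb3 (@SM R)).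
Local Notation inni := (inner leb2 (@influx R)).
Implicit Types (f g h : R * R -> R[i]) (x : R * R) (u : R * R * R -> R[i]) (e k : int) (m n q : nat).

Let mD := @measurable_disk R.

Let mI := @measurable_influx R.

Let mS := @measurable_SM R.

Lemma sum_freq_delta n a (tau : nat -> int) f p : (a < n)%N ->
  \sum_(j < n) freq (fun x => if (j : nat) == a then f x else 0) (tau j) p = freq f (tau a) p.
Proof.
move=> an; rewrite (bigD1 (Ordinal an))//= [X in X + _]/freq eqxx big1 ?addr0// => j ja.
by rewrite /freq ifN ?mul0r//; apply: contra ja => /eqP ja; apply/eqP/val_inj.
Qed.

Lemma tfreqS M j : tfreq M.+2 j.+1 = tfreq M j.
Proof. by rewrite /tfreq doubleS; lia. Qed.

Lemma tfreq0 M : tfreq M 0 = - M%:Z. Proof. by rewrite /tfreq addr0. Qed.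

Lemma tfreq_max M : tfreq M M = M%:Z.
Proof. by rewrite /tfreq; lia. Qed.

(** [xray_descent] removes the top frequency M + 2 directly and the bottom one -(M + 2) through
    conjugation. The remainders are added to the frequencies M and -M. *)
Lemma descent_step M (f : nat -> R * R -> R[i]) g : (forall j, L2d (f j)) ->
  xray (fun p => \sum_(j < M.+3) freq (f j) (tfreq M.+2 j) p) g ->
  exists (f' : nat -> R * R -> R[i]) g' gm gp, [/\ forall j, L2d (f' j),
    xray (fun p => \sum_(j < M.+1) freq (f' j) (tfreq M j) p) g',
    minus_image M.+2%:Z gm, plus_image (- M.+2%:Z) gp &
    g = fun x => g' x + gm x + gp x].
Proof.
move=> Lf xg; have Lc := L2conj mD (Lf 0%N).
have [G [w [LG Lw hG xt]]] := xray_descent M.+2%:Z (Lf M.+2).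
have [G' [w' [LG' Lw' hG' xb']]] := xray_descent M.+2%:Z Lc.
have xb := xray_conj xb'.
have LcG := L2conj mD LG'; have Lcw := L2conj mD Lw'.
have [gm xm] := xray_total (L2SM_freq M.+2%:Z LG).
have [gp xp] := xray_total (L2SM_freq (- M.+2%:Z) LcG).
(* The index is shifted by 1, as frequencies are counted from the bottom. For M = 0 both corrections
   fall on the same index, hence two separate conditionals. *)
pose f' (j : nat) (x : R * R) : R[i] := f j.+1 x - (if j == M then w x else 0) -
  (if j == 0%N then conjc (w' x) else 0).
have Lif (b : bool) h : L2d h -> L2d (fun x => if b then h x else 0).
  by move=> Lh; case: b => //; exact: L2_0.
exists f', (fun x => g x - gm x - gp x), gm, gp; split.
- by move=> j; apply: L2d_B; [apply: L2d_B => //|]; exact: Lif.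
- have := xrayB (xrayB (xrayB (xrayB xg xt) xb) xm) xp.
  congr (xray _ _); apply/funext => p; last by rewrite rmorph0 !subr0.
  under [RHS]eq_bigr do rewrite !freqB.
  rewrite !sumrB (@sum_freq_delta M.+1 M (tfreq M) w)// (@sum_freq_delta M.+1 0 (tfreq M) (fun x =>
    conjc (w' x)))//.
  rewrite big_ord_recl big_ord_recr /= tfreq_max tfreq0 tfreq0 tfreq_max.
  under eq_bigr do rewrite tfreqS.
  have -> : conjc (freq (fun x => conjc (f 0%N x) - G' x) M.+2 p + freq w' (M.+2%:Z - 2) p) =
      freq (f 0%N) (- M.+2%:Z) p - freq (fun x => conjc (G' x)) (- M.+2%:Z) p + freq (fun x =>
        conjc (w' x)) (- M%:Z) p.
    rewrite rmorphD /= !freq_conj -freqB (_ : - (M.+2%:Z - 2) = - M%:Z); last by lia.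
    congr (_ + _); rewrite /freq; congr (_ * _).
    by move: (f 0%N p.1) (G' p.1) => a b; rewrite rmorphB; congr (_ - _); exact: conjcK.
  rewrite freqB (_ : M.+2%:Z - 2 = M%:Z); last by lia.
  move: (\sum_(i < _) _) (freq _ _ _) (freq _ _ _) (freq _ _ _) (freq _ _ _) (freq _ _ _) (freq _ _
    _) => *; ring.
- by apply/minus_imageE; exists G; split => //; exact: hol_limit_weakly.
- apply/plus_imageE; exists (fun x => conjc (G' x)); split => //.
  by apply: weakly_delbar_conj => //; exact: hol_limit_weakly.
- by apply/funext => x; ring.
Qed.

End range_decomposition.

Definition lev (q k : nat) := (2 * k + q)%N.

(** * Assembly of the decomposition for both parities *)

Section orthogonal_decomposition.
Variable R : realType.
Local Notation leb1 := (@lebesgue_measure R).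
Local Notation leb2 := (leb1 \x leb1)%E.
Local Notation leb3 := (leb2 \x leb1)%E.
Local Notation L2d := (L2 leb2 (@disk R)).
Local Notation L2i := (L2 leb2 (@influx R)).
Local Notation NI := (sqnorm leb2 (@influx R)).
Local Notation NS := (sqnorm leb3 (@SM R)).
Local Notation inni := (inner leb2 (@influx R)).
Implicit Types (f g h : R * R -> R[i]) (x : R * R) (u : R * R * R -> R[i]) (e : int) (k m n q : nat).

Let mD := @measurable_disk R.

Let mI := @measurable_influx R.

Let mS := @measurable_SM R.

Lemma low_base q (f : nat -> R * R -> R[i]) g : (q <= 1)%N -> (forall j, L2d (f j)) ->
  xray (fun p => \sum_(j < q.+1) freq (f j) (tfreq q j) p) g -> low_image q g.
Proof.
have L0 : L2d (fun=> 0) by exact: L2_0.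
case: q => [|[|q]] // _ Lf xg.
  exists (f 0%N), (fun=> 0); split => //; move: xg; congr (xray _ _); apply/funext => p.
  by rewrite big_ord1 tfreq0 /freq mul0r addr0 oppr0.
exists (f 1%N), (f 0%N); split => //; move: xg; congr (xray _ _); apply/funext => p.
by rewrite big_ord_recl big_ord1 /= tfreq0 (tfreq_max 1) addrC.
Qed.

Lemma descent q m (f : nat -> R * R -> R[i]) g : (q <= 1)%N -> (forall j, L2d (f j)) ->
  xray (fun p => \sum_(j < (lev q m).+1) freq (f j) (tfreq (lev q m) j) p) g ->
  exists g0 (gm gp : nat -> R * R -> R[i]), [/\ low_image q g0,
    forall k, (k < m)%N -> minus_image (lev q k.+1)%:Z (gm k),
    forall k, (k < m)%N -> plus_image (- (lev q k.+1)%:Z) (gp k) &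
    g = fun x => g0 x + (\sum_(k < m) gm k x + \sum_(k < m) gp k x)].
Proof.
move=> q1; elim: m f g => [|m ih] f g Lf xg.
  exists g, (fun _ _ => 0), (fun _ _ => 0); split => //; first exact: low_base xg.
  by apply/funext => x; rewrite !big_ord0 !addr0.
have ls : lev q m.+1 = (lev q m).+2 by rewrite /lev mulnS.
rewrite ls in xg; have [f' [g' [am [ap [Lf' xg' hm hp ->]]]]] := descent_step Lf xg.
have [g0 [gm [gp [h0 hgm hgp ->]]]] := ih _ _ Lf' xg'; rewrite -ls in hm hp.
exists g0, (fun k => if k == m then am else gm k), (fun k => if k == m then ap else gp k); split => //.
- move=> k; rewrite ltnS leq_eqVlt => /orP[/eqP ->|km]; first by rewrite eqxx.
  by rewrite ltn_eqF//; exact: hgm.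
- move=> k; rewrite ltnS leq_eqVlt => /orP[/eqP ->|km]; first by rewrite eqxx.
  by rewrite ltn_eqF//; exact: hgp.
- apply/funext => x; rewrite !big_ord_recr /= eqxx.
  have E (a b : nat -> R * R -> R[i]) : \sum_(i < m) (if (i : nat) == m then a i else b i) x =
    \sum_(i < m) b i x.
    by apply: eq_bigr => i _; rewrite ltn_eqF.
  rewrite (E (fun=> am) gm) (E (fun=> ap) gp); ring.
Qed.

Lemma sum_summands m (w : option ('I_m + 'I_m) -> R * R -> R[i]) x :
  \sum_j w j x = w None x + (\sum_(k < m) w (Some (inl k)) x + \sum_(k < m) w (Some (inr k)) x).
Proof.
rewrite (bigD1 None)//=; congr (_ + _); rewrite -(@big_sumType _ _ _ _ _ predT (fun j => w (Some j) x)).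
rewrite (reindex_omap (some : 'I_m + 'I_m -> _) id)/=; last by case.
by apply: eq_bigl => j; rewrite eqxx.
Qed.

Definition tspan n u := exists2 f : nat -> R * R -> R[i], forall j, L2d (f j) &
  u = fun p => \sum_(j < n.+1) freq (f j) (tfreq n j) p.

Lemma tspanD n u v : tspan n u -> tspan n v -> tspan n (fun p => u p + v p).
Proof.
move=> [f Lf ->] [f' Lf' ->]; exists (fun j x => f j x + f' j x).
  by move=> j; exact: (L2D mD (Lf j) (Lf' j)).
by apply/funext => p; rewrite -big_split; apply: eq_bigr => j _; rewrite /freq mulrDl.
Qed.

Lemma tspan_freq n j f : (j <= n)%N -> L2d f -> tspan n (freq f (tfreq n j)).
Proof.
move=> jn Lf; exists (fun i x => if i == j then f x else 0).
  by move=> i; case: eqP => // _; exact: L2_0.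
by apply/funext => p; rewrite (@sum_freq_delta R n.+1 j (tfreq n)).
Qed.

Lemma tspan_lev q m (k : nat) f : (k <= m)%N -> L2d f -> tspan (lev q m) (freq f (lev q k)).
Proof.
move=> km Lf; have := @tspan_freq (lev q m) (m + k + q) f; rewrite (_ : tfreq _ _ = (lev q k)%:Z).
  by apply => //; rewrite /lev; lia.
by rewrite /tfreq /lev; lia.
Qed.

Lemma tspan_levN q m (k : nat) f : (k <= m)%N -> L2d f -> tspan (lev q m) (freq f (- (lev q k)%:Z)).
Proof.
move=> km Lf; have := @tspan_freq (lev q m) (m - k) f; rewrite (_ : tfreq _ _ = - (lev q k)%:Z).
  by apply => //; rewrite /lev; lia.
by rewrite /tfreq /lev; lia.
Qed.

Section assembly.
Variables (q m : nat) (W0 : set (R * R -> R[i])).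
Hypothesis q1 : (q <= 1)%N.
Hypothesis W0E : forall g, W0 g <-> low_image q g.

Let W := summands (m := m) W0 (fun k => minus_image (R := R) (lev q k)%:Z)
  (fun k => plus_image (R := R) (- (lev q k)%:Z)).

Lemma summands_tspan j g : W j g -> exists2 u, tspan (lev q m) u & xray u g.
Proof.
case: j => [[k|k]|] /=.
- by move=> /minus_image_freq[f Lf xg]; exists (freq f (lev q k.+1)) => //; exact: tspan_lev.
- by move=> /plus_image_freq[f Lf xg]; exists (freq f (- (lev q k.+1)%:Z)) => //; exact: tspan_levN.
- move=> /W0E[f1 [f2 [L1 L2' xg]]]; exists (fun p => freq f1 q p + freq f2 (- q%:Z) p) => //.
  by apply: tspanD; [exact: (@tspan_lev q m 0)|exact: (@tspan_levN q m 0)].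
Qed.

Lemma summands_L2influx j g : W j g -> L2influx g.
Proof. by move=> /summands_tspan[u _ []]. Qed.

Lemma summands_L2 j g : W j g -> L2i g.
Proof. by move=> /summands_L2influx []. Qed.

(** The orthogonality lemmas are one-sided: the second function must come from a kernel of higher
    frequency ([delbar]) or lower frequency ([del]) than the first. This relation orients each pair
    of summands accordingly. *)
Let before (i j : option ('I_m + 'I_m)) : bool :=
  match i, j with
  | None, Some _ => true
  | Some (inl k), Some (inl l) => (k < l)%N
  | Some (inl _), Some (inr _) => true
  | Some (inr k), Some (inr l) => (k < l)%N
  | _, _ => false
  end.

Let before_total i j : i != j -> before i j || before j i.
Proof.
case: i j => [[k|k]|] [[l|l]|] //= kl; rewrite -neq_ltn; apply: contra kl => /eqP kl;
  by apply/eqP; congr (Some (_ _)); exact: val_inj.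
Qed.

Let orthogonal_before i j g h : before i j -> W i g -> W j h -> inni g h = 0.
Proof.
move=> ij Wg Wh; have Lg := summands_L2 Wg; have Lh := summands_L2 Wh.
case: i j ij Wg Wh => [[k|k]|] [[l|l]|] //= kl Wg Wh.
(* The frequency gap is 2 (l - k); as [k < l], the predecessor is undone exactly by the successor in
   the lemma. *)
- apply: (@orthogonal_minus R (lev q k.+1) (l - k).-1 _ _ (minus_image_freq Wg)).
  by rewrite (_ : _ + _ = (lev q l.+1)%:Z)// /lev; lia.
- apply: (@orthogonal_plus R (lev q k.+1) (k + l + q).+1 _ _ (minus_image_freq Wg)).
  by rewrite (_ : _ - _ = - (lev q l.+1)%:Z)// /lev; lia.
- apply: (@orthogonal_plus R (- (lev q k.+1)%:Z) (l - k).-1 _ _ (plus_image_freq Wg)).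
  by rewrite (_ : _ - _ = - (lev q l.+1)%:Z)// /lev; lia.
- move/W0E: Wg => lg; apply: (orthogonal_low lg Lh) => a fa.
  + apply: (@orthogonal_minus R q l _ _ fa).
    by rewrite (_ : _ + _ = (lev q l.+1)%:Z)// /lev; lia.
  + apply: (@orthogonal_minus R (- q%:Z) (l + q) _ _ fa).
    by rewrite (_ : _ + _ = (lev q l.+1)%:Z)// /lev; lia.
- move/W0E: Wg => lg; apply: (orthogonal_low lg Lh) => a fa.
  + apply: (@orthogonal_plus R q (l + q) _ _ fa).
    by rewrite (_ : _ - _ = - (lev q l.+1)%:Z)// /lev; lia.
  + apply: (@orthogonal_plus R (- q%:Z) l _ _ fa).
    by rewrite (_ : _ - _ = - (lev q l.+1)%:Z)// /lev; lia.
Qed.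

Lemma summands_orthogonal i j g h : i != j -> W i g -> W j h -> inni g h = 0.
Proof.
move=> /before_total /orP[] ij Wg Wh; first exact: orthogonal_before ij Wg Wh.
by rewrite (innerC mI (summands_L2 Wh) (summands_L2 Wg)) (orthogonal_before ij Wh Wg) rmorph0.
Qed.

Lemma xray_summands (w : option ('I_m + 'I_m) -> R * R -> R[i]) : (forall j, W j (w j)) ->
  exists2 u, tspan (lev q m) u & xray u (fun x => \sum_j w j x).
Proof.
move=> Ww; elim: (index_enum _) => [|j s [u tu xu]].
  exists (fun=> 0).
    exists (fun _ _ => 0); first by move=> j; exact: L2_0.
    by apply/funext => p; rewrite big1// => j _; rewrite /freq mul0r.
  by have := xray_0 R; congr (xray _ _); apply/funext => x; rewrite big_nil.
have [v tv xv] := summands_tspan (Ww j); exists (fun p => v p + u p); first exact: tspanD.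
by have := xrayD xv xu; congr (xray _ _); apply/funext => x; rewrite big_cons.
Qed.

Lemma tspan_tensors n u : tspan n u -> tensors R n u.
Proof. by move=> [f Lf ->]; exact: tensors_freq_sum. Qed.

Lemma sqnormB0_ae g h : L2i g -> L2i h ->
  NI (fun x => g x - h x) = 0 <-> {ae leb2, forall x, @influx R x -> g x = h x}.
Proof.
move=> Lg Lh; have Ld := L2B mI Lg Lh; split => [z|z].
  by apply: (ae_imp (sqnorm0_ae mI Ld z)) => x zx /zx /eqP; rewrite subr_eq0 => /eqP.
have z0 : {ae leb2, forall x, @influx R x -> g x - h x = 0}.
  by apply: (ae_imp z) => x zx /zx ->; rewrite subrr.
by case: (ae_sqnorm0 mI (L2_meas Ld) z0).
Qed.

Theorem orthogonal_summands :
  orthogonal_direct_sum (xray_image (tensors R (lev q m))) W.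
Proof.
split.
- by move=> j g /summands_L2influx.
- move=> g; split.
    move=> [u tu xg]; have [Lu Lg _] := xg; split => //.
    have [f Lf zf] := tensor_decomposition tu.
    (* [u] agrees with its finite Fourier sum almost everywhere only; this sum is periodic and
       square-integrable, so [xray_ext] gives it the same image [g]. *)
    have [Lt _] := tensors_freq_sum (lev q m) Lf.
    have z : NI (fun x => g x - g x) = 0.
      by transitivity (NI (fun=> 0)); [apply: eq_sqnorm => p _; rewrite subrr|exact: sqnorm0].
    have [g0 [gm [gp [h0 hm hp E]]]] := descent q1 Lf (xray_ext xg Lt Lg zf z).
    pose w (j : option ('I_m + 'I_m)) := match j with None => g0 | Some (inl k) => gm k | Some (inr
      k) => gp k end.
    exists w.
      by case=> [[k|k]|]; [exact: hm|exact: hp|exact/W0E].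
    by apply: aeW => x _; rewrite {1}E; exact: esym (sum_summands w x).
  move=> [Lg [w Ww aw]]; have [u tu xu] := xray_summands Ww.
  have [Lu Ls _] := xu; exists u; first exact: tspan_tensors.
  apply: (xray_ext xu Lu Lg).
    by transitivity (NS (fun=> 0)); [apply: eq_sqnorm => p _; rewrite subrr|exact: sqnorm0].
  case: Ls Lg => _ Ls [_ Lg]; apply/(sqnormB0_ae Ls Lg).
  by apply: (ae_imp aw) => x ax /ax ->.
- move=> w w' Ww Ww' aw j.
  have Lw i := summands_L2 (Ww i); have Lw' i := summands_L2 (Ww' i).
  apply/(sqnormB0_ae (Lw j) (Lw' j)); apply: (orthogonal_unique mI Lw Lw').
    move=> i i' ii'; split; apply: (summands_orthogonal ii'); by [exact: Ww|exact: Ww'].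
  by apply/sqnormB0_ae => //; apply: L2_sum.
- by move=> i j ij g h; exact: summands_orthogonal.
Qed.

End assembly.

Lemma range_I0E g : range_I0 R g <-> low_image 0 g.
Proof.
have E f : freq f 0 = fun p => f p.1 by apply/funext => p; rewrite /freq expi0 mulr1.
split.
  move=> [_ [f Lf ->] xg]; exists f, (fun=> 0); split => //; first exact: L2_0.
  by move: xg; congr (xray _ _); apply/funext => p; rewrite oppr0 !E addr0.
move=> [f1 [f2 [L1 L2' xg]]]; exists (fun p => f1 p.1 + f2 p.1).
  by exists (fun x => f1 x + f2 x) => //; exact: (L2D mD L1 L2').
by move: xg; congr (xray _ _); apply/funext => p; rewrite oppr0 !E.
Qed.

(** Writing sin and cos as exponentials gives one inclusion. The converse is [odd_descent]:
    subtracting an element of the kernel of the transform changes the function but not [g]. *)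
Lemma range_IperpE g : range_Iperp R g <-> low_image 1 g.
Proof.
split.
  move=> [_ [h [hx [hy [[tau [[_ Lx Ly _ _] _ _] _] ->]]]] xg].
  exists (fun x => 2^-1 * (- (0 +i* 1) * hx x - hy x)), (fun x => 2^-1 * ((0 +i* 1) * hx x - hy x)).
  split.
  - by apply: (L2Z mD); apply: (L2B mD) => //; exact: (L2Z mD).
  - by apply: (L2Z mD); apply: (L2B mD) => //; exact: (L2Z mD).
  - by move: xg; congr (xray _ _); apply/funext => p; exact: X_perp_freq.
move=> [f1 [f2 [L1 L2' xg]]]; have [h [hx [hy [Hh x0]]]] := odd_descent L1 L2'.
exists (X_perp hx hy); first by exists h, hx, hy.
have := xrayB xg x0; congr (xray _ _); apply/funext => p; last by rewrite subr0.
by rewrite subKr.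
Qed.

End orthogonal_decomposition.

Theorem theorem2 (R : realType) (m : nat) :
  orthogonal_direct_sum
    (xray_image (tensors R (2 * m)))
    (summands (m := m) (range_I0 R)
       (fun k => xray_image (ker_eta_minus R (2 * k)%:Z))
       (fun k => xray_image (ker_eta_plus R (- (2 * k)%:Z)))) /\
  orthogonal_direct_sum
    (xray_image (tensors R (2 * m + 1)))
    (summands (m := m) (range_Iperp R)
       (fun k => xray_image (ker_eta_minus R (2 * k + 1)%:Z))
       (fun k => xray_image (ker_eta_plus R (- (2 * k + 1)%:Z)))).
Proof.
split; last exact: (orthogonal_summands m (leqnn 1) (@range_IperpE R)).
have := orthogonal_summands m (leq0n 1) (@range_I0E R).
(* [lev 0] adds a trailing 0, which has to be removed by rewriting, whereas [lev 1] unfolds to the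
   form of the statement. *)
have -> : lev 0 = muln 2 by apply/funext => k; rewrite /lev addn0.
exact.
Qed.
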